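(* Let $A:(\mathbb R^2,0)\to(\mathrm{Sym}_3,O_3)$ be a smooth map-germ of corank at most $1$ and of $\mathcal G_e$-codimension less than $9$. Then $A$ is $\mathcal G$-equivalent to one of the following normal forms, all of corank $0$, whose $\mathcal G_e$-codimension is as indicated (all signs $\pm$ are chosen independently): 1. $\begin{pmatrix} x_1 & 0 & 0 \\ 0 & x_2 & 0 \\ 0 & 0 & x_1-x_2 \end{pmatrix}$; codimension $4$. 2. $\begin{pmatrix} x_1 & 0 & 0 \\ 0 & x_2 & 0 \\ 0 & 0 & \pm(x_1+x_2) \end{pmatrix}$; codimension $4$. 3. $\begin{pmatrix} \pm x_1 & 0 & 0 \\ 0 & x_1 & x_2 \\ 0 & x_2 & -x_1 \end{pmatrix}$; codimension $4$. 4. $\begin{pmatrix} \pm x_2^{\ell_1} & x_1 & 0 \\ x_1 & \pm x_2^{\ell_2} & 0 \\ 0 & 0 & x_2 \end{pmatrix}$, $\ell_1\ge\ell_2\ge1$, $\ell_1\ge2$; codimension $\ell_1+\ell_2+2$. 5. $\begin{pmatrix} x_1 & x_2^\ell & 0 \\ x_2^\ell & x_1 & 0 \\ 0 & 0 & x_2 \end{pmatrix}$, $\ell\ge2$; codimension $2\ell+2$. 6. $\begin{pmatrix} 0 & x_2 & x_1 \\ x_2 & x_1 & 0 \\ x_1 & 0 & \pm x_2^2 \end{pmatrix}$; codimension $6$. 7. $\begin{pmatrix} 0 & x_2 & x_1 \\ x_2 & x_1 & 0 \\ x_1 & 0 & x_1x_2 \end{pmatrix}$; codimension $7$. 8. $\begin{pmatrix}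 x_2 & x_1 & 0 \\ x_1 & \pm x_2^2 & 0 \\ 0 & 0 & x_1 \end{pmatrix}$; codimension $7$. 9. $\begin{pmatrix} 0 & x_2 & x_1 \\ x_2 & x_1 & 0 \\ x_1 & 0 & x_2^3 \end{pmatrix}$; codimension $8$. 10. $\begin{pmatrix} x_2 & x_1 & 0 \\ x_1 & 0 & x_2^2 \\ 0 & x_2^2 & x_1 \end{pmatrix}$; codimension $8$.
   Context: $\mathrm{Sym}_n$ and $\mathrm{GL}_n$ are the real symmetric and the real invertible $n\times n$ matrices, $M_n$ all real $n\times n$ matrices, $O_n$ the zero matrix; $C^\infty(\mathbb R^r,S)$ is the space of smooth map-germs at $0\in\mathbb R^r$ with values in $S$. $A,B\in C^\infty(\mathbb R^r,\mathrm{Sym}_n)$ are $\mathcal G$-equivalent if $B=X^T(A\circ\Phi)X$ for some diffeomorphism-germ $\Phi:(\mathbb R^r,0)\to(\mathbb R^r,0)$ and some $X\in C^\infty(\mathbb R^r,\mathrm{GL}_n)$. The corank of $A:(\mathbb R^2,0)\to(\mathrm{Sym}_n,O_n)$ is $2-\operatorname{rank}dA(0)$. The $\mathcal G_e$-codimension of $A$ is the real dimension of the quotient of $C^\infty(\mathbb R^r,\mathrm{Sym}_n)$ by the subspace $\{dA(V)+U^TA+AU\}$, where $V$ ranges over all smooth vector field-germs at $0\in\mathbb R^r$ (not necessarily vanishing at $0$) and $U$ over $C^\infty(\mathbb R^r,M_n)$. *)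

(* Defs.v *)
From mathcomp Require Import all_boot all_order all_algebra.
From mathcomp Require Import boolp classical_sets functions reals topology.
From mathcomp Require Import normedtype derive.

Set Implicit Arguments.
Unset Strict Implicit.
Unset Printing Implicit Defensive.

Import Order.TTheory GRing.Theory Num.Theory.
Import numFieldTopology.Exports numFieldNormedType.Exports.

Local Open Scope classical_set_scope.
Local Open Scope ring_scope.

(* A germ at 0 is represented by a total function; only its values near 0 are  *)
(* ever used, and equality of germs is equality near 0.                        *)

Section Germs.
Context {R : realType} {r : nat}.

(* [iter_partial f [:: i1; ...; ik]] is d_{i1} ... d_{ik} f. *)
Definition iter_partial (W : normedModType R) (f : 'rV[R]_r -> W)
    (s : seq 'I_r) : 'rV[R]_r -> W :=
  foldr (fun i g x => 'D_(delta_mx 0 i) g x) f s.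

(* All partial derivatives exist and are continuous on one neighbourhood of 0, *)
(* the same for all orders of differentiation.                                 *)
Definition smooth_germ (W : normedModType R) (f : 'rV[R]_r -> W) : Prop :=
  \forall x \near (0 : 'rV[R]_r), forall s : seq 'I_r,
    {for x, continuous (iter_partial f s)} /\
    forall i : 'I_r, derivable (iter_partial f s) x (delta_mx 0 i).

Definition sym_germ n (A : 'rV[R]_r -> 'M[R]_n) : Prop :=
  smooth_germ A /\ \forall x \near (0 : 'rV[R]_r), (A x)^T = A x.

Definition GL_germ n (X : 'rV[R]_r -> 'M[R]_n) : Prop :=
  smooth_germ X /\ \forall x \near (0 : 'rV[R]_r), X x \in unitmx.

Definition diffeo_germ (Phi : 'rV[R]_r -> 'rV[R]_r) : Prop :=
  [/\ smooth_germ Phi, Phi 0 = 0 &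
    exists Psi : 'rV[R]_r -> 'rV[R]_r, [/\ smooth_germ Psi, Psi 0 = 0,
      \forall x \near (0 : 'rV[R]_r), Psi (Phi x) = x &
      \forall x \near (0 : 'rV[R]_r), Phi (Psi x) = x]].

Definition G_equivalent n (A B : 'rV[R]_r -> 'M[R]_n) : Prop :=
  exists (Phi : 'rV[R]_r -> 'rV[R]_r) (X : 'rV[R]_r -> 'M[R]_n),
    [/\ diffeo_germ Phi, GL_germ X &
      \forall x \near (0 : 'rV[R]_r), B x = (X x)^T *m A (Phi x) *m X x].

Definition Ge_tangent n (A : 'rV[R]_r -> 'M[R]_n) :
    set ('rV[R]_r -> 'M[R]_n) :=
  [set F | exists (V : 'rV[R]_r -> 'rV[R]_r) (U : 'rV[R]_r -> 'M[R]_n),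
    [/\ smooth_germ V, smooth_germ U &
      \forall x \near (0 : 'rV[R]_r),
        F x = 'd A x (V x) + (U x)^T *m A x + A x *m U x]].

End Germs.

(* For subspaces T of E of V: the quotient E / T has dimension d, i.e. the     *)
(* classes of some b_0, ..., b_(d-1) in E form a basis of it.                  *)
Definition quotient_has_dim (K : fieldType) (V : lmodType K) (E T : set V)
    (d : nat) : Prop :=
  exists b : 'I_d -> V,
    [/\ forall i, E (b i),
        forall c : 'I_d -> K, T (\sum_i c i *: b i) -> forall i, c i = 0 &
        forall v, E v -> exists c : 'I_d -> K, T (v - \sum_i c i *: b i)].

(* The functions vanishing near 0 lie in [Ge_tangent A], so the quotient of    *)
(* representatives is the quotient of the spaces of germs.                     *)
Definition has_Ge_codim (R : realType) r n (A : 'rV[R]_r -> 'M[R]_n)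
    (d : nat) : Prop :=
  quotient_has_dim (@sym_germ R r n) (Ge_tangent A) d.

(* [lin_mx] is the matrix of a linear map between matrix spaces. *)
Definition corank (R : realType) n (A : 'rV[R]_2 -> 'M[R]_n) : nat :=
  (2 - \rank (lin_mx ('d A (0%R : 'rV[R]_2))))%N.

Definition mx3_of_rows (R : realType) (rows : R -> R -> seq (seq R)) :
    'rV[R]_2 -> 'M[R]_3 :=
  fun x => \matrix_(i, j) nth 0 (nth [::] (rows (x 0 0) (x 0 1)) i) j.

(* [normal_form N c]: N is in the list, with indicated codimension c.          *)
(* The booleans encode the signs.                                              *)
Inductive normal_form (R : realType) : ('rV[R]_2 -> 'M[R]_3) -> nat -> Prop :=
| NF1 : normal_form (mx3_of_rows (fun x1 x2 =>
    [:: [:: x1; 0 ; 0      ];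
        [:: 0 ; x2; 0      ];
        [:: 0 ; 0 ; x1 - x2]])) 4%N
| NF2 (s : bool) : normal_form (mx3_of_rows (fun x1 x2 =>
    [:: [:: x1; 0 ; 0                    ];
        [:: 0 ; x2; 0                    ];
        [:: 0 ; 0 ; (-1) ^+ s * (x1 + x2)]])) 4%N
| NF3 (s : bool) : normal_form (mx3_of_rows (fun x1 x2 =>
    [:: [:: (-1) ^+ s * x1; 0 ; 0   ];
        [:: 0             ; x1; x2  ];
        [:: 0             ; x2; - x1]])) 4%N
| NF4 (s1 s2 : bool) (l1 l2 : nat) :
    (l2 <= l1)%N -> (1 <= l2)%N -> (2 <= l1)%N ->
  normal_form (mx3_of_rows (fun x1 x2 =>
    [:: [:: (-1) ^+ s1 * x2 ^+ l1; x1                   ; 0 ];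
        [:: x1                   ; (-1) ^+ s2 * x2 ^+ l2; 0 ];
        [:: 0                    ; 0                    ; x2]])) (l1 + l2 + 2)%N
| NF5 (l : nat) : (2 <= l)%N -> normal_form (mx3_of_rows (fun x1 x2 =>
    [:: [:: x1     ; x2 ^+ l; 0 ];
        [:: x2 ^+ l; x1     ; 0 ];
        [:: 0      ; 0      ; x2]])) (2 * l + 2)%N
| NF6 (s : bool) : normal_form (mx3_of_rows (fun x1 x2 =>
    [:: [:: 0 ; x2; x1                 ];
        [:: x2; x1; 0                  ];
        [:: x1; 0 ; (-1) ^+ s * x2 ^+ 2]])) 6%N
| NF7 : normal_form (mx3_of_rows (fun x1 x2 =>
    [:: [:: 0 ; x2; x1     ];
        [:: x2; x1; 0      ];
        [:: x1; 0 ; x1 * x2]])) 7%N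
| NF8 (s : bool) : normal_form (mx3_of_rows (fun x1 x2 =>
    [:: [:: x2; x1                 ; 0 ];
        [:: x1; (-1) ^+ s * x2 ^+ 2; 0 ];
        [:: 0 ; 0                  ; x1]])) 7%N
| NF9 : normal_form (mx3_of_rows (fun x1 x2 =>
    [:: [:: 0 ; x2; x1     ];
        [:: x2; x1; 0      ];
        [:: x1; 0 ; x2 ^+ 3]])) 8%N
| NF10 : normal_form (mx3_of_rows (fun x1 x2 =>
    [:: [:: x2; x1     ; 0      ];
        [:: x1; 0      ; x2 ^+ 2];
        [:: 0 ; x2 ^+ 2; x1     ]])) 8%N.

(* Main.v *)
Require Import Defs.
From mathcomp Require Import all_boot all_order all_algebra.
From mathcomp Require Import reals topology normedtype derive.
From HB Require Import structures.
From mathcomp Require Import boolp classical_sets functions.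
From mathcomp Require Import perm normedtype derive landau realfun sequences.
From mathcomp Require Import sesquilinear prodnormedzmodule tvs interval_inference.
From mathcomp Require Import constructive_ereal ereal measure lebesgue_measure.
From mathcomp Require Import lebesgue_integral ftc.
From mathcomp Require Import ring lra zify.

Set Implicit Arguments.
Unset Strict Implicit.
Unset Printing Implicit Defensive.

Import Order.TTheory GRing.Theory Num.Theory.
Import numFieldTopology.Exports numFieldNormedType.Exports.

Local Open Scope classical_set_scope.
Local Open Scope ring_scope.

(* Everything takes place in the ring of germs, of which the algebra only uses
   evaluation, the two derivations, substitution, Hadamard's lemma and the fact that
   polynomial maps of germs are solvable when they are close enough to linear ones.
   The 1-jet of A is a pencil of ternary quadratic forms.  Up to equivalence a pencil
   either forces codimension at least 9, or is one of the few representatives for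
   which A has a versal unfolding with at most three free coefficients.  The orders of
   these coefficients along the y-axis decide between the normal forms, each of which
   is finitely determined for weights making it homogeneous: the terms of higher weight
   are made small by the weighted scaling and then removed at once, by inverting the
   polynomial map that expresses the action of the group.  If the orders are too large,
   explicit independent elements modulo the tangent space give codimension at least 9. *)

(** * Calculus in the plane *)

(** Finite determinacy is usually obtained by integrating vector fields along a homotopy, after the
    preparation theorem. Both are replaced here by a single device: a system p_k + q_k(p) = r_k,
    whose unknowns are germs and whose q_k are polynomials with germs as coefficients and without
    terms of degree below two, becomes a map of the plane times the space of values of p, and the
    inverse function theorem solves it when the values r_k(0) are small. To bring the action of the
    group to this shape one needs finitely many generators for the perturbations and, for each
    generator, a solution of the linearised equation. The obstacle is that the quadratic error has
    to stay in the module spanned by these generators: this is what the weights demanded of u, v and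
    U ensure. The values r_k(0) are either 0, when a matrix is compared with its 1-jet, or made
    small by scaling. The codimension is used as a bound: d classes span the quotient. This is
    transported by equivalence and refuted by nine independent classes, or by counting dimensions in
    the jets of tangent elements. *)

Section SmoothOn.
Context {R : realType} {r : nat}.
Local Notation V := 'rV[R]_r.
Implicit Types (D : set V) (f g h : V -> R).

Definition smooth_on D f := forall x, D x -> forall s : seq 'I_r,
  {for x, continuous (iter_partial f s)} /\
  forall i, derivable (iter_partial f s) x (delta_mx 0 i).

Lemma smooth_onS D E f : E `<=` D -> smooth_on D f -> smooth_on E f.
Proof. by move=> ED sf x /ED /sf. Qed.

Lemma smooth_germP f :
  smooth_germ f <-> exists D, [/\ open D, D 0 & smooth_on D f].
Proof.
split=> [|[D [oD D0 sf]]]; last first.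
  by apply: filterS (open_nbhs_nbhs (conj oD D0)) => x /sf.
rewrite /smooth_germ => /nbhs_interior n0.
pose D := [set x | forall s : seq 'I_r, {for x, continuous (iter_partial f s)} /\
    forall i, derivable (iter_partial f s) x (delta_mx 0 i)]°.
exists D; split; first exact: open_interior.
  exact: nbhs_singleton n0.
by move=> x /interior_subset.
Qed.

Lemma smooth_on_continuous D f x : smooth_on D f -> D x -> {for x, continuous f}.
Proof. by move=> sf /sf /(_ [::]) []. Qed.

Lemma smooth_on_derivable D f x i : smooth_on D f -> D x ->
  derivable f x (delta_mx 0 i).
Proof. by move=> sf /sf /(_ [::]) []. Qed.

Lemma iter_partial_rcons f s i :
  iter_partial f (rcons s i) = iter_partial ('D_(delta_mx 0 i) f) s.
Proof. by rewrite /iter_partial foldr_rcons. Qed.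

Lemma smooth_on_derive D f i : smooth_on D f -> smooth_on D ('D_(delta_mx 0 i) f).
Proof. by move=> sf x Dx s; have := sf x Dx (rcons s i); rewrite iter_partial_rcons. Qed.

Lemma smooth_on_iter D f s : smooth_on D f -> smooth_on D (iter_partial f s).
Proof.
move=> sf; elim: s => [|i s IH]; first exact: sf.
exact: (@smooth_on_derive _ (iter_partial f s) i IH).
Qed.

(** Smoothness is always proved by exhibiting a family of functions whose partial derivatives are
    polynomials in the family. The induction on the order of differentiation is then done once, for
    the algebra generated by the family. *)
Inductive algebra_gen (B : set (V -> R)) : (V -> R) -> Prop :=
| algebra_gen_base g : B g -> algebra_gen B g
| algebra_gen_cst c : algebra_gen B (cst c)
| algebra_gen_add g h : algebra_gen B g -> algebra_gen B h -> algebra_gen B (g + h)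
| algebra_gen_mul g h : algebra_gen B g -> algebra_gen B h -> algebra_gen B (g * h).

Lemma algebra_gen_trans B C f : B `<=` algebra_gen C -> algebra_gen B f ->
  algebra_gen C f.
Proof.
move=> BC; elim=> [g /BC|c|g h _ Cg _ Ch|g h _ Cg _ Ch] //.
- exact: algebra_gen_cst.
- exact: algebra_gen_add.
- exact: algebra_gen_mul.
Qed.

Definition partials_in D (C : set (V -> R)) g :=
  (forall x, D x -> {for x, continuous g}) /\
  forall i, exists h, algebra_gen C h /\
    forall x, D x -> is_derive x (delta_mx 0 i) g (h x).

Definition stable_partials D (B : set (V -> R)) := forall g, B g -> partials_in D B g.

Lemma algebra_gen_partials D B C g : B `<=` algebra_gen C ->
  (forall g, B g -> partials_in D C g) -> algebra_gen B g -> partials_in D C g.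
Proof.
move=> BC sB; elim => {g} [g /sB[cg dg]|c|g h _ [cg dg] _ [ch dh]|g h gB [cg dg] hB [ch dh]].
- by [].
- split=> [x _|i]; first exact: cst_continuous.
  exists (cst 0); split; first exact: algebra_gen_cst.
  by move=> x _; exact: is_derive_cst.
- split=> [x Dx|i]; first by apply: continuousD; [exact: cg|exact: ch].
  have [g' [g'B dg']] := dg i; have [h' [h'B dh']] := dh i.
  exists (g' + h'); split; first exact: algebra_gen_add.
  by move=> x Dx; apply: is_deriveD; [exact: dg'|exact: dh'].
- split=> [x Dx|i]; first by apply: continuousM; [exact: cg|exact: ch].
  have [g' [g'B dg']] := dg i; have [h' [h'B dh']] := dh i.
  exists (g * h' + h * g'); split.
    have ? := algebra_gen_trans BC gB; have ? := algebra_gen_trans BC hB.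
    by apply: algebra_gen_add; apply: algebra_gen_mul.
  move=> x Dx; have := dg' x Dx; have := dh' x Dx => ? ?.
  exact: is_deriveM.
Qed.

Lemma algebra_gen_sum (I : Type) (s : seq I) (P : pred I) B (F : I -> V -> R) :
  (forall i, P i -> algebra_gen B (F i)) ->
  algebra_gen B (fun x => \sum_(i <- s | P i) F i x).
Proof.
move=> sF; rewrite (_ : (fun _ => _) = \sum_(i <- s | P i) F i); last first.
  by apply/funext => x; rewrite fct_sumE.
elim/big_rec: _ => [|i f Pi sf]; first exact: algebra_gen_cst.
exact: algebra_gen_add (sF _ Pi) sf.
Qed.

Lemma algebra_gen_prod (I : Type) (s : seq I) (P : pred I) B (F : I -> V -> R) :
  (forall i, P i -> algebra_gen B (F i)) ->
  algebra_gen B (fun x => \prod_(i <- s | P i) F i x).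
Proof.
move=> sF; rewrite (_ : (fun _ => _) = \big[( *%R)/(cst 1)]_(i <- s | P i) F i); last first.
  by apply/funext => x; elim/big_rec2: _ => // i f _ _ ->.
elim/big_rec: _ => [|i f Pi sf]; first exact: algebra_gen_cst.
exact: algebra_gen_mul (sF _ Pi) sf.
Qed.

Lemma algebra_gen_det n B (F : 'I_n -> 'I_n -> V -> R) :
  (forall i j, algebra_gen B (F i j)) ->
  algebra_gen B (fun x => \det (\matrix_(i, j) F i j x)).
Proof.
move=> BF; apply: algebra_gen_sum => s _.
rewrite (_ : (fun _ => _) = cst ((-1) ^+ s) * (fun x => \prod_i F i (s i) x)).
  by apply: algebra_gen_mul; [exact: algebra_gen_cst|exact: algebra_gen_prod].
apply/funext => x; congr (_ * _); apply: eq_bigr => i _; rewrite mxE //.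
Qed.

Lemma near_eq_continuous (f g : V -> R) x : (\forall y \near x, f y = g y) ->
  {for x, continuous f} -> {for x, continuous g}.
Proof.
move=> fg cf; have -> : {for x, continuous g} = (g @ x --> f x) :> Prop.
  by rewrite (nbhs_singleton fg).
exact: cvg_trans (near_eq_cvg fg) cf.
Qed.

Lemma iter_partial_ext D f g s : open D -> (forall x, D x -> f x = g x) ->
  forall x, D x -> iter_partial f s x = iter_partial g s x.
Proof.
move=> oD fg; elim: s => [|i s IH] x Dx; first exact: fg.
apply: near_eq_derive; apply: filterS (open_nbhs_nbhs (conj oD Dx)) => y Dy.
exact: IH.
Qed.

Lemma smooth_on_ext D f g : open D -> (forall x, D x -> f x = g x) ->
  smooth_on D f -> smooth_on D g.
Proof.
move=> oD fg sf x Dx s; have [cf df] := sf x Dx s.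
have nfg : \forall y \near x, iter_partial f s y = iter_partial g s y.
  by apply: filterS (open_nbhs_nbhs (conj oD Dx)); exact: iter_partial_ext.
split=> [|i]; [exact: near_eq_continuous nfg cf|exact: near_eq_derivable nfg (df i)].
Qed.

(** By induction on the order, each iterated partial agrees on the open set D with an element of the
    algebra, hence is continuous and derivable there. *)
Lemma algebra_gen_smooth D B f : open D -> stable_partials D B ->
  algebra_gen B f -> smooth_on D f.
Proof.
move=> oD sB Bf.
have approx : forall s, exists g, algebra_gen B g /\
    forall x, D x -> iter_partial f s x = g x.
  elim=> [|i s [g [Bg gE]]]; first by exists f.
  have [_ /(_ i)[h [Bh dh]]] := algebra_gen_partials (@algebra_gen_base B) sB Bg.
  exists h; split=> // x Dx; have [_ <-] := dh x Dx.
  apply: near_eq_derive; exact: filterS (open_nbhs_nbhs (conj oD Dx)).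
move=> x Dx s; have [g [Bg gE]] := approx s.
have ng : \forall y \near x, g y = iter_partial f s y.
  by apply: filterS (open_nbhs_nbhs (conj oD Dx)) => y /gE.
have [cg dg] := algebra_gen_partials (@algebra_gen_base B) sB Bg.
split=> [|i]; first exact: near_eq_continuous ng (cg x Dx).
have [h [_ /(_ x Dx)[dgx _]]] := dg i; exact: near_eq_derivable ng dgx.
Qed.

Lemma stable_partialsU D B C :
  (forall g, B g -> partials_in D (B `|` C) g) ->
  (forall g, C g -> partials_in D (B `|` C) g) ->
  stable_partials D (B `|` C).
Proof. by move=> sB sC g [/sB|/sC]. Qed.

Definition iter_partials f : set (V -> R) := [set g | exists s, g = iter_partial f s].

Lemma iter_partials_stable D f : smooth_on D f -> stable_partials D (iter_partials f).
Proof.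
move=> sf _ [s ->]; split=> [x Dx|i]; first by have [] := sf x Dx s.
exists (iter_partial f (i :: s)); split.
  by apply: algebra_gen_base; exists (i :: s).
by move=> x Dx; apply: derivableP; have [_] := sf x Dx s; exact.
Qed.

Lemma algebra_genS B C f : B `<=` C -> algebra_gen B f -> algebra_gen C f.
Proof. by move=> BC; apply: algebra_gen_trans => g /BC; exact: algebra_gen_base. Qed.

Lemma stable_partials_setU D B C : stable_partials D B -> stable_partials D C ->
  stable_partials D (B `|` C).
Proof.
move=> sB sC; apply: stable_partialsU => g.
- move=> /sB[cg dg]; split=> // i; have [h [hB ?]] := dg i.
  by exists h; split=> //; apply: algebra_genS hB; exact: subsetUl.
- move=> /sC[cg dg]; split=> // i; have [h [hB ?]] := dg i.
  by exists h; split=> //; apply: algebra_genS hB; exact: subsetUr.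
Qed.

Lemma iter_partials_self f : iter_partials f f.
Proof. by exists [::]. Qed.

Lemma smooth_on_cst D c : open D -> smooth_on D (cst c).
Proof.
move=> oD; apply: (@algebra_gen_smooth D set0) => //; exact: algebra_gen_cst.
Qed.

Lemma smooth_onD D f g : open D -> smooth_on D f -> smooth_on D g ->
  smooth_on D (f + g).
Proof.
move=> oD /iter_partials_stable sf /iter_partials_stable sg.
apply: (algebra_gen_smooth oD (stable_partials_setU sf sg)).
apply: algebra_gen_add; apply: algebra_gen_base; [left|right];
  exact: iter_partials_self.
Qed.

Lemma smooth_onM D f g : open D -> smooth_on D f -> smooth_on D g ->
  smooth_on D (f * g).
Proof.
move=> oD /iter_partials_stable sf /iter_partials_stable sg.
apply: (algebra_gen_smooth oD (stable_partials_setU sf sg)).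
apply: algebra_gen_mul; apply: algebra_gen_base; [left|right];
  exact: iter_partials_self.
Qed.

Lemma smooth_onZ D c f : open D -> smooth_on D f -> smooth_on D (fun x => c * f x).
Proof. by move=> oD; exact: smooth_onM (smooth_on_cst c oD). Qed.

Lemma smooth_onN D f : open D -> smooth_on D f -> smooth_on D (- f).
Proof.
move=> oD /(smooth_onZ (-1) oD); apply: smooth_on_ext => // x _.
by rewrite mulN1r.
Qed.

Lemma smooth_on_sum (I : Type) (s : seq I) (P : pred I) D (F : I -> V -> R) :
  open D -> (forall i, P i -> smooth_on D (F i)) ->
  smooth_on D (fun x => \sum_(i <- s | P i) F i x).
Proof.
move=> oD sF; rewrite (_ : (fun _ => _) = \sum_(i <- s | P i) F i); last first.
  by apply/funext => x; rewrite fct_sumE.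
elim/big_rec: _ => [|i f Pi sf]; first exact: smooth_on_cst.
exact: smooth_onD oD (sF _ Pi) sf.
Qed.

Lemma is_derive_coord i x v : is_derive x v (fun y : V => y 0 i) (v 0 i).
Proof.
have [+ _] := @derivable_mxP R V 1 r id x v.
move=> /(_ (@derivable_id _ _ _ _)) /(_ 0 i) dx.
apply: DeriveDef => //.
have /matrixP/(_ 0 i) := @derive_mx R V 1 r id x v (@derivable_id _ _ _ _).
by rewrite mxE derive_id => ->.
Qed.

Lemma smooth_on_coord D i : open D -> smooth_on D (fun y : V => y 0 i).
Proof.
move=> oD; pose B : set (V -> R) := [set fun y : V => y 0 i].
apply: (@algebra_gen_smooth D B) => //; last exact: algebra_gen_base.
move=> _ ->; split=> [x _|j].
  exact: coord_continuous.
exists (cst ((delta_mx 0 j : V) 0 i)); split; first exact: algebra_gen_cst.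
by move=> x _; exact: is_derive_coord.
Qed.

(** The partials of 1/f are -(1/f)^2 times those of f, so adding 1/f to the iterated partials of f
    gives a stable family. *)
Lemma smooth_onV D f : open D -> (forall x, D x -> f x != 0) ->
  smooth_on D f -> smooth_on D (fun x => (f x)^-1).
Proof.
move=> oD f0 sf; pose B := iter_partials f `|` [set fun x => (f x)^-1].
have Bf s : algebra_gen B (iter_partial f s).
  by apply: algebra_gen_base; left; exists s.
have Bv : algebra_gen B (fun x => (f x)^-1).
  by apply: algebra_gen_base; right.
apply: (@algebra_gen_smooth D B) => //.
apply: stable_partialsU.
- move=> g /(iter_partials_stable sf)[cg dg]; split=> // i.
  have [h [hB ?]] := dg i.
  by exists h; split=> //; apply: algebra_genS hB; exact: subsetUl.
- move=> _ ->; split=> [x Dx|i].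
    apply: continuousV; [exact: f0|exact: smooth_on_continuous sf Dx].
  exists (cst (-1) * ((fun x => (f x)^-1) * (fun x => (f x)^-1) * iter_partial f [:: i])).
  split.
    apply: algebra_gen_mul; first exact: algebra_gen_cst.
    apply: algebra_gen_mul; first exact: algebra_gen_mul.
    exact: Bf.
  move=> x Dx; have fx0 := f0 x Dx; have dfx := smooth_on_derivable (i := i) sf Dx.
  apply: DeriveDef; first exact: derivableV.
  rewrite deriveV // /cst /=.
  rewrite !fctE /= mulN1r scaleNr -expr2 exprVn; congr (- _).
Qed.
End SmoothOn.

(** The differential is obtained by choice from its defining property, so the estimate alone does
    not produce it: the explicit candidate [df] witnesses that property, and uniqueness identifies
    the chosen map with [df]. *)
Lemma differentiable_intro (R : numFieldType) (V W : normedModType R) (f : V -> W)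
    (x : V) (df : {linear V -> W}) : continuous df ->
  (forall e, 0 < e -> \forall h \near (0 : V),
     `|f (h + x) - (f x + df h)| <= e * `|h|) ->
  differentiable f x /\ 'd f x = df :> (V -> W).
Proof.
move=> cdf fdf.
have dxf : f \o shift x = cst (f x) + df +o_ (0 : V) id.
  apply/eqaddoP => e e0; apply: filterS (fdf e e0) => h; exact.
split; last exact: diff_unique.
apply/diffP => /=; rewrite /diff.
have [|cdx dxE] := (@getPex _ (fun (df : {linear V -> W}) => continuous df /\
  forall y, f y = f (lim (nbhs x)) + df (y - lim (nbhs x))
                  +o_(y \near x) (y - lim (nbhs x)))); last first.
  by split.
exists df; split=> //; apply: eqaddoEx => z.
have hdf (h : V -> W) : (f \o shift x = cst (f x) + h +o_ (0 : V) id) ->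
    h = f \o shift x - cst (f x) +o_ (0 : V) id.
  move=> hE; apply: eqaddoE.
  rewrite hE addrAC -!addrA addrC !addrA subrK.
  rewrite -[LHS]addr0 -addrA; congr (_ + _).
  by apply/eqP; rewrite eq_sym addrC addr_eq0 oppo.
rewrite (hdf _ dxf) !addrA lim_id // /(_ \o _) /= subrK [f _ + _]addrC addrK.
rewrite -addrA -[LHS]addr0; congr (_ + _).
apply/eqP; rewrite eq_sym addrC addr_eq0 oppox; apply/eqP.
rewrite [in LHS]littleo_center0 (comp_centerK x id).
by rewrite -[- _ in RHS](comp_centerK x).
Qed.

(** * Mean values and differentiability *)

Section MeanValue.
Context {R : realType} {V : normedModType R}.

Lemma is_derive_line (W : normedModType R) (f : V -> W) (z v : V) (t : R) (d : W) :
  is_derive (t *: v + z) v f d <-> is_derive t 1 (fun s : R => f (s *: v + z)) d.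
Proof.
have E : (fun h : R => h^-1 *: (((fun s : R => f (s *: v + z)) \o shift t) (h *: 1) - f (t *: v + z)))
   = (fun h : R => h^-1 *: ((f \o shift (t *: v + z)) (h *: v) - f (t *: v + z))).
  by apply/funext => h /=; rewrite scaler1 scalerDl addrA.
split=> -[df dE]; apply: DeriveDef.
- by rewrite /derivable E; exact: df.
- by rewrite /derive E; exact: dE.
- by rewrite /derivable -E; exact: df.
- by rewrite /derive -E; exact: dE.
Qed.

Lemma MVT_line (f : V -> R) (z v : V) (s : R) :
  (forall t, t \in `[Num.min 0 s, Num.max 0 s]%R ->
     {for t *: v + z, continuous f} /\ derivable f (t *: v + z) v) ->
  exists2 t, t \in `[Num.min 0 s, Num.max 0 s]%R &
    f (s *: v + z) - f z = 'D_v f (t *: v + z) * s.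
Proof.
move=> fP.
have cf a b : a <= b -> `[a, b] `<=` `[Num.min 0 s, Num.max 0 s] ->
   {within `[a, b], continuous (fun t : R => f (t *: v + z))}.
  move=> ab sub; apply: continuous_in_subspaceT => t /set_mem tab.
  apply: (@continuous_comp _ _ _ (fun t : R => t *: v + z) f).
    by apply: continuousD; [exact: scalel_continuous|exact: cst_continuous].
  by have [] := fP t (sub t tab).
have df t : t \in `[Num.min 0 s, Num.max 0 s]%R ->
    is_derive t 1 (fun t : R => f (t *: v + z)) ('D_v f (t *: v + z)).
  by move=> /fP[_ dft]; apply/is_derive_line; exact: derivableP.
pose g (t : R) := f (t *: v + z); pose dg (t : R) := 'D_v f (t *: v + z).
have sub a b t : `[a, b] `<=` `[Num.min 0 s, Num.max 0 s] -> t \in `]a, b[%R ->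
    t \in `[Num.min 0 s, Num.max 0 s]%R.
  move=> sub; rewrite in_itv /= => /andP[/ltW at_ /ltW tb]; apply: sub.
  by rewrite /= in_itv /= at_ tb.
have [s0|/ltW s0] := lerP 0 s.
- have E : `[0, s] `<=` `[Num.min 0 s, Num.max 0 s] by rewrite min_l // max_r.
  have dfE : forall t, t \in `]0, s[%R -> is_derive t 1 g (dg t).
    by move=> t ts; apply: df; exact: sub E ts.
  have [t ts tE] := MVT_segment s0 dfE (cf 0 s s0 E).
  exists t; first exact: ts.
  by move: tE; rewrite /g scale0r add0r subr0.
- have E : `[s, 0] `<=` `[Num.min 0 s, Num.max 0 s] by rewrite min_r // max_l.
  have dfE : forall t, t \in `]s, 0[%R -> is_derive t 1 g (dg t).
    by move=> t ts; apply: df; exact: sub E ts.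
  have [t ts tE] := MVT_segment s0 dfE (cf s 0 s0 E).
  exists t; first exact: ts.
  move: tE; rewrite /g scale0r add0r sub0r mulrN => tE.
  by rewrite -[LHS]opprB tE opprK.
Qed.
End MeanValue.

Section Differentiable.
Context {R : realType} {r : nat}.
Local Notation V := 'rV[R]_r.

Lemma mx_norm_lt (x : V) (e : R) : 0 < e -> (`|x| < e) = [forall i, `|x 0 i| < e].
Proof.
move=> e0; apply/idP/forallP => [xe i|xe].
  apply: le_lt_trans xe; rewrite [leRHS]/Num.Def.normr /= mx_normrE.
  exact: (@le_bigmax _ _ _ _ (fun k => `|x k.1 k.2|) (0, i)).
rewrite [ltLHS]/Num.Def.normr /= mx_normrE; apply/bigmax_ltP; split=> // -[j i] _ /=.
by rewrite ord1; exact: xe.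
Qed.

Lemma mx_norm_coord (x : V) i : `|x 0 i| <= `|x|.
Proof.
rewrite [leRHS]/Num.Def.normr /= mx_normrE.
exact: (@le_bigmax _ _ _ _ (fun k => `|x k.1 k.2|) (0, i)).
Qed.

Lemma between_normr (a x y e t : R) : `|a - x| < e -> `|a - y| < e ->
  t \in `[Num.min 0 (y - x), Num.max 0 (y - x)]%R -> `|a - (x + t)| < e.
Proof.
rewrite !ltr_norml in_itv /= => /andP[h1 h2] /andP[h3 h4] /andP[].
by rewrite ge_min le_max => /orP[h5|h5] /orP[h6|h6]; apply/andP; split; lra.
Qed.

(** x is moved to y one coordinate at a time, and each move is a one-variable mean value theorem,
    with its own intermediate point. The broken line stays in the ball because a ball of the sup
    norm is a cube. *)
Lemma mean_value (f : V -> R) (a : V) (e : R) (x y : V) : 0 < e ->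
  (forall z, ball a e z -> {for z, continuous f} /\
     forall i, derivable f z (delta_mx 0 i)) ->
  ball a e x -> ball a e y ->
  exists xi : 'I_r -> V, (forall i, ball a e (xi i)) /\
    f y - f x = \sum_i 'D_(delta_mx 0 i) f (xi i) * (y 0 i - x 0 i).
Proof.
move=> e0 fP.
have ballP z : ball a e z <-> forall i, `|a 0 i - z 0 i| < e.
  rewrite -ball_normE /ball_ /= mx_norm_lt //; split.
    by move=> /forallP h i; have := h i; rewrite !mxE.
  by move=> h; apply/forallP => i; rewrite !mxE.
move=> /ballP ax /ballP ay.
pose z (k : nat) : V := \row_j (if (j < k)%N then y 0 j else x 0 j).
have zk (i : 'I_r) : z i.+1 = (y 0 i - x 0 i) *: delta_mx 0 i + z i.
  apply/rowP => j; rewrite !mxE /= ltnS.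
  have [->|ji] := eqVneq j i; first by rewrite leqnn ltnn mulr1 subrK.
  by rewrite mulr0 add0r leq_eqVlt (inj_eq val_inj) (negPf ji).
have step (i : 'I_r) : exists c, ball a e c /\
    f (z i.+1) - f (z i) = 'D_(delta_mx 0 i) f c * (y 0 i - x 0 i).
  have zb t : t \in `[Num.min 0 (y 0 i - x 0 i), Num.max 0 (y 0 i - x 0 i)]%R ->
      ball a e (t *: delta_mx 0 i + z i).
    move=> tb; apply/ballP => j; rewrite !mxE /=.
    have [->|ji] := eqVneq j i; last first.
      by rewrite mulr0 add0r; case: ifP => _; [exact: ay|exact: ax].
    by rewrite ltnn mulr1 addrC; exact: between_normr (ax i) (ay i) tb.
  have [t tb] := @MVT_line _ _ f (z i) (delta_mx 0 i) (y 0 i - x 0 i)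
    (fun t tb => let: conj cf df := fP _ (zb t tb) in conj cf (df i)).
  by rewrite -zk => E; exists (t *: delta_mx 0 i + z i); split=> //; exact: zb.
have [xi xiP] := choice step; exists xi; split=> [i|].
  by have [] := xiP i.
have zr : z r = y by apply/rowP => j; rewrite mxE ltn_ord.
have z0 : z 0%N = x by apply/rowP => j; rewrite mxE.
rewrite -zr -[in f x]z0 -(telescope_sumr (f \o z)) // big_mkord.
by apply: eq_bigr => i _ /=; have [_ ->] := xiP i; rewrite zr.
Qed.

(* Continuous partial derivatives give Frechet differentiability. *)
Lemma smooth_on_diff (D : set V) (f : V -> R) (a : V) : open D -> smooth_on D f -> D a ->
  differentiable f a /\
  forall h, 'd f a h = \sum_i 'D_(delta_mx 0 i) f a * h 0 i.
Proof.
move=> oD sf Da.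
pose df (h : V) : R := \sum_i 'D_(delta_mx 0 i) f a * h 0 i.
have ldf : linear df.
  move=> k u v; rewrite /df scaler_sumr -big_split /=; apply: eq_bigr => i _.
  by rewrite !mxE mulrDr scalerAr mulrCA.
pose Ldf : {linear V -> R} := HB.pack df (GRing.isLinear.Build _ _ _ _ df ldf).
have [] := @differentiable_intro R V R f a Ldf.
- move=> h; apply: (@smooth_on_continuous _ _ setT) => //.
  apply: smooth_on_sum; first exact: openT.
  by move=> i _; apply: smooth_onZ; [exact: openT|apply: smooth_on_coord; exact: openT].
- move=> e e0.
  have r0 : 0 < r%:R + 1 :> R by rewrite ltr_wpDl.
  have nD : \forall z \near a, D z /\ forall i,
      `|'D_(delta_mx 0 i) f z - 'D_(delta_mx 0 i) f a| < e / (r%:R + 1).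
    apply: filterI; first exact: (open_nbhs_nbhs (conj oD Da)).
    apply: (@filter_forall _ _ (fun (i : 'I_r) z => `|'D_(delta_mx 0 i) f z - 'D_(delta_mx 0 i) f a| < e / (r%:R + 1)) (nbhs a) _) => i.
    have cdf := smooth_on_continuous (smooth_on_derive i sf) Da.
    have /cvgrPdist_lt/(_ (e / (r%:R + 1))) := cdf.
    rewrite divr_gt0 // => /(_ isT); apply: filterS => z.
    by rewrite distrC.
  have [d /= d0 dD] := (nbhs_ballP _ _).1 nD.
  apply/(nbhs_ballP _ _); exists d => //= h; rewrite -ball_normE /ball_ /= sub0r normrN => hd.
  have ba : ball a d a by exact: ballxx.
  have bh : ball a d (h + a).
    by rewrite -ball_normE /ball_ /= opprD addrCA subrr addr0 normrN.
  have fP z : ball a d z -> {for z, continuous f} /\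
      forall i, derivable f z (delta_mx 0 i).
    move=> /dD[Dz _]; split=> [|i]; first exact: smooth_on_continuous sf Dz.
    exact: smooth_on_derivable sf Dz.
  have [xi [xib]] := mean_value d0 fP ba bh.
  move=> E; rewrite opprD addrA E -sumrB.
  apply: (le_trans (ler_norm_sum _ _ _)).
  apply: (@le_trans _ _ (\sum_(i < r) (e / (r%:R + 1) * `|h|))); last first.
    rewrite sumr_const card_ord -[leLHS]mulr_natl mulrA ler_wpM2r ?normr_ge0 //.
    rewrite mulrCA; apply: ler_piMr; first exact: ltW.
    by rewrite ler_pdivrMr // mul1r lerDl.
  apply: ler_sum => i _; rewrite !mxE addrK -mulrBl normrM ler_pM ?normr_ge0 //.
    by have [_ /(_ i)/ltW] := dD _ (xib i).
  exact: mx_norm_coord.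
by move=> df' dE; split=> // h; rewrite dE.
Qed.
End Differentiable.

(** * Composition of smooth maps *)

Section Composition.
Context {R : realType} {r n : nat}.
Local Notation V := 'rV[R]_r.
Local Notation W := 'rV[R]_n.

(** A derivative along v only sees the line through x directed by v. On that line derivability is
    differentiability, so the chain rule applies although phi is only assumed derivable in the
    direction v. *)
Lemma is_derive_comp_smooth (E : set W) (f : W -> R) (phi : V -> W) (x v : V)
    (d : 'I_n -> R) : open E -> smooth_on E f -> E (phi x) ->
  (forall j, is_derive x v (fun y => phi y 0 j) (d j)) ->
  is_derive x v (f \o phi) (\sum_j 'D_(delta_mx 0 j) f (phi x) * d j).
Proof.
move=> oE sf Ex dphi.
have dphix : is_derive x v phi (\row_j d j).
  have dphi' : derivable phi x v.
    by apply/derivable_mxP => i j; rewrite ord1; have [] := dphi j.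
  apply: DeriveDef => //; rewrite derive_mx //; apply/matrixP => i j.
  by rewrite !mxE ord1; have [_ ->] := dphi j.
have x0 : x = (0 : R) *: v + x by rewrite scale0r add0r.
rewrite [X in is_derive X _ _ _]x0; apply/is_derive_line.
rewrite [X in is_derive X _ _ _]x0 in dphix; move/is_derive_line : dphix.
set g := fun s : R => phi (s *: v + x) => dg.
have g0 : g 0 = phi x by rewrite /g -x0.
have [df dfE] := smooth_on_diff oE sf Ex.
rewrite -g0 in df dfE *.
have [dg' dgE] := dg; have dg1 := dg'; move/derivable1_diffP : dg1 => dg1.
have dfg : differentiable (f \o g) (0 : R) by exact: differentiable_comp.
apply: DeriveDef; first by apply/derivable1_diffP.
have E1 : 'd g (0 : R) 1 = \row_j d j by rewrite -dgE deriveE.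
rewrite deriveE // (diff_comp dg1 df) [LHS]/= E1 dfE.
by apply: eq_bigr => j _; rewrite mxE.
Qed.

Lemma continuous_rV (phi : V -> W) (x : V) :
  (forall j, {for x, continuous (fun y => phi y 0 j)}) -> {for x, continuous phi}.
Proof.
move=> cphi; suff : phi y @[y --> x] --> phi x by [].
apply/(@cvgrPdist_lt _ _ _ (nbhs x) _ phi (phi x)) => e e0.
have n0 : \forall y \near x, forall j : 'I_n, `|phi x 0 j - phi y 0 j| < e.
  apply: (@filter_forall _ _ (fun (j : 'I_n) y => `|phi x 0 j - phi y 0 j| < e) (nbhs x) _) => j.
  by have /cvgrPdist_lt/(_ e e0) := cphi j.
apply: filterS n0 => y yP; rewrite mx_norm_lt //.
by apply/forallP => j; rewrite !mxE.
Qed.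

Definition map_smooth_on (D : set V) (phi : V -> W) :=
  forall j, smooth_on D (fun y => phi y 0 j).

Lemma map_smooth_on_continuous D phi x : map_smooth_on D phi -> D x ->
  {for x, continuous phi}.
Proof.
by move=> sphi Dx; apply: continuous_rV => j; exact: smooth_on_continuous (sphi j) Dx.
Qed.

(** The iterated partials of f composed with phi, together with the iterated partials of the
    components of phi, form a stable family by the chain rule. *)
Lemma smooth_on_comp (D : set V) (E : set W) (f : W -> R) (phi : V -> W) :
  open D -> open E -> (forall x, D x -> E (phi x)) ->
  smooth_on E f -> map_smooth_on D phi -> smooth_on D (f \o phi).
Proof.
move=> oD oE DE sf sphi.
pose B := [set g : V -> R | exists s, g = iter_partial f s \o phi].
pose C := [set g : V -> R | exists j, iter_partials (fun y => phi y 0 j) g].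
have BC : stable_partials D (B `|` C).
  apply: stable_partialsU => g.
    move=> [s ->]; have sfs := smooth_on_iter s sf; split=> [x Dx|i].
      apply: (@continuous_comp _ _ _ phi); first exact: map_smooth_on_continuous sphi Dx.
      exact: smooth_on_continuous sfs (DE x Dx).
    exists (fun x => \sum_j 'D_(delta_mx 0 j) (iter_partial f s) (phi x) *
        'D_(delta_mx 0 i) (fun y => phi y 0 j) x); split.
      rewrite (_ : (fun _ => _) = \sum_j (iter_partial f (j :: s) \o phi) *
          iter_partial (fun y => phi y 0 j) [:: i]).
        elim/big_rec: _ => [|j g' _ IH]; first exact: algebra_gen_cst.
        apply: algebra_gen_add IH; apply: algebra_gen_mul; apply: algebra_gen_base.
          by left; exists (j :: s).
        by right; exists j, [:: i].
      by apply/funext => x; rewrite fct_sumE.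
    move=> x Dx; apply: is_derive_comp_smooth oE sfs (DE x Dx) _ => j.
    by apply: derivableP; exact: smooth_on_derivable (sphi j) Dx.
  move=> [j gj]; have [cg dg] := iter_partials_stable (sphi j) gj.
  split=> // i; have [h [hB dh]] := dg i; exists h; split=> //.
  by apply: algebra_genS hB => h' ?; right; exists j.
apply: (algebra_gen_smooth oD BC); apply: algebra_gen_base; left.
by exists [::].
Qed.
End Composition.

(** * The inverse function theorem *)

Lemma half_contraction_fixpoint (R : realType) (X : completeNormedModType R) (U : set X)
    (f : X -> X) : closed U -> U !=set0 -> (forall x, U x -> U (f x)) ->
  (forall x y, U x -> U y -> `|f x - f y| <= 2^-1 * `|x - y|) ->
  exists2 x, U x & x = f x.
Proof.
move=> cU U0 fU lip.
pose F : {fun U >-> U} := mkfun_fun (fU : set_fun U U f).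
apply: (@banach_fixed_point R X U F) cU U0.
have q0 : 0 <= 2^-1 :> R by rewrite invr_ge0.
exists (NngNum q0); split => /=; first by rewrite invf_lt1 ?ltr1n.
by move=> -[x y] [/= Ux Uy]; exact: lip.
Qed.

Definition complete_rV (R : realType) (n : nat) : completeNormedModType R :=
  HB.pack_for (completeNormedModType R) ('rV[R]_n).

Section InverseFunction.
Context {R : realType} {n : nat}.
Local Notation V := 'rV[R]_n.
Implicit Types (D : set V) (H : V -> V).

Definition jac H (x : V) : 'M[R]_n :=
  \matrix_(i, j) 'D_(delta_mx 0 i) (fun y => H y 0 j) x.

Lemma map_smooth_on_diff D H a (e : R) : open D -> map_smooth_on D H -> D a -> 0 < e ->
  \forall h \near (0 : V), `|H (h + a) - H a - h *m jac H a| <= e * `|h|.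
Proof.
move=> oD sH Da e0.
have nj : \forall h \near (0 : V), forall j : 'I_n,
    `|(H (h + a) - H a - h *m jac H a) 0 j| <= e * `|h|.
  apply: (@filter_forall _ _ (fun (j : 'I_n) (h : V) =>
    `|(H (h + a) - H a - h *m jac H a) 0 j| <= e * `|h|) (nbhs (0 : V)) _) => j.
  have [df dfE] := smooth_on_diff oD (sH j) Da.
  have /eqaddoP/(_ e e0) := diff_locally df; apply: filterS => h.
  suff -> : (H (h + a) - H a - h *m jac H a) 0 j =
    H (h + a) 0 j - (H a 0 j + 'd (fun y => H y 0 j) a h) by [].
  rewrite dfE opprD addrA !mxE; congr (_ - _).
  by apply: eq_bigr => i _; rewrite mxE mulrC.
apply: filterS nj => h hj; rewrite [leLHS]/Num.Def.normr /= mx_normrE.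
apply: bigmax_le => [|[k j] _ /=]; first by rewrite mulr_ge0 ?normr_ge0 // ltW.
by rewrite ord1; exact: hj.
Qed.

Lemma mx_norm_le (x : V) (e : R) : 0 <= e -> (forall i, `|x 0 i| <= e) -> `|x| <= e.
Proof.
move=> e0 xe; rewrite [leLHS]/Num.Def.normr /= mx_normrE.
by apply: bigmax_le => // -[k j] _ /=; rewrite ord1.
Qed.

(** A matrix with entries bounded by c at most halves the sup norm of a row of length n. The
    successor of n keeps c positive when n = 0. *)
Local Notation c := ((2 * n.+1%:R)^-1 : R).

Lemma sum_small (a v : 'I_n -> R) (m : R) : (forall i, `|a i| <= c) ->
  (forall i, `|v i| <= m) -> 0 <= m -> `|\sum_i v i * a i| <= 2^-1 * m.
Proof.
move=> ac vm m0; apply: (le_trans (ler_norm_sum _ _ _)).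
apply: (@le_trans _ _ (\sum_(i < n) (m * c))).
  by apply: ler_sum => i _; rewrite normrM ler_pM ?normr_ge0.
rewrite sumr_const card_ord -[leLHS]mulr_natl mulrCA mulrC; apply: ler_wpM2r => //.
rewrite invfM mulrCA ler_piMr ?invr_ge0 //.
by rewrite ler_pdivrMr ?ltr0n // mul1r ler_nat.
Qed.

(** A row v with v M = 0 satisfies v = - v (M - 1), so its norm is at most half of itself. *)
Lemma near_id_unitmx (M : 'M[R]_n) : (forall i j, `|M i j - (i == j)%:R| <= c) ->
  M \in unitmx.
Proof.
move=> Mc; rewrite -row_free_unit -kermx_eq0; apply/eqP/row_matrixP => k.
have vM : row k (kermx M) *m M = 0 by apply/sub_kermxP; exact: row_sub.
rewrite row0; move: (row k _) vM => v vM.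
suff : `|v| <= 2^-1 * `|v|.
  by rewrite -subr_le0 -{1}[`|v|]mul1r -mulrBl pmulr_rle0 ?normr_le0; [move=> /eqP|lra].
apply: mx_norm_le => [|j]; first by rewrite mulr_ge0 ?normr_ge0 ?invr_ge0.
have -> : v 0 j = - \sum_i v 0 i * (M i j - (i == j)%:R).
  have /matrixP/(_ 0 j) := vM; rewrite !mxE => vMj.
  rewrite (eq_bigr (fun i => v 0 i * M i j - v 0 i * (i == j)%:R)); last first.
    by move=> i _; rewrite mulrBr.
  rewrite sumrB vMj sub0r opprK (bigD1 j) //= eqxx mulr1 big1 ?addr0 // => i /negPf ->.
  by rewrite mulr0.
rewrite normrN; apply: sum_small => // i; exact: mx_norm_coord.
Qed.

(** The mean value theorem is applied to each coordinate of H. The rows of the Jacobian are taken at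
    different points of the ball, which is harmless because the bound by c is entrywise. *)
Lemma near_id_lipschitz D H (e : R) : 0 < e -> map_smooth_on D H ->
  (forall x, ball (0 : V) e x -> D x /\ forall i j, `|jac H x i j - (i == j)%:R| <= c) ->
  forall x y, ball (0 : V) e x -> ball (0 : V) e y ->
    `|(x - H x) - (y - H y)| <= 2^-1 * `|x - y|.
Proof.
move=> e0 sH small x y bx by_; rewrite (distrC x y).
apply: mx_norm_le => [|j]; first by rewrite mulr_ge0 ?normr_ge0 ?invr_ge0.
have fP z : ball (0 : V) e z -> {for z, continuous (fun x => H x 0 j)} /\
    forall i, derivable (fun x => H x 0 j) z (delta_mx 0 i).
  move=> /small[Dz _]; split=> [|i]; first exact: smooth_on_continuous (sH j) Dz.
  exact: smooth_on_derivable (sH j) Dz.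
have [xi [xib xiE]] := mean_value e0 fP bx by_.
have -> : (x - H x - (y - H y)) 0 j =
    \sum_i (y - x) 0 i * (jac H (xi i) i j - (i == j)%:R).
  rewrite (eq_bigr (fun i => (y - x) 0 i * jac H (xi i) i j -
    (y - x) 0 i * (i == j)%:R)); last by move=> i _; rewrite mulrBr.
  rewrite sumrB.
  have -> : \sum_i (y - x) 0 i * (i == j)%:R = (y - x) 0 j.
    rewrite (bigD1 j) //= eqxx mulr1 big1 ?addr0 // => i /negPf ->.
    by rewrite mulr0.
  rewrite (eq_bigr (fun i => 'D_(delta_mx 0 i) (fun z => H z 0 j) (xi i) *
    (y 0 i - x 0 i))); last by move=> i _; rewrite !mxE mulrC.
  by rewrite -xiE !mxE; ring.
apply: sum_small => [i|i|]; [|exact: mx_norm_coord|exact: normr_ge0].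
by have [_] := small _ (xib i).
Qed.
Lemma near_id_ball D H : open D -> D 0 -> map_smooth_on D H -> jac H 0 = 1%:M ->
  exists e : R, 0 < e /\ forall x, ball (0 : V) e x ->
    D x /\ forall i j, `|jac H x i j - (i == j)%:R| <= c.
Proof.
move=> oD D0 sH J0.
have c0 : 0 < c by rewrite invr_gt0 mulr_gt0.
have nJ : \forall x \near (0 : V), forall i j, `|jac H x i j - (i == j)%:R| <= c.
  apply: (@filter_forall _ _ (fun (i : 'I_n) (x : V) =>
    forall j, `|jac H x i j - (i == j)%:R| <= c) (nbhs (0 : V)) _) => i.
  apply: (@filter_forall _ _ (fun (j : 'I_n) (x : V) =>
    `|jac H x i j - (i == j)%:R| <= c) (nbhs (0 : V)) _) => j.
  have cd := smooth_on_continuous (smooth_on_derive i (sH j)) D0.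
  have /cvgrPdist_le/(_ c c0) := cd; apply: filterS => x.
  have /matrixP/(_ i j) := J0; rewrite !mxE => ->.
  by rewrite distrC.
have [e /= e0 eP] := (nbhs_ballP _ _).1
  (filterI (open_nbhs_nbhs (conj oD D0)) nJ).
by exists e; split=> // x /eP.
Qed.

(** K w is the fixed point of x |-> w + (x - H x), a half contraction of the closed ball of radius
    e/2; [|w| < e/4] makes the image land strictly inside. The same contraction gives |x - y| <= 2
    |H x - H y|, hence injectivity and the Lipschitz constant 2 of K. *)
Lemma local_inverse D H : open D -> D 0 -> map_smooth_on D H -> H 0 = 0 ->
  jac H 0 = 1%:M -> exists (d : R) (K : V -> V), [/\ 0 < d, K 0 = 0,
    forall w, ball (0 : V) d w -> [/\ D (K w), H (K w) = w & jac H (K w) \in unitmx],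
    forall w w', ball (0 : V) d w -> ball (0 : V) d w' -> `|K w - K w'| <= 2 * `|w - w'| &
    \forall x \near (0 : V), K (H x) = x].
Proof.
move=> oD D0 sH H0 J0; have [e [e0 eP]] := near_id_ball oD D0 sH J0.
have lip := near_id_lipschitz e0 sH eP.
have ballE (d : R) x : ball (0 : V) d x = (`|x| < d) :> Prop.
  by rewrite -ball_normE /ball_ /= sub0r normrN.
pose U := [set x : V | `|x| <= e / 2].
have Ub x : U x -> ball (0 : V) e x.
  by rewrite ballE /U /= => xe; apply: le_lt_trans xe _; lra.
have b0 : ball (0 : V) e 0 by exact: ballxx.
have lip0 x : U x -> `|x - H x| <= 2^-1 * `|x|.
  by move=> /Ub xe; have := lip x 0 xe b0; rewrite H0 !subr0.
have cU : closed U.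
  rewrite (_ : U = closed_ball_ Num.norm (0 : V) (e / 2)); first exact: closed_closed_ball_.
  by apply/seteqP; split=> x; rewrite /U /closed_ball_ /= sub0r normrN.
have ex w : exists x, `|w| < e / 4 -> `|x| < e / 2 /\ H x = w.
  have [we|] := ltrP `|w| (e / 4); last by exists 0.
  have Uw x : U x -> `|w + (x - H x)| < e / 2.
    move=> Ux; apply: le_lt_trans (ler_normD _ _) _.
    by have := lip0 x Ux; move: Ux; rewrite /U /=; lra.
  have fU x : U x -> U (w + (x - H x)) by move=> /Uw/ltW.
  have lipU x y : U x -> U y ->
      `|w + (x - H x) - (w + (y - H y))| <= 2^-1 * `|x - y|.
    by move=> /Ub Ux /Ub Uy; rewrite opprD addrACA subrr add0r; exact: lip.
  have U0 : U !=set0 by exists 0; rewrite /U /= normr0 divr_ge0 // ltW.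
  have [x Ux xE] := @half_contraction_fixpoint R (complete_rV R n) U
      (fun x => w + (x - H x)) cU U0 fU lipU.
  exists x => _; split; first by rewrite {1}xE; exact: Uw.
  move: xE => /(congr1 (fun z => z - x + H x)); rewrite subrr add0r => ->.
  by apply/rowP => j; rewrite !mxE; ring.
have inj x y : `|x| < e / 2 -> `|y| < e / 2 -> `|x - y| <= 2 * `|H x - H y|.
  move=> /ltW/Ub xe /ltW/Ub ye; have := lip x y xe ye.
  have := ler_normD (x - H x - (y - H y)) (H x - H y).
  have -> : x - H x - (y - H y) + (H x - H y) = x - y.
    by apply/rowP => j; rewrite !mxE; ring.
  lra.
have [K KP] := choice ex.
have e40 : 0 < e / 4 by rewrite divr_gt0.
exists (e / 4), K; split => //.
- have [|K0 HK0] := KP 0; first by rewrite normr0.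
  have e20 : `|0 : V| < e / 2 by rewrite normr0 divr_gt0.
  have := inj _ _ K0 e20; rewrite HK0 H0 subrr normr0 mulr0 subr0.
  by rewrite normr_le0 => /eqP.
- move=> w; rewrite ballE => /KP[Kw HKw].
  have [DK JK] := eP (K w) (Ub _ (ltW Kw)).
  by split=> //; exact: near_id_unitmx.
- move=> w w'; rewrite !ballE => /KP[Kw HKw] /KP[Kw' HKw'].
  by rewrite -{2}HKw -{2}HKw'; exact: inj.
- have cH : {for (0 : V), continuous H} by exact: map_smooth_on_continuous sH D0.
  have n1 : \forall x \near (0 : V), `|x| < e / 2.
    apply/(nbhs_ballP _ _); exists (e / 2); first by rewrite /= divr_gt0.
    by move=> x; rewrite ballE.
  have n2 : \forall x \near (0 : V), `|H x| < e / 4.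
    have := cH; rewrite /prop_for /continuous_at H0.
    move=> /(@cvgrPdist_lt _ _ _ (nbhs (0 : V)) _ H (0 : V))/(_ _ e40).
    by apply: filterS => x; rewrite sub0r normrN.
  apply: filterS2 n1 n2 => x xe Hxe; have [Kx HKx] := KP _ Hxe.
  have := inj _ _ Kx xe; rewrite HKx subrr normr0 mulr0 normr_le0 subr_eq0.
  by move=> /eqP.
Qed.
End InverseFunction.

Section InverseSmooth.
Context {R : realType} {n : nat}.
Local Notation V := 'rV[R]_n.
Implicit Types (D : set V) (H : V -> V).

Lemma mulmx_norm_le (u : V) (M : 'M[R]_n) j :
  `|(u *m M) 0 j| <= `|u| * \sum_i `|M i j|.
Proof.
rewrite mxE mulr_sumr; apply: le_trans (ler_norm_sum _ _ _) _.
apply: ler_sum => i _; rewrite normrM; apply: ler_wpM2r; first exact: normr_ge0.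
exact: mx_norm_coord.
Qed.

(** The first-order expansion of H at K w is applied to h = K(k + w) - K w and multiplied by the
    inverse Jacobian. Since |h| <= 2 |k|, the error is small with respect to |k|; the tolerance e /
    (2 C) absorbs this 2 and the size C of a column of the inverse Jacobian. *)
Lemma local_inverse_derive D H (K : V -> V) (d : R) : open D -> map_smooth_on D H ->
  (forall w, ball (0 : V) d w -> [/\ D (K w), H (K w) = w & jac H (K w) \in unitmx]) ->
  (forall w w', ball (0 : V) d w -> ball (0 : V) d w' -> `|K w - K w'| <= 2 * `|w - w'|) ->
  forall w i j, ball (0 : V) d w ->
  is_derive w (delta_mx 0 i) (fun w => K w 0 j) (invmx (jac H (K w)) i j).
Proof.
move=> oD sH KP lip w i j bw; have [DK HK uJ] := KP w bw.
set Ji := invmx _.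
pose df (k : V) : R := (k *m Ji) 0 j.
have ldf : linear df.
  by move=> k u v; rewrite /df mulmxDl -scalemxAl !mxE.
pose Ldf : {linear V -> R} := HB.pack df (GRing.isLinear.Build _ _ _ _ df ldf).
suff [dK dKE] : differentiable (fun w => K w 0 j) w /\ 'd (fun w => K w 0 j) w = Ldf :> (V -> R).
  apply: DeriveDef; first exact: diff_derivable.
  rewrite deriveE // dKE /= /df mxE (bigD1 i) //= big1 ?addr0.
    by rewrite mxE !eqxx mul1r.
  by move=> k /negPf ki; rewrite mxE eqxx ki mul0r.
apply: differentiable_intro.
  move=> k; apply: (@smooth_on_continuous _ _ setT) => //.
  rewrite (_ : _ Ldf = fun k : V => \sum_i Ji i j * k 0 i).
    apply: smooth_on_sum; first exact: openT.
    by move=> l _; apply: smooth_onZ; [exact: openT|apply: smooth_on_coord; exact: openT].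
  by apply/funext => h; rewrite /= /df mxE; apply: eq_bigr => l _; rewrite mulrC.
move=> e e0.
pose C := \sum_i `|Ji i j| + 1.
have C0 : 0 < C by rewrite ltr_wpDl // sumr_ge0.
have ep0 : 0 < e / (2 * C) by rewrite divr_gt0 // mulr_gt0.
have /(nbhs_ballP _ _).1 [d' /= d'0 d'P] := map_smooth_on_diff oD sH DK ep0.
have nw : \forall k \near (0 : V), ball (0 : V) d (k + w).
  have : \forall k \near (0 : V), ball w (d - `|w|) (k + w).
    apply/(nbhs_ballP _ _); exists (d - `|w|) => /=.
      by move: bw; rewrite -ball_normE /ball_ /= sub0r normrN subr_gt0.
    move=> k; rewrite -!ball_normE /ball_ /= sub0r normrN.
    by rewrite opprD addrCA subrr addr0 normrN.
  apply: filterS => k; rewrite -!ball_normE /ball_ /= sub0r normrN => kw.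
  have := ler_normD (k + w - w) w; rewrite subrK => ?; rewrite distrC in kw; lra.
have nd : \forall k \near (0 : V), ball (0 : V) (d' / 2) k.
  by apply/(nbhs_ballP _ _); exists (d' / 2); rewrite /= ?divr_gt0.
apply: filterS2 nw nd => k bkw; rewrite -ball_normE /ball_ /= sub0r normrN => kd.
have [DKk HKk _] := KP _ bkw.
have := lip _ _ bkw bw; rewrite addrK; set h := K (k + w) - K w => hk.
have hd : ball (0 : V) d' h.
  by rewrite -ball_normE /ball_ /= sub0r normrN; lra.
have := d'P h hd; rewrite /h subrK HKk HK -/h addrK => kh.
rewrite opprD addrA; have -> : K (k + w) 0 j - K w 0 j - df k = ((h *m jac H (K w) - k) *m Ji) 0 j.
  by rewrite mulmxBl -mulmxA mulmxV // mulmx1 /df /h !mxE.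
apply: (le_trans (mulmx_norm_le _ _ _)).
rewrite distrC; apply: (@le_trans _ _ (e / (2 * C) * (2 * `|k|) * C)).
  apply: ler_pM; rewrite ?normr_ge0 ?sumr_ge0 //; last by rewrite lerDl.
  by apply: le_trans kh _; apply: ler_wpM2l => //; exact: ltW.
rewrite le_eqVlt; apply/orP; left; apply/eqP; field.
by rewrite gt_eqF.
Qed.

(* The entries of the inverse Jacobian are polynomials in those of the Jacobian
   and in the reciprocal of its determinant. *)
Theorem inverse_function D H : open D -> D 0 -> map_smooth_on D H -> H 0 = 0 ->
  jac H 0 = 1%:M -> exists (E : set V) (K : V -> V), [/\ open E /\ E 0, map_smooth_on E K,
    K 0 = 0, forall w, E w -> D (K w) /\ H (K w) = w &
    \forall x \near (0 : V), K (H x) = x].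
Proof.
move=> oD D0 sH H0 J0.
have [d [K [d0 K0 KP lip KH]]] := local_inverse oD D0 sH H0 J0.
have dK := local_inverse_derive oD sH KP lip.
have oE : open (ball (0 : V) d) by exact: ball_open.
exists (ball (0 : V) d), K; split=> //; first by split=> //; exact: ballxx.
  pose B := [set g : V -> R | exists j s, g = iter_partial (fun y => H y 0 j) s \o K].
  pose B1 := [set g : V -> R | exists j, g = (fun w => K w 0 j)].
  pose B2 := [set fun w => (\det (jac H (K w)))^-1].
  pose C := B1 `|` (B `|` B2).
  have CB g : B g -> algebra_gen C g.
    by move=> Bg; apply: algebra_gen_base; right; left.
  have BJ i j : algebra_gen B (fun w => jac H (K w) i j).
    apply: algebra_gen_base; exists j, [:: i].
    by apply/funext => w; rewrite mxE.
  have Bdet : algebra_gen B (fun w => \det (jac H (K w))).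
    rewrite (_ : (fun _ => _) = fun w => \det (\matrix_(i, j) jac H (K w) i j)).
      exact: algebra_gen_det.
    apply/funext => w; congr (\det _); apply/matrixP => i j; by rewrite [RHS]mxE.
  have Cinv i j : algebra_gen C (fun w => (\det (jac H (K w)))^-1 * \adj (jac H (K w)) i j).
    apply: (@algebra_gen_mul _ _ _ (fun w => (\det (jac H (K w)))^-1)
      (fun w => \adj (jac H (K w)) i j)).
      by apply: algebra_gen_base; right; right.
    apply: (algebra_gen_trans CB).
    rewrite (_ : (fun _ => _) = cst ((-1) ^+ (j + i)) * fun w =>
        \det (\matrix_(k, l) jac H (K w) (lift j k) (lift i l))).
      apply: algebra_gen_mul; first exact: algebra_gen_cst.
      by apply: algebra_gen_det => k l; exact: BJ.
    apply/funext => w; rewrite mxE /cofactor; congr (_ * \det _).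
    by apply/matrixP => k l; rewrite [LHS]mxE [LHS]mxE [RHS]mxE.
  have dKC w i j : ball (0 : V) d w -> is_derive w (delta_mx 0 i) (fun w => K w 0 j)
      ((\det (jac H (K w)))^-1 * \adj (jac H (K w)) i j).
    move=> bw; have [_ _ uJ] := KP w bw; have := dK w i j bw.
    by rewrite /invmx uJ mxE.
  have cK w : ball (0 : V) d w -> {for w, continuous K}.
    move=> bw; suff : K y @[y --> w] --> K w by [].
    apply/(@cvgrPdist_lt _ _ _ (nbhs w) _ K (K w)) => e e0.
    have e20 : 0 < e / 2 by rewrite divr_gt0.
    have n1 : \forall y \near w, ball w (e / 2) y by exact: nbhsx_ballx.
    apply: filterS2 (open_nbhs_nbhs (conj oE bw)) n1 => y by_.
    rewrite -[ball w _ _]/(ball w (e / 2) y) -ball_normE /ball_ /= => wy.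
    by have := lip _ _ bw by_; lra.
  have pB g : B g -> partials_in (ball (0 : V) d) C g.
    move=> [j [s ->]]; have sHs := smooth_on_iter s (sH j); split=> [w bw|i].
      apply: (@continuous_comp _ _ _ K); first exact: cK.
      by apply: smooth_on_continuous sHs _; have [] := KP w bw.
    exists (fun w => \sum_k (iter_partial (fun y => H y 0 j) (k :: s) \o K) w *
      ((\det (jac H (K w)))^-1 * \adj (jac H (K w)) i k)); split.
      apply: algebra_gen_sum => k _.
      apply: (@algebra_gen_mul _ _ _ (iter_partial (fun y => H y 0 j) (k :: s) \o K)
        (fun w => (\det (jac H (K w)))^-1 * \adj (jac H (K w)) i k)) => //.
      by apply: CB; exists j, (k :: s).
    move=> w bw; apply: is_derive_comp_smooth oD sHs _ _; first by have [] := KP w bw.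
    by move=> k; exact: dKC.
  have [cdet ddet] := algebra_gen_partials CB pB Bdet.
  have det0 w : ball (0 : V) d w -> \det (jac H (K w)) != 0.
    by move=> bw; have [_ _] := KP w bw; rewrite unitmxE unitfE.
  have sC : stable_partials (ball (0 : V) d) C.
    move=> g [[j ->]|[/pB //|->]].
      split=> [w bw|i].
        apply: (@continuous_comp _ _ _ K (fun y : V => y 0 j)); first exact: cK.
        exact: coord_continuous.
      by exists (fun w => (\det (jac H (K w)))^-1 * \adj (jac H (K w)) i j); split=> // w /dKC.
    split=> [w bw|i].
      by apply: continuousV; [exact: det0|exact: cdet].
    have [h [hC dh]] := ddet i; pose q w := (\det (jac H (K w)))^-1.
    have Cq : algebra_gen C q by apply: algebra_gen_base; right; right.
    exists (cst (-1) * (q * q * h)); split.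
      by apply: algebra_gen_mul; [exact: algebra_gen_cst|do 2 apply: algebra_gen_mul => //].
    move=> w bw; have [dhw dhE] := dh w bw.
    apply: DeriveDef; first by apply: derivableV; [exact: det0|].
    rewrite deriveV //; last exact: det0.
    rewrite dhE.
    by rewrite !fctE /= mulN1r scaleNr -expr2 exprVn.
  move=> j; apply: (algebra_gen_smooth oE sC).
  by apply: algebra_gen_base; left; exists j.
by move=> w bw; have [] := KP w bw.
Qed.
End InverseSmooth.

(** * Hadamard's lemma *)

Section UnitIntegral.
Context {R : realType}.
Local Notation mu := (@lebesgue_measure R).
Local Notation cont01 f := ({within `[0%R : R, 1%R : R], continuous f}).
Implicit Types f g : R -> R.

Definition integral01 f : R := Rintegral mu `[0%R : R, 1%R : R] f.

Lemma integrable01 f : cont01 f -> mu.-integrable `[0%R : R, 1%R : R] (EFin \o f).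
Proof. by move=> cf; apply: continuous_compact_integrable => //; exact: segment_compact. Qed.

Lemma integral01B f g : cont01 f -> cont01 g ->
  integral01 (fun t => f t - g t) = integral01 f - integral01 g.
Proof. by move=> /integrable01 ? /integrable01 ?; exact: RintegralB. Qed.

Lemma integral01D f g : cont01 f -> cont01 g ->
  integral01 (fun t => f t + g t) = integral01 f + integral01 g.
Proof. by move=> /integrable01 ? /integrable01 ?; exact: RintegralD. Qed.

Lemma integral01Z (c : R) f : cont01 f -> integral01 (fun t => c * f t) = c * integral01 f.
Proof. by move=> /integrable01 ?; exact: RintegralZl. Qed.

Lemma cont01B f g : cont01 f -> cont01 g -> cont01 (fun t => f t - g t).
Proof. by move=> cf cg t; exact: continuousB (cf t) (cg t). Qed.

Lemma cont01Z (c : R) f : cont01 f -> cont01 (fun t => c * f t).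
Proof.
move=> cf t; have cc : {for t, continuous (cst c : subspace `[0%R : R, 1%R : R] -> R)}.
  exact: cst_continuous.
exact: continuousM cc (cf t).
Qed.

Lemma integral01_bound (M : R) f : cont01 f -> (forall t, 0 <= t <= 1 -> `|f t| <= M) ->
  `|integral01 f| <= M.
Proof.
move=> cf fM; have cnf : cont01 (fun t => `|f t|).
  by move=> t; apply: continuous_comp; [exact: cf|exact: norm_continuous].
have cM : cont01 (cst M) by move=> t; exact: cst_continuous.
have fM' t : `[0%R : R, 1%R : R]%classic t -> `|f t| <= cst M t.
  by rewrite /= in_itv /=; exact: fM.
have mI : measurable (`[0%R : R, 1%R : R]%classic : set (measurableTypeR R)) by [].
apply: le_trans (le_normr_Rintegral mI (integrable01 cf)) _.
apply: le_trans (le_Rintegral mI (integrable01 cnf) (integrable01 cM) fM') _.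
rewrite Rintegral_cst //=; rewrite lebesgue_measure_itv /= lte_fin ltr01.
by rewrite oppr0 adde0 mulr1.
Qed.

Lemma integral01_FTC (F f : R -> R) : cont01 f ->
  (forall t : R, 0 <= t <= 1 -> is_derive t 1 F (f t)) -> integral01 f = F 1 - F 0.
Proof.
move=> cf dF; have cF (t : R) : 0 <= t <= 1 -> {for t, continuous F}.
  move=> /dF[dFt _]; apply: differentiable_continuous.
  exact/derivable1_diffP.
rewrite /integral01 /Rintegral (@continuous_FTC2 _ f F) ?ltr01 //.
- split.
  + move=> t; rewrite in_itv /= => /andP[t0 t1].
    have t01 : 0 <= t <= 1 by rewrite !ltW.
    by have [] := dF t t01.
  + by apply: cvg_at_right_filter; apply: cF; rewrite lexx ler01.
  + by apply: cvg_at_left_filter; apply: cF; rewrite lexx ler01.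
- move=> t; rewrite in_itv /= => /andP[t0 t1].
  have t01 : 0 <= t <= 1 by rewrite !ltW.
  by have [_ dFE] := dF t t01; rewrite derive1E dFE.
Qed.
End UnitIntegral.

Section Hadamard.
Context {R : realType} {r : nat}.
Local Notation V := 'rV[R]_r.
Implicit Types (D : set V) (f g : V -> R).

Lemma is_derive_quadratic (W : normedModType R) (F : W -> R) (z v : W) (l C e : R) : 0 < e ->
  (forall h : R, `|h| < e -> `|F (h *: v + z) - F z - h * l| <= C * `|h| * `|h|) ->
  is_derive z v F l.
Proof.
move=> e0 Fl; suff cF : h^-1 *: ((F \o shift z) (h *: v) - F z) @[h --> 0^'] --> l.
  by apply: DeriveDef; [apply/cvg_ex; exists l|apply/cvg_lim].
apply/cvgrPdist_le => d d0.
have C0 : 0 < `|C| + 1 by rewrite ltr_wpDl.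
near=> h.
have h0 : h != 0 by near: h; exact: nbhs_dnbhs_neq.
have he : `|h| < e by near: h; exact: dnbhs0_lt.
have hd : `|h| < d / (`|C| + 1) by near: h; apply: dnbhs0_lt; rewrite divr_gt0.
rewrite distrC -(ler_pM2l (x := `|h|)) ?normr_gt0 // -normrM mulrBr.
rewrite -[_ *: _]/(_ * _) mulrA divff // mul1r; apply: le_trans (Fl h he) _.
rewrite [leRHS]mulrC ler_pM2r ?normr_gt0 //.
apply: (@le_trans _ _ ((`|C| + 1) * `|h|)).
  by rewrite ler_wpM2r ?normr_ge0 //; have := ler_norm C; lra.
by move: hd; rewrite ltr_pdivlMr // mulrC => /ltW.
Unshelve. all: by end_near. Qed.

Lemma smooth_on_bounded D f (e : R) : 0 < e -> (forall x, `|x| <= e -> D x) ->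
  smooth_on D f -> exists M : R, 0 <= M /\ forall x : V, `|x| <= e -> `|f x| <= M.
Proof.
move=> e0 eD sf; pose A := closed_ball_ Num.norm (0 : V) e.
have AE x : A x = (`|x| <= e) :> Prop by rewrite /A /closed_ball_ /= sub0r normrN.
have cA : compact A.
  apply: bounded_closed_compact; last exact: closed_closed_ball_.
  exists e; split; first by rewrite num_real.
  by move=> M eM x; rewrite AE => /le_trans; apply; exact: ltW.
have A0 : A !=set0 by exists 0; rewrite AE normr0 ltW.
have cf : {within A, continuous (fun x => `|f x|)}.
  apply: continuous_in_subspaceT => x /set_mem; rewrite AE => /eD Dx.
  apply: continuous_comp; last exact: norm_continuous.
  exact: smooth_on_continuous sf Dx.
have [c _ cM] := @EVT_max_rV R r (fun x => `|f x|) A A0 cA cf.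
by exists `|f c|; split=> // x xe; apply: cM; rewrite inE AE.
Qed.

Lemma smooth_on_lipschitz D f (e : R) : 0 < e -> (forall x, `|x| <= e -> D x) ->
  smooth_on D f -> exists C : R, 0 <= C /\
    forall x y : V, `|x| < e -> `|y| < e -> `|f x - f y| <= C * `|x - y|.
Proof.
move=> e0 eD sf.
have /choice[M MP] i := smooth_on_bounded e0 eD (smooth_on_derive i sf).
exists (\sum_i M i); split=> [|x y xe ye].
  by apply: sumr_ge0 => i _; have [] := MP i.
have ballE x' : ball (0 : V) e x' = (`|x'| < e) :> Prop.
  by rewrite -ball_normE /ball_ /= sub0r normrN.
have fP z : ball (0 : V) e z -> {for z, continuous f} /\
    forall i, derivable f z (delta_mx 0 i).
  rewrite ballE => /ltW/eD Dz; split=> [|i]; first exact: smooth_on_continuous sf Dz.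
  exact: smooth_on_derivable sf Dz.
rewrite -ballE in xe; rewrite -ballE in ye.
have [xi [xib ->]] := mean_value e0 fP ye xe.
rewrite mulr_suml; apply: le_trans (ler_norm_sum _ _ _) _; apply: ler_sum => i _.
rewrite normrM; apply: ler_pM; rewrite ?normr_ge0 //.
  by have [_] := MP i; apply; have := xib i; rewrite ballE => /ltW.
by have := mx_norm_coord (x - y) i; rewrite !mxE.
Qed.

Lemma mx_norm_ray (e : R) (z : V) (t : R) : 0 <= t <= 1 -> `|z| < e -> `|t *: z| < e.
Proof.
move=> /andP[t0 t1] ze; rewrite normrZ ger0_norm //; apply: le_lt_trans ze.
by rewrite ler_piMl ?normr_ge0.
Qed.

Lemma mx_norm_delta (h : R) i : `|h *: delta_mx 0 i : V| <= `|h|.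
Proof.
apply: mx_norm_le => // j; rewrite !mxE eqxx /=.
by case: eqP; rewrite ?mulr1 ?mulr0 ?normr0.
Qed.

(** Hadamard's coefficients are the case k = 0. The powers of t make the family closed under
    differentiation: a derivative in z brings out one factor t. *)
Definition ray_mean k g (z : V) : R := integral01 (fun t => t ^+ k * g (t *: z)).

Section RayMean.
Context (D : set V) (e : R).
Hypotheses (e0 : 0 < e) (eD : forall x : V, `|x| <= e -> D x).

Lemma ray_cont k g (z : V) : smooth_on D g -> `|z| < e ->
  {within `[0%R : R, 1%R : R], continuous (fun t : R => t ^+ k * g (t *: z))}.
Proof.
move=> sg ze; apply: continuous_in_subspaceT => t /set_mem; rewrite /= in_itv /= => t01.
have ct : {for t, continuous (fun t : R => t ^+ k)}.
  by apply: differentiable_continuous; apply/derivable1_diffP; exact: exprn_derivable.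
have cg : {for t, continuous (fun t : R => g (t *: z))}.
  apply: (@continuous_comp _ _ _ (fun t : R => t *: z) g).
    exact: scalel_continuous.
  apply: smooth_on_continuous sg _; apply: eD; apply: ltW; exact: mx_norm_ray.
exact: continuousM ct cg.
Qed.

Lemma ray_mean_continuous k g (z : V) : smooth_on D g -> `|z| < e ->
  {for z, continuous (ray_mean k g)}.
Proof.
move=> sg ze; have [C [C0 CP]] := smooth_on_lipschitz e0 eD sg.
suff : ray_mean k g y @[y --> z] --> ray_mean k g z by [].
apply/(@cvgrPdist_le _ _ _ (nbhs z) _ (ray_mean k g) (ray_mean k g z)) => d d0.
have C1 : 0 < C + 1 by rewrite ltr_wpDl.
have n1 : \forall y \near z, ball z (e - `|z|) y by apply: nbhsx_ballx; rewrite subr_gt0.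
have n2 : \forall y \near z, ball z (d / (C + 1)) y by apply: nbhsx_ballx; rewrite divr_gt0.
apply: filterS2 n1 n2 => y.
rewrite -[ball z _ _]/(ball z (e - `|z|) y) -!ball_normE /ball_ /= => y1 y2.
have ye : `|y| < e.
  by have := ler_normD (y - z) z; rewrite subrK distrC; lra.
rewrite /ray_mean -integral01B; [|exact: ray_cont..].
apply: (@le_trans _ _ (C * `|z - y|)); last first.
  by move: y2; rewrite ltr_pdivlMr //; have := normr_ge0 (z - y); nra.
apply: integral01_bound => [|t t01]; first by apply: cont01B; exact: ray_cont.
rewrite -mulrBr normrM; apply: (@le_trans _ _ (1 * (C * `|t *: z - t *: y|))).
  apply: ler_pM; rewrite ?normr_ge0 //.
    case/andP: t01 => t0 t1; rewrite normrX ger0_norm //; exact: exprn_ile1.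
  by apply: CP; exact: mx_norm_ray.
rewrite mul1r ler_wpM2l // -scalerBr normrZ ler_piMl ?normr_ge0 //.
by case/andP: t01 => t0 t1; rewrite ger0_norm.
Qed.

(** Differentiation under the integral sign. By the mean value theorem on the segment from t z, and
    the Lipschitz bound for the partial derivative of g, the error of the linear approximation is at
    most C h^2, uniformly in t. *)
Lemma ray_mean_derive k g (z : V) i : smooth_on D g -> `|z| < e ->
  is_derive z (delta_mx 0 i) (ray_mean k g) (ray_mean k.+1 ('D_(delta_mx 0 i) g) z).
Proof.
move=> sg ze; have sdg := smooth_on_derive i sg.
have [C [C0 CP]] := smooth_on_lipschitz e0 eD sdg.
have ez : 0 < e - `|z| by rewrite subr_gt0.
apply: (@is_derive_quadratic _ _ _ _ _ C _ ez) => h he.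
have hb (c : R) : `|c| <= `|h| -> `|c *: delta_mx 0 i + z| < e.
  move=> ch; have := ler_normD (c *: delta_mx 0 i : V) z.
  by have := mx_norm_delta c i; lra.
rewrite /ray_mean -integral01B; [|exact: ray_cont sg (hb _ (lexx _))|exact: ray_cont].
rewrite -(integral01Z h (ray_cont (k := k.+1) sdg ze)).
have c1 := ray_cont (k := k) sg (hb _ (lexx _)); have c2 := ray_cont (k := k) sg ze.
have c3 := cont01Z (c := h) (ray_cont (k := k.+1) sdg ze).
rewrite -integral01B //; last exact: cont01B.
apply: integral01_bound => [|t t01]; first by apply: cont01B => //; exact: cont01B.
have [t0 t1] := andP t01.
have tb (c : R) : c \in `[Num.min 0 (t * h), Num.max 0 (t * h)]%R -> `|c| <= t * `|h|.
  rewrite in_itv /= ge_min le_max => /andP[/orP h1 /orP h2].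
  rewrite -[in leRHS](ger0_norm t0) -normrM ler_norml.
  move: (t * h) h1 h2 => a h1 h2; have := ler_norm a; have := ler_norm (- a).
  have := normr_ge0 a; rewrite normrN => *.
  by apply/andP; split; [case: h1 => ?; lra|case: h2 => ?; lra].
have cb (c : R) : c \in `[Num.min 0 (t * h), Num.max 0 (t * h)]%R ->
    `|c *: delta_mx 0 i + t *: z| < e.
  move=> /tb ct; have := ler_normD (c *: delta_mx 0 i : V) (t *: z).
  have := mx_norm_delta c i; rewrite (normrZ t z) (ger0_norm t0).
  have := normr_ge0 z; have := normr_ge0 h; nra.
have gP c : c \in `[Num.min 0 (t * h), Num.max 0 (t * h)]%R ->
    {for c *: delta_mx 0 i + t *: z, continuous g} /\
    derivable g (c *: delta_mx 0 i + t *: z) (delta_mx 0 i).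
  move=> /cb/ltW/eD Dc; split; first exact: smooth_on_continuous sg Dc.
  exact: smooth_on_derivable sg Dc.
have [c cI cE] := MVT_line gP.
have -> : t ^+ k * g (t *: (h *: delta_mx 0 i + z)) - t ^+ k * g (t *: z) -
    h * (t ^+ k.+1 * 'D_(delta_mx 0 i) g (t *: z)) =
    t ^+ k.+1 * ('D_(delta_mx 0 i) g (c *: delta_mx 0 i + t *: z)
      - 'D_(delta_mx 0 i) g (t *: z)) * h.
  rewrite scalerDr scalerA.
  have -> : g ((t * h) *: delta_mx 0 i + t *: z) = g (t *: z) +
     'D_(delta_mx 0 i) g (c *: delta_mx 0 i + t *: z) * (t * h) by rewrite -cE addrCA subrr addr0.
  by rewrite exprS; ring.
rewrite !normrM ler_wpM2r ?normr_ge0 // normrX (ger0_norm t0).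
apply: (@le_trans _ _ (1 * (C * `|c|))).
  apply: ler_pM; rewrite ?normr_ge0 ?exprn_ge0 //; first exact: exprn_ile1.
  apply: le_trans (CP _ _ (cb c cI) (mx_norm_ray t01 ze)) _.
  by rewrite addrK ler_wpM2l //; exact: mx_norm_delta.
rewrite mul1r ler_wpM2l //; apply: le_trans (tb c cI) _.
by rewrite ler_piMl ?normr_ge0.
Qed.

(** f(z) - f(0) is the integral over [0, 1] of the derivative of t |-> f(t z). The coefficients are
    smooth because all ray means of iterated partials of f form a stable family. *)
Theorem hadamard f : open D -> smooth_on D f -> exists f' : 'I_r -> V -> R,
  (forall i, smooth_on (ball (0 : V) e) (f' i)) /\
  forall z, ball (0 : V) e z -> f z = f 0 + \sum_i z 0 i * f' i z.
Proof.
move=> oD sf.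
have ballE x : ball (0 : V) e x = (`|x| < e) :> Prop.
  by rewrite -ball_normE /ball_ /= sub0r normrN.
have oE : open (ball (0 : V) e) by exact: ball_open.
exists (fun i => ray_mean 0 ('D_(delta_mx 0 i) f)); split=> [i|z ze].
  pose B := [set g | exists k s, g = ray_mean k (iter_partial f s)].
  apply: (@algebra_gen_smooth _ _ (ball (0 : V) e) B _ oE).
    move=> _ [k [s ->]]; have sfs := smooth_on_iter s sf; split=> [z ze|j].
      by rewrite ballE in ze; exact: ray_mean_continuous.
    exists (ray_mean k.+1 (iter_partial f (j :: s))); split.
      by apply: algebra_gen_base; exists k.+1, (j :: s).
    by move=> z ze; rewrite ballE in ze; exact: ray_mean_derive.
  by apply: algebra_gen_base; exists 0%N, [:: i].
rewrite ballE in ze.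
pose F (t : R) := f (t *: z).
have rE t g : 0 <= t <= 1 -> t ^+ 0 * g (t *: z) = g (t *: z) by rewrite mul1r.
have cs i : {within `[0%R : R, 1%R : R],
    continuous (fun t : R => z 0 i * (t ^+ 0 * 'D_(delta_mx 0 i) f (t *: z)))}.
  by apply: cont01Z; exact: (ray_cont (k := 0%N) (smooth_on_derive i sf) ze).
have csum (s : seq 'I_r) : {within `[0%R : R, 1%R : R], continuous (fun t : R =>
    \sum_(i <- s) z 0 i * (t ^+ 0 * 'D_(delta_mx 0 i) f (t *: z)))} /\
    integral01 (fun t : R => \sum_(i <- s) z 0 i * (t ^+ 0 * 'D_(delta_mx 0 i) f (t *: z)))
    = \sum_(i <- s) z 0 i * ray_mean 0 ('D_(delta_mx 0 i) f) z.
  elim: s => [|i s [IH1 IH2]].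
    have -> : (fun t : R => \sum_(i <- [::]) z 0 i * (t ^+ 0 * 'D_(delta_mx 0 i) f (t *: z))) = fun=> 0.
      by apply/funext => t; rewrite big_nil.
    rewrite big_nil; have c0 : {within `[0%R : R, 1%R : R], continuous (fun _ : R => 0 : R)}.
      by move=> t; exact: cst_continuous.
    split=> //; apply/eqP; rewrite -normr_le0; apply: integral01_bound => // t _.
    by rewrite normr0.
  have -> : (fun t : R => \sum_(i <- i :: s) z 0 i * (t ^+ 0 * 'D_(delta_mx 0 i) f (t *: z))) =
     fun t : R => z 0 i * (t ^+ 0 * 'D_(delta_mx 0 i) f (t *: z)) +
       \sum_(i <- s) z 0 i * (t ^+ 0 * 'D_(delta_mx 0 i) f (t *: z)).
    by apply/funext => t; rewrite big_cons.
  split; first by move=> t; exact: continuousD (cs i t) (IH1 t).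
  rewrite integral01D // IH2 big_cons; congr (_ + _).
  by rewrite integral01Z //; exact: (ray_cont (k := 0%N) (smooth_on_derive i sf) ze).
have [c <-] := csum (index_enum 'I_r).
suff dF (t : R) : 0 <= t <= 1 -> is_derive t 1 F
    (\sum_(i <- index_enum 'I_r) z 0 i * (t ^+ 0 * 'D_(delta_mx 0 i) f (t *: z))).
  by rewrite (integral01_FTC c dF) /F scale1r scale0r addrC subrK.
move=> t01; rewrite /F.
have Dtz : D (t *: z) by apply: eD; apply: ltW; exact: mx_norm_ray.
have [df dfE] := smooth_on_diff oD sf Dtz.
have -> : (fun t : R => f (t *: z)) = (fun s : R => f (s *: z + 0)).
  by apply/funext => s; rewrite addr0.
apply: (iffLR (is_derive_line f 0 z t _)).
rewrite addr0; apply: DeriveDef; first exact: diff_derivable.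
rewrite deriveE // dfE; apply: eq_bigr => i _.
by rewrite expr0 mul1r mulrC.
Qed.
End RayMean.
End Hadamard.

(** * The ring of smooth germs *)

Section GermType.
Context {R : realType}.
Local Notation V := 'rV[R]_2.
Implicit Types f g : V -> R.

Definition germ_eq f g := \forall x \near (0 : V), f x = g x.

Lemma germ_eqxx f : germ_eq f f. Proof. by apply: filterE. Qed.

Lemma germ_eq_sym f g : germ_eq f g -> germ_eq g f.
Proof. by apply: filterS. Qed.

Lemma germ_eq_trans f g h : germ_eq f g -> germ_eq g h -> germ_eq f h.
Proof. by apply: filterS2 => x ->. Qed.

Lemma smooth_germ_ext f g : germ_eq f g -> smooth_germ f -> smooth_germ g.
Proof.
move=> fg /smooth_germP[D [oD D0 sf]]; apply/smooth_germP.
have n0 := filterI (open_nbhs_nbhs (conj oD D0)) fg.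
exists ((fun x => D x /\ f x = g x)°); split; first exact: open_interior.
  exact: n0.
have sub : (fun x => D x /\ f x = g x)° `<=` D by move=> x /interior_subset[].
apply: (@smooth_on_ext _ _ _ f g (@open_interior _ _)).
  by move=> x /interior_subset[].
exact: smooth_onS sub sf.
Qed.

Lemma smooth_germ2 (op : (V -> R) -> (V -> R) -> V -> R) f g :
  (forall D, open D -> smooth_on D f -> smooth_on D g -> smooth_on D (op f g)) ->
  smooth_germ f -> smooth_germ g -> smooth_germ (op f g).
Proof.
move=> H /smooth_germP[D [oD D0 sf]] /smooth_germP[E [oE E0 sg]].
apply/smooth_germP; exists (D `&` E); split=> //; first exact: openI.
by apply: H; [exact: openI|apply: smooth_onS sf => x []|apply: smooth_onS sg => x []].
Qed.

Lemma smooth_germ1 (op : (V -> R) -> V -> R) f :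
  (forall D, open D -> smooth_on D f -> smooth_on D (op f)) ->
  smooth_germ f -> smooth_germ (op f).
Proof.
move=> H sf; apply: (smooth_germ2 (op := fun f _ => op f) _ sf sf) => D oD sfD _.
exact: H.
Qed.

Lemma smooth_germ_cst c : smooth_germ (cst c : V -> R).
Proof.
by apply/smooth_germP; exists setT; split=> //; [exact: openT|apply: smooth_on_cst; exact: openT].
Qed.

Lemma smooth_germ_coord i : smooth_germ (fun x : V => x 0 i).
Proof.
by apply/smooth_germP; exists setT; split=> //; [exact: openT|apply: smooth_on_coord; exact: openT].
Qed.
End GermType.

(* A germ is the class of its representatives. *)
Record germ (R : realType) := Germ {
  germ_class : set ('rV[R]_2 -> R);
  germ_classP : exists2 f, smooth_germ f & germ_class = [set g | germ_eq f g] }.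

Section GermRing.
Context {R : realType}.
Local Notation V := 'rV[R]_2.
Local Notation S := (germ R).
Implicit Types (f g : V -> R) (a b c : S).

(** [to_germ] has to be total: a function that is not smooth near 0 is sent to the class of 0. *)
Definition germ_cls f : set (V -> R) :=
  [set g | germ_eq (if pselect (smooth_germ f) then f else cst 0) g].

Lemma germ_clsP f : exists2 h, smooth_germ h & germ_cls f = [set g | germ_eq h g].
Proof.
rewrite /germ_cls; case: pselect => sf; first by exists f.
by exists (cst 0) => //; exact: smooth_germ_cst.
Qed.

Definition to_germ f : S := Germ (germ_clsP f).
Definition germ_fun a : V -> R := projT1 (cid2 (germ_classP a)).

Lemma germ_fun_smooth a : smooth_germ (germ_fun a).
Proof. by rewrite /germ_fun; case: cid2. Qed.

Lemma germ_fun_class a : germ_class a = [set g | germ_eq (germ_fun a) g].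
Proof. by rewrite /germ_fun; case: cid2. Qed.

Lemma germP a b : a = b <-> germ_eq (germ_fun a) (germ_fun b).
Proof.
split=> [->|ab]; first exact: germ_eqxx.
have : germ_class a = germ_class b.
  rewrite !germ_fun_class; apply/seteqP; split=> g /=; apply: germ_eq_trans => //.
  exact: germ_eq_sym.
case: a b {ab} => [A pA] [B pB] /= AB; rewrite AB in pA *.
by rewrite (Prop_irrelevance pA pB).
Qed.

Lemma to_germK f : smooth_germ f -> germ_eq (germ_fun (to_germ f)) f.
Proof.
move=> sf; have E : germ_class (to_germ f) = [set g | germ_eq f g].
  by rewrite /= /germ_cls; case: pselect.
have : [set g | germ_eq (germ_fun (to_germ f)) g] f by rewrite -germ_fun_class E; exact: germ_eqxx.
exact.
Qed.

Lemma germ_funK a : to_germ (germ_fun a) = a.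
Proof. by apply/germP/to_germK/germ_fun_smooth. Qed.

Lemma to_germ_eq f g : smooth_germ f -> smooth_germ g -> to_germ f = to_germ g <-> germ_eq f g.
Proof.
move=> sf sg; split=> [/germP fg|fg].
  apply: germ_eq_trans (to_germK sg); apply: germ_eq_trans fg.
  exact/germ_eq_sym/to_germK.
apply/germP; apply: germ_eq_trans (to_germK sf) _; apply: germ_eq_trans fg _.
exact/germ_eq_sym/to_germK.
Qed.

HB.instance Definition _ := gen_eqMixin S.
HB.instance Definition _ := gen_choiceMixin S.

Definition germ_zero : S := to_germ (cst 0).
Definition germ_one : S := to_germ (cst 1).
Definition germ_opp a : S := to_germ (- germ_fun a).
Definition germ_add a b : S := to_germ (germ_fun a + germ_fun b).
Definition germ_mul a b : S := to_germ (germ_fun a * germ_fun b).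

Lemma germ_fun_cst (k : R) : germ_eq (germ_fun (to_germ (cst k))) (cst k).
Proof. exact/to_germK/smooth_germ_cst. Qed.

Lemma germ_fun_opp a : germ_eq (germ_fun (germ_opp a)) (- germ_fun a).
Proof.
apply: to_germK; apply: (smooth_germ1 (op := fun f => - f) _ (germ_fun_smooth a)) => D.
exact: smooth_onN.
Qed.

Lemma germ_fun_add a b : germ_eq (germ_fun (germ_add a b)) (germ_fun a + germ_fun b).
Proof.
apply: to_germK; apply: (smooth_germ2 (op := fun f g => f + g) _ (germ_fun_smooth a) (germ_fun_smooth b)) => D.
exact: smooth_onD.
Qed.

Lemma germ_fun_mul a b : germ_eq (germ_fun (germ_mul a b)) (germ_fun a * germ_fun b).
Proof.
apply: to_germK; apply: (smooth_germ2 (op := fun f g => f * g) _ (germ_fun_smooth a) (germ_fun_smooth b)) => D.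
exact: smooth_onM.
Qed.

Lemma germ_addA : associative germ_add.
Proof.
move=> a b c; apply/germP; near=> x.
rewrite (near (germ_fun_add a (germ_add b c)) x) // (near (germ_fun_add (germ_add a b) c) x) //.
rewrite !fctE (near (germ_fun_add a b) x) // (near (germ_fun_add b c) x) //.
exact: addrA.
Unshelve. all: by end_near. Qed.

Lemma germ_addC : commutative germ_add.
Proof.
move=> a b; apply/germP; near=> x.
by rewrite (near (germ_fun_add a b) x) // (near (germ_fun_add b a) x) // addrC.
Unshelve. all: by end_near. Qed.

Lemma germ_add0 : left_id germ_zero germ_add.
Proof.
move=> a; apply/germP; near=> x.
by rewrite (near (germ_fun_add germ_zero a) x) // !fctE (near (germ_fun_cst 0) x) // add0r.
Unshelve. all: by end_near. Qed.

Lemma germ_addN : left_inverse germ_zero germ_opp germ_add.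
Proof.
move=> a; apply/germP; near=> x.
rewrite (near (germ_fun_add (germ_opp a) a) x) // !fctE (near (germ_fun_opp a) x) //.
by rewrite (near (germ_fun_cst 0) x) // !fctE addNr.
Unshelve. all: by end_near. Qed.

HB.instance Definition _ := GRing.isZmodule.Build S germ_addA germ_addC germ_add0 germ_addN.

Lemma germ_mulA : associative germ_mul.
Proof.
move=> a b c; apply/germP; near=> x.
rewrite (near (germ_fun_mul a (germ_mul b c)) x) // (near (germ_fun_mul (germ_mul a b) c) x) //.
rewrite !fctE (near (germ_fun_mul a b) x) // (near (germ_fun_mul b c) x) //.
exact: mulrA.
Unshelve. all: by end_near. Qed.

Lemma germ_mulC : commutative germ_mul.
Proof.
move=> a b; apply/germP; near=> x.
by rewrite (near (germ_fun_mul a b) x) // (near (germ_fun_mul b a) x) // !fctE mulrC.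
Unshelve. all: by end_near. Qed.

Lemma germ_mul1 : left_id germ_one germ_mul.
Proof.
move=> a; apply/germP; near=> x.
by rewrite (near (germ_fun_mul germ_one a) x) // !fctE (near (germ_fun_cst 1) x) // mul1r.
Unshelve. all: by end_near. Qed.

Lemma germ_mulDl : left_distributive germ_mul germ_add.
Proof.
move=> a b c; apply/germP; near=> x.
rewrite (near (germ_fun_mul (germ_add a b) c) x) //.
rewrite (near (germ_fun_add (germ_mul a c) (germ_mul b c)) x) // !fctE.
rewrite (near (germ_fun_add a b) x) // (near (germ_fun_mul a c) x) // (near (germ_fun_mul b c) x) //.
exact: mulrDl.
Unshelve. all: by end_near. Qed.

Lemma germ_one_neq0 : germ_one != 0 :> S.
Proof.
apply/eqP => /germP E.
have /nbhs_singleton : germ_eq (cst 1 : V -> R) (cst 0).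
  apply: germ_eq_trans (germ_fun_cst 0); apply: germ_eq_trans E.
  exact/germ_eq_sym/germ_fun_cst.
by move=> /eqP; rewrite oner_eq0.
Qed.

HB.instance Definition _ := GRing.Zmodule_isComNzRing.Build S germ_mulA germ_mulC
  germ_mul1 germ_mulDl germ_one_neq0.

Lemma germ_funD a b : germ_eq (germ_fun (a + b)) (germ_fun a + germ_fun b). Proof. exact: germ_fun_add. Qed.
Lemma germ_funM a b : germ_eq (germ_fun (a * b)) (germ_fun a * germ_fun b). Proof. exact: germ_fun_mul. Qed.
Lemma germ_funN a : germ_eq (germ_fun (- a)) (- germ_fun a). Proof. exact: germ_fun_opp. Qed.

Opaque germ_add germ_mul germ_opp germ_zero germ_one.

Definition germ_const (k : R) : S := to_germ (cst k).
Definition germ_eval a : R := germ_fun a 0.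
Definition germ_coord i : S := to_germ (fun x : V => x 0 i).
Definition germ_partial i a : S := to_germ ('D_(delta_mx 0 i) (germ_fun a)).

Lemma germ_eval_to_germ f : smooth_germ f -> germ_eval (to_germ f) = f 0.
Proof. by move=> /to_germK/nbhs_singleton. Qed.

Lemma germ_eval_zmod : zmod_morphism germ_eval.
Proof.
move=> a b; rewrite /germ_eval (nbhs_singleton (germ_funD a (- b))) fctE.
by rewrite (nbhs_singleton (germ_funN b)).
Qed.

Lemma germ_eval_monoid : monoid_morphism germ_eval.
Proof.
split; first exact: nbhs_singleton (germ_fun_cst 1).
by move=> a b; rewrite /germ_eval (nbhs_singleton (germ_funM a b)).
Qed.

HB.instance Definition _ := GRing.isZmodMorphism.Build S R germ_eval germ_eval_zmod.
HB.instance Definition _ := GRing.isMonoidMorphism.Build S R germ_eval germ_eval_monoid.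

Lemma germ_const_zmod : zmod_morphism germ_const.
Proof.
move=> k l; apply/germP; near=> x.
rewrite (near (germ_funD (germ_const k) (- germ_const l)) x) // !fctE.
rewrite (near (germ_funN (germ_const l)) x) // !fctE.
by rewrite (near (germ_fun_cst k) x) // (near (germ_fun_cst l) x) // (near (germ_fun_cst _) x) //.
Unshelve. all: by end_near. Qed.

Lemma germ_const_monoid : monoid_morphism germ_const.
Proof.
split=> // k l; apply/germP; near=> x.
rewrite (near (germ_funM (germ_const k) (germ_const l)) x) // !fctE.
by rewrite (near (germ_fun_cst k) x) // (near (germ_fun_cst l) x) // (near (germ_fun_cst _) x) //.
Unshelve. all: by end_near. Qed.

HB.instance Definition _ := GRing.isZmodMorphism.Build R S germ_const germ_const_zmod.
HB.instance Definition _ := GRing.isMonoidMorphism.Build R S germ_const germ_const_monoid.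

Lemma germ_evalC k : germ_eval (germ_const k) = k.
Proof. by rewrite germ_eval_to_germ //; exact: smooth_germ_cst. Qed.

Lemma germ_evalX i : germ_eval (germ_coord i) = 0.
Proof. by rewrite germ_eval_to_germ ?mxE //; exact: smooth_germ_coord. Qed.
End GermRing.

#[global] Opaque germ_add germ_mul germ_opp germ_zero germ_one to_germ germ_fun.

Section SmoothGermMaps.
Context {R : realType} {r n : nat}.
Local Notation V := 'rV[R]_r.
Local Notation W := 'rV[R]_n.

Lemma smooth_germs_common (I : finType) (F : I -> V -> R) :
  (forall i, smooth_germ (F i)) ->
  exists D : set V, [/\ open D, D 0 & forall i, smooth_on D (F i)].
Proof.
move=> sF.
have nF : \forall x \near (0 : V), forall i, forall s : seq 'I_r,
  {for x, continuous (iter_partial (F i) s)} /\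
  forall j, derivable (iter_partial (F i) s) x (delta_mx 0 j).
  by apply: (@filter_forall _ _ (fun (i : I) (x : V) => forall s : seq 'I_r,
    {for x, continuous (iter_partial (F i) s)} /\
    forall j, derivable (iter_partial (F i) s) x (delta_mx 0 j)) (nbhs (0 : V)) _) => i; exact: sF.
exists ((fun x => forall i, forall s : seq 'I_r,
  {for x, continuous (iter_partial (F i) s)} /\
  forall j, derivable (iter_partial (F i) s) x (delta_mx 0 j))°); split.
- exact: open_interior.
- exact: nF.
- by move=> i x /interior_subset/(_ i).
Qed.

Lemma smooth_germ_comp_on (E : set W) (f : W -> R) (phi : V -> W) : open E ->
  smooth_on E f -> (forall j, smooth_germ (fun x => phi x 0 j)) -> E (phi 0) ->
  smooth_germ (f \o phi).
Proof.
move=> oE sf sphi Ephi; have [D [oD D0 sD]] := smooth_germs_common sphi.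
have nE : \forall x \near (0 : V), D x /\ E (phi x).
  apply: filterI; first exact: (open_nbhs_nbhs (conj oD D0)).
  have := map_smooth_on_continuous sD D0; apply.
  exact: (open_nbhs_nbhs (conj oE Ephi)).
apply/smooth_germP; exists ((fun x => D x /\ E (phi x))°); split.
- exact: open_interior.
- exact: nE.
- apply: smooth_on_comp oE _ sf _; first exact: open_interior.
    by move=> x /interior_subset[].
  by move=> j; apply: smooth_onS (sD j) => x /interior_subset[].
Qed.

Lemma near0_comp (P : set W) (phi : V -> W) : (forall j, smooth_germ (fun x => phi x 0 j)) ->
  (\forall y \near phi 0, P y) -> \forall x \near (0 : V), P (phi x).
Proof.
move=> sphi nP; have [D [oD D0 sD]] := smooth_germs_common sphi.
exact: map_smooth_on_continuous sD D0 _ nP.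
Qed.
End SmoothGermMaps.

(** * Derivations, Hadamard's lemma and units for germs *)

Section GermCalculus.
Context {R : realType}.
Local Notation V := 'rV[R]_2.
Local Notation S := (germ R).
Implicit Types (f g : V -> R) (a b c : S).

Lemma smooth_germ_partial f i : smooth_germ f -> smooth_germ ('D_(delta_mx 0 i) f).
Proof.
by apply: (smooth_germ1 (op := fun f => 'D_(delta_mx 0 i) f)) => D _; exact: smooth_on_derive.
Qed.

Lemma germ_fun_partial i a : germ_eq (germ_fun (germ_partial i a)) ('D_(delta_mx 0 i) (germ_fun a)).
Proof. exact/to_germK/smooth_germ_partial/germ_fun_smooth. Qed.

Lemma germ_eq_partial i f g : germ_eq f g ->
  germ_eq ('D_(delta_mx 0 i) f) ('D_(delta_mx 0 i) g).
Proof.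
move=> /nbhs_interior fg; apply: filterS fg => x fg.
exact: near_eq_derive.
Qed.

Lemma near_derivable a i : \forall x \near (0 : V), derivable (germ_fun a) x (delta_mx 0 i).
Proof. by apply: filterS (germ_fun_smooth a) => x /(_ [::])[_]. Qed.

Lemma germ_partial_zmod i : zmod_morphism (@germ_partial R i).
Proof.
move=> a b; apply/germP; apply: germ_eq_trans (germ_fun_partial i (a - b)) _.
apply: germ_eq_trans (_ : germ_eq _ ('D_(delta_mx 0 i) (germ_fun a - germ_fun b))) _.
  apply: germ_eq_partial; near=> x.
  by rewrite (near (germ_funD a (- b)) x) // !fctE (near (germ_funN b) x).
apply: germ_eq_trans (_ : germ_eq _ ('D_(delta_mx 0 i) (germ_fun a) - 'D_(delta_mx 0 i) (germ_fun b))) _.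
  by apply: filterS2 (near_derivable a i) (near_derivable b i) => x da db; rewrite deriveB.
near=> x; rewrite (near (germ_funD (germ_partial i a) (- germ_partial i b)) x) // !fctE.
rewrite (near (germ_funN (germ_partial i b)) x) // !fctE.
by rewrite (near (germ_fun_partial i a) x) // (near (germ_fun_partial i b) x) //.
Unshelve. all: by end_near. Qed.

HB.instance Definition _ i := GRing.isZmodMorphism.Build S S (@germ_partial R i) (germ_partial_zmod i).

Lemma germ_partialM i a b :
  germ_partial i (a * b) = germ_partial i a * b + a * germ_partial i b.
Proof.
apply/germP; apply: germ_eq_trans (germ_fun_partial i (a * b)) _.
apply: germ_eq_trans (germ_eq_partial i (germ_funM a b)) _.
apply: germ_eq_trans (_ : germ_eq _ (fun x => 'D_(delta_mx 0 i) (germ_fun a) x * germ_fun b x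
    + germ_fun a x * 'D_(delta_mx 0 i) (germ_fun b) x)) _.
  apply: filterS2 (near_derivable a i) (near_derivable b i) => x da db.
  by rewrite [LHS](deriveM da db) addrC; congr (_ + _); exact: mulrC.
near=> x; rewrite (near (germ_funD (germ_partial i a * b) (a * germ_partial i b)) x) // !fctE.
rewrite (near (germ_funM (germ_partial i a) b) x) // (near (germ_funM a (germ_partial i b)) x) // !fctE.
by rewrite (near (germ_fun_partial i a) x) // (near (germ_fun_partial i b) x) //.
Unshelve. all: by end_near. Qed.

Lemma germ_partialC i k : germ_partial i (germ_const k) = 0 :> S.
Proof.
apply/germP; apply: germ_eq_trans (germ_fun_partial i _) _.
apply: germ_eq_trans (germ_eq_partial i (germ_fun_cst k)) _.
near=> x; rewrite (near (germ_fun_cst 0) x) //.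
by rewrite derive_cst.
Unshelve. all: by end_near. Qed.

Lemma germ_partialX i j : germ_partial i (germ_coord j) = (j == i)%:R :> S.
Proof.
rewrite -[RHS](rmorph_nat (@germ_const R)).
apply/germP; apply: germ_eq_trans (germ_fun_partial i _) _.
apply: germ_eq_trans (germ_eq_partial i (to_germK (smooth_germ_coord j))) _.
near=> x; rewrite (near (germ_fun_cst _) x) //.
by have [_ ->] := is_derive_coord j x (delta_mx 0 i : V); rewrite mxE eqxx.
Unshelve. all: by end_near. Qed.

Lemma germ_hadamard a : exists a' : 'I_2 -> S,
  a = germ_const (germ_eval a) + \sum_i germ_coord i * a' i.
Proof.
have /smooth_germP[D [oD D0 sa]] := germ_fun_smooth a.
have [e /= e0 eD] := (nbhs_ballP _ _).1 (open_nbhs_nbhs (conj oD D0)).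
have e20 : 0 < e / 2 by rewrite divr_gt0.
have eD' x : `|x| <= e / 2 -> D x.
  move=> xe; apply: eD; rewrite -ball_normE /ball_ /= sub0r normrN.
  by apply: le_lt_trans xe _; lra.
have [f' [sf' fE]] := hadamard e20 eD' oD sa.
have sg i : smooth_germ (f' i).
  by apply/smooth_germP; exists (ball (0 : V) (e / 2)); split;
    [exact: ball_open|exact: ballxx|exact: sf'].
exists (fun i => to_germ (f' i)); apply/germP.
rewrite big_ord_recl big_ord1 /=.
set i1 := lift _ _.
have nb : \forall x \near (0 : V), ball (0 : V) (e / 2) x by exact: nbhsx_ballx.
near=> x.
rewrite (near (germ_funD (germ_const (germ_eval a)) (germ_coord ord0 * to_germ (f' ord0) +
  germ_coord i1 * to_germ (f' i1))) x) // !fctE.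
rewrite (near (germ_fun_cst _) x) //.
rewrite (near (germ_funD (germ_coord ord0 * to_germ (f' ord0)) (germ_coord i1 * to_germ (f' i1))) x) // !fctE.
rewrite (near (germ_funM (germ_coord ord0) (to_germ (f' ord0))) x) // !fctE.
rewrite (near (germ_funM (germ_coord i1) (to_germ (f' i1))) x) // !fctE.
rewrite (near (to_germK (smooth_germ_coord ord0)) x) // (near (to_germK (smooth_germ_coord i1)) x) //.
rewrite (near (to_germK (sg ord0)) x) // (near (to_germK (sg i1)) x) //.
have -> := fE x; last by near: x.
by rewrite big_ord_recl big_ord1.
Unshelve. all: by end_near. Qed.

Lemma germ_unit a : germ_eval a != 0 -> exists b, a * b = 1.
Proof.
move=> a0; have /smooth_germP[D [oD D0 sa]] := germ_fun_smooth a.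
have n0 : \forall x \near (0 : V), D x /\ germ_fun a x != 0.
  apply: filterI; first exact: (open_nbhs_nbhs (conj oD D0)).
  have ca := smooth_on_continuous sa D0.
  have oU : open [set y : R | y != 0] by exact: open_neq.
  exact: ca (open_nbhs_nbhs (conj oU a0)).
have si : smooth_germ (fun x => (germ_fun a x)^-1).
  apply/smooth_germP; exists ((fun x => D x /\ germ_fun a x != 0)°); split.
  - exact: open_interior.
  - exact: n0.
  - apply: smooth_onV; first exact: open_interior.
      by move=> x /interior_subset[].
    by apply: smooth_onS sa => x /interior_subset[].
exists (to_germ (fun x => (germ_fun a x)^-1)); apply/germP; near=> x.
rewrite (near (germ_funM a _) x) // fctE (near (to_germK si) x) // (near (germ_fun_cst 1) x) //.
rewrite divff //; have [] := near n0 x; [|by move=> _ ->].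
by [].
Unshelve. all: by end_near. Qed.
End GermCalculus.

Definition ix : 'I_2 := 0.
Definition iy : 'I_2 := 1.

Lemma forall_ord2 (P : 'I_2 -> Prop) : P ix -> P iy -> forall j, P j.
Proof.
move=> P0 P1 [[|[|//]] jP].
  by rewrite (_ : Ordinal jP = ix) //; apply/val_inj.
by rewrite (_ : Ordinal jP = iy) //; apply/val_inj.
Qed.

Lemma sum_ord2 (T : nmodType) (F : 'I_2 -> T) : \sum_j F j = F ix + F iy.
Proof.
rewrite big_ord_recl big_ord1; congr (_ + F _); exact/val_inj.
Qed.

#[global] Opaque ix iy.

(** * Substitution of maps fixing the origin *)

Record germ_map (R : realType) := GermMap {
  germ_map_val :> 'I_2 -> germ R;
  germ_map0 : forall j, germ_eval (germ_map_val j) = 0 }.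

Section Pullback.
Context {R : realType}.
Local Notation V := 'rV[R]_2.
Local Notation S := (germ R).
Implicit Types (f g : V -> R) (a b c : S) (p q : germ_map R).

Definition map_fun (p : 'I_2 -> S) (x : V) : V := \row_j germ_fun (p j) x.

Lemma map_fun_smooth (p : 'I_2 -> S) j : smooth_germ (fun x => map_fun p x 0 j).
Proof.
apply: smooth_germ_ext (germ_fun_smooth (p j)); apply: filterE => x.
by rewrite /map_fun mxE.
Qed.

Lemma map_fun0 p : map_fun p 0 = 0.
Proof. by apply/rowP => j; rewrite !mxE; exact: germ_map0. Qed.

Definition pullback p a : S := to_germ (germ_fun a \o map_fun p).

Lemma near_map_fun p (P : set V) : (\forall x \near (0 : V), P x) ->
  \forall x \near (0 : V), P (map_fun p x).
Proof. by move=> nP; apply: near0_comp (map_fun_smooth p) _; rewrite map_fun0. Qed.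

Lemma smooth_germ_map p f : smooth_germ f -> smooth_germ (f \o map_fun p).
Proof.
move=> /smooth_germP[D [oD D0 sf]].
by apply: smooth_germ_comp_on oD sf (map_fun_smooth p) _; rewrite map_fun0.
Qed.

Lemma germ_fun_pullback p a : germ_eq (germ_fun (pullback p a)) (germ_fun a \o map_fun p).
Proof. exact/to_germK/smooth_germ_map/germ_fun_smooth. Qed.

Lemma pullback_eq p f g : germ_eq f g -> germ_eq (f \o map_fun p) (g \o map_fun p).
Proof. exact: near_map_fun. Qed.

Lemma pullback_to_germ p f : smooth_germ f -> pullback p (to_germ f) = to_germ (f \o map_fun p).
Proof.
move=> sf; apply/to_germ_eq; [exact/smooth_germ_map/germ_fun_smooth|exact: smooth_germ_map|].
exact/pullback_eq/to_germK.
Qed.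

Lemma pullback_zmod p : zmod_morphism (pullback p).
Proof.
move=> a b; apply/germP; apply: germ_eq_trans (germ_fun_pullback p _) _.
apply: germ_eq_trans (pullback_eq p (germ_funD a (- b))) _.
apply: germ_eq_trans (_ : germ_eq _ (fun x => germ_fun a (map_fun p x) - germ_fun b (map_fun p x))) _.
  by apply: filterS (pullback_eq p (germ_funN b)) => x /= E; rewrite !fctE E.
near=> x; rewrite (near (germ_funD (pullback p a) (- pullback p b)) x) // !fctE.
rewrite (near (germ_funN (pullback p b)) x) // !fctE.
by rewrite (near (germ_fun_pullback p a) x) // (near (germ_fun_pullback p b) x) //.
Unshelve. all: by end_near. Qed.

Lemma pullbackC p k : pullback p (germ_const k) = germ_const k.
Proof. by rewrite pullback_to_germ //; exact: smooth_germ_cst. Qed.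

Lemma pullback_monoid p : monoid_morphism (pullback p).
Proof.
split=> [|a b]; first exact: (pullbackC p 1).
apply/germP; apply: germ_eq_trans (germ_fun_pullback p _) _.
apply: germ_eq_trans (pullback_eq p (germ_funM a b)) _.
near=> x; rewrite (near (germ_funM (pullback p a) (pullback p b)) x) // !fctE.
by rewrite (near (germ_fun_pullback p a) x) // (near (germ_fun_pullback p b) x) //.
Unshelve. all: by end_near. Qed.

HB.instance Definition _ p := GRing.isZmodMorphism.Build S S (pullback p) (pullback_zmod p).
HB.instance Definition _ p := GRing.isMonoidMorphism.Build S S (pullback p) (pullback_monoid p).

Lemma pullbackX p j : pullback p (germ_coord j) = p j.
Proof.
rewrite pullback_to_germ; last exact: smooth_germ_coord.
rewrite -[RHS]germ_funK; congr to_germ; apply/funext => x.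
by rewrite /map_fun /= mxE.
Qed.

Lemma germ_eval_pullback p a : germ_eval (pullback p a) = germ_eval a.
Proof.
rewrite germ_eval_to_germ; last exact/smooth_germ_map/germ_fun_smooth.
by rewrite /= map_fun0.
Qed.

Lemma germ_partial_pullback i p a :
  germ_partial i (pullback p a) = \sum_j pullback p (germ_partial j a) * germ_partial i (p j).
Proof.
have /smooth_germP[D [oD D0 sa]] := germ_fun_smooth a.
apply/germP; apply: germ_eq_trans (germ_fun_partial i _) _.
apply: germ_eq_trans (germ_eq_partial i (germ_fun_pullback p a)) _.
have nD : \forall x \near (0 : V), D (map_fun p x).
  by apply: near_map_fun; exact: (open_nbhs_nbhs (conj oD D0)).
apply: germ_eq_trans (_ : germ_eq _ (fun x =>
   \sum_j 'D_(delta_mx 0 j) (germ_fun a) (map_fun p x) * 'D_(delta_mx 0 i) (germ_fun (p j)) x)) _.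
  apply: filterS3 nD (near_derivable (p ix) i) (near_derivable (p iy) i) => x Dx d0 d1.
  have [] := is_derive_comp_smooth (phi := map_fun p) (x := x) (v := delta_mx 0 i)
    (d := fun j => 'D_(delta_mx 0 i) (germ_fun (p j)) x) oD sa Dx; last by [].
  apply: forall_ord2.
    have -> : (fun y => map_fun p y 0 ix) = germ_fun (p ix).
      by apply/funext => y; rewrite mxE.
    exact: derivableP.
  have -> : (fun y => map_fun p y 0 iy) = germ_fun (p iy).
    by apply/funext => y; rewrite mxE.
  exact: derivableP.
rewrite sum_ord2.
have E (j : 'I_2) : germ_eq (germ_fun (pullback p (germ_partial j a) * germ_partial i (p j)))
    (fun x => 'D_(delta_mx 0 j) (germ_fun a) (map_fun p x) * 'D_(delta_mx 0 i) (germ_fun (p j)) x).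
  apply: germ_eq_trans (germ_funM _ _) _.
  have h1 := germ_eq_trans (germ_fun_pullback p (germ_partial j a))
    (pullback_eq p (germ_fun_partial j a)).
  by apply: filterS2 h1 (germ_fun_partial i (p j)) => x E1 E2; rewrite fctE E1 E2.
apply: germ_eq_sym; apply: germ_eq_trans (germ_funD _ _) _.
by apply: filterS2 (E ix) (E iy) => x E1 E2; rewrite fctE E1 E2 sum_ord2.
Qed.

Lemma pullback_comp_subproof p q j : germ_eval (pullback p (q j)) = 0.
Proof. by rewrite germ_eval_pullback germ_map0. Qed.

Definition germ_map_comp p q : germ_map R := GermMap (pullback_comp_subproof p q).

Lemma pullback_comp p q a : pullback p (pullback q a) = pullback (germ_map_comp p q) a.
Proof.
rewrite {2}/pullback pullback_to_germ; last exact/smooth_germ_map/germ_fun_smooth.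
apply/to_germ_eq.
- exact/smooth_germ_map/smooth_germ_map/germ_fun_smooth.
- exact/smooth_germ_map/germ_fun_smooth.
apply: filterS2 (germ_fun_pullback p (q ix)) (germ_fun_pullback p (q iy)) => x E0 E1 /=.
congr (germ_fun a _); apply/rowP; apply: forall_ord2; first by rewrite !mxE E0.
by rewrite !mxE E1.
Qed.

Definition germ_map_id : germ_map R := GermMap (@germ_evalX R).

Lemma pullback_id p a : (forall j, p j = germ_coord j) -> pullback p a = a.
Proof.
move=> pE; rewrite -[RHS]germ_funK; apply/to_germ_eq.
- exact/smooth_germ_map/germ_fun_smooth.
- exact: germ_fun_smooth.
have E j : germ_eq (germ_fun (p j)) (fun x => x 0 j) by rewrite pE; exact/to_germK/smooth_germ_coord.
apply: filterS2 (E ix) (E iy) => x E0 E1 /=.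
congr (germ_fun a _); apply/rowP; apply: forall_ord2; first by rewrite !mxE E0.
by rewrite !mxE E1.
Qed.

Definition germ_jac p : 'M[R]_2 := \matrix_(i, j) germ_eval (germ_partial i (p j)).
(** The Jacobian at 0 is normalised to the identity by the constant matrix Ji: the inverse function
    theorem applies to H = p Ji with inverse K, and the inverse of p is y |-> K(y Ji). *)
Lemma germ_map_inverse p : germ_jac p \in unitmx -> exists q : germ_map R,
  (forall j, pullback p (q j) = germ_coord j) /\ (forall j, pullback q (p j) = germ_coord j).
Proof.
move=> uJ; pose Ji := invmx (germ_jac p).
have [D [oD D0 sD]] := smooth_germs_common (fun j => germ_fun_smooth (p j)).
pose H (x : V) : V := map_fun p x *m Ji.
have HE x k : H x 0 k = germ_fun (p ix) x * Ji ix k + germ_fun (p iy) x * Ji iy k.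
  by rewrite mxE sum_ord2 !mxE.
have sH : map_smooth_on D H.
  move=> k; apply: (@smooth_on_ext _ _ D (fun x => Ji ix k * germ_fun (p ix) x +
      Ji iy k * germ_fun (p iy) x) _ oD).
    by move=> x _; rewrite HE mulrC [X in _ + X]mulrC.
  by apply: smooth_onD => //; apply: smooth_onZ.
have H0 : H 0 = 0 by rewrite /H map_fun0 mul0mx.
have jH : jac H 0 = 1%:M.
  rewrite -(mulmxV uJ) -/Ji; apply/matrixP => i k.
  rewrite [RHS]mxE sum_ord2 ![germ_jac p _ _]mxE [LHS]mxE.
  have dp j : is_derive (0 : V) (delta_mx 0 i) (germ_fun (p j)) (germ_eval (germ_partial i (p j))).
    rewrite /germ_eval (nbhs_singleton (germ_fun_partial i (p j))).
    by apply: derivableP; exact: smooth_on_derivable (sD j) D0.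
  rewrite (_ : (fun y => H y 0 k) = (fun x => Ji ix k *: germ_fun (p ix) x) +
      (fun x => Ji iy k *: germ_fun (p iy) x)); last first.
    by apply/funext => x; rewrite HE mulrC [X in _ + X]mulrC.
  have [d0 E0] := dp ix; have [d1 E1] := dp iy.
  have d0' : derivable (fun x => Ji ix k *: germ_fun (p ix) x) (0 : V) (delta_mx 0 i).
    exact: derivableZ d0.
  have d1' : derivable (fun x => Ji iy k *: germ_fun (p iy) x) (0 : V) (delta_mx 0 i).
    exact: derivableZ d1.
  rewrite [LHS](deriveD d0' d1') (deriveZ _ d0) (deriveZ _ d1) E0 E1.
  by congr (_ + _); exact: mulrC.
have [E [K [[oE E0] sK K0 HK KH]]] := inverse_function oD D0 sH H0 jH.
pose L (y : V) : V := y *m Ji; pose Q (y : V) : V := K (L y).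
have sL j : smooth_germ (fun y => L y 0 j).
  have oT : open (setT : set V) by exact: openT.
  have s0 := smooth_onZ (Ji ix j) oT (smooth_on_coord ix oT).
  have s1 := smooth_onZ (Ji iy j) oT (smooth_on_coord iy oT).
  apply/smooth_germP; exists setT; split; [exact: oT|by []|].
  apply: smooth_on_ext oT _ (smooth_onD oT s0 s1) => y _.
  by rewrite /L mxE sum_ord2 !fctE mulrC [X in _ + X]mulrC.
have L0 : L 0 = 0 by rewrite /L mul0mx.
have sQ j : smooth_germ (fun y => Q y 0 j).
  apply: (@smooth_germ_comp_on _ _ _ E (fun w : V => K w 0 j) L) => //.
  by rewrite L0.
have q0 j : germ_eval (to_germ (fun y => Q y 0 j)) = 0.
  by rewrite germ_eval_to_germ // /Q L0 K0 mxE.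
exists (GermMap q0); split=> j /=.
  rewrite pullback_to_germ //; apply/to_germ_eq; [exact: smooth_germ_map|exact: smooth_germ_coord|].
  by apply: filterS KH => x; rewrite /= /Q => {2}<-.
rewrite -[germ_coord j]germ_funK; apply/to_germ_eq; [exact/smooth_germ_map/germ_fun_smooth|exact: germ_fun_smooth|].
apply: germ_eq_sym; apply: germ_eq_trans (to_germK (smooth_germ_coord j)) _.
have nE : \forall y \near (0 : V), E (L y).
  apply: near0_comp sL _; rewrite L0; exact: (open_nbhs_nbhs (conj oE E0)).
apply: filterS3 nE (to_germK (sQ ix)) (to_germK (sQ iy)) => y Ey E1 E2 /=.
have -> : map_fun (GermMap q0) y = Q y.
  by apply/rowP; apply: forall_ord2; rewrite mxE /= ?E1 ?E2.
have [_ HKy] := HK _ Ey.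
have pQ : map_fun p (Q y) = y.
  have : H (Q y) *m germ_jac p = y by rewrite /Q HKy /L mulmxKV.
  by rewrite /H mulmxKV.
by rewrite -{1}pQ mxE.
Qed.
End Pullback.

(** * Polynomial maps and the ring of germs *)

(* [pideal e f]: f is a polynomial map of p = (p_k) over S all of whose terms
   have degree at least e in p. *)
Inductive pideal (S : comNzRingType) (m : nat) : nat -> (('I_m -> S) -> S) -> Prop :=
| pideal_cst c : pideal 0 (fun _ => c)
| pideal0 e : pideal e (fun _ => 0)
| pideal_var k : pideal 1 (fun p => p k)
| pideal_add e f g : pideal e f -> pideal e g -> pideal e (fun p => f p + g p)
| pideal_mul d e f g : pideal d f -> pideal e g -> pideal (d + e) (fun p => f p * g p)
| pideal_weak d e f : (d <= e)%N -> pideal e f -> pideal d f.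

Section Hensel.
Context {R : realType} {m : nat}.
Local Notation V := 'rV[R]_2.
Local Notation W := 'rV[R]_(2 + m).
Local Notation S := (germ R).

Definition graph (p : 'I_m -> S) (z : V) : W := row_mx z (\row_k germ_fun (p k) z).

Lemma graph_l p z j : graph p z 0 (lshift m j) = z 0 j.
Proof. by rewrite row_mxEl. Qed.

Lemma graph_r p z k : graph p z 0 (rshift 2 k) = germ_fun (p k) z.
Proof. by rewrite row_mxEr mxE. Qed.

Lemma graph_smooth p j : smooth_germ (fun z => graph p z 0 j).
Proof.
case: (split_ordP j) => k ->.
  by rewrite (_ : (fun z => _) = fun z : V => z 0 k);
    [exact: smooth_germ_coord|apply/funext => z; rewrite graph_l].
by rewrite (_ : (fun z => _) = germ_fun (p k));
  [exact: germ_fun_smooth|apply/funext => z; rewrite graph_r].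
Qed.

(** A polynomial map of germs acts pointwise: its value at z is a fixed function of z and of the
    values p(z), that is, of the point of the graph of p above z. *)
Definition realizes (F : W -> R) (f : ('I_m -> S) -> S) := forall p,
  \forall z \near (0 : V), germ_fun (f p) z = F (graph p z).

Lemma pideal_realized e (f : ('I_m -> S) -> S) : pideal e f ->
  exists (D : set W) (F : W -> R), [/\ open D /\ D 0, smooth_on D F, realizes F f,
    ((0 < e)%N -> F 0 = 0) &
    ((1 < e)%N -> forall i, 'D_(delta_mx 0 i) F 0 = 0)].
Proof.
have oT : open (setT : set W) by exact: openT.
elim=> {e f} [c|e|k|e f g _ [D [F [[oD D0] sF Ff F0 dF]]] _ [E [G [[oE E0] sG Gg G0 dG]]]
  |d e f g _ [D [F [[oD D0] sF Ff F0 dF]]] _ [E [G [[oE E0] sG Gg G0 dG]]]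
  |d e f de _ [D [F [oD sF Ff F0 dF]]]].
- have /smooth_germP[D [oD D0 sc]] := germ_fun_smooth c.
  have sl j : smooth_on (setT : set W) (fun w : W => lsubmx w 0 j).
    by apply: smooth_on_ext oT _ (smooth_on_coord (lshift m j) oT) => w _; rewrite mxE.
  have cl : continuous (fun w : W => lsubmx w).
    by move=> w; apply: map_smooth_on_continuous (_ : map_smooth_on setT _) I => j; exact: sl.
  have oE : open ((fun w : W => lsubmx w) @^-1` D).
    by apply: open_comp oD => w _; exact: cl.
  exists ((fun w : W => lsubmx w) @^-1` D), (germ_fun c \o (fun w : W => lsubmx w)); split=> //.
  + split=> //=; by rewrite /preimage /= linear0.
  + apply: smooth_on_comp oE oD _ sc _ => // j.
    by apply: smooth_onS (sl j).
  + by move=> p; apply: filterE => z; rewrite /= /graph row_mxKl.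
- exists setT, (cst 0); split=> //.
  + exact: smooth_on_cst.
  + by move=> p; apply: filterS (germ_fun_cst 0) => z.
  + by move=> _ i; rewrite derive_cst.
- exists setT, (fun w => w 0 (rshift 2 k)); split=> //.
  + exact: smooth_on_coord.
  + by move=> p; apply: filterE => z; rewrite graph_r.
  + by rewrite mxE.
- have oI : open (D `&` E) by exact: openI.
  exists (D `&` E), (F + G); split=> //.
  + by apply: smooth_onD oI _ _; [apply: smooth_onS sF => x []|apply: smooth_onS sG => x []].
  + move=> p; apply: filterS3 (germ_funD (f p) (g p)) (Ff p) (Gg p) => z.
    by rewrite !fctE => -> -> ->.
  + by move=> e0; rewrite fctE F0 // G0 // addr0.
  + move=> e1 i; rewrite deriveD ?dF ?dG ?addr0 //.
      exact: smooth_on_derivable sF D0.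
    exact: smooth_on_derivable sG E0.
- have oI : open (D `&` E) by exact: openI.
  exists (D `&` E), (F * G); split=> //.
  + by apply: smooth_onM oI _ _; [apply: smooth_onS sF => x []|apply: smooth_onS sG => x []].
  + move=> p; apply: filterS3 (germ_funM (f p) (g p)) (Ff p) (Gg p) => z.
    by rewrite !fctE => -> -> ->.
  + rewrite addn_gt0 fctE => /orP[/F0 ->|/G0 ->]; by rewrite ?mul0r ?mulr0.
  + move=> de i; rewrite deriveM; last 2 first.
    * exact: smooth_on_derivable sF D0.
    * exact: smooth_on_derivable sG E0.
    rewrite -![_ *: _]/(_ * _).
    case: d e F0 dF G0 dG de => [|[|d]] [|[|e]] F0 dF G0 dG //= _.
    * by rewrite G0 // dG // mulr0 mul0r addr0.
    * by rewrite F0 // G0 // !mul0r addr0.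
    * by rewrite F0 // G0 // !mul0r addr0.
    * by rewrite F0 // dF // mul0r mulr0 addr0.
    * by rewrite F0 // dF // mul0r mulr0 addr0.
    * by rewrite F0 // dF // mul0r mulr0 addr0.
- exists D, F; split=> // h; [apply: F0|apply: dF]; exact: leq_trans h de.
Qed.
(** With G realizing q, the map H(z, w) = (z, w + G(z, w)) has identity Jacobian at 0, so it has a
    local inverse K, and K carries the graph of r to the graph of p. Smallness of r(0) places the
    graph of r inside the domain of K; continuity of K at 0 gives the bound on p(0). *)
Lemma hensel (q : 'I_m -> ('I_m -> S) -> S) (eps : R) : 0 < eps ->
  (forall k, pideal 2 (q k)) -> exists delta : R, 0 < delta /\
  forall r : 'I_m -> S, (forall k, `|germ_eval (r k)| < delta) ->
  exists p : 'I_m -> S, [/\ forall k, p k + q k p = r k,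
    forall k, `|germ_eval (p k)| < eps &
    (forall k, germ_eval (r k) = 0) -> forall k, germ_eval (p k) = 0].
Proof.
move=> eps0 qP.
have {qP} /choice[Q QP] k := pideal_realized (qP k).
have {QP} /choice[G GP] k := QP k.
pose D := \bigcap_(k in [set: 'I_m]) Q k.
have [D' [oD D0 sG]] : exists D : set W, [/\ open D, D 0 & forall k, smooth_on D (G k)].
  apply: smooth_germs_common => k; apply/smooth_germP.
  by have [[oQ Q0] sQ _ _ _] := GP k; exists (Q k).
have oT : open (setT : set W) by exact: openT.
pose H (w : W) : W := row_mx (lsubmx w) (\row_k (w 0 (rshift 2 k) + G k w)).
have Hl w j : H w 0 (lshift m j) = w 0 (lshift m j) by rewrite row_mxEl mxE.
have Hr w k : H w 0 (rshift 2 k) = w 0 (rshift 2 k) + G k w by rewrite row_mxEr mxE.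
have sH : map_smooth_on D' H.
  move=> j; case: (split_ordP j) => k ->.
    apply: smooth_on_ext oD _ (smooth_on_coord (lshift m k) oD) => w _.
    by rewrite Hl.
  apply: smooth_on_ext oD _ (smooth_onD oD (smooth_on_coord (rshift 2 k) oD) (sG k)) => w _.
  by rewrite Hr.
have G0 k : G k 0 = 0 by have [_ _ _ /(_ isT)] := GP k.
have H0 : H 0 = 0.
  apply/rowP => j; case: (split_ordP j) => k ->; first by rewrite Hl !mxE.
  by rewrite Hr G0 !mxE addr0.
have jH : jac H 0 = 1%:M.
  apply/matrixP => i j; rewrite [LHS]mxE [RHS]mxE; case: (split_ordP j) => k ->.
    have -> : (fun w => H w 0 (lshift m k)) = (fun w : W => w 0 (lshift m k)).
      by apply/funext => w; rewrite Hl.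
    have [_ ->] := is_derive_coord (lshift m k) (0 : W) (delta_mx 0 i).
    by rewrite mxE eqxx eq_sym.
  have -> : (fun w => H w 0 (rshift 2 k)) = (fun w : W => w 0 (rshift 2 k)) + G k.
    by apply/funext => w; rewrite Hr.
  have [dc dcE] := is_derive_coord (rshift 2 k) (0 : W) (delta_mx 0 i).
  have dG := smooth_on_derivable (i := i) (sG k) D0.
  rewrite (deriveD dc dG) dcE; have [_ _ _ _ /(_ isT i) ->] := GP k.
  by rewrite addr0 mxE eqxx eq_sym.
have [E [K [[oE E0] sK K0 HK _]]] := inverse_function oD D0 sH H0 jH.
have cK : {for (0 : W), continuous K} by exact: map_smooth_on_continuous sK E0.
have nE : \forall w \near (0 : W), E w /\ `|K w| < eps.
  have n1 : \forall w \near (0 : W), `|K w| < eps.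
    have := cK; rewrite /prop_for /continuous_at K0.
    move=> /(@cvgrPdist_lt _ _ _ (nbhs (0 : W)) _ K (0 : W))/(_ _ eps0).
    by apply: filterS => w; rewrite sub0r normrN.
  by apply: filterI; [exact: (open_nbhs_nbhs (conj oE E0))|exact: n1].
have [d /= d0 dP] := (nbhs_ballP _ _).1 nE.
exists d; split=> // r rd.
have gd : ball (0 : W) d (graph r 0).
  rewrite -ball_normE /ball_ /= sub0r normrN mx_norm_lt //; apply/forallP => j.
  case: (split_ordP j) => k ->; first by rewrite graph_l mxE normr0.
  by rewrite graph_r; exact: rd.
have [Eg Kg] := dP _ gd.
have sp j : smooth_germ (fun z => K (graph r z) 0 j).
  exact: (smooth_germ_comp_on (phi := graph r) oE (sK j) (graph_smooth r) Eg).
pose p k : S := to_germ (fun z => K (graph r z) 0 (rshift 2 k)).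
have p0 k : germ_eval (p k) = K (graph r 0) 0 (rshift 2 k) by rewrite germ_eval_to_germ.
exists p; split=> [k|k|r0 k].
- apply/germP; apply: germ_eq_trans (germ_funD _ _) _.
  have nEg : \forall z \near (0 : V), E (graph r z).
    apply: near0_comp (graph_smooth r) _; exact: (open_nbhs_nbhs (conj oE Eg)).
  have [_ _ rG _ _] := GP k.
  have nK : \forall z \near (0 : V), forall l, germ_fun (p l) z = K (graph r z) 0 (rshift 2 l).
    apply: (@filter_forall _ _ (fun (l : 'I_m) (z : V) =>
      germ_fun (p l) z = K (graph r z) 0 (rshift 2 l)) (nbhs (0 : V)) _) => l.
    exact: (to_germK (sp (rshift 2 l))).
  apply: filterS3 nEg (rG p) nK => z Ez rz pz; rewrite fctE rz.
  have [_ HKz] := HK _ Ez.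
  have -> : graph p z = K (graph r z).
    apply/rowP => j; case: (split_ordP j) => l ->; last by rewrite graph_r pz.
    by rewrite graph_l -Hl HKz graph_l.
  by rewrite pz -Hr HKz graph_r.
- rewrite p0; apply: le_lt_trans Kg; exact: mx_norm_coord.
- rewrite p0 (_ : graph r 0 = 0) ?K0 ?mxE //.
  apply/rowP => j; case: (split_ordP j) => l ->; first by rewrite graph_l !mxE.
  by rewrite graph_r [RHS]mxE; exact: r0.
Qed.
End Hensel.

(* The algebraic structure of the ring of germs at 0 of functions of two real
   variables on which the classification rests. *)
Record germ_theory (R : realType) := GermTheory {
  gring :> comNzRingType;
  gev : {rmorphism gring -> R};
  gcst : {rmorphism R -> gring};
  gX : gring;
  gY : gring;
  gdx : gring -> gring;
  gdy : gring -> gring;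
  gsubst : gring -> gring -> {rmorphism gring -> gring};
  gev_cst : forall k, gev (gcst k) = k;
  gevX : gev gX = 0;
  gevY : gev gY = 0;
  g_hadamard : forall a, exists b c, a = gcst (gev a) + gX * b + gY * c;
  g_unit : forall a, gev a != 0 -> exists b, a * b = 1;
  gdxD : forall a b, gdx (a + b) = gdx a + gdx b;
  gdyD : forall a b, gdy (a + b) = gdy a + gdy b;
  gdxM : forall a b, gdx (a * b) = gdx a * b + a * gdx b;
  gdyM : forall a b, gdy (a * b) = gdy a * b + a * gdy b;
  gdxC : forall k, gdx (gcst k) = 0;
  gdyC : forall k, gdy (gcst k) = 0;
  gdxX : gdx gX = 1;
  gdxY : gdx gY = 0;
  gdyX : gdy gX = 0;
  gdyY : gdy gY = 1;
  gsubstC : forall u v, gev u = 0 -> gev v = 0 -> forall k, gsubst u v (gcst k) = gcst k;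
  gsubstX : forall u v, gev u = 0 -> gev v = 0 -> gsubst u v gX = u;
  gsubstY : forall u v, gev u = 0 -> gev v = 0 -> gsubst u v gY = v;
  gev_subst : forall u v, gev u = 0 -> gev v = 0 -> forall a, gev (gsubst u v a) = gev a;
  gdx_subst : forall u v, gev u = 0 -> gev v = 0 -> forall a,
    gdx (gsubst u v a) = gsubst u v (gdx a) * gdx u + gsubst u v (gdy a) * gdx v;
  gdy_subst : forall u v, gev u = 0 -> gev v = 0 -> forall a,
    gdy (gsubst u v a) = gsubst u v (gdx a) * gdy u + gsubst u v (gdy a) * gdy v;
  gsubst_comp : forall u v u' v', gev u = 0 -> gev v = 0 -> gev u' = 0 -> gev v' = 0 ->
    forall a, gsubst u v (gsubst u' v' a) = gsubst (gsubst u v u') (gsubst u v v') a;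
  gsubst_id : forall a, gsubst gX gY a = a;
  gsubst_inv : forall u v, gev u = 0 -> gev v = 0 ->
    gev (gdx u) * gev (gdy v) - gev (gdy u) * gev (gdx v) != 0 ->
    exists u' v', [/\ gev u' = 0 /\ gev v' = 0, gsubst u v u' = gX, gsubst u v v' = gY,
      gsubst u' v' u = gX & gsubst u' v' v = gY];
  g_hensel : forall m (q : 'I_m -> ('I_m -> gring) -> gring) (eps : R), 0 < eps ->
    (forall k, pideal 2 (q k)) -> exists delta : R, 0 < delta /\
    forall r : 'I_m -> gring, (forall k, `|gev (r k)| < delta) ->
    exists p : 'I_m -> gring, [/\ forall k, p k + q k p = r k,
      forall k, `|gev (p k)| < eps &
      (forall k, gev (r k) = 0) -> forall k, gev (p k) = 0] }.

(** * Smooth germs as an instance of the abstract structure *)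

Section SmoothTheory.
Context (R : realType).
Local Notation S := (germ R).

Definition pair_map (u v : S) (j : 'I_2) : S := if j == ix then u else v.

Lemma iyP : (iy == ix) = false. Proof. by []. Qed.

(** Substitution has to be total in (u, v). Pairs that do not vanish at 0 are given the identity;
    the laws of [germ_theory] are stated for vanishing pairs. *)
Definition mk_map (u v : S) : germ_map R :=
  if pselect (forall j, germ_eval (pair_map u v j) = 0) is left h then GermMap h
  else germ_map_id.

Lemma mk_mapE (u v : S) : germ_eval u = 0 -> germ_eval v = 0 ->
  mk_map u v ix = u /\ mk_map u v iy = v.
Proof.
move=> u0 v0; rewrite /mk_map; case: pselect => [h|[]] /=.
  by rewrite /pair_map eqxx iyP.
by apply: forall_ord2; rewrite /pair_map ?eqxx ?iyP.
Qed.

Lemma pullback_ext (p q : germ_map R) (a : S) : p ix = q ix -> p iy = q iy ->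
  pullback p a = pullback q a.
Proof.
move=> E0 E1; rewrite /pullback; congr (to_germ (germ_fun a \o _)).
by apply/funext => z; apply/rowP; apply: forall_ord2; rewrite !mxE ?E0 ?E1.
Qed.

Lemma germ_jac2 (p : germ_map R) : (germ_jac p \in unitmx) =
  (germ_eval (germ_partial ix (p ix)) * germ_eval (germ_partial iy (p iy)) -
   germ_eval (germ_partial iy (p ix)) * germ_eval (germ_partial ix (p iy)) != 0).
Proof.
rewrite unitmxE unitfE (expand_det_row _ ix) sum_ord2 /cofactor !det_mx11.
rewrite !mxE.
have -> : lift ix 0 = iy by exact/val_inj.
have -> : lift iy 0 = ix by exact/val_inj.
rewrite /= expr0 mul1r mulN1r mulrN.
by congr (_ - _ != 0); rewrite mulrC.
Qed.

Lemma hadamard2 (a : S) : exists b c,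
  a = germ_const (germ_eval a) + germ_coord ix * b + germ_coord iy * c.
Proof.
have [f fE] := germ_hadamard a; exists (f ix), (f iy).
by rewrite {1}fE sum_ord2 addrA.
Qed.

Lemma subst_chain i (u v : S) : germ_eval u = 0 -> germ_eval v = 0 -> forall a : S,
  germ_partial i (pullback (mk_map u v) a) =
  pullback (mk_map u v) (germ_partial ix a) * germ_partial i u +
  pullback (mk_map u v) (germ_partial iy a) * germ_partial i v.
Proof.
move=> u0 v0 a; have [Eu Ev] := mk_mapE u0 v0.
by rewrite germ_partial_pullback sum_ord2 Eu Ev.
Qed.

Lemma subst_comp (u v u' v' : S) : germ_eval u = 0 -> germ_eval v = 0 ->
  germ_eval u' = 0 -> germ_eval v' = 0 -> forall a : S,
  pullback (mk_map u v) (pullback (mk_map u' v') a) =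
  pullback (mk_map (pullback (mk_map u v) u') (pullback (mk_map u v) v')) a.
Proof.
move=> u0 v0 u'0 v'0 a; rewrite pullback_comp; have [Eu Ev] := mk_mapE u'0 v'0.
have [] := @mk_mapE (pullback (mk_map u v) u') (pullback (mk_map u v) v');
  rewrite ?germ_eval_pullback // => E1 E2.
by apply: pullback_ext; rewrite /= ?E1 ?E2 ?Eu ?Ev.
Qed.

Lemma coord0 i : germ_eval (germ_coord i) = 0 :> R. Proof. exact: germ_evalX. Qed.

Lemma subst_id (a : S) : pullback (mk_map (germ_coord ix) (germ_coord iy)) a = a.
Proof.
have [E1 E2] := mk_mapE (coord0 ix) (coord0 iy).
by apply: pullback_id; apply: forall_ord2.
Qed.

Lemma subst_inv (u v : S) : germ_eval u = 0 -> germ_eval v = 0 ->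
  germ_eval (germ_partial ix u) * germ_eval (germ_partial iy v) -
  germ_eval (germ_partial iy u) * germ_eval (germ_partial ix v) != 0 ->
  exists u' v', [/\ germ_eval u' = 0 /\ germ_eval v' = 0,
    pullback (mk_map u v) u' = germ_coord ix, pullback (mk_map u v) v' = germ_coord iy,
    pullback (mk_map u' v') u = germ_coord ix & pullback (mk_map u' v') v = germ_coord iy].
Proof.
move=> u0 v0; have [Eu Ev] := mk_mapE u0 v0.
have jE := germ_jac2 (mk_map u v); rewrite Eu Ev in jE; rewrite -jE.
move=> /germ_map_inverse[q [pq qp]].
exists (q ix), (q iy); have [Eu' Ev'] := mk_mapE (germ_map0 q ix) (germ_map0 q iy).
split; [by split; exact: germ_map0|exact: pq|exact: pq| |].
  by rewrite -{1}Eu (@pullback_ext _ q) // qp.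
by rewrite -{1}Ev (@pullback_ext _ q) // qp.
Qed.

(** Left transparent, so that the ring, evaluation and derivations of this instance are convertible
    to those of [germ]. *)
Definition smooth_theory : germ_theory R.
Proof.
refine (@GermTheory R S (@germ_eval R) (@germ_const R) (germ_coord ix) (germ_coord iy)
  (germ_partial ix) (germ_partial iy) (fun u v => pullback (mk_map u v))
  (@germ_evalC R) (coord0 ix) (coord0 iy) hadamard2 (@germ_unit R)
  _ _ (@germ_partialM R ix) (@germ_partialM R iy) (@germ_partialC R ix) (@germ_partialC R iy)
  _ _ _ _ _ _ _ _ (@subst_chain ix) (@subst_chain iy) subst_comp subst_id subst_inv _).
- by move=> a b; exact: raddfD.
- by move=> a b; exact: raddfD.
- by rewrite germ_partialX eqxx.
- by rewrite germ_partialX.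
- by rewrite germ_partialX.
- by rewrite germ_partialX eqxx.
- by move=> u v _ _ k; exact: pullbackC.
- by move=> u v u0 v0; exact: (eq_trans (pullbackX _ _) (proj1 (mk_mapE u0 v0))).
- by move=> u v u0 v0; exact: (eq_trans (pullbackX _ _) (proj2 (mk_mapE u0 v0))).
- by move=> u v _ _ a; exact: germ_eval_pullback.
- by move=> m; exact: hensel.
Defined.
End SmoothTheory.

(** * Matrix-valued germs *)

Section MatrixSmooth.
Context {R : realType} {r m n : nat}.
Local Notation V := 'rV[R]_r.
Implicit Types (F : V -> 'M[R]_(m, n)) (D : set V).

Lemma continuous_mx F x : (forall i j, {for x, continuous (fun y => F y i j)}) ->
  {for x, continuous F}.
Proof.
move=> cF; suff : F y @[y --> x] --> F x by [].
apply/(@cvgrPdist_le _ _ _ (nbhs x) _ F (F x)) => e e0.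
have n0 : \forall y \near x, forall k : 'I_m * 'I_n, `|F x k.1 k.2 - F y k.1 k.2| <= e.
  apply: (@filter_forall _ _ (fun (k : 'I_m * 'I_n) y =>
    `|F x k.1 k.2 - F y k.1 k.2| <= e) (nbhs x) _) => k.
  by have /cvgrPdist_le/(_ e e0) := cF k.1 k.2.
apply: filterS n0 => y yP; rewrite [leLHS]/Num.Def.normr /= mx_normrE.
by apply: bigmax_le => [|k _]; [exact: ltW|rewrite !mxE].
Qed.

Lemma continuous_entry F x i j : {for x, continuous F} ->
  {for x, continuous (fun y => F y i j)}.
Proof.
move=> cF; apply: (@continuous_comp _ _ _ F (fun M : 'M[R]_(m, n) => M i j)) => //.
exact: coord_continuous.
Qed.

Lemma iter_partial_entry D F s : open D ->
  (forall s' x, D x -> (size s' < size s)%N ->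
    forall k, derivable (iter_partial F s') x (delta_mx 0 k)) ->
  forall x i j, D x -> iter_partial (fun y => F y i j) s x = iter_partial F s x i j.
Proof.
move=> oD; elim: s => [//|k s IH] dF x i j Dx.
have {}IH : forall y, D y -> iter_partial (fun y => F y i j) s y = iter_partial F s y i j.
  by move=> y; apply: IH => s' z Dz ss'; apply: dF => //=; exact: ltnW.
have dFx := dF s x Dx (ltnSn _) k.
rewrite /= -/(iter_partial F s) (derive_mx dFx) mxE.
apply: near_eq_derive; exact: filterS (open_nbhs_nbhs (conj oD Dx)).
Qed.

(** The converse is a strong induction on the number of derivatives: the entries of an iterated
    partial are the iterated partials of the entries once all shorter partials of the matrix are
    derivable, and derivability is in turn an entrywise condition. *)
Lemma smooth_germ_mxP F :
  smooth_germ F <-> forall i j, smooth_germ (fun x => F x i j).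
Proof.
split=> [|sF].
  rewrite /smooth_germ => /nbhs_interior n0 i j.
  pose D := [set x | forall s : seq 'I_r, {for x, continuous (iter_partial F s)} /\
    forall i, derivable (iter_partial F s) x (delta_mx 0 i)]°.
  have oD : open D by exact: open_interior.
  have DP x : D x -> forall s : seq 'I_r, {for x, continuous (iter_partial F s)} /\
    forall i, derivable (iter_partial F s) x (delta_mx 0 i) by move=> /interior_subset.
  have E s : forall x, D x -> iter_partial (fun y => F y i j) s x = iter_partial F s x i j.
    by move=> x Dx; apply: (iter_partial_entry oD) => // s' y /DP/(_ s')[].
  apply: filterS n0 => x Dx s; have [cF dF] := DP x Dx s.
  have ns : \forall y \near x, iter_partial F s y i j = iter_partial (fun y => F y i j) s y.
    by apply: filterS (open_nbhs_nbhs (conj oD Dx)) => y /E ->.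
  split=> [|k].
    apply: (near_eq_continuous (f := fun y => iter_partial F s y i j) ns).
    exact: continuous_entry.
  apply: (near_eq_derivable (f := fun y => iter_partial F s y i j) ns).
  by have /derivable_mxP/(_ i j) := dF k.
have [D [oD D0 sD]] := smooth_germs_common (fun k : 'I_m * 'I_n => sF k.1 k.2).
have E s : forall x, D x -> (forall i j, iter_partial (fun y => F y i j) s x = iter_partial F s x i j)
    /\ forall k, derivable (iter_partial F s) x (delta_mx 0 k).
  have [l] := ubnP (size s); elim: l s => // l IH s sl x Dx.
  have E1 y (Dy : D y) i j : iter_partial (fun y => F y i j) s y = iter_partial F s y i j.
    apply: (iter_partial_entry oD) => // s' z Dz ss' k.
    by have [] := IH s' (leq_trans ss' sl) z Dz.
  split=> [i j|k]; first exact: E1.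
  apply/derivable_mxP => i j; apply: (@near_eq_derivable _ _ _ (iter_partial (fun y => F y i j) s)).
    by apply: filterS (open_nbhs_nbhs (conj oD Dx)) => y Dy; exact: E1.
  by have [_] := sD (i, j) x Dx s; apply.
apply: filterS (open_nbhs_nbhs (conj oD D0)) => x Dx s; split; last by have [] := E s x Dx.
apply: continuous_mx => i j.
apply: (@near_eq_continuous _ _ (iter_partial (fun y => F y i j) s)).
  by apply: filterS (open_nbhs_nbhs (conj oD Dx)) => y Dy; have [] := E s y Dy.
by have [] := sD (i, j) x Dx s.
Qed.

Lemma diff_mx D F x : open D -> (forall i j, smooth_on D (fun y => F y i j)) -> D x ->
  forall v, 'd F x v = \matrix_(i, j) \sum_k 'D_(delta_mx 0 k) (fun y => F y i j) x * v 0 k.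
Proof.
move=> oD sF Dx.
pose df (v : V) : 'M[R]_(m, n) := \matrix_(i, j) \sum_k 'D_(delta_mx 0 k) (fun y => F y i j) x * v 0 k.
have ldf : linear df.
  move=> a u v; apply/matrixP => i j; rewrite !mxE mulr_sumr -big_split /=.
  by apply: eq_bigr => k _; rewrite !mxE mulrDr mulrCA.
pose Ldf : {linear V -> 'M[R]_(m, n)} := HB.pack df (GRing.isLinear.Build _ _ _ _ df ldf).
have [] := @differentiable_intro R V 'M[R]_(m, n) F x Ldf.
- move=> h; apply: continuous_mx => i j.
  rewrite (_ : (fun y => _) = fun v : V => \sum_k 'D_(delta_mx 0 k) (fun y => F y i j) x * v 0 k).
    apply: (@smooth_on_continuous _ _ setT) => //.
    apply: smooth_on_sum; first exact: openT.
    by move=> k _; apply: smooth_onZ; [exact: openT|apply: smooth_on_coord; exact: openT].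
  by apply/funext => v; rewrite mxE.
- move=> e e0.
  have n0 : \forall h \near (0 : V), forall k : 'I_m * 'I_n,
      `|F (h + x) k.1 k.2 - (F x k.1 k.2 + df h k.1 k.2)| <= e * `|h|.
    apply: (@filter_forall _ _ (fun (k : 'I_m * 'I_n) (h : V) =>
      `|F (h + x) k.1 k.2 - (F x k.1 k.2 + df h k.1 k.2)| <= e * `|h|) (nbhs (0 : V)) _) => k.
    have [dfk dfkE] := smooth_on_diff oD (sF k.1 k.2) Dx.
    have /eqaddoP/(_ e e0) := diff_locally dfk; apply: filterS => h.
    by rewrite /= !fctE /= dfkE mxE.
  apply: filterS n0 => h hP; rewrite [leLHS]/Num.Def.normr /= mx_normrE.
  apply: bigmax_le => [|k _]; first by rewrite mulr_ge0 // ltW.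
  by have := hP k; rewrite [in X in _ -> X]mxE [in X in _ -> X]mxE [in X in _ -> X]mxE.
by move=> _ E v; rewrite E.
Qed.
End MatrixSmooth.

(** * Equivalence and tangent spaces over the ring of germs *)

Section GermAlgebra.
Context {R : realType} (T : germ_theory R).
Local Notation S := (gring T).
Local Notation ev := (gev T).
Local Notation C := (gcst T).
Local Notation dx := (@gdx R T).
Local Notation dy := (@gdy R T).
Implicit Types (a b u v : S) (A B F U X : 'M[S]_3).

Definition gsym A := A^T = A.

Definition gact A u v U : 'M[S]_3 :=
  u *: map_mx dx A + v *: map_mx dy A + U^T *m A + A *m U.

Definition gtang A F := exists u v U, F = gact A u v U.

(** The upper half of the codimension: the quotient has dimension at most d. It is the form in which
    the bound on the codimension enters the classification, and it passes to equivalent matrices. *)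
Definition gspan A d := exists b : 'I_d -> 'M[S]_3, (forall i, gsym (b i)) /\
  forall F, gsym F -> exists c : 'I_d -> R, gtang A (F - \sum_i C (c i) *: b i).

Definition gindep A d (b : 'I_d -> 'M[S]_3) :=
  forall c : 'I_d -> R, gtang A (\sum_i C (c i) *: b i) -> forall i, c i = 0.

Definition gcodim A d := exists b : 'I_d -> 'M[S]_3, [/\ forall i, gsym (b i),
  gindep A b & forall F, gsym F -> exists c : 'I_d -> R, gtang A (F - \sum_i C (c i) *: b i)].

Definition gjac u v := ev (dx u) * ev (dy v) - ev (dy u) * ev (dx v).

Definition gequiv A B := exists u v X, [/\ ev u = 0 /\ ev v = 0, gjac u v != 0,
  ev (\det X) != 0 & B = X^T *m map_mx (gsubst u v) A *m X].

Lemma gdx0 : dx 0 = 0. Proof. by rewrite -[in LHS](rmorph0 C) gdxC. Qed.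
Lemma gdy0 : dy 0 = 0. Proof. by rewrite -[in LHS](rmorph0 C) gdyC. Qed.
Lemma gdx1 : dx 1 = 0. Proof. by rewrite -(rmorph1 C) gdxC. Qed.
Lemma gdy1 : dy 1 = 0. Proof. by rewrite -(rmorph1 C) gdyC. Qed.
Lemma gdxN a : dx (- a) = - dx a.
Proof. by apply/eqP; rewrite -subr_eq0 opprK -gdxD addNr gdx0. Qed.
Lemma gdyN a : dy (- a) = - dy a.
Proof. by apply/eqP; rewrite -subr_eq0 opprK -gdyD addNr gdy0. Qed.

Lemma gdx_sum (I : Type) (r : seq I) (P : pred I) (f : I -> S) :
  dx (\sum_(i <- r | P i) f i) = \sum_(i <- r | P i) dx (f i).
Proof. by elim/big_rec2: _ => [|i x y _ <-]; rewrite ?gdx0 ?gdxD. Qed.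
Lemma gdy_sum (I : Type) (r : seq I) (P : pred I) (f : I -> S) :
  dy (\sum_(i <- r | P i) f i) = \sum_(i <- r | P i) dy (f i).
Proof. by elim/big_rec2: _ => [|i x y _ <-]; rewrite ?gdy0 ?gdyD. Qed.

Lemma gdx_mulmx m n p (M : 'M[S]_(m, n)) (N : 'M[S]_(n, p)) :
  map_mx dx (M *m N) = map_mx dx M *m N + M *m map_mx dx N.
Proof.
apply/matrixP => i j; rewrite !mxE gdx_sum -big_split /=.
by apply: eq_bigr => k _; rewrite gdxM !mxE.
Qed.
Lemma gdy_mulmx m n p (M : 'M[S]_(m, n)) (N : 'M[S]_(n, p)) :
  map_mx dy (M *m N) = map_mx dy M *m N + M *m map_mx dy N.
Proof.
apply/matrixP => i j; rewrite !mxE gdy_sum -big_split /=.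
by apply: eq_bigr => k _; rewrite gdyM !mxE.
Qed.

Lemma gmx_inv n (X : 'M[S]_n) : ev (\det X) != 0 ->
  exists Y : 'M[S]_n, [/\ X *m Y = 1%:M, Y *m X = 1%:M & ev (\det Y) != 0].
Proof.
move=> /g_unit[b bP]; exists (b *: \adj X).
have E1 : X *m (b *: \adj X) = 1%:M.
  by rewrite -scalemxAr mul_mx_adj -mul_scalar_mx -scalar_mxM mulrC bP.
have E2 : (b *: \adj X) *m X = 1%:M.
  by rewrite -scalemxAl mul_adj_mx -mul_scalar_mx -scalar_mxM mulrC bP.
split=> //; move: E1 => /(congr1 (fun M => ev (\det M))).
rewrite det_mulmx det1 rmorphM rmorph1 => E; apply/eqP => E0.
by move: E; rewrite E0 mulr0 => /eqP; rewrite eq_sym oner_eq0.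
Qed.

Lemma gequiv_congr A X : ev (\det X) != 0 -> gequiv A (X^T *m A *m X).
Proof.
move=> uX; exists (gX T), (gY T), X; split=> //; first by rewrite gevX gevY.
  by rewrite /gjac gdxX gdyY gdyX gdxY !rmorph1 rmorph0 mul1r mul0r subr0 oner_eq0.
by congr (_ *m _ *m _); apply/matrixP => i j; rewrite mxE gsubst_id.
Qed.

Lemma gequiv_subst A u v : ev u = 0 -> ev v = 0 -> gjac u v != 0 ->
  gequiv A (map_mx (gsubst u v) A).
Proof.
move=> u0 v0 J; exists u, v, 1%:M; split=> //; first by rewrite det1 rmorph1 oner_eq0.
by rewrite trmx1 mul1mx mulmx1.
Qed.

Lemma gjac_comp u v u' v' : ev u = 0 -> ev v = 0 -> ev u' = 0 -> ev v' = 0 ->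
  gjac (gsubst u v u') (gsubst u v v') = gjac u v * gjac u' v'.
Proof.
move=> u0 v0 u'0 v'0; rewrite /gjac !gdx_subst // !gdy_subst //.
by rewrite !rmorphD !rmorphM !gev_subst //; ring.
Qed.

Lemma gequiv_trans A B D : gequiv A B -> gequiv B D -> gequiv A D.
Proof.
move=> [u [v [X [[u0 v0] J uX ->]]]] [u' [v' [Y [[u'0 v'0] J' uY ->]]]].
exists (gsubst u' v' u), (gsubst u' v' v), (map_mx (gsubst u' v') X *m Y).
have e0 a : ev (gsubst u' v' a) = ev a by rewrite gev_subst.
split.
- by rewrite !e0.
- by rewrite gjac_comp // mulf_neq0.
- by rewrite det_mulmx rmorphM mulf_neq0 // det_map_mx e0.
- rewrite !map_mxM !trmx_mul map_trmx !mulmxA; congr (_ *m _ *m _ *m _ *m _).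
  by apply/matrixP => i j; rewrite !mxE gsubst_comp.
Qed.

Lemma gequiv_sym A B : gequiv A B -> gequiv B A.
Proof.
move=> [u [v [X [[u0 v0] J uX ->]]]].
have [u' [v' [[u'0 v'0] E1 E2 E3 E4]]] := gsubst_inv u0 v0 J.
have [Y [XY YX uY]] := gmx_inv uX.
exists u', v', (map_mx (gsubst u' v') Y); split=> //.
- have := gjac_comp u'0 v'0 u0 v0; rewrite E3 E4.
  rewrite [LHS]/gjac gdxX gdyY gdyX gdxY !rmorph1 rmorph0 mul1r mul0r subr0.
  by move=> E; apply/eqP => E0; move: E; rewrite E0 mul0r => /eqP; rewrite oner_eq0.
- by rewrite det_map_mx gev_subst.
have E' : map_mx (gsubst u' v') (map_mx (gsubst u v) A) = A.
  by apply/matrixP => i j; rewrite !mxE gsubst_comp // E3 E4 gsubst_id.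
have Ey : map_mx (gsubst u' v') X *m map_mx (gsubst u' v') Y = 1%:M.
  by rewrite -map_mxM XY map_mx1.
have EX : map_mx (gsubst u' v') X^T = (map_mx (gsubst u' v') X)^T by rewrite map_trmx.
rewrite !map_mxM EX E' !mulmxA -trmx_mul Ey trmx1 mul1mx.
by rewrite -mulmxA Ey mulmx1.
Qed.

(* The transported tangent space: differentiate B = X^T (A o phi) X and use the
   chain rule. *)
Lemma gtang_equiv A u v X : ev u = 0 -> ev v = 0 -> ev (\det X) != 0 -> gjac u v != 0 ->
  forall F, gtang A F -> gtang (X^T *m map_mx (gsubst u v) A *m X)
                            (X^T *m map_mx (gsubst u v) F *m X).
Proof.
move=> u0 v0 uX J _ [a [b [U ->]]].
set s := gsubst u v; set B := X^T *m _ *m X.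
have [Y [XY YX uY]] := gmx_inv uX.
have [w wP] : exists w, (dx u * dy v - dy u * dx v) * w = 1.
  by apply: g_unit; rewrite rmorphB !rmorphM.
(* (a', b') solves the linear system given by the Jacobian of (u, v). *)
pose a' := w * (dy v * s a - dy u * s b); pose b' := w * (dx u * s b - dx v * s a).
have Ea : a' * dx u + b' * dy u = s a.
  by rewrite /a' /b' -[RHS]mul1r -wP; ring.
have Eb : a' * dx v + b' * dy v = s b.
  by rewrite /a' /b' -[RHS]mul1r -wP; ring.
pose Z := a' *: map_mx dx X + b' *: map_mx dy X.
exists a', b', (Y *m (map_mx s U *m X - Z)).
pose As := map_mx s A; pose D (M : 'M[S]_3) := a' *: map_mx dx M + b' *: map_mx dy M.
have DM M N : D (M *m N) = D M *m N + M *m D N.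
  rewrite /D gdx_mulmx gdy_mulmx mulmxDl mulmxDr -!scalemxAl -!scalemxAr.
  by rewrite !scalerDr addrACA.
have DT M : D M^T = (D M)^T by apply/matrixP => i j; rewrite !mxE.
have chain : D As = map_mx s (a *: map_mx dx A + b *: map_mx dy A).
  apply/matrixP => i j; rewrite !mxE gdx_subst // gdy_subst // rmorphD !rmorphM -Ea -Eb /s.
  ring.
have YB : Y^T *m B = As *m X by rewrite /B !mulmxA -trmx_mul XY trmx1 mul1mx.
have BY : B *m Y = X^T *m As by rewrite /B -mulmxA XY mulmx1.
have W1 : (Y *m (map_mx s U *m X - Z))^T *m B =
    X^T *m map_mx s U^T *m As *m X - Z^T *m As *m X.
  rewrite trmx_mul -[LHS]mulmxA YB linearB /= mulmxBl !mulmxA trmx_mul.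
  by rewrite map_trmx.
have W2 : B *m (Y *m (map_mx s U *m X - Z)) =
    X^T *m As *m map_mx s U *m X - X^T *m As *m Z.
  by rewrite mulmxA BY mulmxBr !mulmxA.
have DB : D B = Z^T *m As *m X + X^T *m D As *m X + X^T *m As *m Z.
  by rewrite /B -/As !DM DT mulmxDl.
rewrite /gact -/(D B) DB chain W1 W2.
rewrite ![map_mx s (_ + _)]map_mxD !map_mxM -/As !(mulmxDl, mulmxDr) !mulmxA.
set z1 := Z^T *m As *m X; set z2 := X^T *m As *m Z.
by apply/matrixP => i j; rewrite !mxE; ring.
Qed.

Lemma gspan_equiv A B d : gequiv A B -> gspan A d -> gspan B d.
Proof.
move=> [u [v [X [[u0 v0] J uX ->]]]] [b [sb bP]].
have [u' [v' [[u'0 v'0] E1 E2 E3 E4]]] := gsubst_inv u0 v0 J.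
have [Y [XY YX uY]] := gmx_inv uX.
pose f F := X^T *m map_mx (gsubst u v) F *m X.
have fS F : gsym F -> gsym (f F).
  by move=> sF; rewrite /gsym /f !trmx_mul trmxK map_trmx sF mulmxA.
exists (fun i => f (b i)); split=> [i|F sF]; first exact/fS/sb.
pose G := map_mx (gsubst u' v') (Y^T *m F *m Y).
have fG : f G = F.
  have -> : f G = X^T *m (Y^T *m F *m Y) *m X.
    congr (_ *m _ *m _); apply/matrixP => i j; rewrite ![map_mx _ _ _ _]mxE.
    by rewrite gsubst_comp // E1 E2 gsubst_id.
  by rewrite !mulmxA -trmx_mul YX trmx1 mul1mx -mulmxA YX mulmx1.
have sG : gsym G.
  by rewrite /gsym /G map_trmx !trmx_mul trmxK sF mulmxA.
have [c cP] := bP G sG; exists c.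
have := gtang_equiv u0 v0 uX J cP; rewrite -/(f _).
congr (gtang _ _); rewrite -[in RHS]fG /f map_mxB mulmxBr mulmxBl; congr (_ - _).
rewrite rmorph_sum /= mulmx_sumr mulmx_suml; apply: eq_bigr => i _.
by rewrite map_mxZ /= gsubstC // -scalemxAr -scalemxAl.
Qed.
End GermAlgebra.

(** * Transfer between functions and germs *)

Section Bridge.
Context {R : realType}.
Local Notation V := 'rV[R]_2.
Local Notation T0 := (smooth_theory R).
Local Notation S := (germ R).
Local Notation M3 := 'M[S]_3.

Definition mx_germ m n (F : V -> 'M[R]_(m, n)) : 'M[S]_(m, n) :=
  \matrix_(i, j) to_germ (fun z => F z i j).
Definition mx_fun m n (M : 'M[S]_(m, n)) (z : V) : 'M[R]_(m, n) :=
  \matrix_(i, j) germ_fun (M i j) z.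

Lemma near_mx m n (F G : V -> 'M[R]_(m, n)) :
  (forall i j, germ_eq (fun z => F z i j) (fun z => G z i j)) ->
  \forall z \near (0 : V), F z = G z.
Proof.
move=> FG; have : \forall z \near (0 : V), forall k : 'I_m * 'I_n, F z k.1 k.2 = G z k.1 k.2.
  apply: (@filter_forall _ _ (fun (k : 'I_m * 'I_n) z => F z k.1 k.2 = G z k.1 k.2)
    (nbhs (0 : V)) _) => k; exact: FG.
by apply: filterS => z zP; apply/matrixP => i j; exact: (zP (i, j)).
Qed.

Lemma mx_funK m n (M : 'M[S]_(m, n)) : mx_germ (mx_fun M) = M.
Proof.
apply/matrixP => i j; rewrite mxE -[RHS]germ_funK; congr to_germ.
by apply/funext => z; rewrite mxE.
Qed.

Lemma mx_fun_smooth m n (M : 'M[S]_(m, n)) : smooth_germ (mx_fun M).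
Proof.
apply/smooth_germ_mxP => i j; apply: smooth_germ_ext (germ_fun_smooth (M i j)).
by apply: filterE => z; rewrite mxE.
Qed.

Lemma mx_germK m n (F : V -> 'M[R]_(m, n)) : smooth_germ F ->
  \forall z \near (0 : V), mx_fun (mx_germ F) z = F z.
Proof.
move=> /smooth_germ_mxP sF; apply: near_mx => i j.
by apply: filterS (to_germK (sF i j)) => z; rewrite !mxE.
Qed.

Lemma mx_germ_inj m n (F G : V -> 'M[R]_(m, n)) : smooth_germ F -> smooth_germ G ->
  mx_germ F = mx_germ G <-> \forall z \near (0 : V), F z = G z.
Proof.
move=> sF sG; split=> FG.
  have := mx_germK sG; rewrite -FG => h.
  by apply: filterS2 (mx_germK sF) h => z <-.
move/smooth_germ_mxP : sF => sF; move/smooth_germ_mxP : sG => sG.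
apply/matrixP => i j; rewrite !mxE; apply/to_germ_eq => //.
by apply: filterS FG => z ->.
Qed.

Lemma germ_fun_sum (I : Type) (s : seq I) (f : I -> S) :
  \forall z \near (0 : V), germ_fun (\sum_(i <- s) f i) z = \sum_(i <- s) germ_fun (f i) z.
Proof.
elim: s => [|i s IH].
  rewrite big_nil; apply: filterS (germ_fun_cst (0 : R)) => z E.
  by rewrite big_nil -[RHS]E.
rewrite big_cons; apply: filterS2 IH (germ_funD (f i) (\sum_(j <- s) f j)) => z E1 E2.
by rewrite E2 fctE E1 big_cons.
Qed.

Lemma mx_funD m n (M N : 'M[S]_(m, n)) :
  \forall z \near (0 : V), mx_fun (M + N) z = mx_fun M z + mx_fun N z.
Proof.
apply: near_mx => i j; apply: filterS (germ_funD (M i j) (N i j)) => z E.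
by rewrite !mxE E.
Qed.

Lemma mx_funZ m n a (M : 'M[S]_(m, n)) :
  \forall z \near (0 : V), mx_fun (a *: M) z = germ_fun a z *: mx_fun M z.
Proof.
apply: near_mx => i j; apply: filterS (germ_funM a (M i j)) => z E.
by rewrite !mxE E.
Qed.

Lemma mx_fun_mul m n p (M : 'M[S]_(m, n)) (N : 'M[S]_(n, p)) :
  \forall z \near (0 : V), mx_fun (M *m N) z = mx_fun M z *m mx_fun N z.
Proof.
apply: near_mx => i j.
have h : \forall z \near (0 : V), forall k, germ_fun (M i k * N k j) z =
    germ_fun (M i k) z * germ_fun (N k j) z.
  apply: (@filter_forall _ _ (fun (k : 'I_n) z => germ_fun (M i k * N k j) z =
    germ_fun (M i k) z * germ_fun (N k j) z) (nbhs (0 : V)) _) => k.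
  exact: (germ_funM (M i k) (N k j)).
apply: filterS2 h (germ_fun_sum (index_enum 'I_n) (fun k => M i k * N k j)) => z E1 E2.
rewrite !mxE E2; apply: eq_bigr => k _; by rewrite E1 !mxE.
Qed.

Lemma mx_fun_tr m n (M : 'M[S]_(m, n)) z : mx_fun M^T z = (mx_fun M z)^T.
Proof. by apply/matrixP => i j; rewrite !mxE. Qed.

Lemma mx_fun_pullback m n p (M : 'M[S]_(m, n)) :
  \forall z \near (0 : V), mx_fun (map_mx (pullback p) M) z = mx_fun M (map_fun p z).
Proof.
apply: near_mx => i j; apply: filterS (germ_fun_pullback p (M i j)) => z E.
by rewrite !mxE E.
Qed.

Lemma mx_fun_diff (A : V -> 'M[R]_3) (M : M3) : smooth_germ A -> M = mx_germ A ->
  \forall z \near (0 : V), forall v, 'd A z v =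
    v 0 ix *: mx_fun (map_mx (germ_partial ix) M) z +
    v 0 iy *: mx_fun (map_mx (germ_partial iy) M) z.
Proof.
move=> /smooth_germ_mxP sA ->.
have [D [oD D0 sD]] := smooth_germs_common (fun k : 'I_3 * 'I_3 => sA k.1 k.2).
have h k : \forall z \near (0 : V), mx_fun (map_mx (germ_partial k) (mx_germ A)) z =
    \matrix_(i, j) 'D_(delta_mx 0 k) (fun y => A y i j) z.
  apply: near_mx => i j.
  have h1 := germ_eq_trans (germ_fun_partial k (to_germ (fun y => A y i j)))
    (germ_eq_partial k (to_germK (sA i j))).
  by apply: filterS h1 => z E; rewrite !mxE E.
apply: filterS3 (open_nbhs_nbhs (conj oD D0)) (h ix) (h iy) => z Dz Ex Ey v.
rewrite (diff_mx oD (fun i j => sD (i, j)) Dz) Ex Ey; apply/matrixP => i j.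
by rewrite !mxE sum_ord2 mulrC [X in _ + X]mulrC.
Qed.

Lemma gtangP (A F : V -> 'M[R]_3) : smooth_germ A -> smooth_germ F ->
  @gtang R T0 (mx_germ A) (mx_germ F) <-> Ge_tangent A F.
Proof.
move=> sA sF.
have key (v : V -> V) (U : V -> 'M[R]_3) (a b : S) (W : M3) :
    (\forall z \near (0 : V), [/\ germ_fun a z = v z 0 ix, germ_fun b z = v z 0 iy &
        mx_fun W z = U z]) ->
    \forall z \near (0 : V), mx_fun (@gact R T0 (mx_germ A) a b W) z =
      'd A z (v z) + (U z)^T *m A z + A z *m U z.
  move=> vU.
  set B := mx_germ A.
  set Bx := map_mx (germ_partial ix) B; set By := map_mx (germ_partial iy) B.
  have h1 := mx_funD (a *: Bx + b *: By + W^T *m B) (B *m W).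
  have h2 := mx_funD (a *: Bx + b *: By) (W^T *m B).
  have h3 := mx_funD (a *: Bx) (b *: By).
  have h5 := mx_funZ a Bx. have h6 := mx_funZ b By.
  have h7 := mx_fun_mul W^T B. have h8 := mx_fun_mul B W.
  have g1 : \forall z \near (0 : V), mx_fun (@gact R T0 B a b W) z =
      mx_fun (a *: Bx + b *: By) z + mx_fun (W^T *m B) z + mx_fun (B *m W) z.
    by apply: filterS2 h1 h2 => z E1 E2; rewrite -E2; exact: E1.
  have g2 : \forall z \near (0 : V), mx_fun (a *: Bx + b *: By) z =
      germ_fun a z *: mx_fun Bx z + germ_fun b z *: mx_fun By z.
    by apply: filterS3 h3 h5 h6 => z E1 E2 E3; exact: (etrans E1 (f_equal2 +%R E2 E3)).
  have g3 : \forall z \near (0 : V), mx_fun (a *: Bx + b *: By) z = 'd A z (v z).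
    apply: filterS3 g2 (mx_fun_diff sA erefl) vU => z E1 E2 [E3 E4 _].
    by rewrite E1 E2 E3 E4.
  have g4 : \forall z \near (0 : V), mx_fun (W^T *m B) z = (U z)^T *m A z.
    apply: filterS3 h7 (mx_germK sA) vU => z E1 E2 [_ _ E3].
    by rewrite E1 mx_fun_tr E2 E3.
  have g5 : \forall z \near (0 : V), mx_fun (B *m W) z = A z *m U z.
    apply: filterS3 h8 (mx_germK sA) vU => z E1 E2 [_ _ E3].
    by rewrite E1 E2 E3.
  by apply: filterS2 g1 (filterI g3 (filterI g4 g5)) => z -> [-> [-> ->]].
split.
  move=> [a [b [W E]]].
  exists (fun z => \row_j germ_fun (if j == ix then a else b) z), (mx_fun W).
  have sv : smooth_germ (fun z => \row_j germ_fun (if j == ix then a else b) z : V).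
    apply/smooth_germ_mxP => i j.
    rewrite (_ : (fun x => _) = germ_fun (if j == ix then a else b)).
      exact: germ_fun_smooth.
    by apply/funext => z; rewrite mxE.
  split; [exact: sv|exact: mx_fun_smooth|].
  have h : \forall z \near (0 : V), [/\ germ_fun a z = (\row_j germ_fun (if j == ix then a else b) z : V) 0 ix,
      germ_fun b z = (\row_j germ_fun (if j == ix then a else b) z : V) 0 iy & mx_fun W z = mx_fun W z].
    by apply: filterE => z; rewrite !mxE eqxx iyP.
  have := key _ _ _ _ _ h; rewrite -E => hE.
  by apply: filterS2 (mx_germK sF) hE => z <-.
move=> [v [U [sv sU E]]].
exists (to_germ (fun z => v z 0 ix)), (to_germ (fun z => v z 0 iy)), (mx_germ U).
have svi j : smooth_germ (fun z => v z 0 j) by exact: (smooth_germ_mxP v).1.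
have h : \forall z \near (0 : V), [/\ germ_fun (to_germ (fun z => v z 0 ix)) z = v z 0 ix,
    germ_fun (to_germ (fun z => v z 0 iy)) z = v z 0 iy & mx_fun (mx_germ U) z = U z].
  apply: filterS3 (to_germK (svi ix)) (to_germK (svi iy)) (mx_germK sU) => z E1 E2 E3.
  by split.
rewrite -[RHS](mx_funK); apply/(mx_germ_inj sF (mx_fun_smooth _)).
by apply: filterS2 E (key _ _ _ _ _ h) => z -> ->.
Qed.
End Bridge.

Lemma scaler_sumNl (K : pzRingType) (W : lmodType K) d (c : 'I_d -> K) (B : 'I_d -> W) :
  \sum_i - c i *: B i = - \sum_i c i *: B i.
Proof. by rewrite -sumrN; apply: eq_bigr => i _; rewrite scaleNr. Qed.

Lemma gcomb_opp (R : realType) (T : germ_theory R) d (c : 'I_d -> R) (B : 'I_d -> 'M[T]_3) :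
  - \sum_i gcst T (c i) *: B i = \sum_i gcst T (- c i) *: B i.
Proof.
by rewrite -scaler_sumNl; apply: eq_bigr => i _; rewrite rmorphN.
Qed.

Section Bridge.
Context {R : realType}.
Local Notation V := 'rV[R]_2.
Local Notation T0 := (smooth_theory R).
Local Notation S := (germ R).
Local Notation M3 := 'M[S]_3.

Lemma mx_fun_sum (I : Type) (s : seq I) (c : I -> R) (B : I -> M3) :
  \forall z \near (0 : V), mx_fun (\sum_(i <- s) germ_const (c i) *: B i) z =
    \sum_(i <- s) c i *: mx_fun (B i) z.
Proof.
elim: s => [|i s IH].
  rewrite !big_nil; have h := mx_funZ (0 : S) (0 : M3); rewrite scale0r in h.
  apply: filterS2 h (germ_fun_cst (0 : R)) => z E1 E2.
  by rewrite big_nil E1 (etrans (f_equal (fun k => k *: _) E2) (scale0r _)).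
rewrite big_cons.
apply: filterS3 (filterI IH (germ_fun_cst (c i))) (mx_funZ (germ_const (c i)) (B i))
  (mx_funD (germ_const (c i) *: B i) (\sum_(j <- s) germ_const (c j) *: B j)) => z [E1 E2] E3 E4.
rewrite big_cons E4 E1 E3; congr (_ + _); exact: (f_equal (fun k => k *: _) E2).
Qed.

Lemma mx_fun_comb d (M : M3) (c : 'I_d -> R) (B : 'I_d -> M3) :
  \forall z \near (0 : V), mx_fun (M - \sum_i germ_const (c i) *: B i) z =
    mx_fun M z - \sum_i c i *: mx_fun (B i) z.
Proof.
have -> : M - \sum_i germ_const (c i) *: B i = M + \sum_i germ_const (- c i) *: B i.
  by congr (_ + _); exact: (@gcomb_opp R T0 d c B).
apply: filterS2 (mx_funD M (\sum_i germ_const (- c i) *: B i))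
  (mx_fun_sum (index_enum 'I_d) (fun i => - c i) B) => z E1 E2.
rewrite E1 E2; congr (_ + _); exact: scaler_sumNl.
Qed.

Lemma smooth_mx_ext m n (F G : V -> 'M[R]_(m, n)) :
  (\forall z \near (0 : V), F z = G z) -> smooth_germ F -> smooth_germ G.
Proof.
move=> FG /smooth_germ_mxP sF; apply/smooth_germ_mxP => i j.
by apply: smooth_germ_ext (sF i j); apply: filterS FG => z ->.
Qed.

Lemma mx_germ_comb d (F : V -> 'M[R]_3) (c : 'I_d -> R) (b : 'I_d -> V -> 'M[R]_3) :
  smooth_germ F -> (forall i, smooth_germ (b i)) ->
  smooth_germ (F - \sum_i c i *: b i) /\
  mx_germ (F - \sum_i c i *: b i) = mx_germ F - \sum_i germ_const (c i) *: mx_germ (b i).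
Proof.
move=> sF sb; set M := RHS.
have hb : \forall z \near (0 : V), forall i, mx_fun (mx_germ (b i)) z = b i z.
  apply: (@filter_forall _ _ (fun (i : 'I_d) z => mx_fun (mx_germ (b i)) z = b i z)
    (nbhs (0 : V)) _) => i; exact: mx_germK (sb i).
have h : \forall z \near (0 : V), mx_fun M z = (F - \sum_i c i *: b i) z.
  apply: filterS3 (mx_fun_comb (mx_germ F) c (fun i => mx_germ (b i))) (mx_germK sF) hb.
  move=> z E1 E2 E3; rewrite /M E1 E2 fctE; congr (_ + _).
  rewrite fctE fct_sumE; congr (- _); apply: eq_bigr => i _; rewrite E3.
  by [].
have sG : smooth_germ (F - \sum_i c i *: b i).
  exact: smooth_mx_ext h (mx_fun_smooth M).
split; first exact: sG.
rewrite -[RHS]mx_funK; apply/(mx_germ_inj sG (mx_fun_smooth M)).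
by apply: filterS h => z ->.
Qed.

Lemma sym_germP (F : V -> 'M[R]_3) : smooth_germ F ->
  sym_germ F <-> @gsym R T0 (mx_germ F).
Proof.
move=> sF.
have sFt : smooth_germ (fun z => (F z)^T).
  apply/smooth_germ_mxP => i j.
  rewrite (_ : (fun z => (F z)^T i j) = fun z => F z j i); first exact: (smooth_germ_mxP F).1.
  by apply/funext => z; rewrite mxE.
have E : (mx_germ F)^T = mx_germ (fun z => (F z)^T).
  by apply/matrixP => i j; rewrite !mxE; congr to_germ; apply/funext => z; rewrite mxE.
rewrite /gsym E; split.
  by move=> [_ h]; apply/(mx_germ_inj sFt sF).
by move=> /(mx_germ_inj sFt sF) h; split.
Qed.

Lemma codim_gspan (A : V -> 'M[R]_3) d : sym_germ A -> has_Ge_codim A d ->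
  @gspan R T0 (mx_germ A) d.
Proof.
move=> [sA _] [b [bE _ bP]].
have sb i : smooth_germ (b i) by case: (bE i).
exists (fun i => mx_germ (b i)); split=> [i|F sF]; first exact: (sym_germP (sb i)).1.
have sF' := mx_fun_smooth F.
have [c cP] := bP (mx_fun F) ((sym_germP sF').2 (eq_ind_r (@gsym R T0) sF (mx_funK F))).
exists c; have [sG EG] := mx_germ_comb c sF' sb.
rewrite mx_funK in EG.
by have := (gtangP sA sG).2 cP; rewrite EG.
Qed.

Lemma gcodim_codim (N : V -> 'M[R]_3) d : smooth_germ N ->
  @gcodim R T0 (mx_germ N) d -> has_Ge_codim N d.
Proof.
move=> sN [b [bE bI bP]].
have sb i := mx_fun_smooth (b i).
exists (fun i => mx_fun (b i)); split=> [i|c|F FE].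
- by apply/(sym_germP (sb i)); rewrite mx_funK; exact: bE.
- move=> cT; apply: bI.
  have s0 : smooth_germ (fun _ : V => 0 : 'M[R]_3).
    by apply/smooth_germ_mxP => i j; exact: smooth_germ_cst.
  have [sG EG] := mx_germ_comb (fun i => - c i) s0 sb.
  have E0 : (fun _ : V => 0 : 'M[R]_3) - \sum_i (- c i) *: mx_fun (b i) =
      \sum_i c i *: mx_fun (b i).
    by rewrite scaler_sumNl opprK; exact: add0r.
  rewrite E0 in sG EG.
  have := (gtangP sN sG).2 cT; rewrite EG.
  congr (gtang _ _).
  have -> : mx_germ (fun _ : V => 0 : 'M[R]_3) = 0.
    by apply/matrixP => i j; rewrite !mxE.
  rewrite sub0r; apply: (etrans (@gcomb_opp R T0 d _ _)).
  by apply: eq_bigr => i _; rewrite mx_funK opprK.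
have [sF sF'] := FE.
have [c cP] := bP (mx_germ F) ((sym_germP sF).1 FE).
exists c; have [sG EG] := mx_germ_comb c sF sb.
apply/(gtangP sN sG); rewrite EG.
move: cP; congr (gtang _ (_ - _)); apply: eq_bigr => i _.
by rewrite mx_funK.
Qed.
End Bridge.

Lemma gmap0 (R : realType) (T : germ_theory R) (d : T -> T) (M : 'M[T]_3) :
  (forall i j, gev T (d (M i j)) = 0) -> map_mx (gev T) (map_mx d M) = 0.
Proof. by move=> d0; apply/matrixP => i j; rewrite !mxE. Qed.

Section Bridge.
Context {R : realType}.
Local Notation V := 'rV[R]_2.
Local Notation T0 := (smooth_theory R).
Local Notation S := (germ R).
Local Notation M3 := 'M[S]_3.

Lemma mx_fun1 n : \forall z \near (0 : V), mx_fun (1%:M : 'M[S]_n) z = 1%:M.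
Proof.
apply: near_mx => i j; rewrite /mx_fun.
have E : (1%:M : 'M[S]_n) i j = (if i == j then 1 else 0 : S) by rewrite mxE; case: (i == j).
have h : germ_eq (germ_fun (if i == j then 1 else 0 : S)) (cst (if i == j then 1 else 0)).
  by case: (i == j); [exact: (germ_fun_cst (1 : R))|exact: (germ_fun_cst (0 : R))].
apply: filterS h => z hz; rewrite mxE E hz mxE.
by case: (i == j).
Qed.

Lemma map_fun_inv (p q : germ_map R) : (forall j, pullback p (q j) = germ_coord j) ->
  \forall z \near (0 : V), map_fun q (map_fun p z) = z.
Proof.
move=> pq.
have h j : \forall z \near (0 : V), germ_fun (q j) (map_fun p z) = z 0 j.
  have := germ_fun_pullback p (q j); rewrite pq => E1.
  have E2 := to_germK (smooth_germ_coord (R := R) j).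
  by apply: filterS2 E1 E2 => z e1 e2; rewrite -e2 e1.
apply: filterS2 (h ix) (h iy) => z E1 E2; apply/rowP; apply: forall_ord2;
  by rewrite mxE.
Qed.

Lemma map_fun_smooth_mx (p : germ_map R) : smooth_germ (map_fun p : V -> V).
Proof.
apply/smooth_germ_mxP => i j.
rewrite (_ : (fun z => _) = fun z => map_fun p z 0 j); first exact: map_fun_smooth.
by apply/funext => z; rewrite (ord1 i).
Qed.

Lemma gequiv_G_equivalent (A B : V -> 'M[R]_3) : smooth_germ A -> smooth_germ B ->
  @gequiv R T0 (mx_germ A) (mx_germ B) -> G_equivalent A B.
Proof.
move=> sA sB [u [v [X [[u0 v0] J uX E]]]].
have [Eu Ev] := mk_mapE u0 v0.
have jE := germ_jac2 (mk_map u v); rewrite Eu Ev in jE.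
have {jE} : germ_jac (mk_map u v) \in unitmx by rewrite jE; exact: J.
move=> /germ_map_inverse[q [pq qp]].
have [Y [XY _ _]] := gmx_inv uX.
exists (map_fun (mk_map u v)), (mx_fun X); split.
- split; [exact: map_fun_smooth_mx|exact: map_fun0|].
  exists (map_fun q); split; [exact: map_fun_smooth_mx|exact: map_fun0| |].
    exact: map_fun_inv.
  exact: map_fun_inv.
- split; first exact: mx_fun_smooth.
  have h := mx_fun_mul X Y; rewrite XY in h.
  apply: filterS2 h (mx_fun1 3) => z E1 E2; rewrite E2 in E1.
  by have [] := mulmx1_unit (esym E1).
have h1 := mx_fun_mul (X^T *m map_mx (pullback (mk_map u v)) (mx_germ A)) X.
have h2 := mx_fun_mul X^T (map_mx (pullback (mk_map u v)) (mx_germ A)).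
have h3 := mx_fun_pullback (mk_map u v) (mx_germ A).
have h4 : \forall z \near (0 : V), mx_fun (mx_germ A) (map_fun (mk_map u v) z) =
    A (map_fun (mk_map u v) z).
  exact: (near_map_fun (mk_map u v) (mx_germK sA)).
have h5 := mx_germK sB; rewrite E in h5.
have h6 : \forall z \near (0 : V), mx_fun (map_mx (pullback (mk_map u v)) (mx_germ A)) z =
    A (map_fun (mk_map u v) z).
  by apply: filterS2 h3 h4 => z -> ->.
have h7 : \forall z \near (0 : V), mx_fun (X^T *m map_mx (pullback (mk_map u v)) (mx_germ A)) z =
    (mx_fun X z)^T *m A (map_fun (mk_map u v) z).
  by apply: filterS2 h2 h6 => z -> ->; rewrite mx_fun_tr.
by apply: filterS3 h5 h1 h7 => z <- -> ->.
Qed.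

Lemma mx_fun_diff0 (A : V -> 'M[R]_3) : smooth_germ A -> forall v,
  'd A (0 : V) v =
    v 0 ix *: map_mx (gev T0) (map_mx (@gdx R T0) (mx_germ A)) +
    v 0 iy *: map_mx (gev T0) (map_mx (@gdy R T0) (mx_germ A)).
Proof.
move=> sA v; have /nbhs_singleton/(_ v) -> := mx_fun_diff sA erefl.
by congr (_ *: _ + _ *: _); apply/matrixP => i j; rewrite !mxE.
Qed.

Lemma corank_nonzero (A : V -> 'M[R]_3) : smooth_germ A -> (corank A <= 1)%N ->
  ~ (forall i j, gev T0 (@gdx R T0 (mx_germ A i j)) = 0 /\ gev T0 (@gdy R T0 (mx_germ A i j)) = 0).
Proof.
move=> sA cA d0; move: cA; rewrite /corank.
suff -> : lin_mx ('d A (0 : V)) = 0 by rewrite mxrank0.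
apply/matrixP => i j; rewrite mxE [RHS]mxE /= (mx_fun_diff0 sA).
rewrite (_ : _ + _ = 0) ?mxE ?linear0 ?mxE //; last first.
have Zx := @gmap0 R T0 _ (mx_germ A) (fun a b => (d0 a b).1).
have Zy := @gmap0 R T0 _ (mx_germ A) (fun a b => (d0 a b).2).
have E c1 c2 (M N : 'M[R]_3) : M = 0 -> N = 0 -> c1 *: M + c2 *: N = 0.
  by move=> -> ->; rewrite !scaler0 addr0.
exact: E Zx Zy.
Qed.

Lemma corank0 (A : V -> 'M[R]_3) : smooth_germ A ->
  (forall a b, a *: map_mx (gev T0) (map_mx (@gdx R T0) (mx_germ A)) +
    b *: map_mx (gev T0) (map_mx (@gdy R T0) (mx_germ A)) = 0 -> a = 0 /\ b = 0) ->
  corank A = 0%N.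
Proof.
move=> sA inj; rewrite /corank; suff /eqP -> : row_free (lin_mx ('d A (0 : V))) by [].
apply: inj_row_free => w w0; have := mul_vec_lin ('d A (0 : V)) (vec_mx w).
rewrite vec_mxK w0 => /esym/(canRL mxvecK); rewrite linear0 (mx_fun_diff0 sA) => /inj[e1 e2].
apply: (can_inj vec_mxK); rewrite linear0; apply/rowP; apply: forall_ord2; by rewrite [RHS]mxE.
Qed.
End Bridge.

(** * Normal forms *)

(** The arguments are the upper triangle read by rows: entries 11, 12, 13, 22, 23, 33. *)
Definition sym3 (K : Type) (a b c d e f : K) : 'M[K]_3 :=
  \matrix_(i, j) nth a (nth [::] [:: [:: a; b; c]; [:: b; d; e]; [:: c; e; f]] i) j.

Definition o0 : 'I_3 := @Ordinal 3 0 isT.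
Definition o1 : 'I_3 := @Ordinal 3 1 isT.
Definition o2 : 'I_3 := @Ordinal 3 2 isT.

Lemma forall_ord3 (P : 'I_3 -> Prop) : P o0 -> P o1 -> P o2 -> forall i, P i.
Proof.
move=> P0 P1 P2 [[|[|[|//]]] h]; [move: P0|move: P1|move: P2];
  by congr P; apply/val_inj.
Qed.

Lemma sum_ord3 (K : nmodType) (f : 'I_3 -> K) : \sum_i f i = f o0 + f o1 + f o2.
Proof.
rewrite !big_ord_recl big_ord0 addr0 addrA.
by congr (f _ + f _ + f _); apply/val_inj.
Qed.

Lemma sym3E (K : Type) (a b c d e f : K) : let M := sym3 a b c d e f in
  (((M o0 o0 = a) * (M o0 o1 = b) * (M o0 o2 = c) * (M o1 o0 = b) * (M o1 o1 = d)) *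
  ((M o1 o2 = e) * (M o2 o0 = c) * (M o2 o1 = e) * (M o2 o2 = f)))%type.
Proof. by rewrite /= !mxE. Qed.

Lemma sym3_tr (K : Type) (a b c d e f : K) : (sym3 a b c d e f)^T = sym3 a b c d e f.
Proof. by apply/matrixP; apply: forall_ord3; apply: forall_ord3; rewrite mxE !sym3E. Qed.

Lemma symP (K : Type) (M : 'M[K]_3) : M^T = M ->
  M = sym3 (M o0 o0) (M o0 o1) (M o0 o2) (M o1 o1) (M o1 o2) (M o2 o2).
Proof.
move=> sM; have E i j : M i j = M j i by rewrite -[in LHS]sM mxE.
by apply/matrixP; apply: forall_ord3; apply: forall_ord3; rewrite !sym3E.
Qed.

Lemma map_sym3 (K L : Type) (g : K -> L) a b c d e f :
  map_mx g (sym3 a b c d e f) = sym3 (g a) (g b) (g c) (g d) (g e) (g f).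
Proof. by apply/matrixP; apply: forall_ord3; apply: forall_ord3; rewrite mxE !sym3E. Qed.

Lemma sym3D (K : nmodType) (a b c d e f a' b' c' d' e' f' : K) :
  sym3 a b c d e f + sym3 a' b' c' d' e' f' =
  sym3 (a + a') (b + b') (c + c') (d + d') (e + e') (f + f').
Proof. by apply/matrixP; apply: forall_ord3; apply: forall_ord3; rewrite mxE !sym3E. Qed.

Lemma sym3Z (K : pzRingType) (k a b c d e f : K) :
  k *: sym3 a b c d e f = sym3 (k * a) (k * b) (k * c) (k * d) (k * e) (k * f).
Proof. by apply/matrixP; apply: forall_ord3; apply: forall_ord3; rewrite mxE !sym3E. Qed.

Lemma sym3_inj (K : Type) (a b c d e f a' b' c' d' e' f' : K) :
  sym3 a b c d e f = sym3 a' b' c' d' e' f' ->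
  (a = a' /\ b = b' /\ c = c') /\ (d = d' /\ e = e' /\ f = f').
Proof.
move=> /matrixP E; have := (E o0 o0, E o0 o1, E o0 o2, E o1 o1, E o1 o2, E o2 o2).
by rewrite !sym3E => -[[[[[-> ->] ->] ->] ->] ->].
Qed.

Inductive gnormal (R : realType) (T : germ_theory R) : 'M[T]_3 -> nat -> Prop :=
| GNF1 : gnormal (sym3 (gX T) 0 0 (gY T) 0 (gX T - gY T)) 4
| GNF2 (s : bool) : gnormal (sym3 (gX T) 0 0 (gY T) 0 ((-1) ^+ s * (gX T + gY T))) 4
| GNF3 (s : bool) : gnormal (sym3 ((-1) ^+ s * gX T) 0 0 (gX T) (gY T) (- gX T)) 4
| GNF4 (s1 s2 : bool) l1 l2 : (l2 <= l1)%N -> (1 <= l2)%N -> (2 <= l1)%N ->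
    gnormal (sym3 ((-1) ^+ s1 * gY T ^+ l1) (gX T) 0 ((-1) ^+ s2 * gY T ^+ l2) 0 (gY T))
      (l1 + l2 + 2)
| GNF5 l : (2 <= l)%N -> gnormal (sym3 (gX T) (gY T ^+ l) 0 (gX T) 0 (gY T)) (2 * l + 2)
| GNF6 (s : bool) : gnormal (sym3 0 (gY T) (gX T) (gX T) 0 ((-1) ^+ s * gY T ^+ 2)) 6
| GNF7 : gnormal (sym3 0 (gY T) (gX T) (gX T) 0 (gX T * gY T)) 7
| GNF8 (s : bool) : gnormal (sym3 (gY T) (gX T) 0 ((-1) ^+ s * gY T ^+ 2) 0 (gX T)) 7
| GNF9 : gnormal (sym3 0 (gY T) (gX T) (gX T) 0 (gY T ^+ 3)) 8
| GNF10 : gnormal (sym3 (gY T) (gX T) 0 0 (gY T ^+ 2) (gX T)) 8.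

Section NormalForms.
Context {R : realType}.
Local Notation V := 'rV[R]_2.
Local Notation T0 := (smooth_theory R).
Local Notation S := (germ R).
Implicit Types (a b : S) (f g : V -> R).

Definition represents a f := germ_eq (germ_fun a) f.

Lemma representsD a b f g : represents a f -> represents b g ->
  represents (a + b) (fun z => f z + g z).
Proof. by move=> af bg; apply: filterS3 (germ_funD a b) af bg => z -> /= <- <-. Qed.
Lemma representsM a b f g : represents a f -> represents b g ->
  represents (a * b) (fun z => f z * g z).
Proof. by move=> af bg; apply: filterS3 (germ_funM a b) af bg => z -> /= <- <-. Qed.
Lemma representsN a f : represents a f -> represents (- a) (fun z => - f z).
Proof. by move=> af; apply: filterS2 (germ_funN a) af => z -> /= <-. Qed.
Lemma represents0 : represents 0 (fun=> 0).
Proof. exact: germ_fun_cst (0 : R). Qed.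
Lemma represents1 : represents 1 (fun=> 1).
Proof. exact: germ_fun_cst (1 : R). Qed.
Lemma representsX n a f : represents a f -> represents (a ^+ n) (fun z => f z ^+ n).
Proof.
move=> af; elim: n => [|n IH].
  by rewrite expr0; apply: filterS represents1 => z ->; rewrite expr0.
by rewrite exprS; apply: filterS (representsM af IH) => z ->; rewrite exprS.
Qed.
Lemma representsx : represents (gX T0) (fun z => z 0 0).
Proof. exact: to_germK (smooth_germ_coord (R := R) ix). Qed.
Lemma representsy : represents (gY T0) (fun z => z 0 1).
Proof. exact: to_germK (smooth_germ_coord (R := R) iy). Qed.
Lemma representsS (s : bool) a f : represents a f ->
  represents ((-1) ^+ s * a) (fun z => (-1) ^+ s * f z).
Proof.
exact: representsM (representsX s (representsN represents1)).
Qed.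

Lemma mx3_represents (rows : R -> R -> seq (seq R)) a b c d e (f : S) fa fb fc fd fe ff :
  represents a fa -> represents b fb -> represents c fc ->
  represents d fd -> represents e fe -> represents f ff ->
  (forall z : V, rows (z 0 0) (z 0 1) =
    [:: [:: fa z; fb z; fc z]; [:: fb z; fd z; fe z]; [:: fc z; fe z; ff z]]) ->
  smooth_germ (mx3_of_rows rows) /\ mx_germ (mx3_of_rows rows) = sym3 a b c d e f.
Proof.
move=> ha hb hc hd he hf E.
have h : \forall z \near (0 : V), mx_fun (sym3 a b c d e f) z = mx3_of_rows rows z.
  apply: filterS3 (filterI ha hb) (filterI hc hd) (filterI he hf).
  move=> z [Ea Eb] [Ec Ed] [Ee Ef]; apply/matrixP => i j.
  rewrite !mxE E.
  by case: i => [[|[|[|]]]] // ?; case: j => [[|[|[|]]]] // ?.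
have sN := smooth_mx_ext h (mx_fun_smooth _).
split; first exact: sN.
rewrite -[RHS]mx_funK; apply/(mx_germ_inj sN (mx_fun_smooth _)).
by apply: filterS h => z ->.
Qed.

Local Ltac rep := lazymatch goal with
  | |- represents 0 _ => refine represents0
  | |- represents (gX _) _ => refine representsx
  | |- represents (gY _) _ => refine representsy
  | |- represents ((-1) ^+ _ * _) _ => refine (representsS _ _); rep
  | |- represents (_ ^+ _) _ => refine (representsX _ _); rep
  | |- represents (- _) _ => refine (representsN _); rep
  | |- represents (_ + _) _ => refine (representsD _ _); rep
  | |- represents (_ * _) _ => refine (representsM _ _); rep
  end.
Local Ltac bridge := refine (mx3_represents _ _ _ _ _ _ _); [rep|rep|rep|rep|rep|rep|move=> z; reflexivity].

Lemma normal_form_gnormal (N : V -> 'M[R]_3) c : normal_form N c ->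
  smooth_germ N /\ gnormal (T := T0) (mx_germ N) c.
Proof.
have key N' M c' : gnormal (T := T0) M c' -> smooth_germ N' /\ mx_germ N' = M ->
    smooth_germ N' /\ gnormal (T := T0) (mx_germ N') c'.
  by move=> h [sN ->].
case.
- by apply: key (GNF1 T0) _; bridge.
- by move=> s; apply: key (GNF2 T0 s) _; bridge.
- by move=> s; apply: key (GNF3 T0 s) _; bridge.
- by move=> s1 s2 l1 l2 h1 h2 h3; apply: key (GNF4 T0 s1 s2 h1 h2 h3) _; bridge.
- by move=> l h; apply: key (GNF5 T0 h) _; bridge.
- by move=> s; apply: key (GNF6 T0 s) _; bridge.
- by apply: key (GNF7 T0) _; bridge.
- by move=> s; apply: key (GNF8 T0 s) _; bridge.
- by apply: key (GNF9 T0) _; bridge.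
- by apply: key (GNF10 T0) _; bridge.
Qed.

Lemma gnormal_normal_form M c : gnormal (T := T0) M c ->
  exists N : V -> 'M[R]_3, [/\ normal_form N c, smooth_germ N & mx_germ N = M].
Proof.
have key N' M' c' : normal_form N' c' -> smooth_germ N' /\ mx_germ N' = M' ->
    exists N : V -> 'M[R]_3, [/\ normal_form N c', smooth_germ N & mx_germ N = M'].
  by move=> h [sN E]; exists N'.
case.
- by apply: key (NF1 R) _; bridge.
- by move=> s; apply: key (NF2 R s) _; bridge.
- by move=> s; apply: key (NF3 R s) _; bridge.
- by move=> s1 s2 l1 l2 h1 h2 h3; apply: key (NF4 R s1 s2 h1 h2 h3) _; bridge.
- by move=> l h; apply: key (NF5 R h) _; bridge.
- by move=> s; apply: key (NF6 R s) _; bridge.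
- by apply: key (NF7 R) _; bridge.
- by move=> s; apply: key (NF8 R s) _; bridge.
- by apply: key (NF9 R) _; bridge.
- by apply: key (NF10 R) _; bridge.
Qed.
End NormalForms.

(** * Weighted finite determinacy *)

Section PolymapContinuity.
Context {R : realType} {m : nat}.

Lemma pideal_sum (S : comNzRingType) e (I : Type) (s : seq I) (f : I -> ('I_m -> S) -> S) :
  (forall i, pideal e (f i)) -> pideal e (fun p => \sum_(i <- s) f i p).
Proof.
move=> fi; elim: s => [|i s IH].
  by rewrite (_ : (fun p => _) = fun=> 0); [exact: pideal0|apply/funext => p; rewrite big_nil].
rewrite (_ : (fun p => _) = fun p => f i p + \sum_(i <- s) f i p); first exact: pideal_add.
by apply/funext => p; rewrite big_cons.
Qed.

Lemma pideal_prod (S : comNzRingType) (I : Type) (s : seq I) (f : I -> ('I_m -> S) -> S) :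
  (forall i, pideal 0 (f i)) -> pideal 0 (fun p => \prod_(i <- s) f i p).
Proof.
move=> fi; elim: s => [|i s IH].
  rewrite (_ : (fun p => _) = fun=> 1); first exact: pideal_cst.
  by apply/funext => p; rewrite big_nil.
rewrite (_ : (fun p => _) = fun p => f i p * \prod_(i <- s) f i p).
  exact: (@pideal_mul _ _ 0 0).
by apply/funext => p; rewrite big_cons.
Qed.

Lemma pideal_det (S : comNzRingType) n (M : ('I_m -> S) -> 'M[S]_n) :
  (forall i j, pideal 0 (fun p => M p i j)) -> pideal 0 (fun p => \det (M p)).
Proof.
move=> Mij; rewrite /determinant; apply: pideal_sum => s.
apply: (@pideal_mul _ _ 0 0); first exact: pideal_cst.
by apply: pideal_prod => i.
Qed.

Lemma pideal_small (f : ('I_m -> R) -> R) e : pideal e f -> forall c, 0 < c ->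
  exists eps, 0 < eps /\ forall p, (forall k, `|p k| < eps) -> `|f p - f (fun=> 0)| < c.
Proof.
elim=> {e f} [a|e|k|e f g _ IHf _ IHg|d e f g _ IHf _ IHg|d e f _ _ IH] c c0.
- by exists 1; split=> // p _; rewrite subrr normr0.
- by exists 1; split=> // p _; rewrite subrr normr0.
- by exists c; split=> // p; rewrite subr0.
- have c2 : 0 < c / 2 by rewrite divr_gt0.
  have [u [u0 uP]] := IHf _ c2; have [v [v0 vP]] := IHg _ c2.
  exists (Num.min u v); split=> [|p pP]; first by rewrite lt_min u0.
  have hf : `|f p - f (fun=> 0)| < c / 2.
    by apply: uP => k; have := pP k; rewrite lt_min => /andP[].
  have hg : `|g p - g (fun=> 0)| < c / 2.
    by apply: vP => k; have := pP k; rewrite lt_min => /andP[].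
  have -> : f p + g p - (f (fun=> 0) + g (fun=> 0)) =
    (f p - f (fun=> 0)) + (g p - g (fun=> 0)) by ring.
  by apply: le_lt_trans (ler_normD _ _) _; rewrite [ltRHS]splitr ltrD.
- set f0 := f (fun=> 0); set g0 := g (fun=> 0).
  pose K := `|f0| + `|g0| + 1.
  have K0 : 0 < K by rewrite /K ltr_wpDl // addr_ge0.
  pose c' := Num.min 1 (c / (2 * K)).
  have c'0 : 0 < c' by rewrite /c' lt_min ltr01 divr_gt0 // mulr_gt0.
  have [u [u0 uP]] := IHf _ c'0; have [v [v0 vP]] := IHg _ c'0.
  exists (Num.min u v); split=> [|p pP]; first by rewrite lt_min u0.
  have hf : `|f p - f0| < c'.
    by apply: uP => k; have := pP k; rewrite lt_min => /andP[].
  have hg : `|g p - g0| < c'.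
    by apply: vP => k; have := pP k; rewrite lt_min => /andP[].
  have -> : f p * g p - f0 * g0 = (f p - f0) * (g p - g0) + (f p - f0) * g0 + f0 * (g p - g0).
    by ring.
  have h1 : `|(f p - f0) * (g p - g0) + (f p - f0) * g0 + f0 * (g p - g0)| <=
      c' * (1 + `|g0| + `|f0|).
    have e1 : `|(f p - f0) * (g p - g0)| <= c' * 1.
      rewrite normrM; apply: ler_pM; rewrite ?normr_ge0 ?(ltW hf) //.
      by apply: ltW; apply: lt_le_trans hg _; rewrite /c' ge_min lexx.
    have e2 : `|(f p - f0) * g0| <= c' * `|g0|.
      by rewrite normrM; apply: ler_wpM2r; rewrite ?normr_ge0 ?(ltW hf).
    have e3 : `|f0 * (g p - g0)| <= c' * `|f0|.
      by rewrite normrM mulrC; apply: ler_wpM2r; rewrite ?normr_ge0 ?(ltW hg).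
    rewrite [leRHS]mulrDr [X in _ <= X + _]mulrDr.
    apply: le_trans (ler_normD _ _) _; apply: (lerD _ e3).
    by apply: le_trans (ler_normD _ _) _; apply: lerD.
  apply: le_lt_trans h1 _.
  have -> : 1 + `|g0| + `|f0| = K by rewrite /K; ring.
  apply: (@le_lt_trans _ _ (c / (2 * K) * K)).
    by apply: ler_wpM2r; [exact: ltW|rewrite /c' ge_min lexx orbT].
  by rewrite invfM mulrA mulfVK ?gt_eqF // ltr_pdivrMr // ltr_pMr // ltr1n.
by have [u [u0 uP]] := IH _ c0; exists u.
Qed.

(** Applied to the Jacobian of a substitution and to the determinant of a congruence: at the origin
    both are polynomials in the values p(0), equal to 1 when these vanish. *)
Lemma pideal_nonzero (f : ('I_m -> R) -> R) e : pideal e f -> f (fun=> 0) != 0 ->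
  exists eps, 0 < eps /\ forall p, (forall k, `|p k| < eps) -> f p != 0.
Proof.
move=> fe f0; have f0' : 0 < `|f (fun=> 0)| by rewrite normr_gt0.
have [u [u0 uP]] := pideal_small fe f0'; exists u; split=> // p /uP.
by apply: contraTneq => ->; rewrite sub0r normrN ltxx.
Qed.
End PolymapContinuity.

(** * The filtration by weighted order *)

Section Weights.
Context {R : realType} (T : germ_theory R).
Local Notation S := (gring T).
Local Notation ev := (gev T).
Local Notation C := (gcst T).
Local Notation dx := (@gdx R T).
Local Notation dy := (@gdy R T).
Local Notation x := (gX T).
Local Notation y := (gY T).
Variables wx wy : nat.

(** The ideal of germs of weighted order at least a. The coefficients c are arbitrary germs, so no
    Taylor series is involved. *)
Inductive wideal (a : nat) : S -> Prop :=
| wideal_mono i j c : (a <= i * wx + j * wy)%N -> wideal a (c * (x ^+ i * y ^+ j))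
| wideal_add c d : wideal a c -> wideal a d -> wideal a (c + d).

Hypotheses (wx0 : (0 < wx)%N) (wy0 : (0 < wy)%N).

Lemma wideal0 a : wideal a 0.
Proof.
rewrite -(mul0r (x ^+ a * y ^+ 0)); apply: wideal_mono; rewrite mul0n addn0.
exact: leq_pmulr.
Qed.

Lemma wideal_weak a b c : (a <= b)%N -> wideal b c -> wideal a c.
Proof.
move=> ab; elim=> [i j d bij|d d' _ IH _ IH']; last exact: wideal_add.
by apply: wideal_mono; exact: leq_trans bij.
Qed.

Lemma widealM a b c d : wideal a c -> wideal b d -> wideal (a + b) (c * d).
Proof.
move=> ac; elim=> {d} [i j d bij|d d' _ IH _ IH']; last by rewrite mulrDr; exact: wideal_add.
elim: ac => {c} [i' j' c aij|c c' _ IH _ IH']; last by rewrite mulrDl; exact: wideal_add.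
rewrite (_ : _ * _ = (c * d) * (x ^+ (i' + i) * y ^+ (j' + j))); last by rewrite !exprD; ring.
by apply: wideal_mono; rewrite !mulnDl addnACA leq_add.
Qed.

Lemma wideal_all c : wideal 0 c.
Proof. by rewrite -(mulr1 c) -(mulr1 1) -{1}(expr0 x) -(expr0 y); apply: wideal_mono. Qed.

Lemma widealMr a c d : wideal a c -> wideal a (c * d).
Proof. by move=> ac; have := widealM ac (wideal_all d); rewrite addn0. Qed.
Lemma widealMl a c d : wideal a c -> wideal a (d * c).
Proof. by rewrite mulrC; exact: widealMr. Qed.
Lemma widealN a c : wideal a c -> wideal a (- c).
Proof. by rewrite -mulN1r; exact: widealMl. Qed.

Lemma wideal_x : wideal wx x.
Proof.
rewrite (_ : x = 1 * (x ^+ 1 * y ^+ 0)); last by rewrite expr0 expr1; ring.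
by apply: wideal_mono; rewrite mul1n leq_addr.
Qed.
Lemma wideal_y : wideal wy y.
Proof.
rewrite (_ : y = 1 * (x ^+ 0 * y ^+ 1)); last by rewrite expr0 expr1; ring.
by apply: wideal_mono; rewrite mul1n leq_addl.
Qed.
Lemma widealX a c n : wideal a c -> wideal (n * a) (c ^+ n).
Proof.
move=> ac; elim: n => [|n IH]; first exact: wideal_all.
by rewrite exprS mulSn; exact: widealM.
Qed.

Lemma wideal_ev a c : (0 < a)%N -> wideal a c -> ev c = 0.
Proof.
move=> a0; elim=> {c} [[|i] [|j] c|c d _ IH _ IH'].
- by rewrite !mul0n leqNgt a0.
- by rewrite !rmorphM exprS rmorphM gevY /= mul0r !mulr0.
- by rewrite !rmorphM exprS rmorphM gevX /= !mul0r mulr0.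
- by rewrite !rmorphM exprS rmorphM gevX /= !mul0r mulr0.
- by rewrite rmorphD IH IH' addr0.
Qed.

Variable m : nat.
Local Notation P := ('I_m -> S).

(** Two gradings at once: order at least a in the weighted variables x, y and degree at least e in
    the unknown germs p. *)
Inductive wpoly (a e : nat) : (P -> S) -> Prop :=
| wpoly_mono i j q : (a <= i * wx + j * wy)%N -> pideal e q ->
    wpoly a e (fun p => q p * (x ^+ i * y ^+ j))
| wpoly_add f g : wpoly a e f -> wpoly a e g -> wpoly a e (fun p => f p + g p).

Lemma wpoly_ext a e f g : f =1 g -> wpoly a e f -> wpoly a e g.
Proof. by move=> /funext ->. Qed.

Lemma wpoly_weak a b d e f : (a <= b)%N -> (d <= e)%N -> wpoly b e f -> wpoly a d f.
Proof.
move=> ab de; elim=> [i j q bij qe|f' g _ IH _ IH']; last exact: wpoly_add.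
by apply: wpoly_mono; [exact: leq_trans bij|exact: pideal_weak de qe].
Qed.

Lemma wpolyM a b d e f g : wpoly a d f -> wpoly b e g ->
  wpoly (a + b) (d + e) (fun p => f p * g p).
Proof.
move=> af; elim=> {g} [i j q bij qe|g g' _ IH _ IH']; last first.
  by apply: wpoly_ext (wpoly_add IH IH') => p; rewrite mulrDr.
elim: af => {f} [i' j' q' aij qe'|f f' _ IH _ IH']; last first.
  by apply: wpoly_ext (wpoly_add IH IH') => p; rewrite mulrDl.
apply: (@wpoly_ext _ _ (fun p => (q' p * q p) * (x ^+ (i' + i) * y ^+ (j' + j)))).
  by move=> p; rewrite !exprD; ring.
by apply: wpoly_mono; [rewrite !mulnDl addnACA leq_add|exact: pideal_mul].
Qed.

Lemma wpoly_cst a c : wideal a c -> wpoly a 0 (fun=> c).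
Proof.
elim=> {c} [i j c aij|c d _ IH _ IH']; last exact: wpoly_add.
by apply: (@wpoly_mono a 0 i j (fun=> c)) => //; exact: pideal_cst.
Qed.

Lemma wpoly0 a e : wpoly a e (fun=> 0).
Proof.
apply: (@wpoly_ext _ _ (fun p => 0 * (x ^+ a * y ^+ 0))); first by move=> p; rewrite mul0r.
apply: wpoly_mono; last exact: pideal0.
by rewrite mul0n addn0 leq_pmulr.
Qed.

Lemma wpoly_var k : wpoly 0 1 (fun p => p k).
Proof.
apply: (@wpoly_ext _ _ (fun p => p k * (x ^+ 0 * y ^+ 0))).
  by move=> p; rewrite !expr0 !mulr1.
by apply: wpoly_mono => //; exact: pideal_var.
Qed.

Lemma wpoly_lin a (c : 'I_m -> S) : (forall k, wideal a (c k)) ->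
  wpoly a 1 (fun p => \sum_k p k * c k).
Proof.
move=> ac; have h (s : seq 'I_m) : wpoly a 1 (fun p => \sum_(k <- s) p k * c k).
  elim: s => [|k s IH].
    by apply: wpoly_ext (wpoly0 a 1) => p; rewrite big_nil.
  apply: (@wpoly_ext _ _ (fun p => p k * c k + \sum_(k <- s) p k * c k)).
    by move=> p; rewrite big_cons.
  by apply: wpoly_add IH; have := wpolyM (wpoly_var k) (wpoly_cst (ac k)).
exact: h.
Qed.

(** As the weights are positive, cutting the exponents i and j down to at most a keeps the weight at
    least a; the remaining powers go into the coefficient. Hence finitely many monomials
    generate. *)
Lemma wpoly_bounded a e f B : (a < B)%N -> wpoly a e f ->
  exists2 q : 'I_B * 'I_B -> P -> S, forall k, pideal e (q k) &
    forall p, f p = \sum_(k : 'I_B * 'I_B | (a <= k.1 * wx + k.2 * wy)%N) q k p * (x ^+ k.1 * y ^+ k.2).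
Proof.
move=> aB; elim=> {f} [i j q aij qe|f g _ [q qe qP] _ [q' qe' qP']]; last first.
  exists (fun k p => q k p + q' k p) => [k|p]; first exact: pideal_add.
  by rewrite qP qP' -big_split; apply: eq_bigr => k _; rewrite mulrDl.
have iB : (minn i a < B)%N by rewrite (leq_ltn_trans (geq_minr _ _)).
have jB : (minn j a < B)%N by rewrite (leq_ltn_trans (geq_minr _ _)).
pose k0 := (Ordinal iB, Ordinal jB).
exists (fun k p => if k == k0 then q p * (x ^+ (i - minn i a) * y ^+ (j - minn j a)) else 0) => [k|p].
  case: (k == k0); last exact: pideal0.
  by rewrite -[e]addn0; apply: pideal_mul qe _; exact: pideal_cst.
rewrite (bigD1 k0) /=; last first.
  have [ia|ia] := leqP i a; last by rewrite (leq_trans (leq_pmulr a wx0)) ?leq_addr.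
  have [ja|ja] := leqP j a; first by [].
  by rewrite (leq_trans (leq_pmulr a wy0)) ?leq_addl.
rewrite eqxx big1 => [|k /andP[_ /negPf ->]]; last by rewrite mul0r.
rewrite addr0 -mulrA; congr (_ * _).
by rewrite mulrACA -!exprD !subnK ?geq_minl.
Qed.
End Weights.

(** * First-order expansions with weights *)

Section Taylor.
Context {R : realType} (T : germ_theory R).
Local Notation S := (gring T).
Local Notation ev := (gev T).
Local Notation C := (gcst T).
Local Notation dx := (@gdx R T).
Local Notation dy := (@gdy R T).
Local Notation x := (gX T).
Local Notation y := (gY T).
Variables wx wy : nat.
Hypotheses (wx0 : (0 < wx)%N) (wy0 : (0 < wy)%N).
Variable m : nat.
Local Notation P := ('I_m -> S).
Local Notation wideal := (wideal (T := T) wx wy).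
Local Notation wpoly := (wpoly wx wy).

(* [taylor a b f c l]: f(p) = c + l(p) + O(p^2) where c has weight at least a and
   the other terms have weight at least b. *)
Definition taylor a b (f : P -> S) c (l : P -> S) :=
  [/\ wideal a c, wpoly b 1 l & wpoly b 2 (fun p => f p - c - l p)].

Lemma taylor_ext a b f f' c c' l l' : f =1 f' -> c = c' -> l =1 l' ->
  taylor a b f c l -> taylor a b f' c' l'.
Proof. by move=> /funext -> -> /funext ->. Qed.

Lemma taylorD a b f f' c c' l l' : taylor a b f c l -> taylor a b f' c' l' ->
  taylor a b (fun p => f p + f' p) (c + c') (fun p => l p + l' p).
Proof.
move=> [ac bl bf] [ac' bl' bf']; split; [exact: wideal_add|exact: wpoly_add|].
by apply: wpoly_ext (wpoly_add bf bf') => p; ring.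
Qed.

Lemma taylor_cst a b c : wideal a c -> taylor a b (fun=> c) c (fun=> 0).
Proof.
move=> ac; split=> //; first exact: wpoly0.
by apply: wpoly_ext (wpoly0 T wy wx0 m b 2) => p; ring.
Qed.

Lemma taylor_lin a b l : wpoly b 1 l -> taylor a b l 0 l.
Proof.
move=> bl; split=> //; first exact: wideal0.
by apply: wpoly_ext (wpoly0 T wy wx0 m b 2) => p; ring.
Qed.

Lemma taylorM a b a' b' g d f f' c c' l l' :
  (g <= a + a')%N -> (d <= a + b')%N -> (d <= b + a')%N -> (d <= b + b')%N ->
  taylor a b f c l -> taylor a' b' f' c' l' ->
  taylor g d (fun p => f p * f' p) (c * c') (fun p => c * l' p + l p * c').
Proof.
move=> h1 h2 h3 h4 [ac bl bf] [ac' bl' bf'].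
have cc := wpoly_cst m ac; have cc' := wpoly_cst m ac'.
split; first exact: wideal_weak h1 (widealM ac ac').
  apply: wpoly_add.
    exact: (wpoly_weak h2 _ (wpolyM cc bl')).
  exact: (wpoly_weak h3 _ (wpolyM bl cc')).
have e1 := wpoly_weak (e := 0 + 2) (d := 2) h2 isT (wpolyM cc bf').
have e2 := wpoly_weak (e := 2 + 0) (d := 2) h3 isT (wpolyM bf cc').
have e3 := wpoly_weak (e := 1 + 1) (d := 2) h4 isT (wpolyM bl bl').
have e4 := wpoly_weak (e := 1 + 2) (d := 2) h4 isT (wpolyM bl bf').
have e5 := wpoly_weak (e := 2 + 1) (d := 2) h4 isT (wpolyM bf bl').
have e6 := wpoly_weak (e := 2 + 2) (d := 2) h4 isT (wpolyM bf bf').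
apply: wpoly_ext (wpoly_add (wpoly_add (wpoly_add e1 e2) (wpoly_add e3 e4)) (wpoly_add e5 e6)).
by move=> p; ring.
Qed.

Lemma taylor_sum a b (I : Type) (s : seq I) (f : I -> P -> S) c l :
  (forall i, taylor a b (f i) (c i) (l i)) ->
  taylor a b (fun p => \sum_(i <- s) f i p) (\sum_(i <- s) c i) (fun p => \sum_(i <- s) l i p).
Proof.
move=> fi; elim: s => [|i s IH].
  apply: taylor_ext (taylor_cst b (wideal0 T wy wx0 a)) => [p||p]; by rewrite big_nil.
apply: taylor_ext (taylorD (fi i) IH) => [p||p]; by rewrite big_cons.
Qed.

(** Weighted homogeneous polynomials, kept as functions of two germs so that they can be evaluated
    at (x, y), at a displaced point, or after a substitution. *)
Inductive whpoly : nat -> (S -> S -> S) -> Prop :=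
| whpoly_x : whpoly wx (fun u v => u)
| whpoly_y : whpoly wy (fun u v => v)
| whpoly_c k : whpoly 0 (fun u v => C k)
| whpoly_0 a : whpoly a (fun u v => 0)
| whpoly_add a f g : whpoly a f -> whpoly a g -> whpoly a (fun u v => f u v + g u v)
| whpoly_mul a b f g : whpoly a f -> whpoly b g -> whpoly (a + b) (fun u v => f u v * g u v).

Lemma whpoly_subst a f u v : ev u = 0 -> ev v = 0 -> whpoly a f -> gsubst u v (f x y) = f u v.
Proof.
move=> u0 v0; elim=> {a f} [||k|a|a f g _ IHf _ IHg|a b f g _ IHf _ IHg].
- exact: gsubstX.
- exact: gsubstY.
- exact: gsubstC.
- exact: rmorph0.
- by rewrite rmorphD IHf IHg.
- by rewrite rmorphM IHf IHg.
Qed.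

Lemma whpolyX a f n : whpoly a f -> whpoly (n * a) (fun u v => f u v ^+ n).
Proof.
move=> af; elim: n => [|n IH].
  rewrite mul0n (_ : (fun u v => _) = fun u v => C 1); first exact: whpoly_c.
  by apply/funext => u; apply/funext => v; rewrite expr0 rmorph1.
rewrite mulSn (_ : (fun u v => _) = fun u v => f u v * f u v ^+ n); first exact: whpoly_mul.
by apply/funext => u; apply/funext => v; rewrite exprS.
Qed.

Lemma whpolyN a f : whpoly a f -> whpoly a (fun u v => - f u v).
Proof.
move=> af; rewrite (_ : (fun u v => _) = fun u v => C (-1) * f u v).
  by rewrite -[a]add0n; apply: whpoly_mul af; exact: whpoly_c.
by apply/funext => u; apply/funext => v; rewrite rmorphN rmorph1 mulN1r.
Qed.

Lemma whpoly_sign a f (s : bool) : whpoly a f -> whpoly a (fun u v => (-1) ^+ s * f u v).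
Proof.
move=> af; rewrite (_ : (fun u v => _) = fun u v => C ((-1) ^+ s) * f u v).
  by rewrite -[a]add0n; apply: whpoly_mul af; exact: whpoly_c.
by apply/funext => u; apply/funext => v; rewrite rmorphXn rmorphN rmorph1.
Qed.

(** When the displacements raise the weights of x and y by e, every term beyond the constant one
    gains e in weight. Induction on the polynomial gives this together with the linear term. *)
Lemma whpoly_taylor e a f xi eta : wpoly (wx + e) 1 xi -> wpoly (wy + e) 1 eta -> whpoly a f ->
  taylor a (a + e) (fun p => f (x + xi p) (y + eta p)) (f x y)
    (fun p => xi p * dx (f x y) + eta p * dy (f x y)).
Proof.
move=> xiP etaP; elim=> {a f} [||k|a|a f g _ IHf _ IHg|a b f g _ IHf _ IHg].
- apply: taylor_ext (taylorD (taylor_cst _ (wideal_x T wx wy)) (taylor_lin _ xiP)) => [p||p] //=.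
    by rewrite addr0.
  by rewrite gdxX gdyX; ring.
- apply: taylor_ext (taylorD (taylor_cst _ (wideal_y T wx wy)) (taylor_lin _ etaP)) => [p||p] //=.
    by rewrite addr0.
  by rewrite gdxY gdyY; ring.
- apply: taylor_ext (taylor_cst _ (wideal_all wx wy (C k))) => [p||p] //=.
  by rewrite gdxC gdyC; ring.
- apply: taylor_ext (taylor_cst _ (wideal0 T wy wx0 _)) => [p||p] //=.
  by rewrite gdx0 gdy0; ring.
- apply: taylor_ext (taylorD IHf IHg) => [p||p] //=.
  by rewrite gdxD gdyD; ring.
- apply: taylor_ext (taylorM _ _ _ _ IHf IHg) => [p||p||||] //=; try lia.
  by rewrite gdxM gdyM; ring.
Qed.
End Taylor.

Section MatrixTaylor.
Context {R : realType} (T : germ_theory R).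
Local Notation S := (gring T).
Variables wx wy : nat.
Hypotheses (wx0 : (0 < wx)%N) (wy0 : (0 < wy)%N).
Variable m : nat.
Local Notation P := ('I_m -> S).
Local Notation weights := ('I_3 -> 'I_3 -> nat).

Definition mtaylor (a b : weights) (F : P -> 'M[S]_3) (c : 'M[S]_3) (l : P -> 'M[S]_3) :=
  forall i j, taylor wx wy (a i j) (b i j) (fun p => F p i j) (c i j) (fun p => l p i j).

Lemma mtaylorM (a b a' b' g d : weights) F F' c c' l l' :
  (forall i j k, [/\ g i j <= a i k + a' k j, d i j <= a i k + b' k j,
     d i j <= b i k + a' k j & d i j <= b i k + b' k j]%N) ->
  mtaylor a b F c l -> mtaylor a' b' F' c' l' ->
  mtaylor g d (fun p => F p *m F' p) (c *m c') (fun p => c *m l' p + l p *m c').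
Proof.
move=> h tF tF' i j.
apply: (@taylor_ext _ _ _ _ _ _ _ (fun p => \sum_k F p i k * F' p k j) _
  (\sum_k c i k * c' k j) _ (fun p => \sum_k (c i k * l' p k j + l p i k * c' k j))).
- by move=> p; rewrite mxE.
- by rewrite mxE.
- by move=> p; rewrite big_split /= !mxE.
apply: taylor_sum => // k; have [h1 h2 h3 h4] := h i j k.
exact: taylorM h1 h2 h3 h4 (tF i k) (tF' k j).
Qed.
End MatrixTaylor.

Section LinearAction.
Context {R : realType} (T : germ_theory R).
Local Notation S := (gring T).
Lemma gact_sum (A : 'M[S]_3) m (p : 'I_m -> S) u v U :
  gact A (\sum_k p k * u k) (\sum_k p k * v k) (\sum_k p k *: U k) =
  \sum_k p k *: gact A (u k) (v k) (U k).
Proof.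
rewrite /gact !scaler_suml linear_sum /= mulmx_suml mulmx_sumr -!big_split /=.
apply: eq_bigr => k _; rewrite !scalerDr !scalerA linearZ /= -scalemxAl -scalemxAr.
by [].
Qed.
End LinearAction.

(** * Removal of perturbations by the group action *)

Section Unfolding.
Context {R : realType} (T : germ_theory R).
Local Notation S := (gring T).
Local Notation ev := (gev T).
Local Notation C := (gcst T).
Local Notation dx := (@gdx R T).
Local Notation dy := (@gdy R T).
Local Notation x := (gX T).
Local Notation y := (gY T).
Variables (wx wy : nat) (w : 'I_3 -> nat) (e : nat).
Hypotheses (wx0 : (0 < wx)%N) (wy0 : (0 < wy)%N).
Local Notation wideal := (wideal (T := T) wx wy).
Local Notation whpoly := (whpoly (T := T) wx wy).

Definition sym_unit (i j : 'I_3) : 'M[S]_3 :=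
  \matrix_(k, l) (((k == i) && (l == j)) || ((k == j) && (l == i)))%:R.

Variable B : nat.
Local Notation J := (('I_3 * 'I_3) * ('I_B * 'I_B))%type.

(** The perturbations are the symmetric matrices whose (i, j) entry has order at least w i + w j +
    e. Monomials times symmetric units generate them; the index set is a full product, and an index
    that is below the diagonal or of too low weight is given the generator 0. *)
Definition wgate (k : J) :=
  (k.1.1 <= k.1.2)%N && (w k.1.1 + w k.1.2 + e <= k.2.1 * wx + k.2.2 * wy)%N.
Definition wgen (k : J) : 'M[S]_3 :=
  if wgate k then (x ^+ k.2.1 * y ^+ k.2.2) *: sym_unit k.1.1 k.1.2 else 0.

Lemma wgen_sum (c : J -> S) (i j : 'I_3) : (i <= j)%N ->
  (\sum_k c k *: wgen k) i j =
  \sum_(k : 'I_B * 'I_B | (w i + w j + e <= k.1 * wx + k.2 * wy)%N)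
     c ((i, j), k) * (x ^+ k.1 * y ^+ k.2).
Proof.
move=> ij; rewrite summxE.
rewrite [LHS](eq_bigr (fun k : J => c (k.1, k.2) * wgen (k.1, k.2) i j)); last first.
  by case=> a b _; rewrite mxE.
rewrite -(pair_bigA _ (fun a b => c (a, b) * wgen (a, b) i j)) /=.
rewrite (bigD1 (i, j)) //= [X in _ + X]big1 ?addr0 => [|[i' j'] ne]; last first.
  apply: big1 => b _; rewrite /wgen /wgate /=.
  case: ifP => [/andP[ij' _]|_]; last by rewrite mxE mulr0.
  rewrite !mxE; case: eqP => [E1|_]; case: eqP => [E2|_] //=; rewrite ?mulr0 //.
  - by move: ne; rewrite E1 E2 eqxx.
  - case: eqP => [E3|_]; case: eqP => [E4|_] //=; rewrite ?mulr0 //.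
    have E : i = j by apply/val_inj/eqP; rewrite eqn_leq ij E3 E4.
    by move: ne; rewrite -E3 -E4 -E eqxx.
  - case: eqP => [E3|_]; case: eqP => [E4|_] //=; rewrite ?mulr0 //.
    have E : i = j by apply/val_inj/eqP; rewrite eqn_leq ij E3 E4.
    by move: ne; rewrite -E3 -E4 -E eqxx.
  - case: eqP => [E3|_]; case: eqP => [E4|_] //=; rewrite ?mulr0 //.
    have E : i = j by apply/val_inj/eqP; rewrite eqn_leq ij E3 E4.
    by move: ne; rewrite -E3 -E4 -E eqxx.
rewrite [RHS]big_mkcond; apply: eq_bigr => b _; rewrite /wgen /wgate /= ij /=.
by case: (w i + w j + e <= _)%N; rewrite !mxE ?mulr0 // !eqxx mulr1.
Qed.

Lemma wgen_sym k : gsym (wgen k).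
Proof.
rewrite /gsym /wgen; case: ifP => _; last by rewrite trmx0.
by apply/matrixP => i j; rewrite !mxE andbC [X in _ || X]andbC orbC.
Qed.

Lemma wgen_wideal k i j : wideal (w i + w j + e) (wgen k i j).
Proof.
rewrite /wgen; case: ifP => [/andP[_ h]|_]; last by rewrite mxE; exact: wideal0.
rewrite !mxE mulrC; case: orP => [H|_]; last by rewrite mul0r; exact: wideal0.
apply: wideal_mono.
by case: H => /andP[/eqP-> /eqP->] //; rewrite (addnC (w k.1.2)).
Qed.

Lemma sym_ext (A A' : 'M[S]_3) : gsym A -> gsym A' ->
  (forall i j : 'I_3, (i <= j)%N -> A i j = A' i j) -> A = A'.
Proof.
move=> sA sA' h; apply/matrixP => i j; have [/h //|/ltnW/h E] := leqP i j.
by rewrite -sA -sA' !mxE.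
Qed.

Variables (Nf : 'I_3 -> 'I_3 -> S -> S -> S).
Hypotheses (NfP : forall i j, whpoly (w i + w j) (Nf i j)) (NfC : forall i j, Nf i j = Nf j i).
Variables (ns : nat) (Sf : 'I_ns -> 'I_3 -> 'I_3 -> S -> S -> S).
Hypotheses (SfP : forall s i j, whpoly (w i + w j + e) (Sf s i j))
  (SfC : forall s i j, Sf s i j = Sf s j i).
Hypothesis BP : forall i j, (w i + w j + e < B)%N.

Definition nf_mx : 'M[S]_3 := \matrix_(i, j) Nf i j x y.
Definition slice_mx s : 'M[S]_3 := \matrix_(i, j) Sf s i j x y.

Hypothesis solve : forall F, gsym F -> (forall i j, wideal (w i + w j + e) (F i j)) ->
  exists u v (U : 'M[S]_3) (s : 'I_ns -> S), [/\ wideal (wx + e) u, wideal (wy + e) v,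
    forall i j, wideal (w j + e - w i) (U i j) &
    F = gact nf_mx u v U + \sum_s' s s' *: slice_mx s'].

(** The group element is sought as X = 1 + U(p), (x + xi(p), y + eta(p)), with slice coefficients
    t(p), all linear in p. Since e is added to all the weights, the terms of degree at least two in
    p lie in the module spanned by the generators, and by the choice of xi, eta, U and t the linear
    terms are the sum of the p_k times the generators. Comparing coefficients, the equation for the
    perturbation becomes p + q(p) = r with q quadratic. *)
Theorem unfold : exists delta : R, 0 < delta /\
  forall r : J -> S, (forall k, `|ev (r k)| < delta) ->
  exists t : 'I_ns -> S,
    gequiv (nf_mx + \sum_k r k *: wgen k) (nf_mx + \sum_s t s *: slice_mx s) /\
    ((forall k, ev (r k) = 0) -> forall s, ev (t s) = 0).
Proof.
(* A solution (u, v, U, s) of the infinitesimal equation is fixed for each generator. *)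
have /choice[d dP] : forall k : J, exists d : S * S * 'M[S]_3 * ('I_ns -> S),
    [/\ wideal (wx + e) d.1.1.1, wideal (wy + e) d.1.1.2,
      forall i j, wideal (w j + e - w i) (d.1.2 i j) &
      wgen k = gact nf_mx d.1.1.1 d.1.1.2 d.1.2 + \sum_s d.2 s *: slice_mx s].
  move=> k; have [u [v [U [s sP]]]] := solve (wgen_sym k) (wgen_wideal k).
  by exists (u, v, U, s).
pose m := #|{: J}|; pose rk (k : J) : 'I_m := enum_rank k.
pose P := 'I_m -> S.
pose xi (p : P) := \sum_k p k * (d (enum_val k)).1.1.1.
pose eta (p : P) := \sum_k p k * (d (enum_val k)).1.1.2.
pose U (p : P) : 'M[S]_3 := \sum_k p k *: (d (enum_val k)).1.2.
pose t (p : P) s := \sum_k p k * (d (enum_val k)).2 s.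
have xiP : wpoly wx wy (wx + e) 1 xi.
  by apply: wpoly_lin => // k; case: (dP (enum_val k)).
have etaP : wpoly wx wy (wy + e) 1 eta.
  by apply: wpoly_lin => // k; case: (dP (enum_val k)).
have UP i j : wpoly wx wy (w j + e - w i) 1 (fun p => U p i j).
  apply: (@wpoly_ext _ _ _ _ _ _ _ (fun p => \sum_k p k * (d (enum_val k)).1.2 i j)).
    by move=> p; rewrite /U summxE; apply: eq_bigr => k _; rewrite mxE.
  by apply: wpoly_lin => // k; case: (dP (enum_val k)).
have tP s : wpoly wx wy 0 1 (fun p => t p s).
  by apply: wpoly_lin => // k; exact: wideal_all.
(* Normal form plus slice at the displaced point, before the congruence; [M1] is its part linear in
   p. The slice terms carry the factor t(p), so at first order the slice is taken at (x, y). *)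
pose M (p : P) : 'M[S]_3 := \matrix_(i, j) (Nf i j (x + xi p) (y + eta p) +
  \sum_s t p s * Sf s i j (x + xi p) (y + eta p)).
pose M1 (p : P) : 'M[S]_3 := xi p *: map_mx dx nf_mx + eta p *: map_mx dy nf_mx +
  \sum_s t p s *: slice_mx s.
pose Psi (p : P) : 'M[S]_3 := (1%:M + U p)^T *m M p *m (1%:M + U p).
pose L (p : P) : 'M[S]_3 := gact nf_mx (xi p) (eta p) (U p) + \sum_s t p s *: slice_mx s.
(* The linear part of the action is the identity in the coordinates given by the generators. *)
have LE p : L p = \sum_k p k *: wgen (enum_val k).
  rewrite /L gact_sum.
  have -> : \sum_s t p s *: slice_mx s =
      \sum_k p k *: (\sum_s (d (enum_val k)).2 s *: slice_mx s).
    rewrite /t (eq_bigr (fun s => \sum_k (p k * (d (enum_val k)).2 s) *: slice_mx s)).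
      rewrite exchange_big; apply: eq_bigr => k _; rewrite scaler_sumr.
      by apply: eq_bigr => s _; rewrite scalerA.
    by move=> s _; rewrite scaler_suml.
  rewrite -big_split; apply: eq_bigr => k _ /=; rewrite -scalerDr.
  by case: (dP (enum_val k)) => _ _ _ ->.
have MT : mtaylor wx wy (fun i j => w i + w j)%N (fun i j => w i + w j + e)%N M nf_mx M1.
  move=> i j.
  have h := whpoly_taylor wx0 wy0 xiP etaP (NfP i j).
  have hs s : taylor wx wy (w i + w j) (w i + w j + e)
      (fun p => t p s * Sf s i j (x + xi p) (y + eta p)) 0 (fun p => t p s * Sf s i j x y).
    have [a1 a2 a3] := whpoly_taylor wx0 wy0 xiP etaP (SfP s i j).
    split; first exact: wideal0.
      have := wpolyM (tP s) (wpoly_cst m a1).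
      by rewrite add0n addn0; apply: wpoly_ext.
    have b1 := wpolyM (tP s) a2; have b2 := wpolyM (tP s) a3; rewrite !add0n in b1 b2.
    have {}b1 := wpoly_weak (leq_addr e _) (leqnn 2) b1.
    have {}b2 := wpoly_weak (leq_addr e _) (isT : 2 <= 3)%N b2.
    apply: wpoly_ext (wpoly_add b1 b2) => p.
    by ring.
  have hss := taylor_sum wx0 (index_enum 'I_ns) hs.
  apply: (taylor_ext _ _ _ (taylorD h hss)) => [p||p].
  - by rewrite mxE.
  - by rewrite big1 // addr0 mxE.
  - rewrite !mxE summxE; congr (_ * dx _ + _ * dy _ + _); rewrite ?mxE //.
    by apply: eq_bigr => s _; rewrite !mxE.
have UT : mtaylor wx wy (fun i j => w j - w i)%N (fun i j => w j + e - w i)%N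
    (fun p => 1%:M + U p) 1%:M U.
  move=> i j.
  have w1 : wideal (w j - w i) ((1%:M : 'M[S]_3) i j).
    rewrite mxE; case: eqP => [->|_]; last exact: wideal0.
    by rewrite subnn; exact: wideal_all.
  have h1 := taylor_cst wx0 m (w j + e - w i) w1.
  have h2 := taylor_lin wx0 (w j - w i) (UP i j).
  apply: taylor_ext (taylorD h1 h2) => [p||p].
  - by rewrite [RHS]mxE.
  - by rewrite addr0.
  - by rewrite add0r.
have UTt : mtaylor wx wy (fun i j => w i - w j)%N (fun i j => w i + e - w j)%N
    (fun p => (1%:M + U p)^T) 1%:M (fun p => (U p)^T).
  move=> i j; apply: (taylor_ext _ _ _ (UT j i)) => [p||p]; by rewrite !mxE // eq_sym.
have PT : mtaylor wx wy (fun i j => w i + w j)%N (fun i j => w i + w j + e)%N Psi nf_mx L.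
  have h1 : mtaylor wx wy (fun i j => w i + w j)%N (fun i j => w i + w j + e)%N
      (fun p => (1%:M + U p)^T *m M p) (1%:M *m nf_mx)
      (fun p => 1%:M *m M1 p + (U p)^T *m nf_mx).
    by apply: (mtaylorM wx0 _ UTt MT) => i j k; split; lia.
  have h2 : mtaylor wx wy (fun i j => w i + w j)%N (fun i j => w i + w j + e)%N
      Psi (1%:M *m nf_mx *m 1%:M)
      (fun p => 1%:M *m nf_mx *m U p + (1%:M *m M1 p + (U p)^T *m nf_mx) *m 1%:M).
    by apply: (mtaylorM wx0 _ h1 UT) => i j k; split; lia.
  move=> i j; apply: (taylor_ext _ _ _ (h2 i j)) => [p||p].
  - by [].
  - by rewrite mul1mx mulmx1.
  - rewrite !mul1mx !mulmx1 /L /M1 /gact; congr (fun_of_matrix _ _ _).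
    set z := \sum_s _; set z1 := _ *: _; set z2 := _ *: _.
    rewrite addrC -!addrA; congr (_ + (_ + _)).
    by rewrite addrC -addrA; congr (_ + _); rewrite addrC.
(* The remainder of degree two in p is written in the same generators, which gives the quadratic
   maps to which [g_hensel] applies. *)
have [qq qqP] : exists qq : 'I_3 * 'I_3 -> 'I_B * 'I_B -> P -> S, forall ij,
    (forall k, pideal 2 (qq ij k)) /\ forall p,
    Psi p ij.1 ij.2 - nf_mx ij.1 ij.2 - L p ij.1 ij.2 =
    \sum_(k : 'I_B * 'I_B | (w ij.1 + w ij.2 + e <= k.1 * wx + k.2 * wy)%N)
       qq ij k p * (x ^+ k.1 * y ^+ k.2).
  suff /choice[qq h] : forall ij : 'I_3 * 'I_3, exists qq : 'I_B * 'I_B -> P -> S,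
    (forall k, pideal 2 (qq k)) /\ forall p,
    Psi p ij.1 ij.2 - nf_mx ij.1 ij.2 - L p ij.1 ij.2 =
    \sum_(k : 'I_B * 'I_B | (w ij.1 + w ij.2 + e <= k.1 * wx + k.2 * wy)%N)
       qq k p * (x ^+ k.1 * y ^+ k.2) by exists qq.
  move=> [i j] /=; have [_ _ h] := PT i j.
  by have [q qe qP] := wpoly_bounded wx0 wy0 (BP i j) h; exists q.
pose q (k : 'I_m) (p : P) := qq (enum_val k).1 (enum_val k).2 p.
have q2 k : pideal 2 (q k) by case: (qqP (enum_val k).1) => + _; apply.
(* The Jacobian of the displacement at 0 as a polynomial in the values p_k(0). The derivatives of
   p_k do not enter because the coefficients of xi and eta vanish at 0. *)
pose Jf (p : 'I_m -> R) :=
  (1 + \sum_k p k * ev (dx (d (enum_val k)).1.1.1)) *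
    (1 + \sum_k p k * ev (dy (d (enum_val k)).1.1.2)) -
  (\sum_k p k * ev (dy (d (enum_val k)).1.1.1)) *
    (\sum_k p k * ev (dx (d (enum_val k)).1.1.2)).
pose Df (p : 'I_m -> R) := \det (1%:M + \sum_k p k *: map_mx ev (d (enum_val k)).1.2).
have linp (c : 'I_m -> R) : pideal 0 (fun p : 'I_m -> R => \sum_k p k * c k).
  apply: pideal_sum => k; apply: (@pideal_mul _ _ 0 0); last exact: pideal_cst.
  exact: pideal_weak (pideal_var _ k).
have [e1 [e1_gt0 e1P]] : exists eps, 0 < eps /\ forall p, (forall k, `|p k| < eps) -> Jf p != 0.
  apply: (@pideal_nonzero _ _ _ 0).
    rewrite /Jf (_ : (fun p => _) = fun p : 'I_m -> R =>
      (1 + \sum_k p k * ev (dx (d (enum_val k)).1.1.1)) *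
        (1 + \sum_k p k * ev (dy (d (enum_val k)).1.1.2)) +
      (-1) * ((\sum_k p k * ev (dy (d (enum_val k)).1.1.1)) *
        (\sum_k p k * ev (dx (d (enum_val k)).1.1.2)))); last first.
      by apply/funext => p; rewrite mulN1r.
    apply: pideal_add; apply: (@pideal_mul _ _ 0 0).
    - by apply: pideal_add; [exact: pideal_cst|exact: linp].
    - by apply: pideal_add; [exact: pideal_cst|exact: linp].
    - exact: pideal_cst.
    - by apply: (@pideal_mul _ _ 0 0); exact: linp.
  have z (c : 'I_m -> R) : \sum_k (fun=> 0 : R) k * c k = 0.
    by apply: big1 => k _; rewrite mul0r.
  by rewrite /Jf !z !addr0 mul1r mul0r subr0 oner_eq0.
have [e2 [e2_gt0 e2P]] : exists eps, 0 < eps /\ forall p, (forall k, `|p k| < eps) -> Df p != 0.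
  apply: (@pideal_nonzero _ _ _ 0).
    apply: pideal_det => i j.
    rewrite (_ : (fun p => _) = fun p : 'I_m -> R => (1%:M : 'M[R]_3) i j +
      \sum_k p k * (map_mx ev (d (enum_val k)).1.2) i j).
      by apply: pideal_add; [exact: pideal_cst|exact: linp].
    apply/funext => p; rewrite mxE summxE; congr (_ + _).
    by apply: eq_bigr => k _; rewrite mxE.
  rewrite /Df big1 => [|k _]; last by rewrite scale0r.
  by rewrite addr0 det1 oner_eq0.
have eps0 : 0 < Num.min e1 e2 by rewrite lt_min e1_gt0.
have [delta [delta0 dH]] := g_hensel eps0 q2.
exists delta; split=> // r rd.
have [p [pE pS pZ]] := dH (fun k => r (enum_val k)) (fun k => rd (enum_val k)).
have p1 k : `|ev (p k)| < e1 by have := pS k; rewrite lt_min => /andP[].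
have p2 k : `|ev (p k)| < e2 by have := pS k; rewrite lt_min => /andP[].
have xi0 k : ev (d (enum_val k)).1.1.1 = 0.
  by have [h _ _ _] := dP (enum_val k); apply: wideal_ev h; rewrite addn_gt0 wx0.
have eta0 k : ev (d (enum_val k)).1.1.2 = 0.
  by have [_ h _ _] := dP (enum_val k); apply: wideal_ev h; rewrite addn_gt0 wy0.
have evl (c : 'I_m -> S) : (forall k, ev (c k) = 0) -> ev (\sum_k p k * c k) = 0.
  by move=> c0; rewrite rmorph_sum big1 // => k _; rewrite rmorphM c0 mulr0.
have evd (D : S -> S) (c : 'I_m -> S) : (forall a b, D (a * b) = D a * b + a * D b) ->
    D (\sum_k p k * c k) = \sum_k D (p k * c k) -> (forall k, ev (c k) = 0) ->
    ev (D (\sum_k p k * c k)) = \sum_k ev (p k) * ev (D (c k)).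
  move=> DM Ds c0; rewrite Ds rmorph_sum; apply: eq_bigr => k _.
  by rewrite DM rmorphD !rmorphM c0 mulr0 add0r.
set u := x + xi p; set v := y + eta p.
have u0 : ev u = 0 by rewrite /u rmorphD gevX add0r evl.
have v0 : ev v = 0 by rewrite /v rmorphD gevY add0r evl.
have J : gjac u v != 0.
  suff -> : gjac u v = Jf (fun k => ev (p k)) by exact: e1P.
  rewrite /gjac /u /v !gdxD !gdyD gdxX gdxY gdyX gdyY !rmorphD !rmorph1 !rmorph0 !add0r.
  rewrite /xi /eta !(evd dx) ?(evd dy) ?gdx_sum ?gdy_sum //.
  all: try exact: gdxM. all: try exact: gdyM.
have DX : ev (\det (1%:M + U p)) != 0.
  suff -> : ev (\det (1%:M + U p)) = Df (fun k => ev (p k)) by exact: e2P.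
  rewrite -det_map_mx /Df; congr (\det _); rewrite map_mxD map_mx1; congr (_ + _).
  by apply/matrixP => i j; rewrite [LHS]mxE /U !summxE raddf_sum; apply: eq_bigr => k _;
    rewrite [in LHS]mxE [RHS]mxE [in RHS]mxE; exact: rmorphM.
have [u' [v' [[u'0 v'0] E1 E2 E3 E4]]] := gsubst_inv u0 v0 J.
(* The slice coefficients are found at the source point. To become coefficients of a matrix to which
   the substitution is then applied, they are composed with its inverse. *)
pose tau s := gsubst u' v' (t p s).
exists tau; split; last first.
  move=> r0 s; rewrite /tau gev_subst // /t rmorph_sum big1 // => k _.
  by rewrite rmorphM (pZ (fun k => r0 (enum_val k))) mul0r.
apply: gequiv_sym; exists u, v, (1%:M + U p); split=> //.
have tauE s : gsubst u v (tau s) = t p s.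
  by rewrite /tau gsubst_comp // E1 E2 gsubst_id.
transitivity (Psi p).
  apply: sym_ext.
  - rewrite /gsym linearD /= linear_sum /=; congr (_ + _).
      by apply/matrixP => i j; rewrite !mxE NfC.
    by apply: eq_bigr => k _; rewrite linearZ /= wgen_sym.
  - rewrite /gsym /Psi !trmx_mul trmxK mulmxA; congr (_ *m _ *m _).
    apply/matrixP => i j; rewrite !mxE NfC; congr (_ + _); apply: eq_bigr => s _.
    by rewrite SfC.
  move=> i j ij; have [_ /(_ p)] := qqP (i, j).
  rewrite /= => /(canRL (subrK _)) /(canRL (subrK _)) ->.
  rewrite LE mxE addrC; congr (_ + _).
  rewrite (wgen_sum _ ij) /=.
  have -> : \sum_k p k *: wgen (enum_val k) = \sum_k p (rk k) *: wgen k.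
    rewrite (reindex rk) /=; last by apply: onW_bij; exact: enum_rank_bij.
    by apply: eq_bigr => k _; rewrite enum_rankK.
  rewrite (wgen_sum _ ij) -big_split; apply: eq_bigr => k _ /=.
  rewrite -mulrDl; congr (_ * _).
  by have := pE (rk ((i, j), k)); rewrite /q enum_rankK => <-; rewrite addrC.
congr (_ *m _ *m _); apply/matrixP => i j; rewrite !mxE summxE rmorphD rmorph_sum /=.
congr (_ + _); first by rewrite (whpoly_subst u0 v0 (NfP i j)).
by apply: eq_bigr => s _; rewrite !mxE rmorphM tauE (whpoly_subst u0 v0 (SfP s i j)).
Qed.
End Unfolding.

(** * Unfolding the pencil of a 1-jet *)

Section PencilUnfolding.
Context {R : realType} (T : germ_theory R).
Local Notation S := (gring T).
Local Notation ev := (gev T).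
Local Notation C := (gcst T).
Local Notation dx := (@gdx R T).
Local Notation dy := (@gdy R T).
Local Notation x := (gX T).
Local Notation y := (gY T).

Definition pencil (P Q : 'M[R]_3) : 'M[S]_3 := x *: map_mx C P + y *: map_mx C Q.

Lemma ev0_wideal n (c : S) : ev c = 0 -> wideal n n n c.
Proof.
move=> c0; have [a [b ->]] := g_hadamard c; rewrite c0 rmorph0 add0r.
by apply: wideal_add; apply: widealMr; [exact: wideal_x|exact: wideal_y].
Qed.

Lemma gdx_hadamard (c a b : S) : c = x * a + y * b -> ev (dx c) = ev a.
Proof. by move=> ->; rewrite gdxD !gdxM gdxX gdxY !(rmorphD, rmorphM, rmorph1, rmorph0, gevX, gevY) /=; ring. Qed.
Lemma gdy_hadamard (c a b : S) : c = x * a + y * b -> ev (dy c) = ev b.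
Proof. by move=> ->; rewrite gdyD !gdyM gdyX gdyY !(rmorphD, rmorphM, rmorph1, rmorph0, gevX, gevY) /=; ring. Qed.

Lemma pencil_unfold (P Q : 'M[R]_3) ns (Ps Qs : 'I_ns -> 'M[R]_3) :
  P^T = P -> Q^T = Q -> (forall s, (Ps s)^T = Ps s) -> (forall s, (Qs s)^T = Qs s) ->
  (forall F, gsym F -> (forall i j, ev (F i j) = 0) -> exists u v U (s : 'I_ns -> S),
    [/\ ev u = 0, ev v = 0 &
      F = gact (pencil P Q) u v U + \sum_s' s s' *: pencil (Ps s') (Qs s')]) ->
  forall A, gsym A -> (forall i j, [/\ ev (A i j) = 0, ev (dx (A i j)) = P i j &
    ev (dy (A i j)) = Q i j]) ->
  exists t : 'I_ns -> S, (forall s, ev (t s) = 0) /\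
    gequiv A (pencil P Q + \sum_s t s *: pencil (Ps s) (Qs s)).
Proof.
move=> sP sQ sPs sQs solve A sA AP.
pose w := fun _ : 'I_3 => 1%N.
pose Nf i j (u v : S) := u * C (P i j) + v * C (Q i j).
pose Sf s i j (u v : S) := u * C (Ps s i j) + v * C (Qs s i j).
have tr (M : 'M[R]_3) : M^T = M -> forall i j, M i j = M j i.
  by move=> E i j; rewrite -[in LHS]E mxE.
have linP (M M' : 'M[R]_3) i j : whpoly (T := T) 2 2 2 (fun u v => u * C (M i j) + v * C (M' i j)).
  by apply: whpoly_add; apply: (@whpoly_mul _ _ 2 2 2 0);
    [exact: whpoly_x|exact: whpoly_c|exact: whpoly_y|exact: whpoly_c].
have NE : nf_mx Nf = pencil P Q by apply/matrixP => i j; rewrite !mxE.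
have SE s : slice_mx Sf s = pencil (Ps s) (Qs s) by apply/matrixP => i j; rewrite !mxE.
have ab i j : exists ab : S * S, A i j = (pencil P Q) i j + ab.1 * x + ab.2 * y /\
    (ev ab.1 = 0 /\ ev ab.2 = 0).
  have [A0 Ax Ay] := AP i j; have [a [b E]] := g_hadamard (A i j).
  rewrite A0 rmorph0 add0r in E.
  exists (a - C (P i j), b - C (Q i j)) => /=; split.
    by rewrite !mxE E; ring.
  by rewrite !rmorphB !gev_cst -Ax -Ay (gdx_hadamard E) (gdy_hadamard E) !subrr.
have /choice[h hP] : forall ij : 'I_3 * 'I_3, exists ab : S * S,
    A ij.1 ij.2 = (pencil P Q) ij.1 ij.2 + ab.1 * x + ab.2 * y /\ (ev ab.1 = 0 /\ ev ab.2 = 0).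
  by move=> ij; exact: ab.
(* Weight 2 for x and y and 1 for each row makes linear entries homogeneous of weight 1 + 1; the
   bound 3 exceeds this weight. *)
have [||||||delta [d0 dP]] := @unfold R T 2 2 w 0 isT isT 3 Nf _ _ ns Sf _ _ _ _.
- by move=> i j; exact: linP.
- by move=> i j; apply/funext => u; apply/funext => v; rewrite /Nf (tr P) // (tr Q).
- by move=> s i j; exact: linP.
- by move=> s i j; apply/funext => u; apply/funext => v; rewrite /Sf (tr (Ps s)) // (tr (Qs s)).
- by [].
- move=> F sF Fm; have [|u [v [U [s [u0 v0 E]]]]] := solve F sF.
    by move=> i j; apply: wideal_ev (Fm i j).
  exists u, v, U, s; split.
  - exact: ev0_wideal.
  - exact: ev0_wideal.
  - by move=> i j; exact: wideal_all.
  - by rewrite E NE; congr (_ + _); apply: eq_bigr => s' _; rewrite SE.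
pose o0' : 'I_3 := ord0; pose o1' : 'I_3 := @Ordinal 3 1 isT.
(* The two parts of an entry go to the exponents (1, 0) and (0, 1); all other coordinates are 0. *)
pose r (k : ('I_3 * 'I_3) * ('I_3 * 'I_3)) : S :=
  if k.2 == (o1', o0') then (h k.1).1 else if k.2 == (o0', o1') then (h k.1).2 else 0.
have r0 k : ev (r k) = 0.
  rewrite /r; have [_ [h1 h2]] := hP k.1.
  by do 2?[case: eqP => // _]; rewrite rmorph0.
have [k|t [tE t0]] := dP r; first by rewrite r0 normr0.
exists t; split; first exact: t0.
have -> : A = nf_mx Nf + \sum_k r k *: wgen T 2 2 w 0 k.
  apply: sym_ext => //.
    rewrite /gsym linearD /= linear_sum /=; congr (_ + _).
      by rewrite NE /pencil linearD /= !linearZ /= !map_trmx sP sQ.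
    by apply: eq_bigr => k _; rewrite linearZ /= wgen_sym.
  move=> i j ij; rewrite mxE (wgen_sum _ _ _ _ _ ij) NE.
  have [-> _] := hP (i, j); rewrite /= -addrA; congr (_ + _).
  rewrite (bigD1 (o1', o0')) //= (bigD1 (o0', o1')) //= big1 ?addr0.
    by rewrite /r /= !expr0 !expr1 mulr1 mul1r.
  move=> k /andP[/andP[_ k1] k2]; rewrite /r /=.
  by rewrite (negPf k1) (negPf k2) mul0r.
move: tE; rewrite NE; congr (gequiv _ (_ + _)).
by apply: eq_bigr => s _; rewrite SE.
Qed.
End PencilUnfolding.

(** * Finite determinacy for weighted homogeneous matrices *)

Section Determinacy.
Context {R : realType} (T : germ_theory R).
Local Notation S := (gring T).
Local Notation ev := (gev T).
Local Notation C := (gcst T).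
Local Notation x := (gX T).
Local Notation y := (gY T).
Variables (wx wy : nat) (w : 'I_3 -> nat).
Hypotheses (wx0 : (0 < wx)%N) (wy0 : (0 < wy)%N).
Local Notation wideal := (wideal (T := T) wx wy).
Local Notation whpoly := (whpoly (T := T) wx wy).

Lemma det_diag (d : 'I_3 -> S) : \det (\matrix_(i, j) (if i == j then d i else 0)) = \prod_i d i.
Proof.
have -> : \matrix_(i, j) (if i == j then d i else 0) = diag_mx (\row_i d i).
  by apply/matrixP => i j; rewrite !mxE; case: eqP => [->|_]; rewrite ?mulr1n ?mulr0n.
by rewrite det_diag; apply: eq_bigr => i _; rewrite mxE.
Qed.

Lemma diag_congr (d : 'I_3 -> S) (M : 'M[S]_3) i j :
  let D := \matrix_(i, j) (if i == j then d i else 0) in (D^T *m M *m D) i j = d i * M i j * d j.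
Proof.
rewrite /= mxE (bigD1 j) //= big1 => [|k /negPf kj]; last by rewrite [X in _ * X]mxE kj mulr0.
rewrite addr0 [X in _ * X]mxE eqxx; congr (_ * _).
rewrite mxE (bigD1 i) //= big1 => [|k /negPf ki]; last by rewrite !mxE ki mul0r.
by rewrite !mxE eqxx addr0.
Qed.

Lemma scale_small (I : finType) (c : I -> R) (delta : R) : 0 < delta ->
  exists lam : R, [/\ 0 < lam, lam <= 1 & forall i, lam * `|c i| < delta].
Proof.
move=> d0; pose K := delta + \sum_i `|c i|.
have s0 : 0 <= \sum_i `|c i| by apply: sumr_ge0.
have K0 : 0 < K by rewrite /K ltr_wpDr.
exists (delta / K); split; first by rewrite divr_gt0.
  by rewrite ler_pdivrMr // mul1r /K lerDl.
move=> i; rewrite mulrAC ltr_pdivrMr // ltr_pM2l //.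
apply: (@le_lt_trans _ _ (\sum_i `|c i|)); last by rewrite /K ltrDr.
by rewrite (bigD1 i) //= lerDl; apply: sumr_ge0.
Qed.

Variables (Nf : 'I_3 -> 'I_3 -> S -> S -> S).
Hypotheses (NfP : forall i j, whpoly (w i + w j) (Nf i j)) (NfC : forall i j, Nf i j = Nf j i).
Hypothesis homog : forall (lam : R) i j,
  Nf i j (C (lam ^+ wx) * x) (C (lam ^+ wy) * y) = C (lam ^+ (w i + w j)) * Nf i j x y.
Hypothesis solve : forall F, gsym F -> (forall i j, wideal (w i + w j + 1) (F i j)) ->
  exists u v (U : 'M[S]_3), [/\ wideal (wx + 1) u, wideal (wy + 1) v,
    forall i j, wideal (w j + 1 - w i) (U i j) & F = gact (nf_mx Nf) u v U].

(** The scaling (lam^wx x, lam^wy y) followed by the congruence with diag(lam^(- w_i)) fixes the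
    homogeneous matrix and multiplies a term of excess weight g >= 1 by lam^g. For small lam the
    coefficients at 0 are below the threshold of [unfold], which is then used with e = 1 and no
    slice. *)
Theorem weighted_determined (Q : 'M[S]_3) : gsym Q ->
  (forall i j, wideal (w i + w j + 1) (Q i j)) -> gequiv (nf_mx Nf + Q) (nf_mx Nf).
Proof.
move=> sQ QP.
pose B := (\sum_i \sum_j (w i + w j + 1)).+1.
have BP i j : (w i + w j + 1 < B)%N.
  rewrite /B ltnS (bigD1 i) //= (bigD1 j) //=; exact: leq_trans (leq_addr _ _) (leq_addr _ _).
have [|||delta [d0 dP]] := @unfold R T wx wy w 1 wx0 wy0 B Nf NfP NfC 0
    (fun _ _ _ _ _ => 0) _ _ BP _.
- by case.
- by case.
- move=> F sF FP; have [u [v [U [u0 v0 UP ->]]]] := solve sF FP.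
  by exists u, v, U, (fun=> 0); split=> //; rewrite big_ord0 addr0.
have [q qP] : exists q : 'I_3 * 'I_3 -> 'I_B * 'I_B -> S, forall ij, Q ij.1 ij.2 =
    \sum_(k : 'I_B * 'I_B | (w ij.1 + w ij.2 + 1 <= k.1 * wx + k.2 * wy)%N)
      q ij k * (x ^+ k.1 * y ^+ k.2).
  suff /choice[q h] : forall ij : 'I_3 * 'I_3, exists q : 'I_B * 'I_B -> S, Q ij.1 ij.2 =
    \sum_(k : 'I_B * 'I_B | (w ij.1 + w ij.2 + 1 <= k.1 * wx + k.2 * wy)%N)
      q k * (x ^+ k.1 * y ^+ k.2) by exists q.
  move=> ij; have [q _ qP] := wpoly_bounded wx0 wy0 (BP ij.1 ij.2) (wpoly_cst 0 (QP ij.1 ij.2)).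
  by exists (fun k => q k (fun=> 0)).
pose J := (('I_3 * 'I_3) * ('I_B * 'I_B))%type.
have [lam [l0 l1 lP]] := scale_small (fun k : J => ev (q k.1 k.2)) d0.
pose u : S := C (lam ^+ wx) * x; pose v : S := C (lam ^+ wy) * y.
have u0 : ev u = 0 by rewrite rmorphM gevX mulr0.
have v0 : ev v = 0 by rewrite rmorphM gevY mulr0.
(* Excess of the weight of a monomial over that of its entry; the subtraction is genuine, and g is
   positive, whenever the gate holds. *)
pose g (k : J) := (k.2.1 * wx + k.2.2 * wy - (w k.1.1 + w k.1.2))%N.
pose r (k : J) : S := if wgate wx wy w 1 k then C (lam ^+ g k) * gsubst u v (q k.1 k.2) else 0.
have [k|t [tE _]] := dP r.
  rewrite /r; case: ifP => [/andP[_ wk]|_]; last by rewrite rmorph0 normr0.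
  rewrite rmorphM gev_cst gev_subst // normrM (ger0_norm (exprn_ge0 _ (ltW l0))).
  apply: le_lt_trans (lP k); apply: ler_wpM2r; first exact: normr_ge0.
  have : (0 < g k)%N by rewrite /g subn_gt0; apply: leq_trans wk; rewrite addn1.
  case: (g k) => // n _; rewrite exprS ler_piMr ?(ltW l0) //.
  by rewrite exprn_ile1 // ltW.
rewrite big_ord0 addr0 in tE; apply: gequiv_trans tE.
pose D : 'M[S]_3 := \matrix_(i, j) (if i == j then C ((lam ^+ w i)^-1) else 0).
have ln0 n : lam ^+ n != 0 by rewrite expf_neq0 // gt_eqF.
exists u, v, D; split=> //.
- rewrite /gjac /u /v !gdxM !gdyM gdxX gdxY gdyX gdyY !gdxC !gdyC.
  rewrite !(rmorphD, rmorphM, rmorph1, rmorph0, gevX, gevY, gev_cst).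
  by rewrite !(mulr0, mul0r, mulr1, addr0, add0r, subr0) mulf_neq0.
- rewrite det_diag rmorph_prod; apply/prodf_neq0 => i _.
  by rewrite gev_cst invr_eq0.
apply: sym_ext.
- rewrite /gsym linearD /= linear_sum /=; congr (_ + _).
    by apply/matrixP => i j; rewrite !mxE NfC.
  by apply: eq_bigr => k _; rewrite linearZ /= wgen_sym.
- rewrite /gsym !trmx_mul trmxK mulmxA; congr (_ *m _ *m _).
  rewrite map_trmx linearD /= sQ; congr (map_mx _ (_ + _)).
  by apply/matrixP => i j; rewrite !mxE NfC.
move=> i j ij; rewrite diag_congr [LHS]mxE [nf_mx Nf i j]mxE (wgen_sum _ _ _ _ _ ij) /=.
have -> : map_mx (gsubst u v) (nf_mx Nf + Q) i j = gsubst u v (Nf i j x y) + gsubst u v (Q i j).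
  by rewrite !mxE rmorphD.
rewrite (whpoly_subst u0 v0 (NfP i j)) homog.
have -> : C (lam ^+ w i)^-1 * (C (lam ^+ (w i + w j)) * Nf i j x y + gsubst u v (Q i j)) *
   C (lam ^+ w j)^-1 = Nf i j x y + C (lam ^+ w i)^-1 * C (lam ^+ w j)^-1 * gsubst u v (Q i j).
  have e1 : C (lam ^+ w i)^-1 * C (lam ^+ w j)^-1 * C (lam ^+ (w i + w j)) = 1.
    by rewrite -!rmorphM exprD mulrACA !mulVf // mulr1 rmorph1.
  by rewrite -[X in _ = X + _]mul1r -e1; ring.
congr (_ + _); rewrite (qP (i, j)) rmorph_sum mulr_sumr; apply: eq_bigr => k kP.
rewrite /r /wgate /= ij kP /= !rmorphM !rmorphXn gsubstX // gsubstY // !exprMn.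
rewrite -!rmorphXn -!exprM.
set a := gsubst _ _ _; set X := x ^+ _; set Y := y ^+ _.
have -> : C (lam ^+ w i)^-1 * C (lam ^+ w j)^-1 * (a * (C (lam ^+ (wx * k.1)) * X *
   (C (lam ^+ (wy * k.2)) * Y))) = C ((lam ^+ w i)^-1 * (lam ^+ w j)^-1 *
     (lam ^+ (wx * k.1) * lam ^+ (wy * k.2))) * a * (X * Y).
  by rewrite !rmorphM; ring.
congr (C _ * _ * _); rewrite /g /=.
apply: (mulfI (ln0 (w i + w j)%N)); rewrite -[LHS]exprD subnKC; last first.
  by apply: leq_trans kP; rewrite leq_addr.
rewrite mulrA (exprD lam (w i)) [X in X * _]mulrACA !divff // !mul1r -exprD.
by rewrite (mulnC wx) (mulnC wy).
Qed.
End Determinacy.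

Definition mx3 (K : Type) (a b c d e f g h k : K) : 'M[K]_3 :=
  \matrix_(i, j) nth a (nth [::] [:: [:: a; b; c]; [:: d; e; f]; [:: g; h; k]] i) j.

Lemma mx3E (K : Type) (a b c d e f g h k : K) : let M := mx3 a b c d e f g h k in
  (((M o0 o0 = a) * (M o0 o1 = b) * (M o0 o2 = c) * (M o1 o0 = d) * (M o1 o1 = e)) *
  ((M o1 o2 = f) * (M o2 o0 = g) * (M o2 o1 = h) * (M o2 o2 = k)))%type.
Proof. by rewrite /= !mxE. Qed.

Lemma mx3_eta (K : Type) (M : 'M[K]_3) : M = mx3 (M o0 o0) (M o0 o1) (M o0 o2)
  (M o1 o0) (M o1 o1) (M o1 o2) (M o2 o0) (M o2 o1) (M o2 o2).
Proof. by apply/matrixP; apply: forall_ord3; apply: forall_ord3; rewrite mx3E. Qed.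

Section Action.
Context {R : realType} (T : germ_theory R).
Local Notation S := (gring T).
Local Notation ev := (gev T).
Local Notation C := (gcst T).
Local Notation dx := (@gdx R T).
Local Notation dy := (@gdy R T).
Local Notation x := (gX T).
Local Notation y := (gY T).

Lemma gact_sym3 (a b c d e f u v p q r p' q' r' p'' q'' r'' : S) :
  gact (sym3 a b c d e f) u v (mx3 p q r p' q' r' p'' q'' r'') = sym3
    (u * dx a + v * dy a + 2 * (p * a + p' * b + p'' * c))
    (u * dx b + v * dy b + (p * b + p' * d + p'' * e) + (q * a + q' * b + q'' * c))
    (u * dx c + v * dy c + (p * c + p' * e + p'' * f) + (r * a + r' * b + r'' * c))
    (u * dx d + v * dy d + 2 * (q * b + q' * d + q'' * e))
    (u * dx e + v * dy e + (q * c + q' * e + q'' * f) + (r * b + r' * d + r'' * e))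
    (u * dx f + v * dy f + 2 * (r * c + r' * e + r'' * f)).
Proof.
rewrite /gact !map_sym3 !sym3Z sym3D.
apply/matrixP; apply: forall_ord3; apply: forall_ord3;
  rewrite mxE [X in X + _ = _]mxE ![(_ *m _) _ _]mxE !sum_ord3 ![(mx3 _ _ _ _ _ _ _ _ _)^T _ _]mxE !sym3E !mx3E;
  ring.
Qed.

Lemma gdx_exp (a : S) n : dx (a ^+ n.+1) = n.+1%:R * (a ^+ n * dx a).
Proof.
elim: n => [|n IH]; first by rewrite expr1 expr0; ring.
by rewrite exprS gdxM IH -[n.+2]addn1 natrD (exprS a n); ring.
Qed.
Lemma gdy_exp (a : S) n : dy (a ^+ n.+1) = n.+1%:R * (a ^+ n * dy a).
Proof.
elim: n => [|n IH]; first by rewrite expr1 expr0; ring.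
by rewrite exprS gdyM IH -[n.+2]addn1 natrD (exprS a n); ring.
Qed.

Definition gdE := (@gdxD R T, @gdyD R T, @gdxM R T, @gdyM R T, @gdxN R T, @gdyN R T,
  gdx_exp, gdy_exp, @gdxX R T, @gdxY R T, @gdyX R T, @gdyY R T, @gdxC R T, @gdyC R T,
  gdx0 T, gdy0 T, gdx1 T, gdy1 T).

(** A term free of x is a multiple of y^j with j wy >= a, and n wy < a + wy forces j >= n. The
    factor k + 1 is a denominator prepared in advance: solving the infinitesimal equation requires
    rational numbers, and with the right k the witnesses have integer coefficients. *)
Lemma wideal_split wx wy n k a (c : S) : wideal wx wy a c ->
  (0 < n)%N -> (n * wy < a + wy)%N -> exists c1 c2, [/\ c = k.+1%:R * (x * c1 + y ^+ n * c2),
    wideal wx wy (a - wx) c1 & wideal wx wy (a - n * wy) c2].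
Proof.
move=> + n0 na; elim=> {c} [i j c|c d _ [c1 [c2 [-> c1P c2P]]] _ [d1 [d2 [-> d1P d2P]]]]; last first.
  exists (c1 + d1), (c2 + d2); split; [ring|exact: wideal_add|exact: wideal_add].
pose h := C (k.+1%:R^-1); have h1 : k.+1%:R * h = 1.
  by rewrite -(rmorph_nat C) -rmorphM divff ?rmorph1 // pnatr_eq0.
case: i => [|i] aij.
  exists 0, (h * c * y ^+ (j - n)).
  have nj : (n <= j)%N.
    have wy0 : (0 < wy)%N.
      by move: na aij; case: (wy) => //; rewrite !muln0 mul0n addn0; case: (a).
    by rewrite -ltnS -(ltn_pmul2r wy0); move: na aij; rewrite mulSn mul0n; lia.
  split.
  - rewrite -[in LHS](subnKC nj) exprD -[LHS]mul1r -[X in X * _ = _]h1; ring.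
  - by have := wideal_mono (0 : S) aij; rewrite mul0r; apply: wideal_weak; exact: leq_subr.
  - rewrite -(mul1r (y ^+ _)) -(expr0 x); apply: wideal_mono.
    by rewrite mul0n mulnBl leq_sub2r.
exists (h * c * (x ^+ i * y ^+ j)), 0; split.
- by rewrite exprS -[LHS]mul1r -[X in X * _ = _]h1; ring.
- by apply: wideal_mono; move: aij; rewrite mulSn; lia.
- by have := wideal_mono (0 : S) aij; rewrite mul0r; apply: wideal_weak; exact: leq_subr.
Qed.
End Action.

Section Determinacy3.
Context {R : realType} (T : germ_theory R).
Local Notation S := (gring T).
Local Notation C := (gcst T).
Local Notation x := (gX T).
Local Notation y := (gY T).
Variables (wx wy w0 w1 w2 : nat).
Local Notation wideal := (wideal (T := T) wx wy).
Local Notation whpoly := (whpoly (T := T) wx wy).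

Theorem determined_sym3 (a b c d e f : S -> S -> S) : (0 < wx)%N -> (0 < wy)%N ->
  [/\ whpoly (w0 + w0) a, whpoly (w0 + w1) b & whpoly (w0 + w2) c] ->
  [/\ whpoly (w1 + w1) d, whpoly (w1 + w2) e & whpoly (w2 + w2) f] ->
  (forall lam : R, let X := C (lam ^+ wx) * x in let Y := C (lam ^+ wy) * y in
    [/\ a X Y = C (lam ^+ (w0 + w0)) * a x y, b X Y = C (lam ^+ (w0 + w1)) * b x y &
        c X Y = C (lam ^+ (w0 + w2)) * c x y] /\
    [/\ d X Y = C (lam ^+ (w1 + w1)) * d x y, e X Y = C (lam ^+ (w1 + w2)) * e x y &
        f X Y = C (lam ^+ (w2 + w2)) * f x y]) ->
  (forall F11 F12 F13 F22 F23 F33, wideal (w0 + w0 + 1) F11 -> wideal (w0 + w1 + 1) F12 ->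
    wideal (w0 + w2 + 1) F13 -> wideal (w1 + w1 + 1) F22 -> wideal (w1 + w2 + 1) F23 ->
    wideal (w2 + w2 + 1) F33 ->
    exists u v p q r p' q' r' p'' q'' r'',
      sym3 F11 F12 F13 F22 F23 F33 =
        gact (sym3 (a x y) (b x y) (c x y) (d x y) (e x y) (f x y)) u v
          (mx3 p q r p' q' r' p'' q'' r'') /\
      ([/\ wideal (wx + 1) u & wideal (wy + 1) v] /\
      [/\ wideal (w0 + 1 - w0) p, wideal (w1 + 1 - w0) q & wideal (w2 + 1 - w0) r] /\
      [/\ wideal (w0 + 1 - w1) p', wideal (w1 + 1 - w1) q' & wideal (w2 + 1 - w1) r'] /\
      [/\ wideal (w0 + 1 - w2) p'', wideal (w1 + 1 - w2) q'' & wideal (w2 + 1 - w2) r''])) ->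
  forall Q11 Q12 Q13 Q22 Q23 Q33, wideal (w0 + w0 + 1) Q11 -> wideal (w0 + w1 + 1) Q12 ->
    wideal (w0 + w2 + 1) Q13 -> wideal (w1 + w1 + 1) Q22 -> wideal (w1 + w2 + 1) Q23 ->
    wideal (w2 + w2 + 1) Q33 ->
  gequiv (sym3 (a x y + Q11) (b x y + Q12) (c x y + Q13) (d x y + Q22) (e x y + Q23) (f x y + Q33))
    (sym3 (a x y) (b x y) (c x y) (d x y) (e x y) (f x y)).
Proof.
move=> wx0 wy0 [aP bP cP] [dP eP fP] hom solve Q11 Q12 Q13 Q22 Q23 Q33 q11 q12 q13 q22 q23 q33.
pose w (i : 'I_3) := nth 0%N [:: w0; w1; w2] i.
pose Nf i j u v := sym3 (a u v) (b u v) (c u v) (d u v) (e u v) (f u v) i j.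
have ext (g h : S -> S -> S) n n' : (n = n')%N -> whpoly n g -> (forall u v, g u v = h u v) ->
    whpoly n' h.
  move=> <- gP gh; rewrite (_ : h = g) //; apply/funext => u; apply/funext => v.
  by rewrite gh.
have NE : nf_mx Nf = sym3 (a x y) (b x y) (c x y) (d x y) (e x y) (f x y).
  by apply/matrixP => i j; rewrite mxE.
have sP : gsym (sym3 Q11 Q12 Q13 Q22 Q23 Q33) by exact: sym3_tr.
rewrite -sym3D -NE; apply: (weighted_determined wx0 wy0 (w := w)) => //.
- apply: forall_ord3; apply: forall_ord3;
    [apply: (ext _ _ _ _ _ aP)|apply: (ext _ _ _ _ _ bP)|apply: (ext _ _ _ _ _ cP)
    |apply: (ext _ _ _ _ _ bP)|apply: (ext _ _ _ _ _ dP)|apply: (ext _ _ _ _ _ eP)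
    |apply: (ext _ _ _ _ _ cP)|apply: (ext _ _ _ _ _ eP)|apply: (ext _ _ _ _ _ fP)];
    rewrite /w /= ?(addnC w1 w0) ?(addnC w2 w0) ?(addnC w2 w1) //;
    by move=> u v; rewrite /Nf sym3E.
- by move=> i j; apply/funext => u; apply/funext => v; rewrite /Nf -{1}sym3_tr mxE.
- move=> lam; have [[h1 h2 h3] [h4 h5 h6]] := hom lam.
  apply: forall_ord3; apply: forall_ord3;
    by rewrite /Nf !sym3E /w /= ?(addnC w1 w0) ?(addnC w2 w0) ?(addnC w2 w1).
- move=> F sF FP; have FE := symP sF; rewrite NE.
  have [] := solve _ _ _ _ _ _ (FP o0 o0) (FP o0 o1) (FP o0 o2) (FP o1 o1) (FP o1 o2) (FP o2 o2).
  move=> u [v [p [q [r [p' [q' [r' [p'' [q'' [r'' [E [[h1 h2] [[h3 h4 h5] [[h6 h7 h8] [h9 h10 h11]]]]]]]]]]]]]]].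
  exists u, v, (mx3 p q r p' q' r' p'' q'' r''); split=> //; last by rewrite -E.
  by apply: forall_ord3; apply: forall_ord3; rewrite mx3E.
- by apply: forall_ord3; apply: forall_ord3; rewrite sym3E /w /= ?(addnC w1 w0) ?(addnC w2 w0) ?(addnC w2 w1).
Qed.
End Determinacy3.

Ltac weight_term := lazymatch goal with
  | |- wideal _ _ _ (_ * _) => refine (widealM _ _); weight_term
  | |- wideal _ _ _ (_ ^+ _) => refine (widealX _ _); weight_term
  | |- wideal _ _ _ (- _) => refine (widealN _); weight_term
  | |- wideal _ _ _ (gX _) => exact: wideal_x
  | |- wideal _ _ _ (gY _) => exact: wideal_y
  | |- _ => first [eassumption | exact: wideal_all]
  end.
Ltac weight := lazymatch goal with
  | |- wideal _ _ _ (_ + _) => refine (wideal_add _ _); weight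
  | |- wideal _ _ _ (- _) => refine (widealN _); weight
  | |- wideal _ _ _ 0 => apply: wideal0; lia
  | |- _ => refine (wideal_weak _ _); [shelve | weight_term | ..]; try lia
  end.
Ltac wt := unshelve weight; lia.
Ltac weights := repeat match goal with |- _ /\ _ => split | |- and3 _ _ _ => split end;
  wt.
Lemma whpoly_wt (R : realType) (T : germ_theory R) wx wy a b (f : T -> T -> T) :
  a = b -> whpoly wx wy a f -> whpoly wx wy b f.
Proof. by move=> ->. Qed.
Ltac whp := lazymatch goal with
  | |- whpoly _ _ _ (fun u v => 0) => exact: whpoly_0
  | |- whpoly _ _ _ (fun u v => u) => exact: whpoly_x
  | |- whpoly _ _ _ (fun u v => v) => exact: whpoly_y
  | |- whpoly _ _ _ (fun u v => (-1) ^+ _ * _) => apply: whpoly_sign; whp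
  | |- whpoly _ _ _ (fun u v => _ + _) => apply: whpoly_add; whp
  | |- whpoly _ _ _ (fun u v => - _) => apply: whpolyN; whp
  | |- whpoly ?a ?b _ (fun u v => u ^+ ?n) => refine (whpoly_wt _ (whpolyX n (whpoly_x _ a b))); lia
  | |- whpoly ?a ?b _ (fun u v => v ^+ ?n) => refine (whpoly_wt _ (whpolyX n (whpoly_y _ a b))); lia
  end.

Arguments wideal_split {R T wx wy} n k [a c].

(** * Determinacy of the normal forms *)

Section NormalFormDeterminacy.
Context {R : realType} (T : germ_theory R).
Local Notation S := (gring T).
Local Notation C := (gcst T).
Local Notation x := (gX T).
Local Notation y := (gY T).
Variables Q11 Q12 Q13 Q22 Q23 Q33 : S.

(** The weights of x, y and of the rows are those for which every nonzero entry is homogeneous: here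
    wx = w0 + w2 = 2 w1 and wy = w0 + w1 = w2, whose solution is unique up to a factor. The same
    holds for the choices 6, 4 and 10, 6 below. The vector field takes care of the entries (1, 2)
    and (1, 3), the first column of U of (1, 1); the numerical coefficients in the other entries of
    U solve the linear system left by (2, 2), (2, 3) and (3, 3). *)
Lemma NF6_determined (s : bool) : let wideal := wideal (T := T) 4 3 in
  wideal 3 Q11 -> wideal 4 Q12 -> wideal 5 Q13 -> wideal 5 Q22 -> wideal 6 Q23 -> wideal 7 Q33 ->
  gequiv (sym3 (0 + Q11) (y + Q12) (x + Q13) (x + Q22) (0 + Q23) ((-1) ^+ s * y ^+ 2 + Q33))
    (sym3 0 y x x 0 ((-1) ^+ s * y ^+ 2)).
Proof.
rewrite /=.
apply: (@determined_sym3 R T 4 3 1 2 3 (fun u v => 0) (fun u v => v) (fun u v => u)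
  (fun u v => u) (fun u v => 0) (fun u v => (-1) ^+ s * v ^+ 2)) => //.
- by split; whp.
- by split; whp.
- by move=> lam; set sg := (-1) ^+ _; rewrite /= !rmorphXn; split; split; ring.
move=> F11 F12 F13 F22 F23 F33 f11 f12 f13 f22 f23 f33.
have [q [p [-> qP pP]]] := wideal_split 1 1 f11 isT isT.
pose sg : S := (-1) ^+ s.
have sgP : sg = 1 \/ sg = -1 by rewrite /sg; case: (s); [right|left].
have h33 : wideal 4 3 7 (F33 - (2 * sg * y * F12)) by wt.
have [p3 [q3 [E33 p3P q3P]]] := wideal_split 2 1 h33 isT isT.
have h23 : wideal 4 3 6 (F23 - (y * p3 + sg * y ^+ 2 * p)) by wt.
have [h1 [h2 [E23 h1P h2P]]] := wideal_split 2 5 h23 isT isT.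
have hg : wideal 4 3 5 (F22 - F13 + sg * y ^+ 2 * q) by wt.
have [g1 [g2 [Eg g1P g2P]]] := wideal_split 1 2 hg isT isT.
pose U32 := 3 * sg * h2.
pose U13 := p3 + sg * y * (p + U32).
pose U12 := g2 + 2 * h1; pose U23 := 4 * h1 - g2.
pose U22 := 3 * g1 + sg * q3; pose U33 := 3 * g1 + 2 * sg * q3.
have wU32 : wideal 4 3 0 U32 by exact: wideal_all.
have wU13 : wideal 4 3 3 U13 by rewrite /U13 mulrDr; wt.
have wU12 : wideal 4 3 2 U12 by rewrite /U12; wt.
have wU23 : wideal 4 3 2 U23 by rewrite /U23; wt.
have wU22 : wideal 4 3 1 U22 by rewrite /U22; wt.
have wU33 : wideal 4 3 1 U33 by rewrite /U33; wt.
exists (F13 - sg * y ^+ 2 * q - y * U23 - x * U33), (F12 - y * U22 - x * (p + U32)),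
  0, U12, U13, p, U22, U23, q, U32, U33.
split; last by weights.
move/(canRL (subrK _)) : E33 => ->; move/(canRL (subrK _)) : E23 => ->.
move/(canRL (addrK _))/(canRL (subrK _)) : Eg => ->.
rewrite gact_sym3 -/sg /U33 /U22 /U12 /U23 /U13 /U32.
by case: sgP => ->; rewrite !gdE; congr sym3; ring.
Qed.

Lemma NF7_determined :
  wideal 6 4 3 Q11 -> wideal 6 4 5 Q12 -> wideal 6 4 7 Q13 -> wideal 6 4 7 Q22 ->
  wideal 6 4 9 Q23 -> wideal 6 4 11 Q33 ->
  gequiv (sym3 (0 + Q11) (y + Q12) (x + Q13) (x + Q22) (0 + Q23) (x * y + Q33))
    (sym3 0 y x x 0 (x * y)).
Proof.
apply: (@determined_sym3 R T 6 4 1 3 5 (fun u v => 0) (fun u v => v) (fun u v => u)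
  (fun u v => u) (fun u v => 0) (fun u v => u * v)) => //.
- by split; whp.
- by split; [whp|whp|exact: (whpoly_mul (whpoly_x T 6 4) (whpoly_y T 6 4))].
- by move=> lam; rewrite /= !rmorphXn; split; split; ring.
move=> F11 F12 F13 F22 F23 F33 f11 f12 f13 f22 f23 f33.
have [q [p [-> qP pP]]] := wideal_split 1 1 f11 isT isT.
have h33 : wideal 6 4 11 (F33 - (y * F13 + x * F12 - x * y ^+ 2 * q - x ^+ 2 * p)) by wt.
have [a3 [b3 [E33 a3P b3P]]] := wideal_split 3 1 h33 isT isT.
have hg : wideal 6 4 7 (F22 - (F13 - x * y * q + 2 * y ^+ 2 * b3)) by wt.
have [g1 [g2 [Eg g1P g2P]]] := wideal_split 1 1 hg isT isT.
have h23 : wideal 6 4 9 (F23 - (y * a3 + x * g2 - 2 * x * y * b3)) by wt.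
have [h1 [h2 [E23 h1P h2P]]] := wideal_split 3 5 h23 isT isT.
(* The product x y at (3, 3) couples the equations: in the term x h1 of entry (2, 3), the multiples
   of x are absorbed by U23 and the diagonal, those of y by U32 and U13. *)
have [e' [e [Eh e'P eP]]] := wideal_split 1 0 h1P isT isT.
rewrite {h1P}Eh in E23.
pose Dl := 6 * y * e' - 12 * y * h2; pose G := 2 * g1 + 6 * y * e'.
pose U23 := 6 * x * e' - 2 * y * b3; pose U32 := 4 * e.
pose U13 := a3 + 6 * y ^+ 2 * h2 + 2 * x * e.
have wDl : wideal 6 4 1 Dl by rewrite /Dl; wt.
have wG : wideal 6 4 1 G by rewrite /G; wt.
have wU23 : wideal 6 4 3 U23 by rewrite /U23; wt.
have wU13 : wideal 6 4 5 U13 by rewrite /U13; wt.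
have wU32 : wideal 6 4 0 U32 by exact: wideal_all.
exists (F13 - x * y * q - y * U23 - x * (G + 2 * Dl)), (F12 - y * (G + Dl) - x * (p + U32)),
  0, g2, U13, p, (G + Dl), U23, q, U32, (G + 2 * Dl).
split; last by rewrite !mulrDr; weights.
move/(canRL (subrK _)) : E33 => ->; move/(canRL (subrK _)) : E23 => ->.
move/(canRL (subrK _)) : Eg => ->.
rewrite gact_sym3 /U23 /U13 /U32 /G /Dl.
by rewrite !gdE; congr sym3; ring.
Qed.

Lemma NF9_determined :
  wideal 10 6 3 Q11 -> wideal 10 6 7 Q12 -> wideal 10 6 11 Q13 -> wideal 10 6 11 Q22 ->
  wideal 10 6 15 Q23 -> wideal 10 6 19 Q33 ->
  gequiv (sym3 (0 + Q11) (y + Q12) (x + Q13) (x + Q22) (0 + Q23) (y ^+ 3 + Q33))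
    (sym3 0 y x x 0 (y ^+ 3)).
Proof.
apply: (@determined_sym3 R T 10 6 1 5 9 (fun u v => 0) (fun u v => v) (fun u v => u)
  (fun u v => u) (fun u v => 0) (fun u v => v ^+ 3)) => //.
- by split; whp.
- by split; whp.
- by move=> lam; rewrite /= !rmorphXn; split; split; ring.
move=> F11 F12 F13 F22 F23 F33 f11 f12 f13 f22 f23 f33.
have [q [p [-> qP pP]]] := wideal_split 1 1 f11 isT isT.
have h33 : wideal 10 6 19 (F33 - (3 * y ^+ 2 * F12 - 3 * x * y ^+ 2 * p)) by wt.
have [a3 [b3 [E33 a3P b3P]]] := wideal_split 3 1 h33 isT isT.
have hg : wideal 10 6 11 (F22 - (F13 - y ^+ 3 * q)) by wt.
have [g1 [g2 [Eg g1P g2P]]] := wideal_split 1 2 hg isT isT.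
have h23 : wideal 10 6 15 (F23 - y * a3) by wt.
have [h1 [h2 [E23 h1P h2P]]] := wideal_split 3 14 h23 isT isT.
pose U32 := 6 * h2; pose U13 := a3 + 9 * y ^+ 2 * h2.
pose U12 := g2 + 5 * h1; pose U23 := 10 * h1 - g2.
pose U22 := 2 * b3 + 6 * g1; pose U33 := 4 * b3 + 9 * g1.
have wU32 : wideal 10 6 0 U32 by exact: wideal_all.
have wU13 : wideal 10 6 9 U13 by rewrite /U13; wt.
have wU12 : wideal 10 6 5 U12 by rewrite /U12; wt.
have wU23 : wideal 10 6 5 U23 by rewrite /U23; wt.
have wU22 : wideal 10 6 1 U22 by rewrite /U22; wt.
have wU33 : wideal 10 6 1 U33 by rewrite /U33; wt.
exists (F13 - y ^+ 3 * q - y * U23 - x * U33), (F12 - y * U22 - x * p - x * U32),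
  0, U12, U13, p, U22, U23, q, U32, U33.
split; last by weights.
move/(canRL (subrK _)) : E33 => ->; move/(canRL (subrK _)) : E23 => ->.
move/(canRL (subrK _)) : Eg => ->.
rewrite gact_sym3 /U33 /U22 /U12 /U23 /U13 /U32.
by rewrite !gdE; congr sym3; ring.
Qed.

Lemma NF8_determined (s : bool) :
  wideal 6 4 5 Q11 -> wideal 6 4 7 Q12 -> wideal 6 4 6 Q13 -> wideal 6 4 9 Q22 ->
  wideal 6 4 8 Q23 -> wideal 6 4 7 Q33 ->
  gequiv (sym3 (y + Q11) (x + Q12) (0 + Q13) ((-1) ^+ s * y ^+ 2 + Q22) (0 + Q23) (x + Q33))
    (sym3 y x 0 ((-1) ^+ s * y ^+ 2) 0 x).
Proof.
apply: (@determined_sym3 R T 6 4 2 4 3 (fun u v => v) (fun u v => u) (fun u v => 0)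
  (fun u v => (-1) ^+ s * v ^+ 2) (fun u v => 0) (fun u v => u)) => //.
- by split; whp.
- by split; whp.
- by move=> lam; set sg := (-1) ^+ _; rewrite /= !rmorphXn; split; split; ring.
move=> F11 F12 F13 F22 F23 F33 f11 f12 f13 f22 f23 f33.
pose sg : S := (-1) ^+ s.
have sgP : sg = 1 \/ sg = -1 by rewrite /sg; case: (s); [right|left].
have h22 : wideal 6 4 9 (F22 - 2 * sg * y * F11) by wt.
have [a [b [E22 aP bP]]] := wideal_split 2 1 h22 isT isT.
have h12 : wideal 6 4 7 (F12 - (F33 + y * a)) by wt.
have [g [h [E12 gP hP]]] := wideal_split 2 2 h12 isT isT.
have [p [p' [E13 pP p'P]]] := wideal_split 1 0 f13 isT isT.
have [r [r' [E23 rP r'P]]] := wideal_split 2 0 f23 isT isT.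
pose U11 := g + sg * b; pose U22 := 2 * g + 3 * sg * b; pose U33 := 2 * sg * b.
pose U21 := sg * h; pose U12 := a + 2 * sg * y * U21.
have wU11 : wideal 6 4 1 U11 by rewrite /U11; wt.
have wU22 : wideal 6 4 1 U22 by rewrite /U22; wt.
have wU33 : wideal 6 4 1 U33 by rewrite /U33; wt.
have wU21 : wideal 6 4 0 U21 by exact: wideal_all.
have wU12 : wideal 6 4 3 U12 by rewrite /U12; wt.
exists (F33 - 2 * x * U33), (F11 - 2 * y * U11 - 2 * x * U21),
  U11, U12, p', U21, U22, (sg * r'), (p - sg * r'), (r - p'), U33.
split; last by weights.
move/(canRL (subrK _)) : E22 => ->; move/(canRL (subrK _)) : E12 => ->.
rewrite E13 E23 gact_sym3 -/sg /U12 /U11 /U22 /U33 /U21.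
by case: sgP => ->; rewrite !gdE; congr sym3; ring.
Qed.

Lemma NF10_determined :
  wideal 10 6 7 Q11 -> wideal 10 6 11 Q12 -> wideal 10 6 9 Q13 -> wideal 10 6 15 Q22 ->
  wideal 10 6 13 Q23 -> wideal 10 6 11 Q33 ->
  gequiv (sym3 (y + Q11) (x + Q12) (0 + Q13) (0 + Q22) (y ^+ 2 + Q23) (x + Q33))
    (sym3 y x 0 0 (y ^+ 2) x).
Proof.
apply: (@determined_sym3 R T 10 6 3 7 5 (fun u v => v) (fun u v => u) (fun u v => 0)
  (fun u v => 0) (fun u v => v ^+ 2) (fun u v => u)) => //.
- by split; whp.
- by split; whp.
- by move=> lam; rewrite /= !rmorphXn; split; split; ring.
move=> F11 F12 F13 F22 F23 F33 f11 f12 f13 f22 f23 f33.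
have [a [b [E22 aP bP]]] := wideal_split 2 1 f22 isT isT.
have h12 : wideal 10 6 11 (F12 - (F33 + y * a)) by wt.
have [g [h [E12 gP hP]]] := wideal_split 2 2 h12 isT isT.
have h23 : wideal 10 6 13 (F23 - (2 * y * F11 + x * b)) by wt.
have [k [l [E23 kP lP]]] := wideal_split 2 0 h23 isT isT.
have h13 : wideal 10 6 9 (F13 - y * k) by wt.
have [m [n [E13 mP nP]]] := wideal_split 2 14 h13 isT isT.
pose U21 := 3 * n; pose U13 := k + 4 * y * U21.
pose U33 := 2 * l - g; pose U22 := 3 * l + g.
have wU21 : wideal 10 6 0 U21 by exact: wideal_all.
have wU13 : wideal 10 6 3 U13 by rewrite /U13; wt.
have wU33 : wideal 10 6 1 U33 by rewrite /U33; wt.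
have wU22 : wideal 10 6 1 U22 by rewrite /U22; wt.
have wU23 : wideal 10 6 0 (5 * m - h) by exact: wideal_all.
exists (F33 - 2 * y ^+ 2 * (5 * m - h) - 2 * x * U33), (F11 - 2 * y * l - 2 * x * U21),
  l, a, U13, U21, U22, (5 * m - h), (10 * m + h), b, U33.
split; last by weights.
move/(canRL (subrK _)) : E12 => ->; move/(canRL (subrK _)) : E23 => ->.
move/(canRL (subrK _)) : E13 => ->.
rewrite E22 gact_sym3 /U13 /U33 /U22 /U21.
by rewrite !gdE; congr sym3; ring.
Qed.

Lemma NF4_determined (s1 s2 : bool) l1 l2 : (l2 <= l1)%N -> (0 < l2)%N -> (2 <= l1)%N ->
  wideal (l1 + l2) 2 (l1 + l1 + 1) Q11 -> wideal (l1 + l2) 2 (l1 + l2 + 1) Q12 ->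
  wideal (l1 + l2) 2 (l1 + 1 + 1) Q13 -> wideal (l1 + l2) 2 (l2 + l2 + 1) Q22 ->
  wideal (l1 + l2) 2 (l2 + 1 + 1) Q23 -> wideal (l1 + l2) 2 3 Q33 ->
  gequiv (sym3 ((-1) ^+ s1 * y ^+ l1 + Q11) (x + Q12) (0 + Q13) ((-1) ^+ s2 * y ^+ l2 + Q22)
      (0 + Q23) (y + Q33))
    (sym3 ((-1) ^+ s1 * y ^+ l1) x 0 ((-1) ^+ s2 * y ^+ l2) 0 y).
Proof.
case: l1 => [|n1] //; case: l2 => [|n2] // h21 _ h1.
apply: (@determined_sym3 R T (n1.+1 + n2.+1) 2 n1.+1 n2.+1 1
  (fun u v => (-1) ^+ s1 * v ^+ n1.+1) (fun u v => u) (fun u v => 0)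
  (fun u v => (-1) ^+ s2 * v ^+ n2.+1) (fun u v => 0) (fun u v => v)) => //.
- by split; whp.
- by split; whp.
- move=> lam; set sg1 := (-1) ^+ s1; set sg2 := (-1) ^+ s2.
  rewrite /= !exprMn -!rmorphXn -!exprM !mulr0 !mul2n -!addnn.
  by split; split=> //; ring.
move=> F11 F12 F13 F22 F23 F33 f11 f12 f13 f22 f23 f33.
pose sg1 : S := (-1) ^+ s1; pose sg2 : S := (-1) ^+ s2.
have sg1P : sg1 = 1 \/ sg1 = -1 by rewrite /sg1; case: (s1); [right|left].
have sg2P : sg2 = 1 \/ sg2 = -1 by rewrite /sg2; case: (s2); [right|left].
have h11 : wideal (n1.+1 + n2.+1) 2 (n1.+1 + n1.+1 + 1)
  (F11 - sg1 * n1.+1%:R * y ^+ n1 * F33) by wt.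
have [|a [b [E11 aP bP]]] := wideal_split n1.+1 1 h11 isT; first lia.
have h22 : wideal (n1.+1 + n2.+1) 2 (n2.+1 + n2.+1 + 1)
  (F22 - sg2 * n2.+1%:R * y ^+ n2 * F33) by wt.
have [|a' [b' [E22 a'P b'P]]] := wideal_split n2.+1 1 h22 isT; first lia.
have [|d [c [E13 dP cP]]] := wideal_split 1 0 f13 isT; first lia.
have [|d' [c' [E23 d'P c'P]]] := wideal_split 1 0 f23 isT; first lia.
exists (F12 - x * (sg1 * b) - a * (sg2 * y ^+ n2.+1) - a' * (sg1 * y ^+ n1.+1) - x * (sg2 * b')),
  F33, (sg1 * b), a', d', a, (sg2 * b'), d, (c - sg1 * y ^+ n1 * d'), (c' - sg2 * y ^+ n2 * d), 0.
split; last by weights.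
move/(canRL (subrK _)) : E11 => ->; move/(canRL (subrK _)) : E22 => ->.
rewrite E13 E23 gact_sym3 -/sg1 -/sg2.
by case: sg1P => ->; case: sg2P => ->; rewrite !gdE !exprS; congr sym3; ring.
Qed.

Lemma NF5_determined l : (2 <= l)%N ->
  wideal (l + l) 2 (l + l + 1) Q11 -> wideal (l + l) 2 (l + l + 1) Q12 ->
  wideal (l + l) 2 (l + 1 + 1) Q13 -> wideal (l + l) 2 (l + l + 1) Q22 ->
  wideal (l + l) 2 (l + 1 + 1) Q23 -> wideal (l + l) 2 3 Q33 ->
  gequiv (sym3 (x + Q11) (y ^+ l + Q12) (0 + Q13) (x + Q22) (0 + Q23) (y + Q33))
    (sym3 x (y ^+ l) 0 x 0 y).
Proof.
case: l => [|n] // h1.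
apply: (@determined_sym3 R T (n.+1 + n.+1) 2 n.+1 n.+1 1
  (fun u v => u) (fun u v => v ^+ n.+1) (fun u v => 0)
  (fun u v => u) (fun u v => 0) (fun u v => v)) => //.
- by split; whp.
- by split; whp.
- by move=> lam; rewrite /= !exprMn -!rmorphXn -!exprM !mulr0 mul2n -addnn.
move=> F11 F12 F13 F22 F23 F33 f11 f12 f13 f22 f23 f33.
have h12 : wideal (n.+1 + n.+1) 2 (n.+1 + n.+1 + 1) (F12 - n.+1%:R * y ^+ n * F33) by wt.
have [|a [b [E12 aP bP]]] := wideal_split n.+1 1 h12 isT; first lia.
have h22 : wideal (n.+1 + n.+1) 2 (n.+1 + n.+1 + 1) (F22 - F11) by wt.
have [|g [h [E22 gP hP]]] := wideal_split n.+1 3 h22 isT; first lia.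
have [|d [c [E13 dP cP]]] := wideal_split 1 0 f13 isT; first lia.
have [|d' [c' [E23 d'P c'P]]] := wideal_split 1 0 f23 isT; first lia.
exists (F11 - 2 * x * b + 2 * x * g - 2 * y ^+ n.+1 * a + 2 * y ^+ n.+1 * h), F33,
  (b - g), (a + h), d, (a - h), (b + g), d', (c - y ^+ n * d'), (c' - y ^+ n * d), 0.
split; last by weights.
move/(canRL (subrK _)) : E12 => ->; move/(canRL (subrK _)) : E22 => ->.
rewrite E13 E23 gact_sym3.
by rewrite !gdE !exprS; congr sym3; ring.
Qed.
End NormalFormDeterminacy.

(** * Unfoldings of the representative pencils *)

Section PencilUnfolding3.
Context {R : realType} (T : germ_theory R).
Local Notation S := (gring T).
Local Notation ev := (gev T).
Local Notation C := (gcst T).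
Local Notation dx := (@gdx R T).
Local Notation dy := (@gdy R T).
Local Notation x := (gX T).
Local Notation y := (gY T).
Implicit Types (A : 'M[S]_3) (P Q : 'M[R]_3).

Definition jet1 A P Q := forall i j, [/\ ev (A i j) = 0, ev (dx (A i j)) = P i j &
  ev (dy (A i j)) = Q i j].

Lemma pencil_sym3 (a b c d e f a' b' c' d' e' f' : R) :
  pencil T (sym3 a b c d e f) (sym3 a' b' c' d' e' f') =
  sym3 (x * C a + y * C a') (x * C b + y * C b') (x * C c + y * C c')
    (x * C d + y * C d') (x * C e + y * C e') (x * C f + y * C f').
Proof. by rewrite /pencil !map_sym3 !sym3Z sym3D. Qed.

Lemma pencil_unfold3 P Q P0 Q0 P1 Q1 P2 Q2 : P^T = P -> Q^T = Q ->
  P0^T = P0 -> Q0^T = Q0 -> P1^T = P1 -> Q1^T = Q1 -> P2^T = P2 -> Q2^T = Q2 ->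
  (forall F11 F12 F13 F22 F23 F33, [/\ ev F11 = 0, ev F12 = 0 & ev F13 = 0] ->
    [/\ ev F22 = 0, ev F23 = 0 & ev F33 = 0] ->
    exists u v p q r p' q' r' p'' q'' r'' s0 s1 s2, ev u = 0 /\ ev v = 0 /\
    sym3 F11 F12 F13 F22 F23 F33 = gact (pencil T P Q) u v (mx3 p q r p' q' r' p'' q'' r'') +
      (s0 *: pencil T P0 Q0 + s1 *: pencil T P1 Q1 + s2 *: pencil T P2 Q2)) ->
  forall A, gsym A -> jet1 A P Q -> exists t0 t1 t2, [/\ ev t0 = 0, ev t1 = 0, ev t2 = 0 &
    gequiv A (pencil T P Q + (t0 *: pencil T P0 Q0 + t1 *: pencil T P1 Q1 + t2 *: pencil T P2 Q2))].
Proof.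
move=> sP sQ sP0 sQ0 sP1 sQ1 sP2 sQ2 solve A sA AP.
pose Ps (s : 'I_3) := nth P0 [:: P0; P1; P2] s; pose Qs (s : 'I_3) := nth Q0 [:: Q0; Q1; Q2] s.
have [|||t [t0 tE]] := pencil_unfold (T := T) (Ps := Ps) (Qs := Qs) sP sQ _ _ _ sA AP.
- exact: forall_ord3.
- exact: forall_ord3.
- move=> F sF Fm; have [||u [v [p [q [r [p' [q' [r' [p'' [q'' [r'' [s0 [s1 [s2 [u0 [v0 E]]]]]]]]]]]]]]]] :=
    solve (F o0 o0) (F o0 o1) (F o0 o2) (F o1 o1) (F o1 o2) (F o2 o2); try by split.
  exists u, v, (mx3 p q r p' q' r' p'' q'' r''), (fun s => nth 0 [:: s0; s1; s2] s).
  by split=> //; rewrite sum_ord3 -E; exact: symP.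
exists (t o0), (t o1), (t o2); split; try exact: t0.
by rewrite sum_ord3 in tE.
Qed.

(** As in [wideal_split], the factor k + 1 clears denominators in the witnesses that follow. *)
Lemma hadamard_mul k (c : S) : ev c = 0 -> exists a b, c = k.+1%:R * (x * a + y * b).
Proof.
move=> c0; have [a [b [E _ _]]] := wideal_split 1 k (ev0_wideal 1 c0) isT isT.
by exists a, b; rewrite E expr1.
Qed.

Let Cs := (rmorph0 C, rmorph1 C, rmorphN C, mulr0, mulr1, addr0, add0r, mulrN).
Let sym0 : (0 : 'M[R]_3)^T = 0 := trmx0 _ _ _.

Local Ltac start := refine (pencil_unfold3 _ _ _ _ _ _ _ _ _);
  [exact: sym3_tr|exact: sym3_tr|try exact: sym3_tr; exact: sym0|try exact: sym3_tr; exact: sym0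
  |try exact: sym3_tr; exact: sym0|try exact: sym3_tr; exact: sym0
  |try exact: sym3_tr; exact: sym0|try exact: sym3_tr; exact: sym0|];
  move=> F11 F12 F13 F22 F23 F33 [f11 f12 f13] [f22 f23 f33].
Local Ltac evs := rewrite ?(rmorphD, rmorphN, rmorphM, gevX, gevY);
  repeat match goal with H : _ = 0 |- _ => rewrite H end;
  rewrite ?(mul0r, mulr0, oppr0, addr0).
Local Ltac finish := rewrite ?pencil_sym3 !Cs gact_sym3 ?sym3Z ?sym3D.

Lemma pencil0 : pencil T 0 0 = 0.
Proof. by rewrite /pencil !map_mx0 !scaler0 addr0. Qed.

(** Every matrix vanishing at 0 is tangent, with a vector field vanishing at 0. The slice is
    therefore empty, encoded by three zero matrices, and the 1-jet determines A. The next two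
    pencils behave in the same way. *)
Lemma NF1_unfold A : gsym A -> jet1 A (sym3 1 0 0 0 0 1) (sym3 0 0 0 1 0 (-1)) ->
  gequiv A (sym3 x 0 0 y 0 (x - y)).
Proof.
move=> sA jA; suff [t0 [t1 [t2 [_ _ _]]]] : exists t0 t1 t2, [/\ ev t0 = 0, ev t1 = 0, ev t2 = 0 &
  gequiv A (pencil T (sym3 1 0 0 0 0 1) (sym3 0 0 0 1 0 (-1)) + (t0 *: pencil T 0 0 + t1 *: pencil T 0 0 + t2 *: pencil T 0 0))].
  by rewrite pencil0 !scaler0 !addr0 pencil_sym3 !Cs.
move: A sA jA; start.
have [a [b E1]] := @hadamard_mul 1 (F33 - F11 + F22) ltac:(by evs).
have [c [d E2]] := @hadamard_mul 0 F12 f12.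
have [e [f E3]] := @hadamard_mul 0 F13 f13.
have [g [h E4]] := @hadamard_mul 0 F23 f23.
exists (F11 + 2 * a * x), (F22 - 2 * b * y), (- a), c, (e + f), d, b, (g + h), (- f), g, 0, 0, 0, 0.
split; first by evs. split; first by evs.
rewrite !pencil0 !scaler0 !addr0; finish.
have {}E1 : F33 = 2 * (x * a + y * b) + F11 - F22 by rewrite -E1; ring.
rewrite E1 E2 E3 E4 !gdE; congr sym3; ring.
Qed.

Lemma sign_cases (s : bool) : exists sg : S, [/\ sg = 1 \/ sg = -1,
  C ((-1) ^+ s) = sg & (-1) ^+ s = sg].
Proof.
exists ((-1) ^+ s); rewrite rmorphXn rmorphN rmorph1.
by split=> //; case: s; [right|left].
Qed.

Lemma NF2_unfold (s : bool) A : gsym A ->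
  jet1 A (sym3 1 0 0 0 0 ((-1) ^+ s)) (sym3 0 0 0 1 0 ((-1) ^+ s)) ->
  gequiv A (sym3 x 0 0 y 0 ((-1) ^+ s * (x + y))).
Proof.
have [sg [sgP sgR sgS]] := sign_cases s.
set P := sym3 1 0 0 0 0 _; set Q := sym3 0 0 0 1 0 _.
have PQ : pencil T P Q = sym3 x 0 0 y 0 (sg * (x + y)).
  by rewrite pencil_sym3 sgR !Cs; congr sym3; ring.
move=> sA jA; suff [t0 [t1 [t2 [_ _ _]]]] : exists t0 t1 t2, [/\ ev t0 = 0, ev t1 = 0, ev t2 = 0 &
  gequiv A (pencil T P Q + (t0 *: pencil T 0 0 + t1 *: pencil T 0 0 + t2 *: pencil T 0 0))].
  by rewrite pencil0 !scaler0 !addr0 PQ sgS.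
move: A sA jA; start.
have [a [b E1]] := @hadamard_mul 1 (F33 - sg * F11 - sg * F22) ltac:(by evs).
have [c [d E2]] := @hadamard_mul 0 F12 f12.
have [e [f E3]] := @hadamard_mul 0 F13 f13.
have [g [h E4]] := @hadamard_mul 0 F23 f23.
exists (F11 + 2 * sg * a * x), (F22 + 2 * sg * b * y), (- (sg * a)), c, (e - f), d, (- (sg * b)), (h - g),
  (sg * f), (sg * g), 0, 0, 0, 0.
split; first by evs. split; first by evs.
rewrite !pencil0 !scaler0 !addr0 PQ gact_sym3.
have {}E1 : F33 = 2 * (x * a + y * b) + sg * F11 + sg * F22 by rewrite -E1; ring.
by rewrite E1 E2 E3 E4; case: sgP => ->; rewrite !gdE; congr sym3; ring.
Qed.

Lemma NF3_unfold (s : bool) A : gsym A ->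
  jet1 A (sym3 ((-1) ^+ s) 0 0 1 0 (-1)) (sym3 0 0 0 0 1 0) ->
  gequiv A (sym3 ((-1) ^+ s * x) 0 0 x y (- x)).
Proof.
have [sg [sgP sgR sgS]] := sign_cases s.
set P := sym3 _ 0 0 1 0 _; set Q := sym3 0 0 0 0 1 _.
have PQ : pencil T P Q = sym3 (sg * x) 0 0 x y (- x).
  by rewrite pencil_sym3 sgR !Cs; congr sym3; ring.
move=> sA jA; suff [t0 [t1 [t2 [_ _ _]]]] : exists t0 t1 t2, [/\ ev t0 = 0, ev t1 = 0, ev t2 = 0 &
  gequiv A (pencil T P Q + (t0 *: pencil T 0 0 + t1 *: pencil T 0 0 + t2 *: pencil T 0 0))].
  by rewrite pencil0 !scaler0 !addr0 PQ sgS.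
move: A sA jA; start.
have [a [b E1]] := @hadamard_mul 1 (F22 - sg * F11) ltac:(by evs).
have [a' [b' E1']] := @hadamard_mul 1 (F33 + sg * F11) ltac:(by evs).
have [c [d E2]] := @hadamard_mul 0 F12 f12.
have [e [f E3]] := @hadamard_mul 0 F13 f13.
exists (sg * F11), (F23 - y * a + x * b - x * b' + y * a'), 0, (sg * (c - f)), (sg * (e + d)),
  f, a, b', d, b, (- a'), 0, 0, 0.
split; first by evs. split; first by evs.
rewrite !pencil0 !scaler0 !addr0 PQ gact_sym3.
have {}E1 : F22 = 2 * (x * a + y * b) + sg * F11 by rewrite -E1; ring.
have {}E1' : F33 = 2 * (x * a' + y * b') - sg * F11 by rewrite -E1'; ring.
by rewrite E1 E1' E2 E3; case: sgP => ->; rewrite !gdE; congr sym3; ring.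
Qed.

(** What the tangent space of the pencil misses is supplied by y at (1, 1) and y at (2, 2). Their
    coefficients vanish at 0 because the 1-jet of A is already that of the pencil. *)
Lemma diag_unfold (eps : R) A : gsym A ->
  jet1 A (sym3 0 1 0 0 0 0) (sym3 0 0 0 eps 0 1) ->
  exists t0 t1, [/\ ev t0 = 0, ev t1 = 0 &
    gequiv A (sym3 (y * t0) x 0 (y * (C eps + t1)) 0 y)].
Proof.
set P := sym3 _ 1 0 _ _ _; set Q := sym3 _ 0 0 eps _ _.
have PQ : pencil T P Q = sym3 0 x 0 (C eps * y) 0 y.
  by rewrite pencil_sym3 !Cs; congr sym3; ring.
move=> sA jA; pose Q0 : 'M[R]_3 := sym3 1 0 0 0 0 0; pose Q1 : 'M[R]_3 := sym3 0 0 0 1 0 0.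
have SE (M : 'M[R]_3) : pencil T 0 M = y *: map_mx C M by rewrite /pencil map_mx0 scaler0 add0r.
suff [t0 [t1 [t2 [e0 e1 _]]]] : exists t0 t1 t2, [/\ ev t0 = 0, ev t1 = 0, ev t2 = 0 &
  gequiv A (pencil T P Q + (t0 *: pencil T 0 Q0 + t1 *: pencil T 0 Q1 + t2 *: pencil T 0 0))].
  move=> E; exists t0, t1; split=> //; move: E; congr (gequiv _ _).
  rewrite pencil0 scaler0 !addr0 PQ !SE !map_sym3 !sym3Z !sym3D !Cs.
  by congr sym3; ring.
move: A sA jA; start.
have [a [b E1]] := @hadamard_mul 1 F11 f11.
have [c [d E2]] := @hadamard_mul 1 (F22 - C eps * F33) ltac:(by evs).
have [e [f E3]] := @hadamard_mul 0 F13 f13.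
have [g [h E4]] := @hadamard_mul 0 F23 f23.
exists (F12 - C eps * y * a), F33, 0, c, g, a, 0, e, f, (h - C eps * e), 0, (2 * b), (2 * d), 0.
split; first by evs. split; first by evs.
have {}E2 : F22 = 2 * (x * c + y * d) + C eps * F33 by rewrite -E2; ring.
rewrite pencil0 scaler0 !addr0 PQ !SE !map_sym3 gact_sym3 !sym3Z !sym3D !Cs.
by rewrite E1 E2 E3 E4 !gdE; congr sym3; ring.
Qed.

(** Subtracting multiples of x from both diagonal entries is done by the vector field, so the slice
    is y times the traceless symmetric matrices of size 2. *)
Lemma scalar_unfold A : gsym A -> jet1 A (sym3 1 0 0 1 0 0) (sym3 0 0 0 0 0 1) ->
  exists t0 t1, [/\ ev t0 = 0, ev t1 = 0 &
    gequiv A (sym3 (x + y * t0) (y * t1) 0 (x - y * t0) 0 y)].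
Proof.
set P := sym3 _ 0 0 1 _ _; set Q := sym3 _ 0 0 _ _ 1.
have PQ : pencil T P Q = sym3 x 0 0 x 0 y.
  by rewrite pencil_sym3 !Cs; congr sym3; ring.
move=> sA jA; pose Q0 : 'M[R]_3 := sym3 1 0 0 (-1) 0 0; pose Q1 : 'M[R]_3 := sym3 0 1 0 0 0 0.
have SE (M : 'M[R]_3) : pencil T 0 M = y *: map_mx C M by rewrite /pencil map_mx0 scaler0 add0r.
suff [t0 [t1 [t2 [e0 e1 _]]]] : exists t0 t1 t2, [/\ ev t0 = 0, ev t1 = 0, ev t2 = 0 &
  gequiv A (pencil T P Q + (t0 *: pencil T 0 Q0 + t1 *: pencil T 0 Q1 + t2 *: pencil T 0 0))].
  move=> E; exists t0, t1; split=> //; move: E; congr (gequiv _ _).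
  rewrite pencil0 scaler0 !addr0 PQ !SE !map_sym3 !sym3Z !sym3D !Cs.
  by congr sym3; ring.
move: A sA jA; start.
have [a [b E1]] := @hadamard_mul 1 (F11 - F22) ltac:(by evs).
have [c [d E2]] := @hadamard_mul 0 F12 f12.
have [e [f E3]] := @hadamard_mul 0 F13 f13.
have [g [h E4]] := @hadamard_mul 0 F23 f23.
exists (F22 + y * b), F33, a, c, e, 0, 0, g, f, h, 0, b, d, 0.
split; first by evs. split; first by evs.
have {}E1 : F11 = 2 * (x * a + y * b) + F22 by rewrite -E1; ring.
rewrite pencil0 scaler0 !addr0 PQ !SE !map_sym3 gact_sym3 !sym3Z !sym3D !Cs.
by rewrite E1 E2 E3 E4 !gdE; congr sym3; ring.
Qed.

(** Only the entry (3, 3) of the pencil, which is 0, cannot be corrected by the action; the slice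
    lives there, with one coefficient for x and one for y. *)
Lemma block3_unfold A : gsym A -> jet1 A (sym3 0 0 1 1 0 0) (sym3 0 1 0 0 0 0) ->
  exists t0 t1, [/\ ev t0 = 0, ev t1 = 0 &
    gequiv A (sym3 0 y x x 0 (x * t0 + y * t1))].
Proof.
set P := sym3 _ 0 1 1 _ _; set Q := sym3 _ 1 0 _ _ _.
have PQ : pencil T P Q = sym3 0 y x x 0 0.
  by rewrite pencil_sym3 !Cs; congr sym3; ring.
move=> sA jA; pose Q0 : 'M[R]_3 := sym3 0 0 0 0 0 1.
suff [t0 [t1 [t2 [e0 e1 _]]]] : exists t0 t1 t2, [/\ ev t0 = 0, ev t1 = 0, ev t2 = 0 &
  gequiv A (pencil T P Q + (t0 *: pencil T Q0 0 + t1 *: pencil T 0 Q0 + t2 *: pencil T 0 0))].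
  move=> E; exists t0, t1; split=> //; move: E; congr (gequiv _ _).
  rewrite pencil0 scaler0 !addr0 PQ /pencil !map_mx0 !map_sym3 !scaler0 add0r addr0 !sym3Z !sym3D !Cs.
  by congr sym3; ring.
move: A sA jA; start.
have [a [b E1]] := @hadamard_mul 1 F11 f11.
have [c [d E2]] := @hadamard_mul 2 F23 f23.
have [e [f E3]] := @hadamard_mul 2 (F22 - F13) ltac:(by evs).
have [g [h E4]] := @hadamard_mul 0 F33 f33.
exists (F13 + 3 * x * e - y * (2 * c - f)), (F12 + 3 * y * e - x * b), (- (3 * e)), (f + c), (3 * d), b, 0,
  (2 * c - f), a, 0, 0, (g - 6 * d), h, 0.
split; first by evs. split; first by evs.
have {}E3 : F22 = 3 * (x * e + y * f) + F13 by rewrite -E3; ring.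
rewrite pencil0 scaler0 !addr0 PQ /pencil !map_mx0 !map_sym3 !scaler0 add0r addr0 gact_sym3 !sym3Z !sym3D !Cs.
by rewrite E1 E2 E3 E4 !gdE; congr sym3; ring.
Qed.

(** Here the entries (2, 2) and (2, 3) of the pencil are 0. At (2, 3) a multiple of x is absorbed by
    U, so that only y remains. *)
Lemma block21_unfold A : gsym A -> jet1 A (sym3 0 1 0 0 0 1) (sym3 1 0 0 0 0 0) ->
  exists t0 t1 t2, [/\ ev t0 = 0, ev t1 = 0, ev t2 = 0 &
    gequiv A (sym3 y x 0 (x * t0 + y * t1) (y * t2) x)].
Proof.
set P := sym3 _ 1 0 0 _ _; set Q := sym3 _ 0 0 0 _ _.
have PQ : pencil T P Q = sym3 y x 0 0 0 x.
  by rewrite pencil_sym3 !Cs; congr sym3; ring.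
move=> sA jA; pose Q0 : 'M[R]_3 := sym3 0 0 0 1 0 0; pose Q1 : 'M[R]_3 := sym3 0 0 0 0 1 0.
suff [t0 [t1 [t2 [e0 e1 e2]]]] : exists t0 t1 t2, [/\ ev t0 = 0, ev t1 = 0, ev t2 = 0 &
  gequiv A (pencil T P Q + (t0 *: pencil T Q0 0 + t1 *: pencil T 0 Q0 + t2 *: pencil T 0 Q1))].
  move=> E; exists t0, t1, t2; split=> //; move: E; congr (gequiv _ _).
  rewrite PQ /pencil !map_mx0 !map_sym3 !scaler0 !add0r addr0 !sym3Z !sym3D !Cs.
  by congr sym3; ring.
move: A sA jA; start.
have [a [b E1]] := @hadamard_mul 0 (F12 - F33) ltac:(by evs).
have [c [d E2]] := @hadamard_mul 0 F13 f13.
have [e [g E3]] := @hadamard_mul 0 F22 f22.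
have [h [k E4]] := @hadamard_mul 0 F23 f23.
exists F33, (F11), 0, b, d, 0, a, 0, c, (h - d), 0, (e - 2 * b), g, k.
split; first by evs. split; first by evs.
have {}E1 : F12 = (x * a + y * b) + F33 by rewrite -[x * a + _]mul1r -E1; ring.
rewrite PQ /pencil !map_mx0 !map_sym3 !scaler0 !add0r addr0 gact_sym3 !sym3Z !sym3D !Cs.
by rewrite E1 E2 E3 E4 !gdE; congr sym3; ring.
Qed.
End PencilUnfolding3.

(** * Codimensions *)

Section TangentModule.
Context {R : realType} (T : germ_theory R).
Local Notation S := (gring T).
Local Notation ev := (gev T).
Local Notation C := (gcst T).
Local Notation dx := (@gdx R T).
Local Notation dy := (@gdy R T).
Local Notation x := (gX T).
Local Notation y := (gY T).
Implicit Types (A F G : 'M[S]_3).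

Lemma gtangD A F G : gtang A F -> gtang A G -> gtang A (F + G).
Proof.
move=> [u [v [U ->]]] [u' [v' [U' ->]]]; exists (u + u'), (v + v'), (U + U').
rewrite /gact !scalerDl linearD /= mulmxDl mulmxDr.
by apply/matrixP => i j; rewrite !mxE; ring.
Qed.

(** The extended tangent space is a module over the ring of germs, not just a real subspace, since
    u, v and U are arbitrary germs. *)
Lemma gtangZ A F a : gtang A F -> gtang A (a *: F).
Proof.
move=> [u [v [U ->]]]; exists (a * u), (a * v), (a *: U).
by rewrite /gact !scalerDr !scalerA linearZ /= -scalemxAl -scalemxAr.
Qed.

Lemma gtang0 A : gtang A 0.
Proof.
exists 0, 0, 0; rewrite /gact !scale0r trmx0 mul0mx mulmx0.
by apply/matrixP => i j; rewrite !mxE; ring.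
Qed.

Lemma gtang_sum A (I : Type) (s : seq I) (f : I -> 'M[S]_3) :
  (forall i, gtang A (f i)) -> gtang A (\sum_(i <- s) f i).
Proof.
move=> fi; elim: s => [|i s IH]; first by rewrite big_nil; exact: gtang0.
by rewrite big_cons; exact: gtangD.
Qed.

(* Each of the independent elements b_i is a combination of the d spanning ones, so
   more than d of them would be dependent. *)
Lemma gspan_indep A d (I : finType) (b : I -> 'M[S]_3) : gspan A d -> (forall i, gsym (b i)) ->
  (forall c : I -> R, gtang A (\sum_i C (c i) *: b i) -> forall i, c i = 0) -> (#|I| <= d)%N.
Proof.
move=> [e [se eP]] sb bI.
have /choice[m mP] : forall i, exists c : 'I_d -> R, gtang A (b i - \sum_j C (c j) *: e j).
  by move=> i; apply: eP.
pose M : 'M[R]_(#|I|, d) := \matrix_(k, j) m (enum_val k) j.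
suff : row_free M by rewrite /row_free => /eqP <-; exact: rank_leq_col.
apply: inj_row_free => w w0; apply/rowP => k; rewrite mxE.
pose c (i : I) := w 0 (enum_rank i).
suff : c (enum_val k) = 0 by rewrite /c enum_valK.
apply: bI; have -> : \sum_i C (c i) *: b i = \sum_i C (c i) *: (b i - \sum_j C (m i j) *: e j).
  under [RHS]eq_bigr do rewrite scalerBr scaler_sumr.
  rewrite sumrB exchange_big /= [X in _ - X]big1 ?subr0 // => j _.
  under eq_bigr do rewrite scalerA -rmorphM.
  rewrite -scaler_suml -rmorph_sum /= (_ : \sum_i c i * m i j = 0) ?rmorph0 ?scale0r //.
  transitivity ((w *m M) 0 j); last by rewrite w0 mxE.
  rewrite mxE [RHS](reindex (@enum_rank I)) /=; last by apply: onW_bij; exact: enum_rank_bij.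
  by apply: eq_bigr => i _; rewrite mxE enum_rankK.
by apply: gtang_sum => i; exact/gtangZ/mP.
Qed.

Lemma gspan_count A d n m (Pi : 'M[S]_3 -> 'rV[R]_n) (K : 'M[R]_(m, n)) :
  (forall F G, Pi (F + G) = Pi F + Pi G) -> (forall c F, Pi (C c *: F) = c *: Pi F) ->
  (forall w, exists2 F, gsym F & Pi F = w) -> (forall F, gtang A F -> (Pi F <= K)%MS) ->
  gspan A d -> (n <= \rank K + d)%N.
Proof.
move=> PD PZ Psurj PT [e [se eP]].
have P0 : Pi 0 = 0 by rewrite -(scale0r 0) -(rmorph0 C) PZ scale0r.
pose E : 'M[R]_(d, n) := \matrix_(j < d) Pi (e j).
have full : (1%:M <= K + E)%MS.
  apply/row_subP => i; have [F sF <-] := Psurj (row i 1%:M).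
  have [c cT] := eP F sF.
  have -> : F = (F - \sum_j C (c j) *: e j) + \sum_j C (c j) *: e j by rewrite subrK.
  rewrite PD; apply: addmx_sub_adds; first exact: PT.
  have -> : Pi (\sum_j C (c j) *: e j) = \sum_j c j *: Pi (e j).
    elim/big_rec2: _ => [//|j F1 F2 _ E1]; first by rewrite PD PZ E1.
  by apply: summx_sub => j _; apply: scalemx_sub; rewrite -(rowK (fun j => Pi (e j)) j); exact: row_sub.
have := mxrankS full; rewrite mxrank1 => /leq_trans; apply.
apply: leq_trans (mxrank_adds_leqif K E) _; rewrite leq_add2l; exact: rank_leq_row.
Qed.

Lemma gcodim_fin A d (I : finType) (b : I -> 'M[S]_3) : #|I| = d -> (forall i, gsym (b i)) ->
  (forall c : I -> R, gtang A (\sum_i C (c i) *: b i) -> forall i, c i = 0) ->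
  (forall F, gsym F -> exists c : I -> R, gtang A (F - \sum_i C (c i) *: b i)) ->
  gcodim A d.
Proof.
move=> <- sb bI bS; exists (fun k => b (enum_val k)).
have sumE (c : I -> R) : \sum_i C (c i) *: b i = \sum_(k < #|I|) C (c (enum_val k)) *: b (enum_val k).
  rewrite [RHS](reindex (@enum_rank I)) /=; last by apply: onW_bij; exact: enum_rank_bij.
  by apply: eq_bigr => i _; rewrite enum_rankK.
split=> [i|c cT k|F sF]; first exact: sb.
  have := bI (fun i => c (enum_rank i)); rewrite sumE.
  under eq_bigr do rewrite enum_valK.
  by move=> /(_ cT (enum_val k)); rewrite enum_valK.
by have [c cT] := bS F sF; exists (fun k => c (enum_val k)); rewrite -sumE.
Qed.

(** The k-th derivative along the y-axis at 0, that is k! times the Taylor coefficient of y^k. *)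
Definition yjet k (c : S) : R := ev (iter k dy c).

Lemma iter_dyD k a b : iter k dy (a + b) = iter k dy a + iter k dy b.
Proof. by elim: k => //= k ->; rewrite gdyD. Qed.
Lemma yjetD k a b : yjet k (a + b) = yjet k a + yjet k b.
Proof. by rewrite /yjet iter_dyD rmorphD. Qed.
Lemma iter_dyZ k (c : R) a : iter k dy (C c * a) = C c * iter k dy a.
Proof. by elim: k => //= k ->; rewrite gdyM gdyC mul0r add0r. Qed.
Lemma yjetZ k (c : R) a : yjet k (C c * a) = c * yjet k a.
Proof. by rewrite /yjet iter_dyZ rmorphM gev_cst. Qed.
Lemma yjet0 k : yjet k 0 = 0.
Proof. by rewrite -(mul0r 0) -(rmorph0 C) yjetZ mul0r. Qed.
Lemma yjet_x k a : yjet k (x * a) = 0.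
Proof.
rewrite /yjet; have -> : iter k dy (x * a) = x * iter k dy a.
  by elim: k => //= k ->; rewrite gdyM gdyX mul0r add0r.
by rewrite rmorphM gevX mul0r.
Qed.

Lemma iter_dy_y k a : iter k.+1 dy (y * a) = y * iter k.+1 dy a + k.+1%:R * iter k dy a.
Proof.
elim: k => [|k IH]; first by rewrite /= gdyM gdyY; ring.
rewrite iterS IH gdyD gdyM gdyY -!(rmorph_nat C) gdyM gdyC mul0r add0r.
by rewrite !(rmorph_nat C) -!iterS [in RHS]mulrSr; ring.
Qed.
Lemma yjet_y k a : yjet k.+1 (y * a) = k.+1%:R * yjet k a.
Proof. by rewrite /yjet iter_dy_y rmorphD !rmorphM gevY mul0r add0r rmorph_nat. Qed.
Lemma yjet_y0 a : yjet 0 (y * a) = 0.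
Proof. by rewrite /yjet /= rmorphM gevY mul0r. Qed.
Lemma yjet_yn k n a : (k < n)%N -> yjet k (y ^+ n * a) = 0.
Proof.
elim: n k => [|n IH] [|k] // kn; rewrite exprS -mulrA; first by rewrite yjet_y0.
by rewrite yjet_y IH // mulr0.
Qed.
Lemma yjet_mon k n : yjet k (y ^+ n) = (k == n)%:R * n`!%:R.
Proof.
elim: n k => [|n IH] [|k]; rewrite ?expr0.
- by rewrite /yjet /= rmorph1 mulr1.
- have := yjetZ k.+1 1 1; rewrite /yjet iter_dyZ iterSr gdy1 => _.
  rewrite mul0r -[0 : S](mul0r 0) -[X in X * 0](rmorph0 C) iter_dyZ.
  by rewrite rmorph0 mul0r rmorph0.
- by rewrite exprS yjet_y0 mul0r.
- by rewrite exprS yjet_y IH eqSS factS natrM; case: eqP => [->|_]; rewrite ?mul1r ?mul0r ?mulr0.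
Qed.

Lemma yexpand n (c : S) : exists (t : 'I_n -> R) a b,
  c = \sum_(k < n) C (t k) * y ^+ k + x * a + y ^+ n * b.
Proof.
elim: n c => [|n IH] c.
  by exists (fun=> 0), 0, c; rewrite big_ord0 expr0; ring.
have [a [b E]] := g_hadamard c; have [t [a' [b' E']]] := IH b.
exists (fun k : 'I_n.+1 => if unlift ord0 k is Some j then t j else ev c), (a + y * a'), b'.
rewrite big_ord_recl unlift_none expr0.
under eq_bigr do rewrite liftK.
rewrite [LHS]E E' !mulrDr mulr_sumr [\sum_(i < n) y * _](eq_bigr (fun i : 'I_n => C (t i) * y ^+ bump 0 i)).
  by rewrite exprS; ring.
by move=> i _; rewrite /bump /= add1n exprS; ring.
Qed.

Lemma yjet_expand n (c : S) : (forall k, (k < n)%N -> yjet k c = 0) ->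
  exists a b, c = x * a + y ^+ n * b.
Proof.
move=> c0; have [t [a [b E]]] := yexpand n c; exists a, b.
rewrite [LHS]E big1 ?add0r // => k _.
have := c0 k (ltn_ord k); rewrite E !yjetD yjet_x yjet_yn // !addr0.
have -> : yjet k (\sum_(i < n) C (t i) * y ^+ i) = t k * k`!%:R.
  have -> (s : seq 'I_n) : yjet k (\sum_(i <- s) C (t i) * y ^+ i) =
      \sum_(i <- s) t i * ((k == i :> nat)%:R * i`!%:R).
    elim: s => [|i s IH]; first by rewrite !big_nil yjet0.
    by rewrite !big_cons yjetD IH yjetZ yjet_mon.
  rewrite (bigD1 k) //= eqxx mul1r big1 ?addr0 // => i /negPf ik.
  by rewrite (_ : (k == i :> nat) = false) ?mul0r ?mulr0 // eq_sym.
move=> /eqP; rewrite mulf_eq0 pnatr_eq0 -leqn0 leqNgt fact_gt0 orbF => /eqP ->.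
by rewrite rmorph0 mul0r.
Qed.
End TangentModule.

Section Codimensions.
Context {R : realType} (T : germ_theory R).
Local Notation S := (gring T).
Local Notation ev := (gev T).
Local Notation C := (gcst T).
Local Notation dx := (@gdx R T).
Local Notation dy := (@gdy R T).
Local Notation x := (gX T).
Local Notation y := (gY T).

Fixpoint comb (c : nat -> R) (bs : seq 'M[S]_3) : 'M[S]_3 :=
  if bs is b :: bs' then C (c 0%N) *: b + comb (fun k => c k.+1) bs' else 0.

Lemma combE c (bs : seq 'M[S]_3) : comb c bs = \sum_(i < size bs) C (c i) *: bs`_i.
Proof.
elim: bs c => [|b bs IH] c /=; first by rewrite big_ord0.
by rewrite big_ord_recl IH.
Qed.

Lemma gcodim_seq A (bs : seq 'M[S]_3) : (forall i : 'I_(size bs), gsym bs`_i) ->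
  (forall c, gtang A (comb c bs) -> forall i : 'I_(size bs), c i = 0) ->
  (forall F11 F12 F13 F22 F23 F33, exists c, gtang A (sym3 F11 F12 F13 F22 F23 F33 - comb c bs)) ->
  gcodim A (size bs).
Proof.
move=> sb bI bS; apply: (@gcodim_fin _ _ _ _ 'I_(size bs) (fun i => bs`_i)) => //.
- exact: card_ord.
- move=> c cT i; pose c' k := if insub k is Some j then c j else 0.
  have c'E (j : 'I_(size bs)) : c' j = c j by rewrite /c' valK.
  rewrite -c'E; apply: bI; rewrite combE; move: cT; congr (gtang _ _).
  by apply: eq_bigr => j _; rewrite c'E.
- move=> F /symP ->; have [c cT] := bS (F o0 o0) (F o0 o1) (F o0 o2) (F o1 o1) (F o1 o2) (F o2 o2).
  by exists (fun i : 'I_(size bs) => c i); rewrite -combE.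
Qed.

Lemma ev_expand k (c : S) : exists t a b, c = C t + k.+1%:R * (x * a + y * b).
Proof.
exists (ev c).
have [a [b E]] : exists a b, c - C (ev c) = k.+1%:R * (x * a + y * b).
  by apply: hadamard_mul; rewrite rmorphB gev_cst subrr.
by exists a, b; rewrite -E; ring.
Qed.

Lemma germ_half (c : S) : exists c', c = 2 * c'.
Proof.
exists (C 2^-1 * c); by rewrite mulrA -(rmorph_nat C) -rmorphM divff ?rmorph1 ?mul1r ?pnatr_eq0 //.
Qed.

Lemma gtang_sym3 (a b c d e f u v p q r p' q' r' p'' q'' r'' : S) F :
  F = gact (sym3 a b c d e f) u v (mx3 p q r p' q' r' p'' q'' r'') ->
  gtang (sym3 a b c d e f) F.
Proof. by move=> ->; exists u, v, (mx3 p q r p' q' r' p'' q'' r''). Qed.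

Lemma gtang_sym3_inv (a b c d e f : S) F : gtang (sym3 a b c d e f) F ->
  exists u v p q r p' q' r' p'' q'' r'', F = gact (sym3 a b c d e f) u v (mx3 p q r p' q' r' p'' q'' r'').
Proof.
move=> [u [v [U ->]]]; exists u, v, (U o0 o0), (U o0 o1), (U o0 o2), (U o1 o0), (U o1 o1),
  (U o1 o2), (U o2 o0), (U o2 o1), (U o2 o2).
by rewrite -mx3_eta.
Qed.

Lemma sym3N (a b c d e f : S) : - sym3 a b c d e f = sym3 (- a) (- b) (- c) (- d) (- e) (- f).
Proof. by rewrite -scaleN1r sym3Z !mulN1r. Qed.

Definition pt12 : 'M[S]_3 := sym3 0 1 0 0 0 0.
Definition pt13 : 'M[S]_3 := sym3 0 0 1 0 0 0.
Definition pt22 (a : S) : 'M[S]_3 := sym3 0 0 0 a 0 0.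
Definition pt23 (a : S) : 'M[S]_3 := sym3 0 0 0 0 a 0.
Definition pt33 (a : S) : 'M[S]_3 := sym3 0 0 0 0 0 a.

Lemma ev_gact (a b c d e f u v p q r p' q' r' p'' q'' r'' : S) :
  [/\ ev a = 0, ev b = 0 & ev c = 0] -> [/\ ev d = 0, ev e = 0 & ev f = 0] ->
  map_mx ev (gact (sym3 a b c d e f) u v (mx3 p q r p' q' r' p'' q'' r'')) =
  sym3 (ev u * ev (dx a) + ev v * ev (dy a)) (ev u * ev (dx b) + ev v * ev (dy b))
   (ev u * ev (dx c) + ev v * ev (dy c)) (ev u * ev (dx d) + ev v * ev (dy d))
   (ev u * ev (dx e) + ev v * ev (dy e)) (ev u * ev (dx f) + ev v * ev (dy f)).
Proof.
move=> [a0 b0 c0] [d0 e0 f0]; rewrite gact_sym3 map_sym3 !(rmorphD, rmorphM) /=.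
by rewrite a0 b0 c0 d0 e0 f0 !(mulr0, addr0).
Qed.

Let evE := (gevX T, gevY T, rmorph0 ev, rmorph1 ev, rmorphN ev, rmorphB ev, gev_cst T,
  rmorphD ev, rmorphM ev).
Let simp := (mulr0, mul0r, mulr1, mul1r, addr0, add0r, oppr0, subr0).
Local Ltac ords := case=> [[|[|[|[|[|[|[|[|[|?]]]]]]]]]] //= ?.
Local Ltac combs := rewrite /= /pt12 /pt13 /pt22 /pt23 /pt33 addr0 !sym3Z !sym3D.
(** The entries vanish at 0, so U disappears and only the constant part (u, v) of the vector field
    is left. The values at 0 of tangent elements fill at most a plane among the six dimensions of
    symmetric matrices, which explains the number 4 for the first three normal forms. *)
Lemma ev_gtang (a b c d e f : S) (F : 'M[S]_3) :
  [/\ ev a = 0, ev b = 0 & ev c = 0] -> [/\ ev d = 0, ev e = 0 & ev f = 0] ->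
  gtang (sym3 a b c d e f) F -> exists u v : R, map_mx ev F =
  sym3 (u * ev (dx a) + v * ev (dy a)) (u * ev (dx b) + v * ev (dy b))
   (u * ev (dx c) + v * ev (dy c)) (u * ev (dx d) + v * ev (dy d))
   (u * ev (dx e) + v * ev (dy e)) (u * ev (dx f) + v * ev (dy f)).
Proof.
move=> h1 h2 /gtang_sym3_inv[u [v [p [q [r [p' [q' [r' [p'' [q'' [r'' ->]]]]]]]]]]].
by exists (ev u), (ev v); exact: ev_gact.
Qed.

Lemma NF1_codim : gcodim (sym3 x 0 0 y 0 (x - y)) 4.
Proof.
apply: (@gcodim_seq _ [:: pt12; pt13; pt23 1; pt33 1]).
- by ords; rewrite /gsym sym3_tr.
- move=> c /ev_gtang[||u [v]]; try (by rewrite ?evE ?simp).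
  combs; rewrite map_sym3 => E; have := sym3_inj E; rewrite !gdE !evE !simp; move=> [[u0 [E1 E2]] [v0 [E3 E4]]].
  by ords; rewrite ?E1 ?E2 ?E3 ?E4 -?u0 -?v0 ?subrr ?simp.
move=> F11 F12 F13 F22 F23 F33.
have [k1 [a [b E1]]] := ev_expand 1 (F33 - F11 + F22).
have [k2 [c [d E2]]] := ev_expand 0 F12.
have [k3 [e [f E3]]] := ev_expand 0 F13.
have [k4 [g [h E4]]] := ev_expand 0 F23.
exists (nth 0 [:: k2; k3; k4; k1]); combs.
apply: (@gtang_sym3 _ _ _ _ _ _ (F11 + 2 * a * x) (F22 - 2 * b * y)
  (- a) c (e + f) d b (g + h) (- f) g 0).
have {}E1 : F33 = C k1 + 2 * (x * a + y * b) + F11 - F22 by rewrite -E1; ring.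
rewrite E2 E3 E4 E1 sym3N sym3D gact_sym3 !gdE.
by congr sym3; ring.
Qed.

Lemma sgnP (s : bool) : exists sg : S, [/\ sg = 1 \/ sg = -1, (-1) ^+ s = sg & dx sg = 0 /\ dy sg = 0].
Proof.
exists ((-1) ^+ s); split=> //; first by case: s; [right|left].
by case: s; rewrite /= ?expr1 ?expr0 !gdE ?oppr0.
Qed.

Lemma NF2_codim (s : bool) : gcodim (sym3 x 0 0 y 0 ((-1) ^+ s * (x + y))) 4.
Proof.
have [sg [sgP -> [sx sy]]] := sgnP s.
apply: (@gcodim_seq _ [:: pt12; pt13; pt23 1; pt33 1]).
- by ords; rewrite /gsym sym3_tr.
- move=> c /ev_gtang[||u [v]]; try (by rewrite ?evE ?simp).
  combs; rewrite map_sym3 => E; have := sym3_inj E; rewrite !gdE !evE !simp; rewrite ?sx ?sy ?simp ?evE ?simp; move=> [[u0 [E1 E2]] [v0 [E3 E4]]].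
  by ords; rewrite ?E1 ?E2 ?E3 ?E4 -?u0 -?v0 ?simp.
move=> F11 F12 F13 F22 F23 F33.
have [k1 [a [b E1]]] := ev_expand 1 (F33 - sg * F11 - sg * F22).
have [k2 [c [d E2]]] := ev_expand 0 F12.
have [k3 [e [f E3]]] := ev_expand 0 F13.
have [k4 [g [h E4]]] := ev_expand 0 F23.
exists (nth 0 [:: k2; k3; k4; k1]); combs.
apply: (@gtang_sym3 _ _ _ _ _ _ (F11 + 2 * sg * a * x) (F22 + 2 * sg * b * y)
  (- (sg * a)) c (e - f) d (- (sg * b)) (h - g) (sg * f) (sg * g) 0).
have {}E1 : F33 = C k1 + 2 * (x * a + y * b) + sg * F11 + sg * F22 by rewrite -E1; ring.
rewrite E2 E3 E4 E1 sym3N sym3D gact_sym3 !gdE sx sy.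
by case: sgP => ->; congr sym3; ring.
Qed.

Lemma NF3_codim (s : bool) : gcodim (sym3 ((-1) ^+ s * x) 0 0 x y (- x)) 4.
Proof.
have [sg [sgP -> [sx sy]]] := sgnP s.
have esg : ev sg != 0 by case: sgP => ->; rewrite ?rmorphN rmorph1 ?oppr_eq0 oner_eq0.
apply: (@gcodim_seq _ [:: pt12; pt13; pt22 1; pt33 1]).
- by ords; rewrite /gsym sym3_tr.
- move=> c /ev_gtang[||u [v]]; try (by rewrite ?evE ?simp).
  combs; rewrite map_sym3 => E; have := sym3_inj E; rewrite !gdE !evE !simp; rewrite ?sx ?sy ?simp ?evE ?simp; move=> [[u0 [E1 E2]] [E3 [_ E4]]].
  have {}u0 : u = 0 by move/esym/eqP: u0; rewrite mulf_eq0 (negPf esg) orbF => /eqP.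
  by ords; rewrite ?E1 ?E2 ?E3 ?E4 ?u0 ?simp.
move=> F11 F12 F13 F22 F23 F33.
have [k1 [a [b E1]]] := ev_expand 1 (F22 - sg * F11).
have [k1' [a' [b' E1']]] := ev_expand 1 (F33 + sg * F11).
have [k2 [c [d E2]]] := ev_expand 0 F12.
have [k3 [e [f E3]]] := ev_expand 0 F13.
exists (nth 0 [:: k2; k3; k1; k1']); combs.
apply: (@gtang_sym3 _ _ _ _ _ _ (sg * F11) (F23 - y * a + x * b - x * b' + y * a')
  0 (sg * (c - f)) (sg * (e + d)) f a b' d b (- a')).
have {}E1 : F22 = C k1 + 2 * (x * a + y * b) + sg * F11 by rewrite -E1; ring.
have {}E1' : F33 = C k1' + 2 * (x * a' + y * b') - sg * F11 by rewrite -E1'; ring.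
rewrite E2 E3 E1 E1' sym3N sym3D gact_sym3 !gdE sx sy.
by case: sgP => ->; congr sym3; ring.
Qed.

(** The ideal (x, y^n). Germs outside it are detected by their first n derivatives along the
    y-axis. *)
Definition yideal n (c : S) := exists a b, c = x * a + y ^+ n * b.

Lemma yidealD n c d : yideal n c -> yideal n d -> yideal n (c + d).
Proof. by move=> [a [b ->]] [a' [b' ->]]; exists (a + a'), (b + b'); ring. Qed.
Lemma yidealM n c d : yideal n d -> yideal n (c * d).
Proof. by move=> [a [b ->]]; exists (c * a), (c * b); ring. Qed.
Lemma yideal_x n c : yideal n (x * c).
Proof. by exists c, 0; ring. Qed.
Lemma yideal_ev n c : (0 < n)%N -> yideal n c -> ev c = 0.
Proof. by case: n => // n _ [a [b ->]]; rewrite exprS !evE !simp. Qed.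
Lemma yideal_ydy n c : yideal n c -> yideal n (y * dy c).
Proof.
move=> [a [b ->]]; case: n => [|n]; first by exists 0, (y * dy (x * a + y ^+ 0 * b)); rewrite expr0; ring.
exists (y * dy a), (n.+1%:R * b + y * dy b); rewrite !gdE exprS; ring.
Qed.
Lemma yideal_yjet n c : yideal n c -> forall k, (k < n)%N -> yjet k c = 0.
Proof. by move=> [a [b ->]] k kn; rewrite yjetD yjet_x yjet_yn // addr0. Qed.
Lemma yideal_poly n (t : 'I_n -> R) : yideal n (\sum_k C (t k) * y ^+ k) -> forall k, t k = 0.
Proof.
move=> /yideal_yjet h k; have := h k (ltn_ord k).
have -> (s : seq 'I_n) : yjet k (\sum_(i <- s) C (t i) * y ^+ i) =
    \sum_(i <- s) t i * ((k == i :> nat)%:R * i`!%:R).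
  elim: s => [|i s IH]; first by rewrite !big_nil yjet0.
  by rewrite !big_cons yjetD IH yjetZ yjet_mon.
rewrite (bigD1 k) //= eqxx mul1r big1 ?addr0 => [|i /negPf ik].
  by move=> /eqP; rewrite mulf_eq0 pnatr_eq0 -leqn0 leqNgt fact_gt0 orbF => /eqP.
by rewrite (_ : (k == i :> nat) = false) ?mul0r ?mulr0 // eq_sym.
Qed.

Local Ltac yid := repeat first [apply: yidealD | apply: yideal_x | assumption |
  apply: yidealM].

(** The vanishing of the entries (1, 2) and (3, 3) determines u and v. After substitution, each term
    of (1, 1) and (2, 2) is a multiple of x, of f or g, of y times a y-derivative, or of a product
    assumed to lie in the ideal. *)
Lemma diagtype_tang f g m1 m2 F11 F13 F22 F23 : (0 < m1)%N -> (0 < m2)%N ->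
  yideal m1 f -> yideal m2 g -> yideal m1 (dx f * g) -> yideal m2 (dx g * f) ->
  gtang (sym3 f x 0 g 0 y) (sym3 F11 0 F13 F22 F23 0) ->
  [/\ yideal m1 F11, yideal m2 F22, ev F13 = 0 & ev F23 = 0].
Proof.
move=> m10 m20 fJ gJ fgJ gfJ /gtang_sym3_inv[u [v [p [q [r [p' [q' [r' [p'' [q'' [r'' E]]]]]]]]]]].
have ef := yideal_ev m10 fJ; have eg := yideal_ev m20 gJ.
have yf := yideal_ydy fJ; have yg := yideal_ydy gJ.
rewrite gact_sym3 !gdE in E; have [[-> [E12 ->]] [-> [-> E33]]] := sym3_inj E.
have {}E12 : u = - (p * x + p' * g + q * f + q' * x) by apply/eqP; rewrite -addr_eq0 [X in _ == X]E12; apply/eqP; ring.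
have {}E33 : v = - (2 * r'' * y) by apply/eqP; rewrite -addr_eq0 [X in _ == X]E33; apply/eqP; ring.
split.
- rewrite E12 E33 (_ : _ + _ = x * (- (p + q') * dx f + 2 * p') + (- p') * (dx f * g) +
    (- q * dx f + 2 * p) * f + (- 2 * r'') * (y * dy f)); last by ring.
  by yid.
- rewrite E12 E33 (_ : _ + _ = x * (- (p + q') * dx g + 2 * q) + (- q) * (dx g * f) +
    (- p' * dx g + 2 * q') * g + (- 2 * r'') * (y * dy g)); last by ring.
  by yid.
- by rewrite !evE ef !simp.
- by rewrite !evE eg !simp.
Qed.

(** The entry (3, 3) gives v, and opposite diagonal entries (1, 1) and (2, 2) give u by addition;
    then u lies in (x, y^l), and so do the first two entries. *)
Lemma scalartype_tang f g l F11 F12 F13 F23 : (0 < l)%N -> yideal l f -> yideal l g ->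
  gtang (sym3 (x + f) g 0 (x - f) 0 y) (sym3 F11 F12 F13 (- F11) F23 0) ->
  [/\ yideal l F11, yideal l F12, ev F13 = 0 & ev F23 = 0].
Proof.
move=> l0 fJ gJ /gtang_sym3_inv[u [v [p [q [r [p' [q' [r' [p'' [q'' [r'' E]]]]]]]]]]].
have ef := yideal_ev l0 fJ; have eg := yideal_ev l0 gJ.
have yf := yideal_ydy fJ; have yg := yideal_ydy gJ.
rewrite gact_sym3 !gdE in E; have [[E11 [-> ->]] [E22 [-> E33]]] := sym3_inj E.
have {}E33 : v = - (2 * r'' * y) by apply/eqP; rewrite -addr_eq0 [X in _ == X]E33; apply/eqP; ring.
(* Half of the sum of the entries (1, 1) and (2, 2), in which v cancels; the sum is 0 by the shape
   of the element. *)
have [h hE] : exists h, h = u + p * (x + f) + p' * g + q * g + q' * (x - f) by eexists.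
have h0 : 2 * h = 0.
  by rewrite -[RHS](addrN F11) E22 [in RHS]E11 hE; ring.
have {}h0 : h = 0.
  have [h' h'E] := germ_half 1; rewrite -[h]mul1r h'E mulrAC h0; ring.
have uE : u = - (p * (x + f) + p' * g + q * g + q' * (x - f)).
  by apply/eqP; rewrite -addr_eq0; apply/eqP; rewrite -[RHS]h0 hE; ring.
have uJ : yideal l u.
  rewrite uE (_ : - _ = x * (- p - q') + (- p + q') * f + (- p' - q) * g); last by ring.
  by yid.
split.
- rewrite E11 E33 (_ : _ + _ = (1 + dx f) * u + (- 2 * r'') * (y * dy f) + x * (2 * p) + (2 * p) * f +
    (2 * p') * g); last by ring.
  by yid.
- rewrite E33 (_ : _ + _ = dx g * u + (- 2 * r'') * (y * dy g) + x * (p' + q) + (q - p') * f +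
    (p + q') * g); last by ring.
  by yid.
- by rewrite !evE ef eg !simp.
- by rewrite !evE ef eg !simp.
Qed.
End Codimensions.

(** * Independent classes for the pencil with one block of size three *)

Section Codimensions3.
Context {R : realType} (T : germ_theory R).
Local Notation S := (gring T).
Local Notation ev := (gev T).
Local Notation C := (gcst T).
Local Notation dx := (@gdx R T).
Local Notation dy := (@gdy R T).
Local Notation x := (gX T).
Local Notation y := (gY T).
Implicit Types (f g h : S).
Let evE := (gevX T, gevY T, rmorph0 ev, rmorph1 ev, rmorphN ev, rmorphB ev, gev_cst T,
  rmorphD ev, rmorphM ev).
Let simp := (mulr0, mul0r, mulr1, mul1r, addr0, add0r, oppr0, subr0).

Lemma sym3_sum (I : Type) (s : seq I) (a b c d e f : I -> S) :
  \sum_(i <- s) sym3 (a i) (b i) (c i) (d i) (e i) (f i) =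
  sym3 (\sum_(i <- s) a i) (\sum_(i <- s) b i) (\sum_(i <- s) c i) (\sum_(i <- s) d i)
    (\sum_(i <- s) e i) (\sum_(i <- s) f i).
Proof.
elim: s => [|i s IH].
  by rewrite !big_nil; apply/matrixP; apply: forall_ord3; apply: forall_ord3; rewrite sym3E mxE.
by rewrite !big_cons IH sym3D.
Qed.

Lemma yideal1 c : ev c = 0 -> yideal (T := T) 1 c.
Proof. by move=> c0; have [a [b ->]] := hadamard_mul 0 c0; exists a, b; ring. Qed.

Lemma yideal_divy n c : yideal (T := T) n.+1 (y * c) -> yideal n c.
Proof.
move=> h; apply: yjet_expand => k kn; have := yideal_yjet h (k := k.+1) kn.
by rewrite yjet_y => /eqP; rewrite mulf_eq0 pnatr_eq0 => /eqP.
Qed.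

(** For n1 <= n0 this is the ideal (x^2, x y^n1, y^n0), described through g and its x-derivative so
    that membership is a computation modulo x. Modulo it, the y^k with k < n0 and the x y^k with k <
    n1 are independent. *)
Definition Kideal n0 n1 g := yideal n0 g /\ yideal n1 (dx g).
Lemma KidealD n0 n1 g h : Kideal n0 n1 g -> Kideal n0 n1 h -> Kideal n0 n1 (g + h).
Proof. by move=> [a b] [c d]; split; rewrite ?gdxD; exact: yidealD. Qed.
Lemma yideal_weak m n g : (m <= n)%N -> yideal n g -> yideal m g.
Proof.
move=> mn [a [b ->]]; exists a, (y ^+ (n - m) * b).
by rewrite mulrA -exprD subnKC.
Qed.
Lemma KidealM n0 n1 c g : (n1 <= n0)%N -> Kideal n0 n1 g -> Kideal n0 n1 (c * g).
Proof.
move=> n10 [a b]; split; first exact: yidealM.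
by rewrite gdxM; apply: yidealD; apply: yidealM => //; exact: yideal_weak a.
Qed.
Lemma Kideal_xx n0 n1 : Kideal n0 n1 (x * x).
Proof.
split; first exact: yideal_x.
by rewrite !gdE (_ : _ + _ = x * 2); [exact: yideal_x|ring].
Qed.

Lemma Kideal_poly n0 n1 (t : 'I_n0 -> R) (s : 'I_n1 -> R) :
  Kideal n0 n1 (\sum_k C (t k) * y ^+ k + x * \sum_k C (s k) * y ^+ k) ->
  (forall k, t k = 0) /\ (forall k, s k = 0).
Proof.
have dy_poly n (r : 'I_n -> R) : dx (\sum_k C (r k) * y ^+ k) = 0.
  rewrite gdx_sum big1 // => k _; rewrite gdxM gdxC mul0r add0r.
  by case: (k : nat) => [|m]; rewrite ?expr0 ?gdE ?mulr0.
move=> [h1 h2]; split.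
  suff h : yideal n0 (\sum_k C (t k) * y ^+ k) by exact: yideal_poly h.
  move: h1; set P := \sum_k C (t k) * _; set Q := \sum_k C (s k) * _ => h1.
  rewrite (_ : P = (P + x * Q) + x * - Q); last by ring.
  by apply: yidealD h1 _; exact: yideal_x.
rewrite gdxD gdxM !dy_poly gdxX mul1r mulr0 addr0 add0r in h2.
exact: yideal_poly h2.
Qed.

Lemma big_sum3 (I J : finType) (F : 'I_3 + (I + J) -> 'M[S]_3) :
  \sum_i F i = F (inl o0) + F (inl o1) + F (inl o2) +
    (\sum_i F (inr (inl i)) + \sum_j F (inr (inr j))).
Proof. by rewrite big_sumType /= big_sumType /= sum_ord3. Qed.

Section Block3.
Variable f : S.
Local Notation A := (sym3 0 y x x 0 f).

(** The entries (1, 2) and (1, 3) give v and u. What remains at (3, 3) is a combination of the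
    assumed elements of the ideal, provided r' vanishes at 0 and r lies in (x, y^(n-1)); the latter
    comes from dividing the entry (2, 3) by y. *)
Lemma block3_tang n n0 n1 (c1 c2 c3 : R) h : (1 < n)%N -> (n1 <= n0)%N -> yideal n f -> ev (dx f) = 0 ->
  [/\ Kideal n0 n1 (x * dx f), Kideal n0 n1 (y ^+ 2 * dx f), Kideal n0 n1 (x * dy f) &
      Kideal n0 n1 (y * dy f)] -> Kideal n0 n1 f -> Kideal n0 n1 (x * y ^+ n.-1) ->
  gtang A (sym3 (C c1) 0 0 (C c2) (C c3) h) -> [/\ c1 = 0, c2 = 0, c3 = 0 & Kideal n0 n1 h].
Proof.
case: n => // n; rewrite ltnS => n_gt0 n10 fJ fx [K1 K2 K3 K4] K5 K6.
move=> /gtang_sym3_inv[u [v [p [q [r [p' [q' [r' [p'' [q'' [r'' E]]]]]]]]]]].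
rewrite gact_sym3 !gdE in E; have [[E11 [E12 E13]] [E22 [E23 ->]]] := sym3_inj E.
have f0 := yideal_ev (ltn0Sn n) fJ.
have fy : ev (dy f) = 0 by have := yideal_yjet fJ (k := 1); rewrite ltnS n_gt0 => /(_ isT).
have e1 : c1 = 0 by have := congr1 ev E11; rewrite !evE ?f0 !simp.
have vE : v = - (y * (p + q') + x * (p' + q'')).
  by apply/eqP; rewrite -addr_eq0 [X in _ == X]E12; apply/eqP; ring.
have uE : u = - (x * p + f * p'' + y * r' + x * r'').
  by apply/eqP; rewrite -addr_eq0 [X in _ == X]E13; apply/eqP; ring.
have e2 : c2 = 0 by have := congr1 ev E22; rewrite uE !evE ?f0 !simp.
have e3 : c3 = 0 by have := congr1 ev E23; rewrite !evE ?f0 !simp.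
rewrite e2 rmorph0 uE in E22; rewrite e3 rmorph0 in E23.
have rJ : yideal n r.
  apply: yideal_divy; rewrite (_ : y * r = - (x * (q + r')) + (- q'') * f); last first.
    by apply/eqP; rewrite -subr_eq0 [X in _ == X]E23; apply/eqP; ring.
  by apply: yidealD; [rewrite -mulrN; exact: yideal_x|exact: yidealM].
(* At 0, the y-derivative of entry (2, 2) reads r' = 2 q and the x-derivative of entry (2, 3) reads
   q + r' = 0. *)
have r'0 : ev r' = 0.
  have := congr1 (fun c => ev (dy c)) E22; rewrite !gdE !evE f0 fy !simp => h1.
  have := congr1 (fun c => ev (dx c)) E23; rewrite !gdE !evE f0 fx !simp => h2.
  by lra.
have [a [b rE]] := hadamard_mul 0 r'0.
have [a' [b' rE']] := rJ.
split=> //.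
rewrite uE vE rE rE' (_ : _ + _ = (- p - r'' - y * a) * (x * dx f) + (- p'' * dx f + 2 * r'') * f +
  (- b) * (y ^+ 2 * dx f) + (- (p + q')) * (y * dy f) + (- (p' + q'')) * (x * dy f) +
  (2 * a') * (x * x) + (2 * b') * (x * y ^+ n)); last by ring.
by do 6?apply: KidealD; apply: KidealM => //; exact: Kideal_xx.
Qed.

(** For every f, the vector field absorbs (1, 2) and (1, 3), and U absorbs the parts of (1, 1), (2,
    2) and (2, 3) that vanish at 0. The study of the quotient is thus moved to the entry (3, 3). *)
Lemma block3_reduce (F11 F12 F13 F22 F23 F33 : S) : exists (c1 c2 c3 : R) h,
  gtang A (sym3 F11 F12 F13 F22 F23 F33 - sym3 (C c1) 0 0 (C c2) (C c3) h).
Proof.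
have [c1 [a [b E1]]] := ev_expand 1 F11.
have [c3 [c [d E2]]] := ev_expand 2 F23.
have [c2 [e [g E3]]] := ev_expand 2 (F22 - F13 + f * a).
pose u := F13 + 3 * x * e - f * a - y * (2 * c - g); pose v := F12 + 3 * y * e - x * b.
exists c1, c2, c3, (F33 - (u * dx f + v * dy f + 6 * x * d)).
apply: (@gtang_sym3 _ _ _ _ _ _ _ _ u v (- (3 * e)) (g + c) (3 * d) b 0 (2 * c - g) a 0 0).
have {}E3 : F22 = C c2 + 3 * (x * e + y * g) + F13 - f * a by rewrite -E3; ring.
rewrite sym3N sym3D gact_sym3 !gdE E1 E2 E3 /u /v.
by congr sym3; ring.
Qed.

Definition block3_basis n0 n1 (i : 'I_3 + ('I_n0 + 'I_n1)) : 'M[S]_3 :=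
  match i with
  | inl k => nth 0 [:: sym3 1 0 0 0 0 0; sym3 0 0 0 1 0 0; sym3 0 0 0 0 1 0] k
  | inr (inl k) => sym3 0 0 0 0 0 (y ^+ k)
  | inr (inr k) => sym3 0 0 0 0 0 (x * y ^+ k)
  end.

Lemma block3_basis_sym n0 n1 i : gsym (@block3_basis n0 n1 i).
Proof. by case: i => [[[|[|[|]]]]|[]] //= *; exact: sym3_tr. Qed.

Lemma block3_basis_sum n0 n1 (c : 'I_3 + ('I_n0 + 'I_n1) -> R) :
  \sum_i C (c i) *: block3_basis i = sym3 (C (c (inl o0))) 0 0 (C (c (inl o1))) (C (c (inl o2)))
    (\sum_k C (c (inr (inl k))) * y ^+ k + x * \sum_k C (c (inr (inr k))) * y ^+ k).
Proof.
rewrite big_sum3 /=.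
under eq_bigr do rewrite sym3Z; under [X in _ + (_ + X)]eq_bigr do rewrite sym3Z.
rewrite !sym3_sum !sym3Z !sym3D !simp ?big1_eq.
congr sym3; rewrite ?simp; try (by rewrite !big1 ?simp // => k _; rewrite simp).
by rewrite mulr_sumr; congr (_ + _); apply: eq_bigr => k _; ring.
Qed.

(** Stated for an f subject to membership conditions because it serves twice: for the codimensions
    of the normal forms of this type and, when f is too degenerate, for producing nine independent
    classes. *)
Lemma block3_indep n n0 n1 : (1 < n)%N -> (n1 <= n0)%N -> yideal n f -> ev (dx f) = 0 ->
  [/\ Kideal n0 n1 (x * dx f), Kideal n0 n1 (y ^+ 2 * dx f), Kideal n0 n1 (x * dy f) &
      Kideal n0 n1 (y * dy f)] -> Kideal n0 n1 f -> Kideal n0 n1 (x * y ^+ n.-1) ->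
  forall c : 'I_3 + ('I_n0 + 'I_n1) -> R, gtang A (\sum_i C (c i) *: block3_basis i) ->
  forall i, c i = 0.
Proof.
move=> h1 h2 h3 h4 h5 h6 h7 c; rewrite block3_basis_sum.
move=> /(block3_tang h1 h2 h3 h4 h5 h6 h7)[e1 e2 e3 /Kideal_poly[t0 s0]].
case=> [[[|[|[|]]] // k]|[k|k]] //.
- by rewrite -[RHS]e1; congr (c (inl _)); apply/val_inj.
- by rewrite -[RHS]e2; congr (c (inl _)); apply/val_inj.
- by rewrite -[RHS]e3; congr (c (inl _)); apply/val_inj.
Qed.

Lemma block3_codim n n0 n1 : (1 < n)%N -> (n1 <= n0)%N -> yideal n f -> ev (dx f) = 0 ->
  [/\ Kideal n0 n1 (x * dx f), Kideal n0 n1 (y ^+ 2 * dx f), Kideal n0 n1 (x * dy f) &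
      Kideal n0 n1 (y * dy f)] -> Kideal n0 n1 f -> Kideal n0 n1 (x * y ^+ n.-1) ->
  gtang A (sym3 0 0 0 0 0 (x * x)) -> gtang A (sym3 0 0 0 0 0 (x * y ^+ n1)) ->
  gtang A (sym3 0 0 0 0 0 (y ^+ n0)) -> gcodim A (3 + (n0 + n1)).
Proof.
move=> h1 h2 h3 h4 h5 h6 h7 T1 T2 T3.
apply: (gcodim_fin (b := @block3_basis n0 n1)) (block3_indep h1 h2 h3 h4 h5 h6 h7) _.
- by rewrite !card_sum !card_ord.
- exact: block3_basis_sym.
move=> F /symP ->.
have [c1 [c2 [c3 [h hT]]]] := block3_reduce (F o0 o0) (F o0 o1) (F o0 o2) (F o1 o1) (F o1 o2) (F o2 o2).
have [t [a [b E]]] := yexpand n0 h; have [s [a' [b' E']]] := yexpand n1 a.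
pose c (i : 'I_3 + ('I_n0 + 'I_n1)) : R :=
  match i with inl k => nth 0 [:: c1; c2; c3] k | inr (inl k) => t k | inr (inr k) => s k end.
exists c.
rewrite block3_basis_sum /=.
have := gtangD hT (gtangD (gtangZ a' T1) (gtangD (gtangZ b' T2) (gtangZ b T3))).
congr (gtang _ _); rewrite !sym3Z !sym3N !sym3D; congr sym3; rewrite ?simp //; try ring.
rewrite E E'; ring.
Qed.
End Block3.
End Codimensions3.

(** * Explicit codimensions, and the pencil with blocks of sizes two and one *)

Section Codimensions4.
Context {R : realType} (T : germ_theory R).
Local Notation S := (gring T).
Local Notation ev := (gev T).
Local Notation C := (gcst T).
Local Notation dx := (@gdx R T).
Local Notation dy := (@gdy R T).
Local Notation x := (gX T).
Local Notation y := (gY T).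
Implicit Types (f g h : S).
Let evE := (gevX T, gevY T, rmorph0 ev, rmorph1 ev, rmorphN ev, rmorphB ev, gev_cst T,
  rmorphD ev, rmorphM ev).
Let simp := (mulr0, mul0r, mulr1, mul1r, addr0, add0r, oppr0, subr0).

Local Ltac yid := match goal with |- yideal _ ?c =>
    first [by exists 0, 0; ring | by exists 1, 0; ring | by exists 0, 1; ring
     | by exists y, 0; ring | by exists 0, (-1); ring | by exists 0, 2; ring | by exists 2, 0; ring
     | by exists 0, (-2); ring | by exists 0, 3; ring | by exists 0, y; ring | by exists x, 0; ring
     | by exists (2 * x), 0; ring | by exists (2 * y), 0; ring | by exists (-2 * y), 0; ring
     | by exists (y * y), 0; ring | by exists (3 * (y * y)), 0; ring | by exists (3 * y), 0; ring | by exists 3, 0; ring] end.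
Local Ltac kid := split; rewrite ?gdE; yid.

Local Ltac member u v p q r p' q' r' p'' q'' r'' :=
  apply: (@gtang_sym3 _ _ _ _ _ _ _ _ u v p q r p' q' r' p'' q'' r'');
  rewrite gact_sym3 !gdE; congr sym3; ring.

(** The explicit tangent elements used below have integer coefficients and produce an integer
    multiple of the wanted matrix. *)
Lemma gtang_scale A k (F : 'M[S]_3) : gtang A (k.+1%:R *: F) -> gtang A F.
Proof.
by move=> /(gtangZ (C (k.+1%:R^-1))); rewrite scalerA -(rmorph_nat C) -rmorphM mulVf ?rmorph1 ?scale1r ?pnatr_eq0 //.
Qed.

(** Besides the constants at (1, 1), (2, 2) and (2, 3), the surviving monomials at (3, 3) are 1, y,
    x, that is n0 = 2 and n1 = 1. For the next two forms they are 1, y, y^2, x and 1, y, y^2, x, x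
    y. *)
Lemma NF6_codim (s : bool) : gcodim (sym3 0 y x x 0 ((-1) ^+ s * y ^+ 2)) 6.
Proof.
have [sg [sgP -> [sx sy]]] := sgnP T s.
apply: (@block3_codim _ _ _ 2 2 1) => //.
- by case: sgP => ->; yid.
- by case: sgP => ->; rewrite !gdE !evE !simp.
- by case: sgP => ->; split; kid.
- by case: sgP => ->; kid.
- by kid.
- apply: (@gtang_scale _ 5); rewrite sym3Z.
  by case: sgP => ->; member (2 * y ^+ 2) (0 : S) (0 : S) (- y) (3 * x) (0 : S) (0 : S) (- (2 * y)) (0 : S) (0 : S) (0 : S).
- apply: (@gtang_scale _ 3); rewrite sym3Z; case: sgP => ->.
    by member (0 : S) (x : S) (0 : S) (0 : S) (y : S) (0 : S) (0 : S) (0 : S) (0 : S) (- 1 : S) (0 : S).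
  by member (0 : S) (- x) (0 : S) (0 : S) (y : S) (0 : S) (0 : S) (0 : S) (0 : S) (1 : S) (0 : S).
- apply: (@gtang_scale _ 3); rewrite sym3Z; case: sgP => ->.
    by member (0 : S) (y : S) (- 1 : S) (0 : S) (0 : S) (0 : S) (0 : S) (0 : S) (0 : S) (0 : S) (1 : S).
  by member (0 : S) (- y) (1 : S) (0 : S) (0 : S) (0 : S) (0 : S) (0 : S) (0 : S) (0 : S) (- 1 : S).
Qed.

Lemma NF7_codim : gcodim (sym3 0 y x x 0 (x * y)) 7.
Proof.
apply: (@block3_codim _ _ _ 3 3 1) => //.
- by yid.
- by rewrite !gdE !evE !simp.
- by split; kid.
- by kid.
- by kid.
- apply: (@gtang_scale _ 2); rewrite sym3Z.
  by member (0 : S) (x : S) (0 : S) (0 : S) (x : S) (0 : S) (0 : S) (0 : S) (0 : S) (- 1 : S) (0 : S).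
- apply: (@gtang_scale _ 2); rewrite sym3Z.
  by member (0 : S) (y : S) (- 1 : S) (0 : S) (0 : S) (0 : S) (0 : S) (0 : S) (0 : S) (0 : S) (1 : S).
- apply: (@gtang_scale _ 1); rewrite sym3Z.
  by member (2 * y ^+ 2) (- (2 * x)) (0 : S) (- y) (x : S) (0 : S) (0 : S) (- (2 * y)) (0 : S) (2 : S) (0 : S).
Qed.

Lemma NF9_codim : gcodim (sym3 0 y x x 0 (y ^+ 3)) 8.
Proof.
apply: (@block3_codim _ _ _ 3 3 2) => //.
- by yid.
- by rewrite !gdE !evE !simp.
- by split; kid.
- by kid.
- by kid.
- apply: (@gtang_scale _ 5); rewrite sym3Z.
  by member (2 * y ^+ 2) (0 : S) (0 : S) (- y) (3 * x) (0 : S) (0 : S) (- (2 * y)) (0 : S) (0 : S) (0 : S).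
- apply: (@gtang_scale _ 4); rewrite sym3Z.
  by member (0 : S) (x : S) (0 : S) (0 : S) (y ^+ 2) (0 : S) (0 : S) (0 : S) (0 : S) (- 1 : S) (0 : S).
- apply: (@gtang_scale _ 4); rewrite sym3Z.
  by member (0 : S) (y : S) (- 1 : S) (0 : S) (0 : S) (0 : S) (0 : S) (0 : S) (0 : S) (0 : S) (1 : S).
Qed.

Section Block21.
Variables f h : S.
Local Notation A := (sym3 y x 0 f h x).

(** The entries (1, 1) and (3, 3) give v and u. The linear parts of (1, 2), (1, 3) and (2, 3) then
    make q, r and q'' vanish at 0, which puts the terms 2 q x and 2 q'' h of the entry (2, 2) into
    the ideal. *)
Lemma block21_tang n0 m0 (c1 c2 : R) f' h' : (0 < n0)%N -> (0 < m0)%N ->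
  [/\ ev f = 0, ev (dx f) = 0 & ev (dy f) = 0] -> [/\ ev h = 0, ev (dx h) = 0 & ev (dy h) = 0] ->
  [/\ Kideal n0 1 (x * dx f), Kideal n0 1 (h * dx f), Kideal n0 1 (x * dy f) &
      Kideal n0 1 (y * dy f)] -> [/\ Kideal n0 1 f, Kideal n0 1 (x * h) & Kideal n0 1 (y * h)] ->
  Kideal n0 1 (x * y) -> yideal m0 f -> yideal m0 h -> ev (dx h') = 0 ->
  gtang A (sym3 0 (C c1) (C c2) f' h' 0) ->
  [/\ c1 = 0, c2 = 0, Kideal n0 1 f' & yideal m0 h'].
Proof.
move=> n00 m00 [f0 fx fy] [h0 hx hy] [K1 K2 K3 K4] [K5 K6 K7] K8 fJ hJ h'x.
move=> /gtang_sym3_inv[u [v [p [q [r [p' [q' [r' [p'' [q'' [r'' E]]]]]]]]]]].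
rewrite gact_sym3 !gdE in E; have [[E11 [E12 E13]] [E22 [E23 E33]]] := sym3_inj E.
have vE : v = - (2 * (p * y + p' * x)).
  by apply/eqP; rewrite -addr_eq0 [X in _ == X]E11; apply/eqP; ring.
have uE : u = - (2 * (r' * h + r'' * x)).
  by apply/eqP; rewrite -addr_eq0 [X in _ == X]E33; apply/eqP; ring.
have e1 : c1 = 0 by have := congr1 ev E12; rewrite uE !evE h0 f0 !simp.
have e2 : c2 = 0 by have := congr1 ev E13; rewrite !evE h0 !simp.
have q0 : ev q = 0.
  have := congr1 (fun c => ev (dy c)) E12; rewrite uE !gdE -?(rmorph_nat C) ?gdE !evE h0 hy f0 fy !simp.
  by move=> ->.
have r0 : ev r = 0.
  have := congr1 (fun c => ev (dy c)) E13; rewrite !gdE !evE h0 hy !simp.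
  by move=> ->.
have q''0 : ev q'' = 0.
  have := congr1 (fun c => ev (dx c)) E23; rewrite h'x uE vE !gdE -?(rmorph_nat C) ?gdE !evE h0 hx hy fx f0 r0 !simp.
  by move=> ->.
have [a [b qE]] := hadamard_mul 0 q0.
have [a' [b' q''E]] := hadamard_mul 0 q''0.
have n01 : (1 <= n0)%N by [].
split=> //.
- rewrite E22 uE vE qE q''E (_ : _ + _ = (- 2 * r') * (h * dx f) + (- 2 * r'') * (x * dx f) +
    (- 2 * p) * (y * dy f) + (- 2 * p') * (x * dy f) + (2 * q') * f + (2 * a) * (x * x) +
    (2 * b) * (x * y) + (2 * a') * (x * h) + (2 * b') * (y * h)); last by ring.
  by do 8?apply: KidealD; apply: KidealM => //; exact: Kideal_xx.
rewrite E23 uE vE (_ : _ + _ = x * (- 2 * r'' * dx h - 2 * p' * dy h + q'' + r) +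
  (- 2 * r' * dx h + q' + r'') * h + (- 2 * p) * (y * dy h) + r' * f); last by ring.
apply: yidealD; last exact: yidealM.
apply: yidealD; last by apply: yidealM; exact: yideal_ydy.
by apply: yidealD; [exact: yideal_x|exact: yidealM].
Qed.

Definition block21_basis n0 m0 (i : 'I_3 + ('I_n0 + 'I_m0)) : 'M[S]_3 :=
  match i with
  | inl k => nth 0 [:: sym3 0 1 0 0 0 0; sym3 0 0 1 0 0 0; sym3 0 0 0 x 0 0] k
  | inr (inl k) => sym3 0 0 0 (y ^+ k) 0 0
  | inr (inr k) => sym3 0 0 0 0 (y ^+ k) 0
  end.

Lemma block21_basis_sym n0 m0 i : gsym (@block21_basis n0 m0 i).
Proof. by case: i => [[[|[|[|]]]]|[]] //= *; exact: sym3_tr. Qed.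

Lemma block21_basis_sum n0 m0 (c : 'I_3 + ('I_n0 + 'I_m0) -> R) :
  \sum_i C (c i) *: block21_basis i = sym3 0 (C (c (inl o0))) (C (c (inl o1)))
    (\sum_k C (c (inr (inl k))) * y ^+ k + x * \sum_(k < 1) C (c (inl o2)) * y ^+ k)
    (\sum_k C (c (inr (inr k))) * y ^+ k) 0.
Proof.
rewrite big_sum3 /=.
under eq_bigr do rewrite sym3Z; under [X in _ + (_ + X)]eq_bigr do rewrite sym3Z.
rewrite !sym3_sum !sym3Z !sym3D !simp ?big1_eq.
rewrite big_ord_recl big_ord0 expr0.
have z n (t : 'I_n -> S) : \sum_k t k * 0 = 0 by apply: big1 => k _; rewrite mulr0.
rewrite !z !simp; congr sym3.
by rewrite addrC mulrC.
Qed.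

Lemma block21_indep n0 m0 : (0 < n0)%N -> (0 < m0)%N ->
  [/\ ev f = 0, ev (dx f) = 0 & ev (dy f) = 0] -> [/\ ev h = 0, ev (dx h) = 0 & ev (dy h) = 0] ->
  [/\ Kideal n0 1 (x * dx f), Kideal n0 1 (h * dx f), Kideal n0 1 (x * dy f) &
      Kideal n0 1 (y * dy f)] -> [/\ Kideal n0 1 f, Kideal n0 1 (x * h) & Kideal n0 1 (y * h)] ->
  Kideal n0 1 (x * y) -> yideal m0 f -> yideal m0 h ->
  forall c : 'I_3 + ('I_n0 + 'I_m0) -> R, gtang A (\sum_i C (c i) *: block21_basis i) ->
  forall i, c i = 0.
Proof.
move=> h1 h2 h3 h4 h5 h6 h7 h8 h9 c; rewrite block21_basis_sum.
move=> /(block21_tang h1 h2 h3 h4 h5 h6 h7 h8 h9)[|e1 e2 /Kideal_poly[t0 s0] /yideal_poly t1].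
  rewrite gdx_sum big1 ?rmorph0 // => k _; rewrite gdxM gdxC mul0r add0r.
  by case: (k : nat) => [|m]; rewrite ?expr0 ?gdE ?mulr0.
have e3 := s0 ord0.
case=> [[[|[|[|]]] // k]|[k|k]] //.
- by rewrite -[RHS]e1; congr (c (inl _)); apply/val_inj.
- by rewrite -[RHS]e2; congr (c (inl _)); apply/val_inj.
- by rewrite -[RHS]e3; congr (c (inl _)); apply/val_inj.
Qed.

(** [beta] is the (2, 2) entry of a tangent element whose (2, 3) entry is x: removing a multiple of
    x from (2, 3) costs the same multiple of beta at (2, 2). It is 0 for one normal form and 2 y^2
    for the other. *)
Lemma block21_codim beta n0 m0 : (0 < n0)%N -> (0 < m0)%N ->
  [/\ ev f = 0, ev (dx f) = 0 & ev (dy f) = 0] -> [/\ ev h = 0, ev (dx h) = 0 & ev (dy h) = 0] ->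
  [/\ Kideal n0 1 (x * dx f), Kideal n0 1 (h * dx f), Kideal n0 1 (x * dy f) &
      Kideal n0 1 (y * dy f)] -> [/\ Kideal n0 1 f, Kideal n0 1 (x * h) & Kideal n0 1 (y * h)] ->
  Kideal n0 1 (x * y) -> yideal m0 f -> yideal m0 h ->
  (forall F11 F12 F13 F22 F23 F33 : S, exists (c1 c2 : R) f' h',
    gtang A (sym3 F11 F12 F13 F22 F23 F33 - sym3 0 (C c1) (C c2) f' h' 0)) ->
  gtang A (sym3 0 0 0 (x * x) 0 0) -> gtang A (sym3 0 0 0 (x * y) 0 0) ->
  gtang A (sym3 0 0 0 (y ^+ n0) 0 0) -> gtang A (sym3 0 0 0 beta x 0) ->
  gtang A (sym3 0 0 0 0 (y ^+ m0) 0) -> gcodim A (3 + (n0 + m0)).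
Proof.
move=> h1 h2 h3 h4 h5 h6 h7 h8 h9 red T1 T2 T3 T4 T5.
apply: (gcodim_fin (b := @block21_basis n0 m0)) (block21_indep h1 h2 h3 h4 h5 h6 h7 h8 h9) _.
- by rewrite !card_sum !card_ord.
- exact: block21_basis_sym.
move=> F /symP ->.
have [c1 [c2 [f' [h' hT]]]] := red (F o0 o0) (F o0 o1) (F o0 o2) (F o1 o1) (F o1 o2) (F o2 o2).
have [t' [a' [b' E']]] := yexpand m0 h'.
have [t [a [b E]]] := yexpand n0 (f' - beta * a').
have [k [d [e Ea]]] := ev_expand 0 a.
pose c (i : 'I_3 + ('I_n0 + 'I_m0)) : R :=
  match i with inl j => nth 0 [:: c1; c2; k] j | inr (inl j) => t j | inr (inr j) => t' j end.
exists c; rewrite block21_basis_sum /=.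
have := gtangD hT (gtangD (gtangZ d T1) (gtangD (gtangZ e T2) (gtangD (gtangZ b T3)
  (gtangD (gtangZ a' T4) (gtangZ b' T5))))).
congr (gtang _ _); rewrite !sym3Z !sym3N !sym3D big_ord_recl big_ord0 expr0.
congr sym3; rewrite ?simp //; try ring.
  have {}E : f' = \sum_(k < n0) C (t k) * y ^+ k + x * a + y ^+ n0 * b + beta * a'.
    by rewrite -E; ring.
  by rewrite E Ea; ring.
by rewrite E'; ring.
Qed.
End Block21.

Lemma NF8_codim (s : bool) : gcodim (sym3 y x 0 ((-1) ^+ s * y ^+ 2) 0 x) 7.
Proof.
have [sg [sgP -> [sx sy]]] := sgnP T s.
apply: (@block21_codim _ _ 0 2 2) => //.
- by case: sgP => ->; rewrite !gdE !evE !simp.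
- by rewrite !gdE !evE.
- by case: sgP => ->; split; kid.
- by case: sgP => ->; split; kid.
- by kid.
- by case: sgP => ->; yid.
- by yid.
- move=> F11 F12 F13 F22 F23 F33.
  have [c1 [a [b E1]]] := ev_expand 0 (F12 - F33).
  have [c2 [c [d E2]]] := ev_expand 0 F13.
  exists c1, c2, (F22 - F11 * (2 * sg * y) - 2 * (b * x) - 2 * sg * y ^+ 2 * a), (F23 - x * d).
  apply: (@gtang_sym3 _ _ _ _ _ _ _ _ F33 F11 0 b d 0 a 0 c 0 0).
  have {}E1 : F12 = C c1 + 1 * (x * a + y * b) + F33 by rewrite -E1; ring.
  rewrite sym3N sym3D gact_sym3 !gdE sx sy E1 E2; congr sym3; ring.
- apply: (@gtang_scale _ 3); rewrite sym3Z.
  by case: sgP => ->; member (- (2 * x * y)) (0 : S) (0 : S) (2 * x) (0 : S) (0 : S) (0 : S) (0 : S) (0 : S) (0 : S) (y : S).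
- apply: (@gtang_scale _ 5); rewrite sym3Z; case: sgP => ->.
    by member (0 : S) (2 * x) (0 : S) (y : S) (0 : S) (- 1 : S) (0 : S) (0 : S) (0 : S) (0 : S) (0 : S).
  by member (0 : S) (- (2 * x)) (0 : S) (y : S) (0 : S) (1 : S) (0 : S) (0 : S) (0 : S) (0 : S) (0 : S).
- apply: (@gtang_scale _ 5); rewrite sym3Z; case: sgP => ->.
    by member (0 : S) (2 * y) (- 1 : S) (0 : S) (0 : S) (0 : S) (1 : S) (0 : S) (0 : S) (0 : S) (0 : S).
  by member (0 : S) (- (2 * y)) (1 : S) (0 : S) (0 : S) (0 : S) (- 1 : S) (0 : S) (0 : S) (0 : S) (0 : S).
- by case: sgP => ->; member (0 : S) (0 : S) (0 : S) (0 : S) (0 : S) (0 : S) (0 : S) (0 : S) (0 : S) (1 : S) (0 : S).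
- case: sgP => ->.
    by member (0 : S) (0 : S) (0 : S) (0 : S) (0 : S) (0 : S) (0 : S) (1 : S) (- 1 : S) (0 : S) (0 : S).
  by member (0 : S) (0 : S) (0 : S) (0 : S) (0 : S) (0 : S) (0 : S) (- 1 : S) (1 : S) (0 : S) (0 : S).
Qed.

Lemma NF10_codim : gcodim (sym3 y x 0 0 (y ^+ 2) x) 8.
Proof.
apply: (@block21_codim _ _ (2 * y ^+ 2) 3 2) => //.
- by rewrite !gdE !evE.
- by rewrite !gdE !evE !simp.
- by split; kid.
- by split; kid.
- by kid.
- by yid.
- by yid.
- move=> F11 F12 F13 F22 F23 F33.
  have [c2 [c [d E2]]] := ev_expand 0 F13.
  have [c1 [a [b E1]]] := ev_expand 0 (F12 - F33 - y ^+ 2 * c).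
  exists c1, c2, (F22 - 2 * (b * x)), (F23 - F11 * (2 * y) - y ^+ 2 * a - x * d).
  apply: (@gtang_sym3 _ _ _ _ _ _ _ _ F33 F11 0 b d 0 a 0 c 0 0).
  have {}E1 : F12 = C c1 + 1 * (x * a + y * b) + F33 + y ^+ 2 * c by rewrite -E1; ring.
  rewrite sym3N sym3D gact_sym3 !gdE E1 E2; congr sym3; ring.
- apply: (@gtang_scale _ 19); rewrite sym3Z.
  by member (- (10 * x * y)) (- (2 * y ^+ 2)) (y : S) (10 * x) (0 : S) (0 : S) (- y) (0 : S) (0 : S) (0 : S) (5 * y).
- apply: (@gtang_scale _ 5); rewrite sym3Z.
  by member (- (2 * y ^+ 2)) (0 : S) (0 : S) (3 * y) (0 : S) (0 : S) (0 : S) (1 : S) (- 1 : S) (0 : S) (0 : S).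
- apply: (@gtang_scale _ 9); rewrite sym3Z.
  by member (0 : S) (- (2 * x)) (0 : S) (0 : S) (- y) (1 : S) (0 : S) (0 : S) (0 : S) (5 * y) (0 : S).
- by member (0 : S) (0 : S) (0 : S) (0 : S) (0 : S) (0 : S) (0 : S) (0 : S) (0 : S) (1 : S) (0 : S).
- apply: (@gtang_scale _ 4); rewrite sym3Z.
  by member (0 : S) (2 * y) (- 1 : S) (0 : S) (0 : S) (0 : S) (1 : S) (0 : S) (0 : S) (0 : S) (0 : S).
Qed.
End Codimensions4.

(** * Codimensions of the diagonal and scalar families *)

Section Codimensions5.
Context {R : realType} (T : germ_theory R).
Local Notation S := (gring T).
Local Notation ev := (gev T).
Local Notation C := (gcst T).
Local Notation dx := (@gdx R T).
Local Notation dy := (@gdy R T).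
Local Notation x := (gX T).
Local Notation y := (gY T).
Implicit Types (f g h : S).
Let evE := (gevX T, gevY T, rmorph0 ev, rmorph1 ev, rmorphN ev, rmorphB ev, gev_cst T,
  rmorphD ev, rmorphM ev).
Let simp := (mulr0, mul0r, mulr1, mul1r, addr0, add0r, oppr0, subr0).

Lemma big_sum_bool (I J : finType) (F : bool + (I + J) -> 'M[S]_3) :
  \sum_i F i = F (inl true) + F (inl false) +
    (\sum_i F (inr (inl i)) + \sum_j F (inr (inr j))).
Proof. by rewrite big_sumType /= big_sumType /= big_bool. Qed.

Let z n (t : 'I_n -> S) : \sum_k t k * 0 = 0.
Proof. by apply: big1 => k _; rewrite mulr0. Qed.

Definition diag_basis m1 m2 (i : bool + ('I_m1 + 'I_m2)) : 'M[S]_3 :=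
  match i with
  | inl b => if b then sym3 0 0 1 0 0 0 else sym3 0 0 0 0 1 0
  | inr (inl k) => sym3 (y ^+ k) 0 0 0 0 0
  | inr (inr k) => sym3 0 0 0 (y ^+ k) 0 0
  end.

Lemma diag_basis_sym m1 m2 i : gsym (@diag_basis m1 m2 i).
Proof. by case: i => [[]|[]] //= *; exact: sym3_tr. Qed.

Lemma diag_basis_sum m1 m2 (c : bool + ('I_m1 + 'I_m2) -> R) :
  \sum_i C (c i) *: diag_basis i = sym3 (\sum_k C (c (inr (inl k))) * y ^+ k) 0
    (C (c (inl true))) (\sum_k C (c (inr (inr k))) * y ^+ k) (C (c (inl false))) 0.
Proof.
rewrite big_sum_bool /=.
under eq_bigr do rewrite sym3Z; under [X in _ + (_ + X)]eq_bigr do rewrite sym3Z.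
by rewrite !sym3_sum !sym3Z !sym3D !z !simp.
Qed.

(** As for [block3_indep], the general f and g are needed for the lower bound; the signed powers of
    y give the codimension of the normal form. The two extra classes are the constants at (1, 3) and
    (2, 3). *)
Lemma diagtype_indep f g m1 m2 : (0 < m1)%N -> (0 < m2)%N ->
  yideal m1 f -> yideal m2 g -> yideal m1 (dx f * g) -> yideal m2 (dx g * f) ->
  forall c : bool + ('I_m1 + 'I_m2) -> R,
  gtang (sym3 f x 0 g 0 y) (\sum_i C (c i) *: diag_basis i) -> forall i, c i = 0.
Proof.
move=> h1 h2 h3 h4 h5 h6 c; rewrite diag_basis_sum.
move=> /(diagtype_tang h1 h2 h3 h4 h5 h6)[/yideal_poly t0 /yideal_poly s0].
by rewrite !gev_cst => c1 c2; case=> [[]|[]].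
Qed.

Lemma NF4_codim (s1 s2 : bool) l1 l2 : (0 < l1)%N -> (0 < l2)%N ->
  gcodim (sym3 ((-1) ^+ s1 * y ^+ l1) x 0 ((-1) ^+ s2 * y ^+ l2) 0 y) (l1 + l2 + 2).
Proof.
have [sg1 [sg1P -> [s1x s1y]]] := sgnP T s1; have [sg2 [sg2P -> [s2x s2y]]] := sgnP T s2.
case: l1 => // n1 _; case: l2 => // n2 _.
apply: (gcodim_fin (b := @diag_basis n1.+1 n2.+1)).
- by rewrite !card_sum !card_ord card_bool addnC.
- exact: diag_basis_sym.
- apply: diagtype_indep => //.
  + by exists 0, sg1; ring.
  + by exists 0, sg2; ring.
  + by exists 0, 0; rewrite !gdE s1x; ring.
  + by exists 0, 0; rewrite !gdE s2x; ring.
move=> F /symP ->; move: (F o0 o0) (F o0 o1) (F o0 o2) (F o1 o1) (F o1 o2) (F o2 o2).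
move=> {F} F11 F12 F13 F22 F23 F33.
have [t1 [a [b E11]]] := yexpand n1.+1 (F11 - sg1 * n1.+1%:R * y ^+ n1 * F33).
have [t2 [a' [b' E22]]] := yexpand n2.+1 (F22 - sg2 * n2.+1%:R * y ^+ n2 * F33).
have [ha haE] := germ_half a; have [hb hbE] := germ_half b.
have [ha' ha'E] := germ_half a'; have [hb' hb'E] := germ_half b'.
have [c1 [d [c E13]]] := ev_expand 0 F13.
have [c2 [d' [c' E23]]] := ev_expand 0 F23.
pose cf (i : bool + ('I_n1.+1 + 'I_n2.+1)) : R :=
  match i with inl b => if b then c1 else c2 | inr (inl k) => t1 k | inr (inr k) => t2 k end.
exists cf; rewrite diag_basis_sum /=.
set P1 := \sum_k _ in E11 *; set P2 := \sum_k _ in E22 *.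
apply: (@gtang_sym3 _ _ _ _ _ _ _ _
  (F12 - x * (sg1 * hb) - ha * (sg2 * y ^+ n2.+1) - ha' * (sg1 * y ^+ n1.+1) - x * (sg2 * hb'))
  F33 (sg1 * hb) ha' d' ha (sg2 * hb') d (c - sg1 * y ^+ n1 * d') (c' - sg2 * y ^+ n2 * d) 0).
have {}E11 : F11 = P1 + x * a + y ^+ n1.+1 * b + sg1 * n1.+1%:R * y ^+ n1 * F33 by rewrite -E11; ring.
have {}E22 : F22 = P2 + x * a' + y ^+ n2.+1 * b' + sg2 * n2.+1%:R * y ^+ n2 * F33 by rewrite -E22; ring.
rewrite E11 E22 E13 E23 haE hbE ha'E hb'E sym3N sym3D gact_sym3 !gdE s1x s1y s2x s2y !exprS.
by case: sg1P => ->; case: sg2P => ->; congr sym3; ring.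
Qed.

Definition scalar_basis m (i : bool + ('I_m + 'I_m)) : 'M[S]_3 :=
  match i with
  | inl b => if b then sym3 0 0 1 0 0 0 else sym3 0 0 0 0 1 0
  | inr (inl k) => sym3 (y ^+ k) 0 0 (- y ^+ k) 0 0
  | inr (inr k) => sym3 0 (y ^+ k) 0 0 0 0
  end.

Lemma scalar_basis_sym m i : gsym (@scalar_basis m i).
Proof. by case: i => [[]|[]] //= *; exact: sym3_tr. Qed.

Lemma scalar_basis_sum m (c : bool + ('I_m + 'I_m) -> R) :
  \sum_i C (c i) *: scalar_basis i = sym3 (\sum_k C (c (inr (inl k))) * y ^+ k)
    (\sum_k C (c (inr (inr k))) * y ^+ k)
    (C (c (inl true))) (- \sum_k C (c (inr (inl k))) * y ^+ k) (C (c (inl false))) 0.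
Proof.
rewrite big_sum_bool /=.
under eq_bigr do rewrite sym3Z; under [X in _ + (_ + X)]eq_bigr do rewrite sym3Z.
rewrite !sym3_sum !sym3Z !sym3D !z !simp; congr sym3.
by rewrite -sumrN; apply: eq_bigr => k _; rewrite mulrN.
Qed.

Lemma scalartype_indep f g l : (0 < l)%N -> yideal l f -> yideal l g ->
  forall c : bool + ('I_l + 'I_l) -> R,
  gtang (sym3 (x + f) g 0 (x - f) 0 y) (\sum_i C (c i) *: scalar_basis i) -> forall i, c i = 0.
Proof.
move=> h1 h2 h3 c; rewrite scalar_basis_sum.
move=> /(scalartype_tang h1 h2 h3)[/yideal_poly t0 /yideal_poly s0].
by rewrite !gev_cst => c1 c2; case=> [[]|[]].
Qed.

Lemma NF5_codim l : (0 < l)%N -> gcodim (sym3 x (y ^+ l) 0 x 0 y) (2 * l + 2).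
Proof.
case: l => // n _; apply: (gcodim_fin (b := @scalar_basis n.+1)).
- by rewrite !card_sum !card_ord card_bool addnC mul2n addnn.
- exact: scalar_basis_sym.
- have -> : sym3 x (y ^+ n.+1) 0 x 0 y = sym3 (x + 0) (y ^+ n.+1) 0 (x - 0) 0 y by rewrite subr0 addr0.
  apply: scalartype_indep => //.
  + by exists 0, 0; ring.
  + by exists 0, 1; ring.
move=> F /symP ->; move: (F o0 o0) (F o0 o1) (F o0 o2) (F o1 o1) (F o1 o2) (F o2 o2).
move=> {F} F11 F12 F13 F22 F23 F33.
have [t2 [a [b E12]]] := yexpand n.+1 (F12 - n.+1%:R * y ^+ n * F33).
have [s sE] := germ_half (F11 - F22).
have [t1 [g [h Es]]] := yexpand n.+1 s.
have [hb hbE] := germ_half b; have [ha haE] := germ_half a.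
have [hg hgE] := germ_half g; have [hh hhE] := germ_half h.
have [c1 [d [c E13]]] := ev_expand 0 F13.
have [c2 [d' [c' E23]]] := ev_expand 0 F23.
pose cf (i : bool + ('I_n.+1 + 'I_n.+1)) : R :=
  match i with inl b => if b then c1 else c2 | inr (inl k) => t1 k | inr (inr k) => t2 k end.
exists cf; rewrite scalar_basis_sum /=.
set P1 := \sum_k C (t1 k) * _ in Es *; set P2 := \sum_k C (t2 k) * _ in E12 *.
apply: (@gtang_sym3 _ _ _ _ _ _ _ _
  (F11 - P1 - 2 * (hb + hg) * x - 2 * (ha + hh) * y ^+ n.+1) F33
  (hb + hg) (ha - hh) d (ha + hh) (hb - hg) d' (c - y ^+ n * d') (c' - y ^+ n * d) 0).
have {}E12 : F12 = P2 + x * a + y ^+ n.+1 * b + n.+1%:R * y ^+ n * F33 by rewrite -E12; ring.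
have {}sE : F22 = F11 - 2 * s by rewrite -sE; ring.
rewrite sE Es E12 E13 E23 haE hbE hgE hhE sym3N sym3D gact_sym3 !gdE !exprS.
by congr sym3; ring.
Qed.

Theorem normal_form_codim (N : 'M[T]_3) c : gnormal N c ->
  (forall a b : R, a *: map_mx ev (map_mx dx N) + b *: map_mx ev (map_mx dy N) = 0 ->
     a = 0 /\ b = 0) /\ gcodim N c.
Proof.
have cr (a b : R) (p q r s t u : S) :
    a *: map_mx ev (map_mx dx (sym3 p q r s t u)) + b *: map_mx ev (map_mx dy (sym3 p q r s t u)) = 0 ->
    [/\ a * ev (dx p) + b * ev (dy p) = 0, a * ev (dx q) + b * ev (dy q) = 0 &
      a * ev (dx s) + b * ev (dy s) = 0] /\
    [/\ a * ev (dx t) + b * ev (dy t) = 0, a * ev (dx u) + b * ev (dy u) = 0 &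
      a * ev (dx r) + b * ev (dy r) = 0].
  rewrite !map_sym3 !sym3Z !sym3D => /matrixP E.
  have := (E o0 o0, E o0 o1, E o0 o2, E o1 o1, E o1 o2, E o2 o2).
  by rewrite !sym3E !mxE => -[[[[[-> ->] ->] ->] ->] ->].
move=> H; split; last first.
  case: H => *; [exact: NF1_codim|exact: NF2_codim|exact: NF3_codim|apply: NF4_codim; lia
   |apply: NF5_codim; lia|exact: NF6_codim|exact: NF7_codim|exact: NF8_codim|exact: NF9_codim
   |exact: NF10_codim].
have fin (p q a b : R) : a = p -> b = q -> p = 0 -> q = 0 -> a = 0 /\ b = 0 by move=> -> -> -> ->.
case: H => [|s|s|s1 s2 l1 l2 _ _ _|l _|s| |s| |] a b /cr[[h11 h12 h22] [h23 h33 h13]];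
  [apply: fin h11 h22|apply: fin h11 h22|apply: fin h22 h23|apply: fin h12 h33|apply: fin h11 h33
  |apply: fin h13 h12|apply: fin h13 h12|apply: fin h12 h11|apply: fin h13 h12|apply: fin h12 h11];
  by rewrite !gdE !evE !simp.
Qed.
End Codimensions5.

(** * Pencils of ternary quadratic forms *)

Lemma det_mx3 (K : comNzRingType) (a b c d e f g h k : K) :
  \det (mx3 a b c d e f g h k) = a * (e * k - f * h) - b * (d * k - f * g) + c * (d * h - e * g).
Proof.
rewrite (expand_det_row _ ord0) !big_ord_recl big_ord0 /cofactor.
rewrite !(expand_det_row _ ord0) !big_ord_recl !big_ord0 /cofactor !det_mx11 !mxE /=.
by rewrite !(expr0, expr1, exprS); ring.
Qed.

Lemma congr_sym3 (K : comNzRingType) (a b c d e f p q r p' q' r' p'' q'' r'' : K) :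
  let B u u' u'' v v' v'' := u * v * a + u' * v' * d + u'' * v'' * f + (u * v' + u' * v) * b +
    (u * v'' + u'' * v) * c + (u' * v'' + u'' * v') * e in
  (mx3 p q r p' q' r' p'' q'' r'')^T *m sym3 a b c d e f *m mx3 p q r p' q' r' p'' q'' r'' =
  sym3 (B p p' p'' p p' p'') (B p p' p'' q q' q'') (B p p' p'' r r' r'')
    (B q q' q'' q q' q'') (B q q' q'' r r' r'') (B r r' r'' r r' r'').
Proof.
apply/matrixP; apply: forall_ord3; apply: forall_ord3;
  rewrite mxE sum_ord3 ![(_ *m _) _ _]mxE !sum_ord3 ![(mx3 _ _ _ _ _ _ _ _ _)^T _ _]mxE !sym3E !mx3E;
  ring.
Qed.

(** At K and -K, with K = 1 + |a| + |b| + |c|, the leading term dominates, so the cubic changes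
    sign. *)
Lemma cubic_root (R : realType) (a b c : R) : exists t, t ^+ 3 + a * t ^+ 2 + b * t + c = 0.
Proof.
pose K := 1 + `|a| + `|b| + `|c|.
have [a0 b0 c0] := And3 (normr_ge0 a) (normr_ge0 b) (normr_ge0 c).
have K1 : 1 <= K by rewrite /K; lra.
pose p : {poly R} := 'X^3 + a *: 'X^2 + b *: 'X + c%:P.
have pE t : p.[t] = t ^+ 3 + a * t ^+ 2 + b * t + c by rewrite /p !hornerE.
have bnd t : t * t = K * K -> `|a * t ^+ 2 + b * t + c| <= K ^+ 3.
  move=> tK; have tn : `|t| = K by apply: (pexpIrn (n := 2)); rewrite ?nnegrE ?normr_ge0 //; [lra|rewrite -normrX expr2 tK ger0_norm ?expr2 // mulr_ge0 //; lra].
  have e1 : `|a * t ^+ 2| = `|a| * K ^+ 2 by rewrite normrM normrX tn.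
  have e2 : `|b * t| = `|b| * K by rewrite normrM tn.
  apply: le_trans (ler_normD _ _) _; apply: le_trans (lerD (ler_normD _ _) (lexx _)) _.
  rewrite e1 e2.
  have h : `|a| * K ^+ 2 + `|b| * K + `|c| <= (`|a| + `|b| + `|c|) * K ^+ 2.
    have k1 : K <= K ^+ 2 by rewrite expr2 ler_peMr //; lra.
    have k2 : 1 <= K ^+ 2 by lra.
    have h1 : `|b| * K <= `|b| * K ^+ 2 by apply: ler_wpM2l.
    have h2 : `|c| <= `|c| * K ^+ 2 by apply: ler_peMr.
    lra.
  apply: le_trans h _; rewrite (exprS K 2); apply: ler_wpM2r; first by apply: exprn_ge0; lra.
  by rewrite /K; lra.
have [||t _ /rootP] := @poly_ivt R p (- K) K; first lra.
  rewrite !pE; have := bnd (- K); have := bnd K; rewrite mulrNN => /(_ erefl) + /(_ erefl).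
  rewrite !ler_norml => /andP[h1 h2] /andP[h3 h4].
  by apply/andP; split; [rewrite [(- K) ^+ 3]exprNn; lra|lra].
by rewrite pE => E; exists t.
Qed.

Section PencilClassification.
(** [G P Q] stands for what has to be proved of the germs with 1-jet x P + y Q. The classification
    is thus an induction principle: G is inherited backwards along changes of coordinates, holds for
    the representatives, hence for every nonzero pencil. *)
Variables (R : realType) (G : 'M[R]_3 -> 'M[R]_3 -> Prop).
Hypothesis G_step : forall P Q (al be ga de : R) (M : 'M[R]_3), P^T = P -> Q^T = Q ->
  al * de - be * ga != 0 -> \det M != 0 ->
  G (M^T *m (al *: P + ga *: Q) *m M) (M^T *m (be *: P + de *: Q) *m M) -> G P Q.
Hypothesis G_corank1 : forall P, P^T = P -> P != 0 -> G P 0.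
Hypothesis G_block : forall a b d a' b' d', G (sym3 a b 0 d 0 0) (sym3 a' b' 0 d' 0 0).
Hypothesis G_isotropic : G (sym3 0 0 1 0 0 0) (sym3 0 1 0 0 0 0).
Hypothesis G_NF1 : G (sym3 1 0 0 0 0 1) (sym3 0 0 0 1 0 (-1)).
Hypothesis G_NF2 : forall s : bool,
  G (sym3 1 0 0 0 0 ((-1) ^+ s)) (sym3 0 0 0 1 0 ((-1) ^+ s)).
Hypothesis G_NF3 : G (sym3 1 0 0 1 0 (-1)) (sym3 0 0 0 0 1 0).
Hypothesis G_diag : forall eps, G (sym3 0 1 0 0 0 0) (sym3 0 0 0 eps 0 1).
Hypothesis G_scalar : G (sym3 1 0 0 1 0 0) (sym3 0 0 0 0 0 1).
Hypothesis G_block3 : G (sym3 0 0 1 1 0 0) (sym3 0 1 0 0 0 0).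
Hypothesis G_block21 : G (sym3 0 1 0 0 0 1) (sym3 1 0 0 0 0 0).

(** The coordinate form of [G_step]: x and y are replaced by al x + be y and ga x + de y, and the
    columns of M are the new basis vectors. *)
Lemma step3 (al be ga de : R) (p q r p' q' r' p'' q'' r'' a b c d e f a' b' c' d' e' f' : R) P' Q' :
  let M := mx3 p q r p' q' r' p'' q'' r'' in
  let P := sym3 a b c d e f in let Q := sym3 a' b' c' d' e' f' in
  G P' Q' ->
  al * de - be * ga != 0 ->
  p * (q' * r'' - r' * q'') - q * (p' * r'' - r' * p'') + r * (p' * q'' - q' * p'') != 0 ->
  M^T *m (sym3 (al * a + ga * a') (al * b + ga * b') (al * c + ga * c') (al * d + ga * d')
    (al * e + ga * e') (al * f + ga * f')) *m M = P' ->
  M^T *m (sym3 (be * a + de * a') (be * b + de * b') (be * c + de * c') (be * d + de * d')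
    (be * e + de * e') (be * f + de * f')) *m M = Q' -> G P Q.
Proof.
move=> M P Q GPQ D DM E1 E2; apply: (@G_step _ _ al be ga de M); rewrite ?sym3_tr //.
  by rewrite det_mx3.
by rewrite /P /Q !sym3Z !sym3D E1 E2.
Qed.

Local Ltac fld := first [reflexivity | by ring | by field; repeat (apply/andP; split); assumption
  | by field].
Local Ltac eqs := rewrite congr_sym3; congr sym3; fld.
Local Ltac ne := rewrite ?(mulr0, mul0r, mulr1, mul1r, addr0, add0r, subr0, sub0r, mulrN, mulNr,
  opprK, oppr_eq0, invr_eq0); try (exact: oner_neq0); try assumption.

Lemma sqrt_inv (a : R) : 0 < a -> exists u, u != 0 /\ u * u * a = 1.
Proof.
move=> a0; have s0 : Num.sqrt a != 0 by rewrite gt_eqF // sqrtr_gt0.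
exists (Num.sqrt a)^-1; split; first by rewrite invr_eq0.
by rewrite -{3}(sqr_sqrtr (ltW a0)); field.
Qed.

Lemma sqrt_ex (a : R) : 0 < a -> exists m, m != 0 /\ m * m = a.
Proof.
move=> a0; exists (Num.sqrt a); split; first by rewrite gt_eqF // sqrtr_gt0.
by rewrite -expr2 sqr_sqrtr // ltW.
Qed.

Let two0 : (2 : R) != 0. Proof. by rewrite pnatr_eq0. Qed.

(** The kernel line e3 of Q is isotropic for P. If ga is nonzero the pencil is of diagonal type. If
    ga = 0 and be is nonzero, r decides between a pencil divisible by one linear form (r = 0) and
    the block of size three. If Q has rank one, r decides between a pencil in two variables and the
    blocks of sizes two and one. *)
Lemma G_c0 r (al be ga : R) : ~ [/\ al = 0, be = 0 & ga = 0] ->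
  G (sym3 0 0 1 r 0 0) (sym3 al be 0 ga 0 0).
Proof.
move=> Q0; have [ga0|ga0] := eqVneq ga 0; last first.
  pose b := be / ga; pose a := al / ga.
  apply: (@step3 1 0 (- (r / ga)) (ga^-1) 0 1 0 0 (- b) 1 1 ((r * a - 2 * r * b ^+ 2) / 2) (r * b)
    _ _ _ _ _ _ _ _ _ _ _ _ _ _ (G_diag (a - b ^+ 2))).
  - by ne; rewrite invr_eq0.
  - by rewrite (_ : _ + _ = 1) ?oner_neq0 //; ring.
  - by rewrite /a /b; eqs.
  - by rewrite /a /b; eqs.
have [be0|be0] := eqVneq be 0; last first.
  have [r0|r0] := eqVneq r 0.
    apply: (@step3 1 0 0 (be^-1) 1 0 0 (- (al / (2 * be))) 1 0 0 0 1
      _ _ _ _ _ _ _ _ _ _ _ _ _ _ G_isotropic).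
    - by ne; rewrite invr_eq0.
    - by rewrite (_ : _ + _ = 1) ?oner_neq0 //; ring.
    - by rewrite r0; eqs.
    - by rewrite ga0; eqs.
  pose s := - (al / (2 * be)).
  apply: (@step3 (r^-1) 0 0 (be^-1) 1 0 0 s 1 0 (- (s * s * r / 2)) (- (s * r)) r
    _ _ _ _ _ _ _ _ _ _ _ _ _ _ G_block3).
  - by ne; rewrite mulf_neq0 // invr_eq0.
  - by rewrite (_ : _ + _ = r) //; ring.
  - by rewrite ga0 /s; eqs.
  - by rewrite ga0 /s; eqs.
have al0 : al != 0 by apply/eqP => al0; apply: Q0.
have [r0|r0] := eqVneq r 0.
  apply: (@step3 1 0 0 1 1 0 0 0 0 1 0 1 0 _ _ _ _ _ _ _ _ _ _ _ _ _ _ (G_block 0 1 0 al 0 0)).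
  - by ne.
  - by rewrite (_ : _ + _ = - 1) ?oppr_eq0 ?oner_neq0 //; ring.
  - by rewrite r0 ga0 be0; eqs.
  - by rewrite r0 ga0 be0; eqs.
apply: (@step3 (r^-1) 0 0 (al^-1) 1 0 0 0 0 1 0 r 0 _ _ _ _ _ _ _ _ _ _ _ _ _ _ G_block21).
- by ne; rewrite mulf_neq0 // invr_eq0.
- by rewrite (_ : _ + _ = - r) ?oppr_eq0 //; ring.
- by rewrite ga0 be0; eqs.
- by rewrite ga0 be0; eqs.
Qed.

(** A change of basis fixing the line e3 turns the third column of P into e1 and leaves a single
    further entry r at (2, 2). *)
Lemma G_c0' p11 p12 q1 p22 q2 (al be ga : R) : q1 != 0 -> ~ [/\ al = 0, be = 0 & ga = 0] ->
  G (sym3 p11 p12 q1 p22 q2 0) (sym3 al be 0 ga 0 0).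
Proof.
move=> q10 Q0.
have GG : G (sym3 0 0 1 (p22 - 2 * (q2 / q1) * p12 + (q2 / q1) ^+ 2 * p11) 0 0)
  (sym3 (al / q1 ^+ 2) (be / q1 - q2 / q1 ^+ 2 * al) 0 (ga - 2 * (q2 / q1) * be + (q2 / q1) ^+ 2 * al) 0 0).
  apply: G_c0.
  move=> [] /eqP; rewrite mulf_eq0 invr_eq0 expf_eq0 /= (negPf q10) orbF => /eqP a0.
  rewrite a0 mulr0 subr0 => /eqP; rewrite mulf_eq0 invr_eq0 (negPf q10) orbF => /eqP b0.
  by rewrite b0 !mulr0 subr0 addr0 => g0; apply: Q0.
apply: (@step3 1 0 0 1 (q1^-1) (- (q2 / q1)) 0 0 1 0 (- (p11 / (2 * q1 ^+ 2)))
  (q2 * p11 / q1 ^+ 2 - p12 / q1) 1 _ _ _ _ _ _ _ _ _ _ _ _ _ _ GG).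
- by ne.
- by rewrite (_ : _ + _ = q1^-1) ?invr_eq0 //; ring.
- by eqs.
- by eqs.
Qed.

(** P is diagonal and Q hyperbolic on the plane. A zero among a, d gives the diagonal type;
    otherwise the signs decide: equal signs make the pencil simultaneously diagonalisable, opposite
    signs give the third normal form. *)
Lemma G_H a d : G (sym3 a 0 0 d 0 1) (sym3 0 1 0 0 0 0).
Proof.
have [a0|a0] := eqVneq a 0.
  apply: (@step3 0 1 1 0 1 0 0 0 1 0 0 0 1 _ _ _ _ _ _ _ _ _ _ _ _ _ _ (G_diag d)).
  - by ne.
  - by rewrite (_ : _ + _ = 1) ?oner_neq0 //; ring.
  - by eqs.
  - by rewrite a0; eqs.
have [d0|d0] := eqVneq d 0.
  apply: (@step3 0 1 1 0 0 1 0 1 0 0 0 0 1 _ _ _ _ _ _ _ _ _ _ _ _ _ _ (G_diag a)).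
  - by ne.
  - by rewrite (_ : _ + _ = - 1) ?oppr_eq0 ?oner_neq0 //; ring.
  - by eqs.
  - by rewrite d0; eqs.
have pos (c : R) : c != 0 -> exists sg u, [/\ (sg = 1 /\ 0 < c) \/ (sg = -1 /\ c < 0), u != 0 & u * u * (sg * c) = 1].
  move=> c0; have [cn|cp|E] := ltrgtP c 0; last by rewrite E eqxx in c0.
    have [u [u0 uE]] : exists u, u != 0 /\ u * u * (- c) = 1 by apply: sqrt_inv; rewrite oppr_gt0.
    by exists (-1), u; split=> //; [right|rewrite mulN1r].
  have [u [u0 uE]] := sqrt_inv cp.
  by exists 1, u; split=> //; [left|rewrite mul1r].
have [sa [u [saP u0 uE]]] := pos a a0; have [sd [w [sdP w0 wE]]] := pos d d0.
have [k [k0 kE]] : exists k, k != 0 /\ k * k * 2 = 1 :> R by exact: sqrt_inv.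
have [m [m0 mE]] : exists m, m != 0 /\ m * m = 2 :> R by exact: sqrt_ex.
have uw0 : u * w != 0 by rewrite mulf_neq0.
have aE : a = sa / (u * u).
  have h : u * u * a = sa by case: saP uE => [[-> _]|[-> _]] uE; lra.
  by rewrite -h; field; rewrite ?u0.
have dE : d = sd / (w * w).
  have h : w * w * d = sd by case: sdP wE => [[-> _]|[-> _]] wE; lra.
  by rewrite -h; field; rewrite ?w0.
(* The new basis vectors are (u, w, 0) and (u, -w, 0) divided by the square root of 2, on which P
   and Q are both diagonal; the new coordinates are a half sum and a half difference of the
   normalised forms. *)
have same sg : G (sym3 1 0 0 0 0 sg) (sym3 0 0 0 1 0 sg) -> sg = 1 \/ sg = -1 -> sa = sg -> sd = sg ->
    G (sym3 a 0 0 d 0 1) (sym3 0 1 0 0 0 0).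
  move=> Gs sgP Ea Ed.
  apply: (@step3 (sg / 2) (sg / 2) ((u * w)^-1 / 2) (- ((u * w)^-1 / 2)) (k * u) (k * u) 0 (k * w)
    (- (k * w)) 0 0 0 m _ _ _ _ _ _ _ _ _ _ _ _ _ _ Gs).
  - rewrite (_ : _ - _ = - (sg * (u * w)^-1 / 2)); last by field; rewrite ?u0 ?w0.
    rewrite oppr_eq0 !mulf_neq0 ?invr_eq0 //; case: sgP => ->; by rewrite ?oppr_eq0 oner_neq0.
  - rewrite (_ : _ + _ = - (2 * (k * k) * (u * w) * m)); last by ring.
    by rewrite oppr_eq0 !mulf_neq0.
  - rewrite aE dE Ea Ed congr_sym3; congr sym3; case: sgP => ->;
      try (by field; rewrite ?u0 ?w0);
      first [refine (etrans _ kE); by field; rewrite ?u0 ?w0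
        | transitivity (m * m / 2); [by field; rewrite ?u0 ?w0|by rewrite mE divff]
        | transitivity (- (m * m / 2)); [by field; rewrite ?u0 ?w0|by rewrite mE divff]].
  - rewrite aE dE Ea Ed congr_sym3; congr sym3; case: sgP => ->;
      try (by field; rewrite ?u0 ?w0);
      first [refine (etrans _ kE); by field; rewrite ?u0 ?w0
        | transitivity (m * m / 2); [by field; rewrite ?u0 ?w0|by rewrite mE divff]
        | transitivity (- (m * m / 2)); [by field; rewrite ?u0 ?w0|by rewrite mE divff]].
case: saP => [[Ea ap]|[Ea an]]; case: sdP => [[Ed dp]|[Ed dn]].
- by apply: (same 1) => //; [exact: (G_NF2 false)|left].
- apply: (@step3 1 0 0 ((u * w)^-1) 0 u 0 0 0 w 1 0 0 _ _ _ _ _ _ _ _ _ _ _ _ _ _ G_NF3).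
  + by ne; rewrite invr_eq0.
  + by rewrite (_ : _ + _ = u * w) //; ring.
  + by rewrite aE dE Ea Ed; rewrite congr_sym3; congr sym3; field; rewrite ?u0 ?w0.
  + by rewrite congr_sym3; congr sym3; field; rewrite ?u0 ?w0.
- apply: (@step3 1 0 0 ((u * w)^-1) 0 0 u 0 w 0 1 0 0 _ _ _ _ _ _ _ _ _ _ _ _ _ _ G_NF3).
  + by ne; rewrite invr_eq0.
  + by rewrite (_ : _ + _ = - (u * w)) ?oppr_eq0 //; ring.
  + by rewrite aE dE Ea Ed; rewrite congr_sym3; congr sym3; field; rewrite ?u0 ?w0.
  + by rewrite congr_sym3; congr sym3; field; rewrite ?u0 ?w0.
- by apply: (same (-1)) => //; [exact: (G_NF2 true)|right].
Qed.

Lemma G_Hshift a b d : G (sym3 a b 0 d 0 1) (sym3 0 1 0 0 0 0).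
Proof.
apply: (@step3 1 0 (- b) 1 1 0 0 0 1 0 0 0 1 _ _ _ _ _ _ _ _ _ _ _ _ _ _ (G_H a d)).
- by ne.
- by rewrite (_ : _ + _ = 1) ?oner_neq0 //; ring.
- by eqs.
- by eqs.
Qed.

(** The first two columns of the change of basis are isotropic for diag(-1, 1), so Q becomes
    hyperbolic. *)
Lemma G_indef a b d : G (sym3 a b 0 d 0 1) (sym3 (-1) 0 0 1 0 0).
Proof.
have [k [k0 kE]] : exists k, k != 0 /\ k * k * 2 = 1 :> R by exact: sqrt_inv.
apply: (@step3 1 0 0 1 k (- k) 0 k k 0 0 0 1 _ _ _ _ _ _ _ _ _ _ _ _ _ _ (G_Hshift _ _ _)).
- by ne.
- by rewrite (_ : _ + _ = k * k * 2); [rewrite kE oner_neq0|ring].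
- by rewrite congr_sym3; congr sym3; first [by ring | reflexivity].
- by rewrite congr_sym3; congr sym3; first [by ring | refine (etrans _ kE); ring].
Qed.

(** The block of P is singular with eigenvectors (a, b), of eigenvalue t = n / a, and (-b, a), of
    eigenvalue 0, both of squared length n. They diagonalise the pencil; the sign of n t = n^2 / a
    decides in which order they are taken. *)
Lemma G_def' a b d : a * d = b ^+ 2 -> a != 0 -> G (sym3 a b 0 d 0 1) (sym3 1 0 0 1 0 0).
Proof.
move=> ad a0; have n0 : a ^+ 2 + b ^+ 2 != 0.
  by rewrite gt_eqF // ltr_pwDl ?sqr_ge0 // lt_neqAle sqr_ge0 eq_sym expf_neq0.
pose n := a ^+ 2 + b ^+ 2; pose t := n / a.
have t0 : t != 0 by rewrite mulf_neq0 // invr_eq0.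
have dE : d = b ^+ 2 / a by rewrite -ad mulrC mulKf.
have nE : n * t = n ^+ 2 / a by rewrite /t; field.
have nt0 : n * t != 0 by rewrite mulf_neq0.
have [tn|tp|E] := ltrgtP (n * t) 0; last by rewrite E eqxx in nt0.
  have [m [m0 mE]] : exists m, m != 0 /\ m * m = - (n * t) by apply: sqrt_ex; rewrite oppr_gt0.
  apply: (@step3 (- (n * t)^-1) ((n * t)^-1) (n^-1) 0 (- b) a 0 a b 0 0 0 m
    _ _ _ _ _ _ _ _ _ _ _ _ _ _ G_NF1).
  - by ne; rewrite mulf_neq0 ?invr_eq0.
  - by rewrite (_ : _ + _ = - (n * m)) ?oppr_eq0 ?mulf_neq0 // /n; ring.
  - rewrite dE congr_sym3; congr sym3; try (by rewrite nE /n; field; rewrite ?a0 ?n0);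
      by refine (etrans (_ : _ = - (n * t)^-1 * (m * m)) _); [ring|rewrite mE; field; rewrite ?n0 ?t0].
  - rewrite dE congr_sym3; congr sym3; try (by rewrite nE /n; field; rewrite ?a0 ?n0);
      by refine (etrans (_ : _ = (n * t)^-1 * (m * m)) _); [ring|rewrite mE; field; rewrite ?n0 ?t0].
have [m [m0 mE]] : exists m, m != 0 /\ m * m = n * t by apply: sqrt_ex.
apply: (@step3 ((n * t)^-1) (- (n * t)^-1) 0 (n^-1) a (- b) 0 b a 0 0 0 m
  _ _ _ _ _ _ _ _ _ _ _ _ _ _ G_NF1).
- by ne; rewrite mulf_neq0 ?invr_eq0.
- by rewrite (_ : _ + _ = n * m) ?mulf_neq0 // /n; ring.
- rewrite dE congr_sym3; congr sym3; try (by rewrite nE /n; field; rewrite ?a0 ?n0);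
    by refine (etrans (_ : _ = (n * t)^-1 * (m * m)) _); [ring|rewrite mE; field; rewrite ?n0 ?t0].
- rewrite dE congr_sym3; congr sym3; try (by rewrite nE /n; field; rewrite ?a0 ?n0);
    by refine (etrans (_ : _ = - (n * t)^-1 * (m * m)) _); [ring|rewrite mE; field; rewrite ?n0 ?t0].
Qed.

(** t is the larger eigenvalue of the block of P with respect to Q, so P - t Q has a singular block.
    If this block is 0 the pencil is the scalar one. *)
Lemma G_def a b d : G (sym3 a b 0 d 0 1) (sym3 1 0 0 1 0 0).
Proof.
pose D := (a - d) ^+ 2 + 4 * b ^+ 2.
have D0 : 0 <= D by rewrite /D addr_ge0 ?sqr_ge0 // mulr_ge0 ?sqr_ge0.
pose s := Num.sqrt D; have sE : s ^+ 2 = D by rewrite sqr_sqrtr.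
pose t := (a + d + s) / 2.
have tE : (a - t) * (d - t) = b ^+ 2.
  have -> : (a - t) * (d - t) = (s ^+ 2 - (a - d) ^+ 2) / 4 by rewrite /t; field.
  by rewrite sE /D; field.
suff H : G (sym3 (a - t) b 0 (d - t) 0 1) (sym3 1 0 0 1 0 0).
  apply: (@step3 1 0 (- t) 1 1 0 0 0 1 0 0 0 1 _ _ _ _ _ _ _ _ _ _ _ _ _ _ H).
  - by ne.
  - by rewrite (_ : _ + _ = 1) ?oner_neq0 //; ring.
  - by eqs.
  - by eqs.
have [a0|a0] := eqVneq (a - t) 0; last exact: G_def'.
have b0 : b = 0 by move: tE; rewrite a0 mul0r => /esym/eqP; rewrite expf_eq0 /= => /eqP.
rewrite b0 a0; have [d0|d0] := eqVneq (d - t) 0.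
  apply: (@step3 0 1 1 0 1 0 0 0 1 0 0 0 1 _ _ _ _ _ _ _ _ _ _ _ _ _ _ G_scalar).
  - by ne.
  - by rewrite (_ : _ + _ = 1) ?oner_neq0 //; ring.
  - by rewrite d0; eqs.
  - by rewrite d0; eqs.
have H : G (sym3 (d - t) 0 0 0 0 1) (sym3 1 0 0 1 0 0) by apply: G_def' => //; ring.
apply: (@step3 1 0 0 1 0 1 0 1 0 0 0 0 1 _ _ _ _ _ _ _ _ _ _ _ _ _ _ H).
- by ne.
- by rewrite (_ : _ + _ = - 1) ?oppr_eq0 ?oner_neq0 //; ring.
- by eqs.
- by eqs.
Qed.

(** Subtracting a multiple of Q frees the entry (2, 2) of P. What remains is decided by a: positive
    gives the scalar type, negative the diagonal type with eps = 0, and for a = 0 the entry b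
    decides between a pencil in two variables and the blocks of sizes two and one. *)
Lemma G_rank1 a b d : G (sym3 a b 0 d 0 1) (sym3 0 0 0 1 0 0).
Proof.
have [a0|a0] := eqVneq a 0.
  have [b0|b0] := eqVneq b 0.
    apply: (@step3 1 0 0 1 0 0 1 1 0 0 0 1 0 _ _ _ _ _ _ _ _ _ _ _ _ _ _ (G_block d 0 1 1 0 0)).
    - by ne.
    - by rewrite (_ : _ + _ = 1) ?oner_neq0 //; ring.
    - by rewrite a0 b0; eqs.
    - by eqs.
  apply: (@step3 1 0 (- d) 1 0 (b^-1) 0 1 0 0 0 0 1 _ _ _ _ _ _ _ _ _ _ _ _ _ _ G_block21).
  - by ne.
  - by rewrite (_ : _ + _ = - b^-1) ?oppr_eq0 ?invr_eq0 //; ring.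
  - by rewrite a0; eqs.
  - by eqs.
have [an|ap|E] := ltrgtP a 0; last by rewrite E eqxx in a0.
  have [u [u0 uE]] : exists u, u != 0 /\ u * u * (- a) = 1 by apply: sqrt_inv; rewrite oppr_gt0.
  have [k [k0 kE]] : exists k, k != 0 /\ k * k * 2 = 1 :> R by exact: sqrt_inv.
  have uE' : u * u * a = -1 by lra.
  apply: (@step3 1 0 (- (d - b ^+ 2 / a)) 1 (k * u) (- (k * u)) (- (b / a)) 0 0 1 k k 0
    _ _ _ _ _ _ _ _ _ _ _ _ _ _ (G_diag 0)).
  - by ne.
  - by rewrite (_ : _ + _ = - (k * k * 2) * u); [rewrite kE mulf_neq0 ?oppr_eq0 ?oner_neq0|ring].
  - rewrite congr_sym3; congr sym3; try fld.
    + by transitivity (k * k * (u * u * a + 1)); [ring|rewrite uE'; ring].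
    + by transitivity (k * k * (1 - u * u * a)); [ring|rewrite uE'; refine (etrans _ kE); ring].
    + by transitivity (k * k * (u * u * a + 1)); [ring|rewrite uE'; ring].
  - by eqs.
have [u [u0 uE]] := sqrt_inv ap.
apply: (@step3 1 0 (- (d - b ^+ 2 / a)) 1 u 0 (- (b / a)) 0 0 1 0 1 0
  _ _ _ _ _ _ _ _ _ _ _ _ _ _ G_scalar).
- by ne.
- by rewrite (_ : _ + _ = - u) ?oppr_eq0 //; ring.
- rewrite congr_sym3; congr sym3; try fld.
  by refine (etrans _ uE); ring.
- by eqs.
Qed.

(** The kernel line of Q is not isotropic for P and splits off. Completing the square in Q, the sign
    of ka tells whether the plane form is indefinite, definite or of rank one; when both diagonal
    entries vanish it is already hyperbolic. *)
Lemma G_c1 a b d (al be ga : R) : ~ [/\ al = 0, be = 0 & ga = 0] ->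
  G (sym3 a b 0 d 0 1) (sym3 al be 0 ga 0 0).
Proof.
have main a' b' d' al' be' ga' : ga' != 0 -> G (sym3 a' b' 0 d' 0 1) (sym3 al' be' 0 ga' 0 0).
  move=> g0; pose ka := (al' - be' ^+ 2 / ga') / ga'.
  have red (u c : R) : u != 0 -> u * u * ka = c -> (forall a b d, G (sym3 a b 0 d 0 1) (sym3 c 0 0 1 0 0)) ->
      G (sym3 a' b' 0 d' 0 1) (sym3 al' be' 0 ga' 0 0).
    move=> u0 uc Gc.
    apply: (@step3 1 0 0 (ga'^-1) u 0 0 (- (be' / ga') * u) 1 0 0 0 1 _ _ _ _ _ _ _ _ _ _ _ _ _ _ (Gc _ _ _)).
    - by ne; rewrite invr_eq0.
    - by rewrite (_ : _ + _ = u) //; ring.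
    - by rewrite congr_sym3; congr sym3; first [by ring | reflexivity].
    - by rewrite -uc /ka; eqs.
  have [kn|kp|k0] := ltrgtP ka 0.
  - have [u [u0 uE]] : exists u, u != 0 /\ u * u * (- ka) = 1 by apply: sqrt_inv; rewrite oppr_gt0.
    by apply: (red u (-1)) => //; [lra|exact: G_indef].
  - have [u [u0 uE]] := sqrt_inv kp.
    by apply: (red u 1) => //; exact: G_def.
  - by apply: (red 1 0); rewrite ?oner_neq0 ?k0 ?mulr0 //; exact: G_rank1.
move=> Q0; have [g0|g0] := eqVneq ga 0; last exact: main.
have [a0|a0] := eqVneq al 0; last first.
  apply: (@step3 1 0 0 1 0 1 0 1 0 0 0 0 1 _ _ _ _ _ _ _ _ _ _ _ _ _ _ (main d b a ga be al a0)).
  - by ne.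
  - by rewrite (_ : _ + _ = - 1) ?oppr_eq0 ?oner_neq0 //; ring.
  - by eqs.
  - by eqs.
have b0 : be != 0 by apply/eqP => b0; apply: Q0.
apply: (@step3 1 0 0 (be^-1) 1 0 0 0 1 0 0 0 1 _ _ _ _ _ _ _ _ _ _ _ _ _ _ (G_Hshift a b d)).
- by ne; rewrite invr_eq0.
- by rewrite (_ : _ + _ = 1) ?oner_neq0 //; ring.
- by eqs.
- by rewrite g0 a0; eqs.
Qed.

(** The kernel of Q contains e3, and the two regimes are given by whether P vanishes on it. If P has
    no entry in the third row either, the pencil involves two variables only. *)
Lemma G_singular p11 p12 q1 p22 q2 c (al be ga : R) : ~ [/\ al = 0, be = 0 & ga = 0] ->
  G (sym3 p11 p12 q1 p22 q2 c) (sym3 al be 0 ga 0 0).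
Proof.
move=> Q0; have [c0|c0] := eqVneq c 0; last first.
  apply: (@step3 (c^-1) 0 0 1 1 0 0 0 1 0 (- (q1 / c)) (- (q2 / c)) 1 _ _ _ _ _ _ _ _ _ _ _ _ _ _
    (G_c1 ((p11 - q1 ^+ 2 / c) / c) ((p12 - q1 * q2 / c) / c) ((p22 - q2 ^+ 2 / c) / c) Q0)).
  - by ne; rewrite invr_eq0.
  - by rewrite (_ : _ + _ = 1) ?oner_neq0 //; ring.
  - by eqs.
  - by eqs.
rewrite c0; have [q10|q10] := eqVneq q1 0; last exact: G_c0'.
have [q20|q20] := eqVneq q2 0; first by rewrite q10 q20; exact: G_block.
have Q0' : ~ [/\ ga = 0, be = 0 & al = 0] by move=> [a1 a2 a3]; apply: Q0.
apply: (@step3 1 0 0 1 0 1 0 1 0 0 0 0 1 _ _ _ _ _ _ _ _ _ _ _ _ _ _ (G_c0' p22 p12 p11 q1 q20 Q0')).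
- by ne.
- by rewrite (_ : _ + _ = - 1) ?oppr_eq0 ?oner_neq0 //; ring.
- by eqs.
- by eqs.
Qed.

Lemma G_kernel P Q : P^T = P -> Q^T = Q -> Q != 0 -> \det Q = 0 -> G P Q.
Proof.
move=> sP sQ Q0 /eqP/det0P[v v0 vQ].
have [N [DN NE]] : exists N : 'M[R]_3, \det N != 0 /\ row o2 N = v.
  have vE : v = row o2 (mx3 0 0 0 0 0 0 (v 0 o0) (v 0 o1) (v 0 o2)).
    by apply/rowP; apply: forall_ord3; rewrite mxE mx3E.
  have row2 a b c d e f : row o2 (mx3 a b c d e f (v 0 o0) (v 0 o1) (v 0 o2)) = v.
    by apply/rowP; apply: forall_ord3; rewrite mxE mx3E.
  have [e2|e2] := eqVneq (v 0 o2) 0; last first.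
    exists (mx3 1 0 0 0 1 0 (v 0 o0) (v 0 o1) (v 0 o2)); split=> //.
    by rewrite det_mx3 (_ : _ + _ = v 0 o2) //; ring.
  have [e1|e1] := eqVneq (v 0 o1) 0; last first.
    exists (mx3 1 0 0 0 0 1 (v 0 o0) (v 0 o1) (v 0 o2)); split=> //.
    by rewrite det_mx3 (_ : _ + _ = - v 0 o1) ?oppr_eq0 //; ring.
  have [e0|e0] := eqVneq (v 0 o0) 0; last first.
    exists (mx3 0 1 0 0 0 1 (v 0 o0) (v 0 o1) (v 0 o2)); split=> //.
    by rewrite det_mx3 (_ : _ + _ = v 0 o0) //; ring.
  by case/eqP: v0; apply/rowP; apply: forall_ord3; rewrite [RHS]mxE.
pose Q' := N *m Q *m N^T.
have sQ' : Q'^T = Q' by rewrite /Q' !trmx_mul trmxK sQ mulmxA.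
have Q'2 j : Q' o2 j = 0.
  have -> : Q' o2 j = (row o2 Q') 0 j by rewrite [RHS]mxE.
  by rewrite /Q' !row_mul NE vQ mul0mx mxE.
have E2 i : Q' i o2 = 0 by rewrite -sQ' mxE Q'2.
have sP' : (N *m P *m N^T)^T = N *m P *m N^T by rewrite !trmx_mul trmxK sP mulmxA.
apply: (@G_step P Q 1 0 0 1 N^T sP sQ); [by ne|by rewrite det_tr|].
rewrite !scale1r !scale0r addr0 add0r trmxK -/Q' (symP sP') (symP sQ') !E2.
apply: G_singular => -[h0 h1 h2]; case/eqP: Q0.
have Nu : N \in unitmx by rewrite unitmxE unitfE.
have Ntu : N^T \in unitmx by rewrite unitmx_tr.
have : Q' = 0 by rewrite (symP sQ') !E2 h0 h1 h2; apply/matrixP; apply: forall_ord3; apply: forall_ord3; rewrite sym3E mxE.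
by rewrite /Q' => /(canRL (mulmxK Ntu)); rewrite mul0mx => /(canRL (mulKmx Nu)); rewrite mulmx0.
Qed.

(** A real cubic has a root, so some member of the pencil is singular; it is made the second matrix,
    and its kernel vector the third basis vector. If this member is 0, the 1-jet depends on a single
    coordinate. *)
Theorem pencil_classification P Q : P^T = P -> Q^T = Q -> ~ (P = 0 /\ Q = 0) -> G P Q.
Proof.
move=> sP sQ PQ.
have id3 (M : 'M[R]_3) : (1%:M)^T *m M *m 1%:M = M by rewrite trmx1 mul1mx mulmx1.
have [al [ga [D [be [de D0]]]]] : exists be de, \det (be *: P + de *: Q) = 0 /\
    exists al ga, al * de - be * ga != 0.
  have [P0|P0] := eqVneq (\det P) 0.
    by exists 1, 0; rewrite scale1r scale0r addr0; split=> //; exists 0, 1; rewrite mul0r sub0r mul1r oppr_eq0 oner_neq0.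
  have [c0 [c1 [c2 pE]]] : exists c0 c1 c2, forall t, \det (t *: P + 1 *: Q) =
      \det P * t ^+ 3 + c2 * t ^+ 2 + c1 * t + c0.
    have detE a b c d e f : \det (sym3 a b c d e f) = a * (d * f - e * e) - b * (b * f - e * c) + c * (b * e - d * c) :> R.
      rewrite -det_mx3; congr (\det _); apply/matrixP; apply: forall_ord3; apply: forall_ord3; by rewrite sym3E mx3E.
    rewrite (symP sP) (symP sQ).
    move: (P o0 o0) (P o0 o1) (P o0 o2) (P o1 o1) (P o1 o2) (P o2 o2) => a b c d e f.
    move: (Q o0 o0) (Q o0 o1) (Q o0 o2) (Q o1 o1) (Q o1 o2) (Q o2 o2) => a' b' c' d' e' f'.
    exists (a' * (d' * f' - e' * e') - b' * (b' * f' - e' * c') + c' * (b' * e' - d' * c')),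
      (a * (d' * f' - e' * e') + a' * (d * f' + d' * f - 2 * e * e') - b * (b' * f' - e' * c')
       - b' * (b * f' + b' * f - e * c' - e' * c) + c * (b' * e' - d' * c') + c' * (b * e' + b' * e - d * c' - d' * c)),
      (a' * (d * f - e * e) + a * (d * f' + d' * f - 2 * e * e') - b' * (b * f - e * c)
       - b * (b * f' + b' * f - e * c' - e' * c) + c' * (b * e - d * c) + c * (b * e' + b' * e - d * c' - d' * c)).
    by move=> t; rewrite !sym3Z sym3D !detE; ring.
  have [t tE] := cubic_root (c2 / \det P) (c1 / \det P) (c0 / \det P).
  exists t, 1; split; last by exists 1, 0; rewrite mulr0 subr0 mulr1 oner_neq0.
  by rewrite pE -[RHS](mulr0 (\det P)) -tE; field.
have [Q0|Q0] := eqVneq (al *: P + ga *: Q) 0.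
  apply: (@G_step P Q be al de ga 1%:M sP sQ D0); first by rewrite det1 oner_neq0.
  rewrite !id3 Q0; apply: G_corank1; first by rewrite linearD /= !linearZ /= sP sQ.
  apply/eqP => P'0; apply: PQ.
  (* By Cramer's rule P and Q are combinations of the two new members, so these cannot both
     vanish. *)
  set D' := be * ga - al * de in D0.
  have e1 : D' *: P = ga *: (be *: P + de *: Q) - de *: (al *: P + ga *: Q).
    by rewrite !scalerDr !scalerA opprD addrACA -!scalerBl (mulrC de ga) subrr scale0r addr0 /D'; congr (_ *: _); ring.
  have e2 : D' *: Q = be *: (al *: P + ga *: Q) - al *: (be *: P + de *: Q).
    by rewrite !scalerDr !scalerA opprD addrACA -!scalerBl (mulrC be al) subrr scale0r add0r.
  move: e1 e2; rewrite Q0 P'0 !scaler0 subrr => /eqP + /eqP.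
  by rewrite !scaler_eq0 (negPf D0) /= => /eqP -> /eqP ->.
apply: (@G_step P Q be al de ga 1%:M sP sQ D0); first by rewrite det1 oner_neq0.
rewrite !id3; apply: G_kernel => //; by rewrite linearD /= !linearZ /= sP sQ.
Qed.
End PencilClassification.

(** * Degenerate pencils have large codimension *)

Section LowerBounds.
Context {R : realType} (T : germ_theory R).
Local Notation S := (gring T).
Local Notation ev := (gev T).
Local Notation C := (gcst T).
Local Notation dx := (@gdx R T).
Local Notation dy := (@gdy R T).
Local Notation x := (gX T).
Local Notation y := (gY T).

Lemma gcommute (c : S) : ev (dy (dx c)) = ev (dx (dy c)).
Proof.
have [a [b ->]] := g_hadamard c; rewrite !gdE.
by rewrite !(rmorphD, rmorphM, rmorph0, rmorph1, gevX, gevY) /=; ring.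
Qed.

Definition j00 (c : S) := ev c.
Definition j10 (c : S) := ev (dx c).
Definition j01 (c : S) := ev (dy c).
Definition j20 (c : S) := ev (dx (dx c)).
Definition j11 (c : S) := ev (dx (dy c)).
Definition j02 (c : S) := ev (dy (dy c)).

Lemma jD a b : (j00 (a + b) = j00 a + j00 b) * (j10 (a + b) = j10 a + j10 b) *
  (j01 (a + b) = j01 a + j01 b) * (j20 (a + b) = j20 a + j20 b) *
  (j11 (a + b) = j11 a + j11 b) * (j02 (a + b) = j02 a + j02 b).
Proof. by rewrite /j00 /j10 /j01 /j20 /j11 /j02 !(gdxD, gdyD) !rmorphD. Qed.

Lemma jM a b : (j00 (a * b) = j00 a * j00 b) * (j10 (a * b) = j10 a * j00 b + j00 a * j10 b) *
  (j01 (a * b) = j01 a * j00 b + j00 a * j01 b) *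
  (j20 (a * b) = j20 a * j00 b + 2 * (j10 a * j10 b) + j00 a * j20 b) *
  (j11 (a * b) = j11 a * j00 b + j10 a * j01 b + j01 a * j10 b + j00 a * j11 b) *
  (j02 (a * b) = j02 a * j00 b + 2 * (j01 a * j01 b) + j00 a * j02 b).
Proof.
rewrite /j00 /j10 /j01 /j20 /j11 /j02 !(gdxM, gdyM, gdxD, gdyD, gdxM, gdyM) !(rmorphD, rmorphM).
by do !split; ring.
Qed.

Lemma jC k : (j00 (C k) = k) * (j10 (C k) = 0) * (j01 (C k) = 0) * (j20 (C k) = 0) *
  (j11 (C k) = 0) * (j02 (C k) = 0).
Proof. by rewrite /j00 /j10 /j01 /j20 /j11 /j02 !(gdxC, gdyC, gdx0, gdy0) rmorph0 gev_cst. Qed.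

Lemma jx : (j00 x = 0) * (j10 x = 1) * (j01 x = 0) * (j20 x = 0) * (j11 x = 0) * (j02 x = 0).
Proof. by rewrite /j00 /j10 /j01 /j20 /j11 /j02 !(gdxX, gdyX, gdx0, gdy0, gdx1) rmorph0 rmorph1 gevX. Qed.
Lemma jy : (j00 y = 0) * (j10 y = 0) * (j01 y = 1) * (j20 y = 0) * (j11 y = 0) * (j02 y = 0).
Proof. by rewrite /j00 /j10 /j01 /j20 /j11 /j02 !(gdxY, gdyY, gdx0, gdx1, gdy1) rmorph0 rmorph1 gevY. Qed.

Lemma jd c : (j00 (dx c) = j10 c) * (j00 (dy c) = j01 c) * (j10 (dx c) = j20 c) *
  (j01 (dx c) = j11 c) * (j10 (dy c) = j11 c) * (j01 (dy c) = j02 c).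
Proof. by rewrite /j00 /j10 /j01 /j20 /j11 /j02 gcommute. Qed.

Lemma j2 : (2 : S) = C 2. Proof. by rewrite rmorph_nat. Qed.

(** [phi] lists n linear functionals on matrices of germs, and on tangent elements they depend
    linearly, through L, on m real parameters. A nonzero kernel vector of L brings the image of the
    tangent space down to dimension m - 1, so the codimension is at least n - m + 1. *)
Lemma gspan_list (A : 'M[S]_3) d n m (phi : 'M[S]_3 -> seq R) (L : 'rV[R]_m -> seq R) (w0 : 'rV[R]_m) :
  (forall F G k, (phi (F + G))`_k = (phi F)`_k + (phi G)`_k) ->
  (forall c F k, (phi (C c *: F))`_k = c * (phi F)`_k) ->
  (forall w : 'rV[R]_n, exists2 F, gsym F & forall k : 'I_n, (phi F)`_k = w 0 k) ->
  (forall a w w' k, (L (a *: w + w'))`_k = a * (L w)`_k + (L w')`_k) ->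
  (forall F, gtang A F -> exists w, forall k, (phi F)`_k = (L w)`_k) ->
  w0 != 0 -> (forall k, (L w0)`_k = 0) -> gspan A d -> (n < m + d)%N.
Proof.
move=> pD pZ ps LL pT w00 Lw0 Ad.
pose Pi (F : 'M[S]_3) : 'rV[R]_n := \row_k (phi F)`_k.
pose Lf (w : 'rV[R]_m) : 'rV[R]_n := \row_k (L w)`_k.
have lL : linear Lf by move=> a w w'; apply/rowP => k; rewrite !mxE LL.
pose Ll : {linear 'rV[R]_m -> 'rV[R]_n} := HB.pack Lf (GRing.isLinear.Build _ _ _ _ Lf lL).
have KE w : w *m lin1_mx Ll = Lf w by rewrite mul_rV_lin1.
have h := @gspan_count R T A d n m Pi (lin1_mx Ll).
have rk : (\rank (lin1_mx Ll) < m)%N.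
  rewrite ltn_neqAle rank_leq_row andbT; apply/negP => /eqP rf.
  have : row_free (lin1_mx Ll) by rewrite /row_free rf.
  move=> /row_free_inj inj; case/eqP: w00; apply: (inj 1%N); rewrite mul0mx KE.
  by apply/rowP => k; rewrite !mxE Lw0.
apply: leq_trans (_ : (\rank (lin1_mx Ll) + d).+1 <= m + d)%N; last by rewrite -addSn leq_add2r.
rewrite ltnS; apply: h => //.
- by move=> F G; apply/rowP => k; rewrite !mxE pD.
- by move=> c F; apply/rowP => k; rewrite !mxE pZ.
- by move=> w; have [F sF FE] := ps w; exists F => //; apply/rowP => k; rewrite mxE FE.
- move=> F /pT[w wE]; have -> : Pi F = w *m lin1_mx Ll by rewrite KE; apply/rowP => k; rewrite !mxE wE.
  exact: submxMl.
Qed.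

Let evE := (rmorph0 ev, rmorphD ev, rmorphM ev, gev_cst T).

Lemma jet1P (A : 'M[S]_3) P Q : jet1 A P Q <->
  [/\ map_mx ev A = 0, map_mx ev (map_mx dx A) = P & map_mx ev (map_mx dy A) = Q].
Proof.
split=> [h|[h1 h2 h3] i j].
  by split; apply/matrixP => i j; have [e1 e2 e3] := h i j; rewrite !mxE ?e1 ?e2 ?e3.
split; [|by rewrite -h2 !mxE|by rewrite -h3 !mxE].
by have := congr1 (fun M : 'M[R]_3 => M i j) h1; rewrite !mxE.
Qed.

Lemma jet1_transform (A : 'M[S]_3) P Q (al be ga de : R) M : gsym A -> jet1 A P Q ->
  al * de - be * ga != 0 -> \det M != 0 ->
  exists B, [/\ gsym B, gequiv A B &
    jet1 B (M^T *m (al *: P + ga *: Q) *m M) (M^T *m (be *: P + de *: Q) *m M)].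
Proof.
move=> sA /jet1P[A0 Ax Ay] D DM.
pose u : S := C al * x + C be * y; pose v : S := C ga * x + C de * y.
have u0 : ev u = 0 by rewrite /u !evE gevX gevY !mulr0 addr0.
have v0 : ev v = 0 by rewrite /v !evE gevX gevY !mulr0 addr0.
have ux : dx u = C al by rewrite /u !gdE; ring.
have uy : dy u = C be by rewrite /u !gdE; ring.
have vx : dx v = C ga by rewrite /v !gdE; ring.
have vy : dy v = C de by rewrite /v !gdE; ring.
pose X := map_mx C M; pose As := map_mx (gsubst u v) A.
exists (X^T *m As *m X); split.
- have sAs : As^T = As by rewrite /As map_trmx sA.
  by rewrite /gsym !trmx_mul trmxK sAs mulmxA.
- exists u, v, X; split=> //; first by rewrite /gjac ux uy vx vy !gev_cst.
  by rewrite det_map_mx gev_cst.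
have evX : map_mx ev X = M by apply/matrixP => i j; rewrite !mxE gev_cst.
have Xx : map_mx dx X = 0 by apply/matrixP => i j; rewrite !mxE gdxC.
have Xy : map_mx dy X = 0 by apply/matrixP => i j; rewrite !mxE gdyC.
have dT (D' : S -> S) N : map_mx D' N^T = (map_mx D' N)^T :> 'M[S]_3 by rewrite map_trmx.
apply/jet1P; split.
- rewrite !map_mxM (_ : map_mx ev As = 0) ?mulmx0 ?mul0mx //.
  by apply/matrixP => i j; have := congr1 (fun N : 'M[R]_3 => N i j) A0; rewrite !mxE gev_subst.
- rewrite !gdx_mulmx dT Xx trmx0 !mul0mx add0r mulmx0 addr0 !map_mxM -map_trmx evX.
  congr (_ *m _ *m _); apply/matrixP => i j; rewrite -Ax -Ay !mxE gdx_subst // ux vx.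
  by rewrite !evE !gev_subst // mulrC [X in _ + X]mulrC.
- rewrite !gdy_mulmx dT Xy trmx0 !mul0mx add0r mulmx0 addr0 !map_mxM -map_trmx evX.
  congr (_ *m _ *m _); apply/matrixP => i j; rewrite -Ax -Ay !mxE gdy_subst // uy vy.
  by rewrite !evE !gev_subst // mulrC [X in _ + X]mulrC.
Qed.
End LowerBounds.

Section LowerBounds2.
Context {R : realType} (T : germ_theory R).
Local Notation S := (gring T).
Local Notation ev := (gev T).
Local Notation C := (gcst T).
Local Notation dx := (@gdx R T).
Local Notation dy := (@gdy R T).
Local Notation x := (gX T).
Local Notation y := (gY T).

(** The parameters are read from a function on the natural numbers, so that L and the jets of a
    tangent element can be written by numbers instead of ordinals. *)
Lemma gspan_nat (A : 'M[S]_3) d n m (phi : 'M[S]_3 -> seq R) (L : (nat -> R) -> seq R) (c0 : nat -> R) i0 :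
  (forall F G k, (phi (F + G))`_k = (phi F)`_k + (phi G)`_k) ->
  (forall c F k, (phi (C c *: F))`_k = c * (phi F)`_k) ->
  (forall c : nat -> R, exists2 F, gsym F & forall k, (k < n)%N -> (phi F)`_k = c k) ->
  (forall a c c' k, (L (fun i => a * c i + c' i))`_k = a * (L c)`_k + (L c')`_k) ->
  (forall c c', (forall i, (i < m)%N -> c i = c' i) -> L c = L c') ->
  (forall F, gtang A F -> exists c, forall k, (phi F)`_k = (L c)`_k) ->
  (i0 < m)%N -> c0 i0 != 0 -> (forall k, (L c0)`_k = 0) -> gspan A d -> (n < m + d)%N.
Proof.
move=> pD pZ ps LL Le pT im c00 Lc0.
pose ext p (w : 'rV[R]_p) i := if insub i is Some j then w 0 j else 0.
have extE p (c : nat -> R) i : (i < p)%N -> ext p (\row_(j < p) c j) i = c i.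
  by move=> ip; rewrite /ext insubT mxE.
apply: (@gspan_list R T A d n m phi (fun w => L (ext m w)) (\row_(j < m) c0 j)) => //.
- move=> w; have [F sF FE] := ps (ext n w); exists F => // k; rewrite FE //.
  by rewrite /ext valK.
- move=> a w w' k; rewrite -LL; congr (_`_k); apply: Le => i im'.
  by rewrite /ext insubT !mxE.
- by move=> F /pT[c cE]; exists (\row_j c j) => k; rewrite cE; congr (_`_k); apply: Le => i im'; rewrite extE.
- by apply: contra_neq c00 => /rowP/(_ (Ordinal im)); rewrite !mxE.
- by move=> k; rewrite -[RHS](Lc0 k); congr (_`_k); apply: Le => i im'; rewrite extE.
Qed.

Let jr := (@jD R T, @jM R T, @jd R T, @jC R T, @jx R T, @jy R T).
Local Ltac nths tac := do 24 (case=> [|]; first (by tac)); by move=> k; rewrite /= ?nth_nil; tac.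
Local Ltac addt := rewrite /= ?mxE ?jr; ring.

Lemma jet1_sym3 (a b c d e f : S) P Q : jet1 (sym3 a b c d e f) P Q ->
  ([/\ j00 a = 0, j10 a = P o0 o0 & j01 a = Q o0 o0] /\
   [/\ j00 b = 0, j10 b = P o0 o1 & j01 b = Q o0 o1] /\
   [/\ j00 c = 0, j10 c = P o0 o2 & j01 c = Q o0 o2]) /\
  ([/\ j00 d = 0, j10 d = P o1 o1 & j01 d = Q o1 o1] /\
   [/\ j00 e = 0, j10 e = P o1 o2 & j01 e = Q o1 o2] /\
   [/\ j00 f = 0, j10 f = P o2 o2 & j01 f = Q o2 o2]).
Proof.
move=> h; have := (h o0 o0, h o0 o1, h o0 o2, h o1 o1, h o1 o2, h o2 o2).
by rewrite !sym3E => -[[[[[]]]]].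
Qed.

(** Twelve functionals: the values and the y-derivatives of the six entries. As A and its
    y-derivative vanish at 0, U contributes to none of them, and a tangent element depends on u, v
    and the y-derivative of u at 0. At most three of twelve dimensions are tangent. *)
Lemma gspan_corank1 (A : 'M[S]_3) P d : gsym A -> jet1 A P 0 -> gspan A d -> (8 < d)%N.
Proof.
move=> /symP ->; move: (A o0 o0) (A o0 o1) (A o0 o2) (A o1 o1) (A o1 o2) (A o2 o2).
move=> a b c d' e f jA.
have [[[a0 _ ay] [[b0 _ by_] [c0 _ cy]]] [[d0 _ dy_] [[e0 _ ey] [f0 _ fy]]]] := jet1_sym3 jA.
move=> Ad; rewrite !mxE in ay by_ cy dy_ ey fy.
pose phi (F : 'M[S]_3) := [:: j00 (F o0 o0); j00 (F o0 o1); j00 (F o0 o2); j00 (F o1 o1); j00 (F o1 o2);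
  j00 (F o2 o2); j01 (F o0 o0); j01 (F o0 o1); j01 (F o0 o2); j01 (F o1 o1); j01 (F o1 o2); j01 (F o2 o2)].
pose l1 (w : nat -> R) (g : S) := w 0%N * j10 g.
pose l2 (w : nat -> R) (g : S) := w 0%N * j11 g + w 1%N * j02 g + w 2%N * j10 g.
(* L reads the parameters 0, 1 and 2; the fourth is a placeholder that supplies the kernel
   vector. *)
pose L (w : nat -> R) : seq R := [:: l1 w a; l1 w b; l1 w c; l1 w d'; l1 w e; l1 w f; l2 w a; l2 w b; l2 w c; l2 w d'; l2 w e; l2 w f].
have := @gspan_nat (sym3 a b c d' e f) d 12 4 phi L (nth 0 [:: 0; 0; 0; 1 : R]) 3.
move=> /(_ _ _ _ _ _ _ _ _ _ Ad); rewrite (_ : (12 < 4 + d)%N = (8 < d)%N) //; apply.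
- by move=> F G; nths addt.
- by move=> t F; nths addt.
- move=> w; pose g i := C (w i) + C (w (i + 6)%N) * y.
  exists (sym3 (g 0%N) (g 1%N) (g 2%N) (g 3%N) (g 4%N) (g 5%N)); first exact: sym3_tr.
  by do 12 (case=> [_|]; first by rewrite /= sym3E /g ?jr; ring).
- by move=> t w w'; nths ltac:(rewrite /= /l1 /l2; ring).
- by move=> w w' ww'; rewrite /L /l1 /l2 !ww'.
- move=> F /gtang_sym3_inv[u [v [p [q [r [p' [q' [r' [p'' [q'' [r'' ->]]]]]]]]]]].
  exists (nth 0 [:: j00 u; j00 v; j01 u]); rewrite gact_sym3.
  by nths ltac:(rewrite /= /l1 /l2 ?sym3E /= ?j2 ?jr ?a0 ?b0 ?c0 ?d0 ?e0 ?f0 ?ay ?by_ ?cy ?dy_ ?ey ?fy; ring).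
- by [].
- by rewrite oner_neq0.
- by nths ltac:(rewrite /= /l1 /l2 /=; ring).
Qed.

End LowerBounds2.

Section LowerBoundsb.
Context {R : realType} (T : germ_theory R).
Local Notation S := (gring T).
Local Notation ev := (gev T).
Local Notation C := (gcst T).
Local Notation dx := (@gdx R T).
Local Notation dy := (@gdy R T).
Local Notation x := (gX T).
Local Notation y := (gY T).

Let jr := (@jD R T, @jM R T, @jd R T, @jC R T, @jx R T, @jy R T).
Local Ltac nths tac := do 24 (case=> [|]; first (by tac)); by move=> k; rewrite /= ?nth_nil; tac.
Local Ltac addt := rewrite /= ?mxE ?jr; ring.

(** Twenty-one functionals: the 1-jets of the six entries and the second-order part of (3, 3), which
    itself starts at order two. They depend on thirteen parameters, the 1-jet of the vector field
    and seven constants in U, and Euler's relation lowers the rank to twelve. *)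
Lemma gspan_block (A : 'M[S]_3) d p1 p2 p3 q1 q2 q3 : gsym A ->
  jet1 A (sym3 p1 p2 0 p3 0 0) (sym3 q1 q2 0 q3 0 0) -> gspan A d -> (8 < d)%N.
Proof.
move=> /symP ->; move: (A o0 o0) (A o0 o1) (A o0 o2) (A o1 o1) (A o1 o2) (A o2 o2).
move=> a b c d' e f jA.
have [[[a0 ax ay] [[b0 bx by_] [c0 cx cy]]] [[d0 dx_ dy_] [[e0 ex ey] [f0 fx fy]]]] := jet1_sym3 jA.
rewrite !sym3E in ax ay bx by_ cx cy dx_ dy_ ex ey fx fy => Ad.
pose t3 (g : S) := [:: j00 g; j10 g; j01 g].
pose phi (F : 'M[S]_3) := t3 (F o0 o0) ++ t3 (F o0 o1) ++ t3 (F o1 o1) ++ t3 (F o0 o2) ++ t3 (F o1 o2) ++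
  t3 (F o2 o2) ++ [:: 2^-1 * j20 (F o2 o2); j11 (F o2 o2); 2^-1 * j02 (F o2 o2)].
pose dl (w : nat -> R) (g : S) (k k1 k2 : R) := [:: w 0%N * j10 g + w 1%N * j01 g;
  w 2%N * j10 g + w 0%N * j20 g + w 4%N * j01 g + w 1%N * j11 g + k1;
  w 3%N * j10 g + w 0%N * j11 g + w 5%N * j01 g + w 1%N * j02 g + k2].
pose L (w : nat -> R) : seq R := dl w a 0 (2 * (w 6%N * p1 + w 7%N * p2)) (2 * (w 6%N * q1 + w 7%N * q2)) ++
  dl w b 0 (w 6%N * p2 + w 7%N * p3 + (w 8%N * p1 + w 9%N * p2)) (w 6%N * q2 + w 7%N * q3 + (w 8%N * q1 + w 9%N * q2)) ++
  dl w d' 0 (2 * (w 8%N * p2 + w 9%N * p3)) (2 * (w 8%N * q2 + w 9%N * q3)) ++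
  dl w c 0 (w 10%N * p1 + w 11%N * p2) (w 10%N * q1 + w 11%N * q2) ++
  dl w e 0 (w 10%N * p2 + w 11%N * p3) (w 10%N * q2 + w 11%N * q3) ++
  dl w f 0 0 0 ++
  [:: 2^-1 * (2 * (w 2%N * j20 f) + w 0%N * j20 (dx f) + 2 * (w 4%N * j11 f) + w 1%N * j20 (dy f) +
      2 * (w 10%N * j20 c + w 11%N * j20 e + w 12%N * j20 f));
    w 2%N * j11 f + w 3%N * j20 f + w 0%N * j11 (dx f) + w 4%N * j02 f + w 5%N * j11 f + w 1%N * j11 (dy f) +
      2 * (w 10%N * j11 c + w 11%N * j11 e + w 12%N * j11 f);
    2^-1 * (2 * (w 3%N * j11 f) + w 0%N * j02 (dx f) + 2 * (w 5%N * j02 f) + w 1%N * j02 (dy f) +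
      2 * (w 10%N * j02 c + w 11%N * j02 e + w 12%N * j02 f))].
(* Euler's relation: the field x d/dx + y d/dy is compensated by U = diag(-1/2, -1/2, -1), the
   entries of the block being of degree one and (3, 3) of degree two. *)
pose cw := nth 0 [:: 0; 0; 1; 0; 0; 1; - 2^-1; 0; 0; - 2^-1; 0; 0; - 1 : R].
have := @gspan_nat R T (sym3 a b c d' e f) d 21 13 phi L cw 2.
move=> /(_ _ _ _ _ _ _ _ _ _ Ad); rewrite (_ : (21 < 13 + d)%N = (8 < d)%N) //; apply.
- by move=> F G; nths addt.
- by move=> t F; nths addt.
- move=> w; pose g i := C (w i) + C (w i.+1) * x + C (w i.+2) * y.
  exists (sym3 (g 0%N) (g 3%N) (g 9%N) (g 6%N) (g 12%N) (g 15%N + C (w 18%N) * (x * x) +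
    C (w 19%N) * (x * y) + C (w 20%N) * (y * y))); first exact: sym3_tr.
  by do 21 (case=> [_|]; first by rewrite /= sym3E /g ?jr; first [ring | field]).
- by move=> t w w'; nths ltac:(rewrite /=; ring).
- by move=> w w' ww'; rewrite /L /dl !ww'.
- move=> F /gtang_sym3_inv[u [v [p [q [r [p' [q' [r' [p'' [q'' [r'' ->]]]]]]]]]]].
  exists (nth 0 [:: j00 u; j00 v; j10 u; j01 u; j10 v; j01 v; j00 p; j00 p'; j00 q; j00 q'; j00 r; j00 r'; j00 r'']).
  rewrite gact_sym3.
  by nths ltac:(rewrite /= ?sym3E /= ?j2 ?jr ?a0 ?b0 ?c0 ?d0 ?e0 ?f0 ?ax ?bx ?dx_ ?cx ?ex ?fx ?ay ?by_ ?cy ?dy_ ?ey ?fy; ring).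
- by [].
- by rewrite oner_neq0.
- by nths ltac:(rewrite /= /cw /= ?ax ?bx ?dx_ ?cx ?ex ?fx ?ay ?by_ ?cy ?dy_ ?ey ?fy; field).
Qed.

End LowerBoundsb.

Section LowerBoundsc.
Context {R : realType} (T : germ_theory R).
Local Notation S := (gring T).
Local Notation ev := (gev T).
Local Notation C := (gcst T).
Local Notation dx := (@gdx R T).
Local Notation dy := (@gdy R T).
Local Notation x := (gX T).
Local Notation y := (gY T).

Let jr := (@jD R T, @jM R T, @jd R T, @jC R T, @jx R T, @jy R T).
Local Ltac nths tac := do 24 (case=> [|]; first (by tac)); by move=> k; rewrite /= ?nth_nil; tac.
Local Ltac addt := rewrite /= ?mxE ?jr; ring.

(* In coordinates where the (1,2) and (1,3) entries are y and x, the restriction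
   x^2 F22 - 2 x y F23 + y^2 F33 of F to the kernel of this row is what detects the
   tangent space. *)
Lemma gspan_isotropic' (a d' e f : S) d :
  jet1 (sym3 a y x d' e f) (sym3 0 0 1 0 0 0) (sym3 0 1 0 0 0 0) ->
  gspan (sym3 a y x d' e f) d -> (8 < d)%N.
Proof.
move=> jA; have [[[a0 ax ay] _] [[d0 dx_ dy_] [[e0 ex ey] [f0 fx fy]]]] := jet1_sym3 jA.
rewrite !sym3E in ax ay dx_ dy_ ex ey fx fy => Ad.
pose phi (F : 'M[S]_3) := [:: j00 (F o0 o0); j00 (F o1 o1); j00 (F o1 o2); j00 (F o2 o2);
  j00 (F o0 o1); j00 (F o0 o2); j10 (F o1 o1); j01 (F o1 o1) - 2 * j10 (F o1 o2);
  j10 (F o2 o2) - 2 * j01 (F o1 o2); j01 (F o2 o2);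
  2^-1 * j20 (F o1 o1); j11 (F o1 o1) - j20 (F o1 o2); 2^-1 * (j02 (F o1 o1) - 4 * j11 (F o1 o2) + j20 (F o2 o2));
  j11 (F o2 o2) - j02 (F o1 o2); 2^-1 * j02 (F o2 o2);
  j10 (F o0 o1); j01 (F o0 o1); j10 (F o0 o2); j01 (F o0 o2)].
pose D1 (w : nat -> R) (g : S) := w 0%N * j20 g + w 1%N * j11 g.
pose D2 (w : nat -> R) (g : S) := w 0%N * j11 g + w 1%N * j02 g.
(* second jets of u g_x + v g_y *)
pose E20 (w : nat -> R) (g : S) := 2 * (w 2%N * j20 g) + w 0%N * j20 (dx g) + 2 * (w 4%N * j11 g) + w 1%N * j20 (dy g).
pose E11 (w : nat -> R) (g : S) := w 2%N * j11 g + w 3%N * j20 g + w 0%N * j11 (dx g) + w 4%N * j02 g + w 5%N * j11 g + w 1%N * j11 (dy g).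
pose E02 (w : nat -> R) (g : S) := 2 * (w 3%N * j11 g) + w 0%N * j02 (dx g) + 2 * (w 5%N * j02 g) + w 1%N * j02 (dy g).
pose B22 (w : nat -> R) (J : S -> R) := 2 * (w 6%N * J d' + w 7%N * J e).
pose B23 (w : nat -> R) (J : S -> R) := w 6%N * J e + w 7%N * J f + w 8%N * J d' + w 9%N * J e.
pose B33 (w : nat -> R) (J : S -> R) := 2 * (w 8%N * J e + w 9%N * J f).
pose L (w : nat -> R) : seq R := [:: 0; 0; 0; 0; w 1%N; w 0%N; D1 w d'; D2 w d' - 2 * D1 w e;
  D1 w f - 2 * D2 w e; D2 w f;
  2^-1 * (E20 w d' + B22 w (@j20 R T)); E11 w d' + B22 w (@j11 R T) - (E20 w e + B23 w (@j20 R T));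
  2^-1 * (E02 w d' + B22 w (@j02 R T) - 4 * (E11 w e + B23 w (@j11 R T)) + (E20 w f + B33 w (@j20 R T)));
  E11 w f + B33 w (@j11 R T) - (E02 w e + B23 w (@j02 R T)); 2^-1 * (E02 w f + B33 w (@j02 R T));
  w 4%N + w 7%N; w 5%N + w 10%N + w 6%N; w 2%N + w 10%N + w 9%N; w 3%N + w 8%N].
(* Again Euler's field, now with U = diag(0, -1, -1): it cancels on the linear entries x, y of the
   first row and on the quadratic parts of the other block. The rank is at most ten among nineteen
   functionals. *)
pose cw := nth 0 [:: 0; 0; 1; 0; 0; 1; - 1; 0; 0; - 1; 0 : R].
have := @gspan_nat R T (sym3 a y x d' e f) d 19 11 phi L cw 2.
move=> /(_ _ _ _ _ _ _ _ _ _ Ad); rewrite (_ : (19 < 11 + d)%N = (8 < d)%N) //; apply.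
- by move=> F G; nths addt.
- by move=> t F; nths addt.
- move=> w.
  exists (sym3 (C (w 0%N)) (C (w 4%N) + C (w 15%N) * x + C (w 16%N) * y)
    (C (w 5%N) + C (w 17%N) * x + C (w 18%N) * y)
    (C (w 1%N) + C (w 6%N) * x + C (w 7%N) * y + C (w 10%N) * (x * x) + C (w 11%N) * (x * y) + C (w 12%N) * (y * y))
    (C (w 2%N)) (C (w 3%N) + C (w 8%N) * x + C (w 9%N) * y + C (w 13%N) * (x * y) + C (w 14%N) * (y * y)));
    first exact: sym3_tr.
  by do 19 (case=> [_|]; first by rewrite /= !sym3E ?jr; first [ring | field]).
- by move=> t w w'; nths ltac:(rewrite /= /D1 /D2 /E20 /E11 /E02 /B22 /B23 /B33; ring).
- by move=> w w' ww'; rewrite /L /D1 /D2 /E20 /E11 /E02 /B22 /B23 /B33 !ww'.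
- move=> F /gtang_sym3_inv[u [v [p [q [r [p' [q' [r' [p'' [q'' [r'' ->]]]]]]]]]]].
  exists (nth 0 [:: j00 u; j00 v; j10 u; j01 u; j10 v; j01 v; j00 q'; j00 q''; j00 r'; j00 r''; j00 p]).
  rewrite gact_sym3 !gdE.
  by nths ltac:(rewrite /= /D1 /D2 /E20 /E11 /E02 /B22 /B23 /B33 ?sym3E /= ?j2 -?(rmorph0 C) -?(rmorph1 C) ?jr ?a0 ?d0 ?e0 ?f0 ?ax ?dx_ ?ex ?fx ?ay ?dy_ ?ey ?fy; first [ring | field]).
- by [].
- by rewrite oner_neq0.
- by nths ltac:(rewrite /= /cw /= /D1 /D2 /E20 /E11 /E02 /B22 /B23 /B33 /=; first [ring | field]).
Qed.

(** The entries (1, 3) and (1, 2) have independent differentials, so they can be taken as the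
    coordinates x and y; the other entries keep a zero 1-jet. *)
Lemma gspan_isotropic (A : 'M[S]_3) d : gsym A ->
  jet1 A (sym3 0 0 1 0 0 0) (sym3 0 1 0 0 0 0) -> gspan A d -> (8 < d)%N.
Proof.
move=> sA jA Ad; rewrite (symP sA) in jA Ad; move: jA Ad.
move: (A o0 o0) (A o0 o1) (A o0 o2) (A o1 o1) (A o1 o2) (A o2 o2) => a b c d' e f jA Ad.
have [[[a0 ax ay] [[b0 bx by_] [c0 cx cy]]] [[d0 dx_ dy_] [[e0 ex ey] [f0 fx fy]]]] := jet1_sym3 jA.
rewrite !sym3E in ax ay bx by_ cx cy dx_ dy_ ex ey fx fy.
have [|u [v [[u0 v0] _ _ E1 E2]]] := gsubst_inv c0 b0.
  by rewrite -/(j10 c) -/(j01 b) -/(j01 c) -/(j10 b) cx by_ cy bx mulr1 mul0r subr0 oner_neq0.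
have J : gjac u v != 0.
  have := gjac_comp u0 v0 c0 b0; rewrite E1 E2 [LHS]/gjac gdxX gdyY gdyX gdxY !rmorph1 rmorph0 mul1r mul0r subr0.
  by move=> E; apply/eqP => E0; move: E; rewrite E0 mul0r => /eqP; rewrite oner_eq0.
have := gspan_equiv (@gequiv_subst R T (sym3 a b c d' e f) u v u0 v0 J) Ad.
rewrite map_sym3 E1 E2; apply: gspan_isotropic'.
have z g : j00 g = 0 -> j10 g = 0 -> j01 g = 0 ->
    [/\ ev (gsubst u v g) = 0, ev (dx (gsubst u v g)) = 0 & ev (dy (gsubst u v g)) = 0].
  rewrite /j00 /j10 /j01 => g0 gx gy; rewrite gdx_subst // gdy_subst // !(rmorphD, rmorphM) !gev_subst //.
  by rewrite g0 gx gy !mul0r addr0.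
by apply: forall_ord3; apply: forall_ord3; rewrite !sym3E ?gdE ?gevX ?gevY ?rmorph0 ?rmorph1; first [by split | exact: z].
Qed.
End LowerBoundsc.

(** * Classification *)

Section Classification.
Context {R : realType} (T : germ_theory R).
Local Notation S := (gring T).
Local Notation ev := (gev T).
Local Notation C := (gcst T).
Local Notation dx := (@gdx R T).
Local Notation dy := (@gdy R T).
Local Notation x := (gX T).
Local Notation y := (gY T).
Let evE := (gevX T, gevY T, rmorph0 ev, rmorph1 ev, rmorphN ev, rmorphB ev, gev_cst T,
  rmorphD ev, rmorphM ev, rmorphXn ev).

Definition classified (A : 'M[S]_3) := exists N c, gnormal N c /\ gequiv A N.

Lemma classified_equiv A B : gequiv A B -> classified B -> classified A.
Proof. by move=> AB [N [c [nN BN]]]; exists N, c; split=> //; exact: gequiv_trans BN. Qed.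

Lemma gequiv_scale (d1 d2 d3 lam mu : R) (a b c d e f : S) :
  [/\ d1 != 0, d2 != 0 & d3 != 0] -> lam != 0 -> mu != 0 ->
  let s := gsubst (C lam * x) (C mu * y) in
  gequiv (sym3 a b c d e f) (sym3 (C d1 * C d1 * s a) (C d1 * C d2 * s b) (C d1 * C d3 * s c)
    (C d2 * C d2 * s d) (C d2 * C d3 * s e) (C d3 * C d3 * s f)).
Proof.
move=> [d10 d20 d30] l0 m0 s.
exists (C lam * x), (C mu * y), (mx3 (C d1) 0 0 0 (C d2) 0 0 0 (C d3)); split.
- by rewrite !evE !mulr0.
- by rewrite /gjac !gdE !evE !(mulr0, mul0r, mulr1, addr0, add0r, subr0) mulf_neq0.
- rewrite det_mx3 !evE (_ : _ + _ = d1 * d2 * d3); last by ring.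
  by rewrite !mulf_neq0.
- by rewrite map_sym3 congr_sym3 -/s; congr sym3; ring.
Qed.

Lemma scale_sign (b : R) : b != 0 -> exists k (s : bool), 0 < k /\ k ^+ 2 * b = (-1) ^+ s.
Proof.
move=> b0; have nb : 0 < `|b| by rewrite normr_gt0.
exists (Num.sqrt `|b|)^-1, (b < 0); split; first by rewrite invr_gt0 sqrtr_gt0.
by rewrite exprVn sqr_sqrtr ?ltW // {2}[b]realEsign ?num_real // mulrCA mulVf ?gt_eqF // mulr1.
Qed.

Lemma gcst_sign (s : bool) : C ((-1) ^+ s) = (-1) ^+ s.
Proof. by rewrite rmorphXn rmorphN rmorph1. Qed.

(** The expansion of the unfolding entry up to the ideal (x^2, x y^2, y^4). The monomials y^2, x y,
    y^3 are those that separate the normal forms; the ideal is of higher weight for each of them. *)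
Definition quartic (b k c : R) (p q r : S) : S :=
  C b * y ^+ 2 + C k * (x * y) + C c * y ^+ 3 + x ^+ 2 * p + x * y ^+ 2 * q + y ^+ 4 * r.

Lemma quartic_expand t0 t1 : ev t0 = 0 -> ev t1 = 0 ->
  exists b k c p q r, x * t0 + y * t1 = quartic b k c p q r.
Proof.
move=> /(hadamard_mul 0)[a0 [b0 ->]] /(hadamard_mul 0)[a1 [b1 ->]].
have [b [p1 [q1 ->]]] := ev_expand 0 b1; have [c [p2 [q2 ->]]] := ev_expand 0 q1.
have [k [p3 [q3 E]]] := ev_expand 0 (b0 + a1).
exists b, k, c, (a0 + y * p3), (q3 + p1 + y * p2), q2; rewrite /quartic.
transitivity (x ^+ 2 * a0 + x * y * (b0 + a1) + y ^+ 2 * (C b + (x * p1 + y * (C c + (x * p2 + y * q2)))));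
  last rewrite E; ring.
Qed.

Lemma quartic_dx b k c p q r : exists U V, dx (quartic b k c p q r) = C k * y + x * U + y ^+ 2 * V.
Proof.
by exists (2 * p + x * dx p + y ^+ 2 * dx q), (q + y ^+ 2 * dx r); rewrite /quartic !gdE; ring.
Qed.

Lemma quartic_dy b k c p q r : exists U V W, dy (quartic b k c p q r) =
  2 * C b * y + C k * x + 3 * C c * y ^+ 2 + x * (x * U + y * V) + y ^+ 3 * W.
Proof.
by exists (dy p), (2 * q + y * dy q), (4 * r + y * dy r); rewrite /quartic !gdE; ring.
Qed.

Lemma quartic_subst (l m g : R) b k c p q r : exists p' q' r',
  C g * gsubst (C l * x) (C m * y) (quartic b k c p q r) =
  quartic (g * m ^+ 2 * b) (g * l * m * k) (g * m ^+ 3 * c) p' q' r'.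
Proof.
have ux : ev (C l * x) = 0 by rewrite !evE mulr0.
have uy : ev (C m * y) = 0 by rewrite !evE mulr0.
set s := gsubst _ _.
exists (C g * C l ^+ 2 * s p), (C g * C l * C m ^+ 2 * s q), (C g * C m ^+ 4 * s r).
by rewrite /quartic !(rmorphD s, rmorphM s, rmorphXn s) /s !gsubstC // gsubstX // gsubstY // !(rmorphXn C, rmorphM C); ring.
Qed.

(** The congruence diag(1, k, k^2) with x and y scaled by k^(-2) and k^(-1) is the one-parameter
    group fixing the other entries. It multiplies the coefficient of a monomial x^i y^j at (3, 3) by
    k^(4 - 2 i - j). *)
Lemma block3_scale (k b k0 c : R) p q r : k != 0 -> exists p' q' r',
  gequiv (sym3 0 y x x 0 (quartic b k0 c p q r))
    (sym3 0 y x x 0 (quartic (k ^+ 2 * b) (k * k0) (k * c) p' q' r')).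
Proof.
move=> n0; have [p' [q' [r' E]]] := quartic_subst (k ^- 2) k^-1 (k ^+ 4) b k0 c p q r.
exists p', q', r'; rewrite /=; have := @gequiv_scale 1 k (k ^+ 2) (k ^- 2) k^-1 0 y x x 0 (quartic b k0 c p q r)
  (And3 (oner_neq0 R) n0 (expf_neq0 2 n0)) (invr_neq0 (expf_neq0 2 n0)) (invr_neq0 n0).
have ux : ev (C (k ^- 2) * x) = 0 by rewrite !evE mulr0.
have uy : ev (C k^-1 * y) = 0 by rewrite !evE mulr0.
rewrite /= !rmorph0 !gsubstX // !gsubstY // !mulrA -!(rmorphM C); congr (gequiv _ _).
congr sym3; rewrite ?mulr0 //.
- by rewrite mul1r divff // rmorph1 mul1r.
- by rewrite mul1r divff ?expf_neq0 // rmorph1 mul1r.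
- by rewrite -expr2 divff ?expf_neq0 // rmorph1 mul1r.
- rewrite -exprD E; congr (quartic _ _ _ _ _ _); field; exact: n0.
Qed.

Local Ltac wid := rewrite ?addr0; repeat first [exact: wideal0 | apply: wideal_mono; done | apply: wideal_add].

(** The first nonzero coefficient, in the order y^2, x y, y^3, names the normal form: scaling makes
    it a sign or 1, and all other terms have higher weight for that form. If all three vanish, nine
    classes are independent. *)
Lemma block3_classified t0 t1 d : ev t0 = 0 -> ev t1 = 0 ->
  gspan (sym3 0 y x x 0 (x * t0 + y * t1)) d -> (d < 9)%N ->
  classified (sym3 0 y x x 0 (x * t0 + y * t1)).
Proof.
move=> e0 e1; have [b [k [c [p [q [r ->]]]]]] := quartic_expand e0 e1.
have [b0|b0] := eqVneq b 0; last first.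
  have [u [s [u0 ub]]] := scale_sign b0; move=> _ _.
  have [p' [q' [r' E]]] := block3_scale b k c p q r (lt0r_neq0 u0).
  apply: (classified_equiv E); exists (sym3 0 y x x 0 ((-1) ^+ s * y ^+ 2)), 6; split; first exact: GNF6.
  pose Q : S := C (u * k) * (x ^+ 1 * y ^+ 1) + C (u * c) * (x ^+ 0 * y ^+ 3) +
    p' * (x ^+ 2 * y ^+ 0) + q' * (x ^+ 1 * y ^+ 2) + r' * (x ^+ 0 * y ^+ 4).
  have := @NF6_determined R T 0 0 0 0 0 Q s.
  rewrite !addr0 (_ : quartic _ _ _ _ _ _ = (-1) ^+ s * y ^+ 2 + Q); first by apply; try rewrite /Q; wid.
  by rewrite /Q /quartic ub gcst_sign; ring.
have [k0|k0] := eqVneq k 0; last first.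
  have [p' [q' [r' E]]] := block3_scale b k c p q r (invr_neq0 k0); move=> _ _.
  apply: (classified_equiv E); exists (sym3 0 y x x 0 (x * y)), 7; split; first exact: GNF7.
  pose Q : S := C (k^-1 * c) * (x ^+ 0 * y ^+ 3) +
    p' * (x ^+ 2 * y ^+ 0) + q' * (x ^+ 1 * y ^+ 2) + r' * (x ^+ 0 * y ^+ 4).
  have := @NF7_determined R T 0 0 0 0 0 Q.
  rewrite !addr0 (_ : quartic _ _ _ _ _ _ = x * y + Q); first by apply; try rewrite /Q; wid.
  by rewrite /Q /quartic b0 mulr0 mulVf // rmorph0 rmorph1; ring.
have [c0|c0] := eqVneq c 0; last first.
  have [p' [q' [r' E]]] := block3_scale b k c p q r (invr_neq0 c0); move=> _ _.
  apply: (classified_equiv E); exists (sym3 0 y x x 0 (y ^+ 3)), 8; split; first exact: GNF9.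
  pose Q : S := p' * (x ^+ 2 * y ^+ 0) + q' * (x ^+ 1 * y ^+ 2) + r' * (x ^+ 0 * y ^+ 4).
  have := @NF9_determined R T 0 0 0 0 0 Q.
  rewrite !addr0 (_ : quartic _ _ _ _ _ _ = y ^+ 3 + Q); first by apply; try rewrite /Q; wid.
  by rewrite /Q /quartic b0 k0 !mulr0 mulVf // !rmorph0 rmorph1; ring.
rewrite b0 k0 c0; set f := quartic 0 0 0 p q r => Ad d9.
have [U [V fx]] := quartic_dx 0 0 0 p q r; have [U' [V' [W' fy]]] := quartic_dy 0 0 0 p q r.
rewrite -/f !rmorph0 in fx fy.
have fE : f = x * (x * p + y ^+ 2 * q) + y ^+ 4 * r by rewrite /f /quartic !rmorph0; ring.
(* Three constants outside (3, 3), where 1, y, y^2, y^3 and x, x y also survive: 3 + 4 + 2 = 9. *)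
suff : (#|{: 'I_3 + ('I_4 + 'I_2)}| <= d)%N by rewrite !card_sum !card_ord leqNgt d9.
apply: (gspan_indep Ad (@block3_basis_sym R T 4 2)).
apply: (@block3_indep _ _ _ 4) => //.
- by rewrite fE; eexists; eexists; reflexivity.
- by rewrite fx !evE; ring.
- split; split; rewrite ?fx ?fy ?gdE.
  + exact: yideal_x.
  + by exists (2 * U + x * dx U + y ^+ 2 * dx V), V; ring.
  + by exists (y ^+ 2 * U), V; ring.
  + by exists 0, (U + x * dx U + y ^+ 2 * dx V); ring.
  + exact: yideal_x.
  + by exists (2 * (x * U' + y * V') + x * (U' + x * dx U' + y * dx V') + y ^+ 3 * dx W'), (y * W'); ring.
  + by exists (y * (x * U' + y * V')), W'; ring.
  + by exists (y * U' + y * (U' + x * dx U' + y * dx V')), (V' + y ^+ 2 * dx W'); ring.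
- by split; rewrite ?fx ?fE; [eexists; eexists; reflexivity | exists U, V; ring].
- by split; rewrite ?gdE; [exact: yideal_x | exists 0, y; rewrite /=; ring].
Qed.

(** The congruence diag(k^2, m^2, k m) fixes the pencil when x is scaled by (k m)^(-2) and y by
    k^(-4). This torus of dimension two normalises the leading coefficients at (2, 2) and (2, 3). *)
Lemma block21_scale (k m b k0 c : R) p q r h0 h1 h2 : k != 0 -> m != 0 -> exists p' q' r' h1' h2',
  gequiv (sym3 y x 0 (quartic b k0 c p q r) (C h0 * y ^+ 2 + x * y * h1 + y ^+ 3 * h2) x)
    (sym3 y x 0 (quartic (m ^+ 4 / k ^+ 8 * b) (m ^+ 2 / k ^+ 6 * k0) (m ^+ 4 / k ^+ 12 * c) p' q' r')
       (C (m ^+ 3 / k ^+ 7 * h0) * y ^+ 2 + x * y * h1' + y ^+ 3 * h2') x).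
Proof.
move=> n0 m0; pose l := k ^- 2 * m ^- 2; pose v := k ^- 4.
have [p' [q' [r' E]]] := quartic_subst l v (m ^+ 4) b k0 c p q r.
have ux : ev (C l * x) = 0 by rewrite !evE mulr0.
have uy : ev (C v * y) = 0 by rewrite !evE mulr0.
pose s := gsubst (C l * x) (C v * y); pose g := C (k * m ^+ 3).
exists p', q', r', (g * C l * C v * s h1), (g * C v ^+ 3 * s h2).
have := @gequiv_scale (k ^+ 2) (m ^+ 2) (k * m) l v y x 0 (quartic b k0 c p q r)
  (C h0 * y ^+ 2 + x * y * h1 + y ^+ 3 * h2) x
  (And3 (expf_neq0 2 n0) (expf_neq0 2 m0) (mulf_neq0 n0 m0))
  (mulf_neq0 (invr_neq0 (expf_neq0 2 n0)) (invr_neq0 (expf_neq0 2 m0))) (invr_neq0 (expf_neq0 4 n0)).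
rewrite /= -/s -!(rmorphM C); congr (gequiv _ _).
have sx : s x = C l * x by rewrite /s gsubstX.
have sy : s y = C v * y by rewrite /s gsubstY.
have one (a a' : R) (z : S) : a * a' = 1 -> C a * (C a' * z) = z.
  by move=> aa; rewrite mulrA -rmorphM aa rmorph1 mul1r.
congr sym3; rewrite ?sx ?sy ?rmorph0 ?mulr0 //.
- by apply: one; rewrite /v; field; rewrite n0.
- by apply: one; rewrite /l; field; rewrite n0 m0.
- rewrite -exprD E /l /v; congr (quartic _ _ _ _ _ _); field; by rewrite ?n0 ?m0.
- rewrite (_ : m ^+ 2 * (k * m) = k * m ^+ 3); last by ring.
  rewrite -/g !(rmorphD s, rmorphM s, rmorphXn s) sx sy /s gsubstC //.
  rewrite (_ : m ^+ 3 / k ^+ 7 * h0 = k * m ^+ 3 * v ^+ 2 * h0); last by rewrite /v; field; rewrite n0.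
  by rewrite !(rmorphXn C, rmorphM C) /g !(rmorphXn C, rmorphM C); ring.
- by apply: one; rewrite /l; field; rewrite n0 m0.
Qed.

(** A term y^2 at (2, 2) dominates and gives the eighth normal form; failing that, a term y^2 at (2,
    3) gives the tenth; failing both, nine classes are independent. *)
Lemma block21_classified t0 t1 t2 d : ev t0 = 0 -> ev t1 = 0 -> ev t2 = 0 ->
  gspan (sym3 y x 0 (x * t0 + y * t1) (y * t2) x) d -> (d < 9)%N ->
  classified (sym3 y x 0 (x * t0 + y * t1) (y * t2) x).
Proof.
move=> e0 e1; have [b [k [c [p [q [r ->]]]]]] := quartic_expand e0 e1.
move=> /(hadamard_mul 0)[a0 [b1 ->]]; have [h0 [a1 [h2 ->]]] := ev_expand 0 b1.
pose h1 := a0 + y * a1.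
rewrite (_ : y * _ = C h0 * y ^+ 2 + x * y * h1 + y ^+ 3 * h2); last by rewrite /h1; ring.
have [b0|b0] := eqVneq b 0; last first.
  have [u [s [u0 ub]]] := scale_sign b0; move=> _ _.
  have v0 : Num.sqrt u != 0 by rewrite sqrtr_eq0 -ltNge.
  (* k = 1 and m^2 = u, so that the coefficient of y^2 becomes m^4 b = u^2 b, a sign. *)
  have [p' [q' [r' [h1' [h2' E]]]]] := block21_scale b k c p q r h0 h1 h2 (oner_neq0 R) v0.
  apply: (classified_equiv E); exists (sym3 y x 0 ((-1) ^+ s * y ^+ 2) 0 x), 7; split; first exact: GNF8.
  move: E => _; rewrite !expr1n !divr1.
  rewrite (_ : Num.sqrt u ^+ 4 * b = (-1) ^+ s); last by rewrite (exprM _ 2 2) sqr_sqrtr ?ltW.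
  pose Q : S := C (Num.sqrt u ^+ 2 * k) * (x ^+ 1 * y ^+ 1) +
    C (Num.sqrt u ^+ 4 * c) * (x ^+ 0 * y ^+ 3) + p' * (x ^+ 2 * y ^+ 0) + q' * (x ^+ 1 * y ^+ 2) +
    r' * (x ^+ 0 * y ^+ 4).
  pose Q' : S := C (Num.sqrt u ^+ 3 * h0) * (x ^+ 0 * y ^+ 2) + h1' * (x ^+ 1 * y ^+ 1) +
    h2' * (x ^+ 0 * y ^+ 3).
  have := @NF8_determined R T 0 0 0 Q Q' 0 s.
  rewrite !addr0 add0r (_ : quartic _ _ _ _ _ _ = (-1) ^+ s * y ^+ 2 + Q); last first.
    by rewrite /Q /quartic gcst_sign; ring.
  rewrite (_ : C _ * y ^+ 2 + x * y * h1' + y ^+ 3 * h2' = Q'); last by rewrite /Q'; ring.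
  by apply; try rewrite /Q; try rewrite /Q'; wid.
have [h00|h00] := eqVneq h0 0; last first.
  (* k = h0 and m = h0^2 make the new coefficient m^3 / k^7 * h0 equal to 1. *)
  move=> _ _; have [p' [q' [r' [h1' [h2' E]]]]] := block21_scale b k c p q r h0 h1 h2 h00 (expf_neq0 2 h00).
  apply: (classified_equiv E); exists (sym3 y x 0 0 (y ^+ 2) x), 8; split; first exact: GNF10.
  move: E => _; rewrite b0 mulr0.
  rewrite (_ : _ / h0 ^+ 7 * h0 = 1); last by field; rewrite h00.
  set k' := _ * k; set c' := _ * c.
  have := @NF10_determined R T 0 0 0 (C k' * (x ^+ 1 * y ^+ 1) +
    C c' * (x ^+ 0 * y ^+ 3) + p' * (x ^+ 2 * y ^+ 0) + q' * (x ^+ 1 * y ^+ 2) +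
    r' * (x ^+ 0 * y ^+ 4)) (h1' * (x ^+ 1 * y ^+ 1) + h2' * (x ^+ 0 * y ^+ 3)) 0.
  rewrite !addr0 add0r (_ : quartic _ _ _ _ _ _ = C k' * (x ^+ 1 * y ^+ 1) + C c' * (x ^+ 0 * y ^+ 3) + p' * (x ^+ 2 * y ^+ 0) + q' * (x ^+ 1 * y ^+ 2) + r' * (x ^+ 0 * y ^+ 4)); last first.
    by rewrite /quartic rmorph0; ring.
  rewrite (_ : C 1 * y ^+ 2 + x * y * h1' + y ^+ 3 * h2' = y ^+ 2 + (h1' * (x ^+ 1 * y ^+ 1) + h2' * (x ^+ 0 * y ^+ 3))); last by rewrite rmorph1; ring.
  by apply; wid.
rewrite b0 h00; set f := quartic 0 k c p q r; set h := _ + y ^+ 3 * h2 => Ad d9.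
have [U [V fx]] := quartic_dx 0 k c p q r; have [U' [V' [W' fy]]] := quartic_dy 0 k c p q r.
rewrite -/f !rmorph0 in fx fy.
have fE : f = x * (C k * y + x * p + y ^+ 2 * q) + y ^+ 3 * (C c + y * r) by rewrite /f /quartic !rmorph0; ring.
have hE : h = x * (y * h1) + y ^+ 3 * h2 by rewrite /h rmorph0; ring.
have f3 : yideal 3 f by rewrite fE; eexists; eexists; reflexivity.
have h3 : yideal 3 h by rewrite hE; eexists; eexists; reflexivity.
(* Constants at (1, 2), (1, 3) and x at (2, 2), then 1, y, y^2 at (2, 2) and again at (2, 3): nine
   classes. *)
suff : (#|{: 'I_3 + ('I_3 + 'I_3)}| <= d)%N by rewrite !card_sum !card_ord leqNgt d9.
apply: (gspan_indep Ad (@block21_basis_sym R T 3 3)).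
apply: block21_indep => //.
- by rewrite fx fy fE !evE; split; ring.
- by rewrite hE !gdE !evE; split; ring.
- have e1' g : ev (dx g) = 0 -> yideal 1 (dx g) by exact: yideal1.
  split; split; first [apply: e1'; rewrite ?fx ?fy ?hE !gdE !evE; ring | exact: yideal_x | idtac].
  + by rewrite mulrC; exact: yidealM.
  + exact: yideal_ydy.
- split; split; first [apply: yideal1; rewrite ?gdE ?fx ?hE ?gdE !evE; ring | exact: yideal_x | exact: yidealM | done].
- by split; [exact: yideal_x | apply: yideal1; rewrite !gdE !evE; ring].
Qed.
End Classification.

(** * The diagonal and scalar families *)

Section Diagonal.
Context {R : realType} (T : germ_theory R).
Local Notation S := (gring T).
Local Notation ev := (gev T).
Local Notation C := (gcst T).
Local Notation dx := (@gdx R T).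
Local Notation dy := (@gdy R T).
Local Notation x := (gX T).
Local Notation y := (gY T).
Local Notation Y p := ((map_poly C p).[y]).
(** The powers of the maximal ideal. *)
Local Notation mi := (wideal (T := T) 1 1).
Let evE := (gevX T, gevY T, rmorph0 ev, rmorph1 ev, rmorphN ev, rmorphB ev, gev_cst T,
  rmorphD ev, rmorphM ev, rmorphXn ev).

Lemma ypoly_step (p : {poly R}) c : Y (p * 'X + c%:P) = Y p * y + C c.
Proof. by rewrite rmorphD rmorphM /= map_polyX map_polyC !hornerE. Qed.

Lemma ypoly_expand n (c : S) : exists p a b, c = Y p + x * a + y ^+ n * b.
Proof.
elim: n => [|n [p [a [b ->]]]]; first by exists 0, 0, c; rewrite rmorph0 horner0; ring.
have [t [b1 [b2 ->]]] := ev_expand 0 b.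
exists (p + t *: 'X^n), (a + y ^+ n * b1), b2.
have -> : Y (p + t *: 'X^n) = Y p + C t * y ^+ n by rewrite rmorphD /= map_polyZ map_polyXn !hornerE.
by rewrite exprS; move: (y ^+ n) => yn; ring.
Qed.

Lemma ypoly_monom n p : Y ('X^n * p) = y ^+ n * Y p.
Proof. by rewrite rmorphM /= map_polyXn !hornerE. Qed.

Lemma ypoly_dx p : dx (Y p) = 0.
Proof.
elim/poly_ind: p => [|p c IH]; first by rewrite rmorph0 horner0 gdx0.
by rewrite ypoly_step !gdE IH; ring.
Qed.

Lemma ypoly_subst u p : ev u = 0 -> gsubst u y (Y p) = Y p.
Proof.
move=> u0; elim/poly_ind: p => [|p c IH]; first by rewrite !rmorph0 horner0 rmorph0.
by rewrite ypoly_step rmorphD rmorphM IH gsubstC ?gsubstY ?gevY.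
Qed.

Lemma poly_split (p : {poly R}) : exists q c, p = q * 'X + c%:P.
Proof. by elim/poly_ind: p => [|p c _]; [exists 0, 0; rewrite mul0r addr0 | exists p, c]. Qed.

Lemma ypoly_order N p : (exists b, Y p = y ^+ N * b) \/
  exists l t b, [/\ (l < N)%N, t != 0 & Y p = y ^+ l * (C t + y * b)].
Proof.
elim: N p => [|N IH] p; first by left; exists (Y p); rewrite mul1r.
have [q [c ->]] := poly_split p; rewrite ypoly_step.
have [c0|c0] := eqVneq c 0; last first.
  by right; exists 0, c, (Y q); split=> //; ring.
rewrite c0 rmorph0; have [[b ->]|[l [t [b [lN t0 ->]]]]] := IH q.
  by left; exists b; rewrite exprS; ring.
by right; exists l.+1, t, b; split=> //; rewrite exprS; ring.
Qed.

Lemma ypoly_order2 N p q : (exists b b', Y p = y ^+ N * b /\ Y q = y ^+ N * b') \/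
  exists l t b t' b', [/\ (l < N)%N, (t != 0) || (t' != 0), Y p = y ^+ l * (C t + y * b) &
    Y q = y ^+ l * (C t' + y * b')].
Proof.
elim: N p q => [|N IH] p q; first by left; exists (Y p), (Y q); rewrite !mul1r.
have [p1 [c ->]] := poly_split p; have [q1 [c' ->]] := poly_split q; rewrite !ypoly_step.
have [c0|c0] := boolP ((c != 0) || (c' != 0)).
  by right; exists 0, c, (Y p1), c', (Y q1); split=> //; ring.
move: c0; rewrite negb_or !negbK => /andP[/eqP-> /eqP->]; rewrite rmorph0.
have [[b [b' [-> ->]]]|[l [t [b [t' [b' [lN t0 -> ->]]]]]]] := IH p1 q1.
  by left; exists b, b'; rewrite exprS; split; ring.
by right; exists l.+1, t, b, t', b'; split=> //; rewrite exprS; ring.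
Qed.

Lemma wideal_le wx wy a b (c : S) : wideal wx wy b c -> (a <= b)%N -> wideal wx wy a c.
Proof. by move=> h ab; apply: wideal_weak ab h. Qed.

Lemma mi_subst n u c : ev u = 0 -> mi n c -> mi n (gsubst u y c).
Proof.
move=> u0; elim=> {c} [i j c ij|c d _ IHc _ IHd]; last by rewrite rmorphD; exact: wideal_add.
rewrite !rmorphM !rmorphXn gsubstX ?gsubstY ?gevY //; apply: widealMl => //.
apply: wideal_le ij; apply: widealM => //; apply: widealX => //; [exact: ev0_wideal | exact: wideal_y].
Qed.

Lemma mi_yideal n c : mi n c -> yideal n c.
Proof.
elim=> {c} [[|i] j c|c d _ IHc _ IHd]; last exact: yidealD.
  by rewrite mul0n muln1 add0n => nj; exists 0, (c * y ^+ (j - n)); rewrite -{1}(subnKC nj) exprD; ring.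
by move=> _; exists (c * (x ^+ i * y ^+ j)), 0; rewrite exprS; ring.
Qed.

Lemma mi_weight wx n c : (2 <= wx)%N -> mi n c -> wideal wx 2 (2 * n) c.
Proof.
move=> w2; elim=> {c} [i j c ij|c d _ IHc _ IHd]; last exact: wideal_add.
by apply: wideal_mono; nia.
Qed.

(* f is a function of y, up to x m^K and a negligible power of y *)
Definition ytype K (f : S) := exists p f' b, f = Y p + x * f' + y ^+ 10 * b /\ mi K f'.

Lemma ytypeD K f g : ytype K f -> ytype K g -> ytype K (f + g).
Proof.
move=> [p [f' [b [-> h]]]] [q [g' [c [-> h']]]]; exists (p + q), (f' + g'), (b + c).
by rewrite rmorphD hornerD; split; [ring | exact: wideal_add].
Qed.

Lemma ytype_mi K f : mi K.+1 f -> ytype K f.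
Proof.
move=> h; have [|c1 [c2 [-> h1 _]]] := wideal_split K.+1 0 h isT; first by rewrite !muln1 addn1.
have [p [a [b ->]]] := ypoly_expand 10 c2.
exists ('X^(K.+1) * p), (c1 + y ^+ K.+1 * a), (y ^+ K.+1 * b); split; first by rewrite ypoly_monom; ring.
move: h1; rewrite subn1 => h1; apply: wideal_add => //; apply: widealMr => //.
apply: (@wideal_le _ _ _ (K.+1 * 1)); rewrite ?muln1 //.
by rewrite -[X in wideal _ _ X]muln1; apply: widealX => //; exact: wideal_y.
Qed.

Lemma ytype_subst K u f : ev u = 0 -> ytype K f -> ytype K (gsubst u y f).
Proof.
move=> u0 [p [f' [b [-> h]]]]; rewrite !(rmorphD, rmorphXn, rmorphM) ypoly_subst // gsubstX ?gsubstY ?gevY //.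
apply: ytypeD; first apply: ytypeD.
- by exists p, 0, 0; split; [ring | exact: wideal0].
- apply: ytype_mi; rewrite -[K.+1]/(1 + K)%N; apply: widealM => //; [exact: ev0_wideal | exact: mi_subst].
- by exists 0, 0, (gsubst u y b); split; [rewrite rmorph0 horner0; ring | exact: wideal0].
Qed.

Lemma mi2_ev f : mi 2 f -> [/\ ev f = 0, ev (dx f) = 0 & ev (dy f) = 0].
Proof.
elim=> {f} [i j c|c d _ [c1 c2 c3] _ [d1 d2 d3]]; last first.
  by rewrite !gdE !rmorphD c1 c2 c3 d1 d2 d3 !addr0.
rewrite !muln1; case: i => [|[|i]]; case: j => [|[|j]] // _; rewrite ?exprS ?expr0 !gdE !evE; split; ring.
Qed.

(** A Newton step. With t = - f'/2 and u = - g'/2, adding t times the second basis vector to the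
    first, and u times the first to the second, cancels x f' and x g' up to the quadratic terms t^2
    g and u^2 f, whence the doubling of K. The entry x becomes z, whose linear part is x; a
    substitution fixing y makes z the coordinate again. *)
Lemma diag_step K f g : mi 2 f -> mi 1 g -> (0 < K)%N -> ytype K f -> ytype K g ->
  exists f1 g1, [/\ mi 2 f1, mi 1 g1, ytype (K + K) f1, ytype (K + K) g1 &
    gequiv (sym3 f x 0 g 0 y) (sym3 f1 x 0 g1 0 y)].
Proof.
move=> f2 g1 K0 fK gK; have [ef efx efy] := mi2_ev f2.
have eg : ev g = 0 by exact: wideal_ev g1.
have [p [f' [b [fE f'K]]]] := fK; have [q [g' [b' [gE g'K]]]] := gK.
pose k := C 2^-1; have k2 : k + k = 1 by rewrite -rmorphD -[1 in RHS](rmorph1 C); congr (C _); field.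
have [t tE] : exists t, t = - (k * f') by eexists.
have [u uE] : exists u, u = - (k * g') by eexists.
have tK : mi K t by rewrite tE; apply: widealN => //; exact: widealMl.
have uK : mi K u by rewrite uE; apply: widealN => //; exact: widealMl.
have et : ev t = 0 by exact: wideal_ev tK.
have eu : ev u = 0 by exact: wideal_ev uK.
pose z := f * u + t * g + (1 + t * u) * x.
have z0 : ev z = 0 by rewrite !evE ef et; ring.
have zx : ev (dx z) = 1 by rewrite !gdE !evE ef efx et eu eg; ring.
have zy : ev (dy z) = 0 by rewrite !gdE !evE ef efy et eu eg; ring.
have y0 := gevY T; have J : gjac z y != 0 by rewrite /gjac gdyY gdxY !evE zx zy mul1r mul0r subr0 oner_neq0.
have [u' [v' [[u0 v0] E1 E2 E3 E4]]] := gsubst_inv z0 y0 J.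
have v'E : v' = y by rewrite -E4 gsubstY.
subst v'; pose f2' := f + t * t * g + 2 * t * x; pose g2' := g + u * u * f + 2 * u * x.
have back a : gsubst z y (gsubst u' y a) = a by rewrite gsubst_comp // E1 E2 gsubst_id.
have xm c : mi K c -> mi 2 (c * x).
  by move=> h; apply: (@wideal_le _ _ _ (K + 1)); last lia; apply: widealM => //; exact: wideal_x.
have f22 : mi 2 f2'.
  apply: wideal_add; last by rewrite -mulrA; apply: widealMl => //; exact: xm.
  apply: wideal_add => //; rewrite -mulrA; apply: (@wideal_le _ _ _ (K + (K + 1))); last lia.
  by apply: widealM => //; exact: widealM.
have g22 : mi 1 g2'.
  apply: wideal_add; last by apply: (@wideal_le _ _ _ 2); rewrite // -mulrA; apply: widealMl => //; exact: xm.
  apply: wideal_add => //; apply: (@wideal_le _ _ _ 2) => //; exact: widealMl.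
have f2K : ytype (K + K) f2'.
  have -> : f2' = Y p + y ^+ 10 * b + t * t * g by
    rewrite /f2' {1}fE; transitivity (Y p + y ^+ 10 * b + t * t * g + x * (f' * (1 - (k + k)))); [rewrite tE; ring | rewrite k2; ring].
  apply: ytypeD; first by exists p, 0, b; split; [ring | exact: wideal0].
  by apply: ytype_mi; rewrite -[(K + K).+1]addn1; apply: widealM => //; exact: widealM.
have g2K : ytype (K + K) g2'.
  have -> : g2' = Y q + y ^+ 10 * b' + u * u * f by
    rewrite /g2' {1}gE; transitivity (Y q + y ^+ 10 * b' + u * u * f + x * (g' * (1 - (k + k)))); [rewrite uE; ring | rewrite k2; ring].
  apply: ytypeD; first by exists q, 0, b'; split; [ring | exact: wideal0].
  apply: ytype_mi; rewrite -[(K + K).+1]addn1; apply: widealM => //; first exact: widealM.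
  exact: (@wideal_le _ _ _ 2).
exists (gsubst u' y f2'), (gsubst u' y g2'); split; try exact: mi_subst; try exact: ytype_subst.
apply: (@gequiv_trans _ _ _ (sym3 f2' z 0 g2' 0 y)).
  have := @gequiv_congr R T (sym3 f x 0 g 0 y) (mx3 1 u 0 t 1 0 0 0 1).
  rewrite det_mx3 congr_sym3 (_ : ev _ = 1); last by rewrite !evE et eu; ring.
  move=> /(_ (oner_neq0 R)); congr (gequiv _ _); congr sym3; rewrite /f2' /g2' /z; ring.
apply: gequiv_sym; have := @gequiv_subst R T (sym3 (gsubst u' y f2') x 0 (gsubst u' y g2') 0 y) z y z0 y0 J.
by rewrite map_sym3 !back rmorph0 gsubstX // gsubstY.
Qed.

Definition yshape l (f : S) := exists t b f', [/\ t != 0, mi 8 f' & f = y ^+ l * (C t + y * b) + x * f'].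

(** Orders are truncated at 7: two orders with sum at least 7 already give nine independent classes.
    The tail in y^10 disappears in the unit or in the multiple of y^7. *)
Lemma ytype_order f : ytype 8 f -> [/\ yideal 7 (dx f) &
  exists l, [/\ (l <= 7)%N, yideal l f & (l < 7)%N -> yshape l f]].
Proof.
move=> [p [f' [b [-> h]]]]; split.
  rewrite !gdE ypoly_dx; apply: yidealD.
    rewrite add0r; apply: yidealD; last exact: yideal_x.
    by rewrite mul1r; apply: (@yideal_weak R T 7 8) => //; exact: mi_yideal.
  by exists 0, (y ^+ 3 * dx b); ring.
have [[c ->]|[l [t [c [l7 t0 ->]]]]] := ypoly_order 7 p.
  by exists 7; split=> //; exists f', (c + y ^+ 3 * b); ring.
have [e yE] : exists e, y ^+ 10 = y ^+ l * y * e.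
  by exists (y ^+ (9 - l)); rewrite -exprSr -exprD; congr (_ ^+ _); lia.
exists l; rewrite ltnW // yE; split=> //.
  by exists f', (C t + y * c + y * e * b); move: (y ^+ l) => yl; ring.
by move=> _; exists t, (c + e * b), f'; split=> //; move: (y ^+ l) => yl; ring.
Qed.

(** Congruence by k1, k2 turns the leading coefficients into signs, and x is scaled by the inverse
    of k1 k2 to keep the entry (1, 2). The rest has higher weight for the fourth normal form. *)
Lemma diag_normal f g l1 l2 : yshape l1 f -> yshape l2 g -> (l2 <= l1)%N -> (0 < l2)%N -> (2 <= l1)%N ->
  (l1 + l2 < 7)%N -> classified (sym3 f x 0 g 0 y).
Proof.
move=> [t1 [b1 [f1 [t10 h1 ->]]]] [t2 [b2 [f2 [t20 h2 ->]]]] l21 l20 l12 l7.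
have [k1 [s1 [k10 E1]]] := scale_sign t10; have [k2 [s2 [k20 E2]]] := scale_sign t20.
have n1 := lt0r_neq0 k10; have n2 := lt0r_neq0 k20.
pose lam := (k1 * k2)^-1.
have ux : ev (C lam * x) = 0 by rewrite !evE mulr0.
have := @gequiv_scale R T k1 k2 1 lam 1 (y ^+ l1 * (C t1 + y * b1) + x * f1) x 0
  (y ^+ l2 * (C t2 + y * b2) + x * f2) 0 y (And3 n1 n2 (oner_neq0 R)) (invr_neq0 (mulf_neq0 n1 n2)) (oner_neq0 R).
rewrite /= rmorph1 !mul1r; set s := gsubst _ _ => E; apply: (classified_equiv E) => {E}.
exists (sym3 ((-1) ^+ s1 * y ^+ l1) x 0 ((-1) ^+ s2 * y ^+ l2) 0 y), (l1 + l2 + 2); split; first exact: GNF4.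
(* With y of weight 2, a germ in the eighth power of the maximal ideal has weight at least 16, hence
   at least 2 l + 1 because l <= 7. *)
have Q i l k t sg b f' : (0 < l)%N -> (i <= 7)%N -> (l <= i)%N -> mi 8 f' -> k ^+ 2 * t = (-1) ^+ (sg : bool) ->
    exists Q, C k * C k * s (y ^+ l * (C t + y * b) + x * f') = (-1) ^+ sg * y ^+ l + Q /\
      wideal (l1 + l2) 2 (l + l + 1) Q.
  move=> l0 i7 li h kt; exists (C k * C k * (y ^+ l.+1 * s b) + C k * C k * C lam * (x * s f')); split.
    rewrite !(rmorphD s, rmorphM s, rmorphXn s) /s gsubstC ?gsubstX ?gsubstY ?gevY //.
    by rewrite -gcst_sign -kt !(rmorphXn C, rmorphM C) !exprS; move: (y ^+ l) => yl; ring.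
  apply: wideal_add; apply: widealMl => //; try lia.
    apply: widealMr => //; try lia.
    apply: (@wideal_le _ _ _ (l.+1 * 2)); last lia.
    by apply: widealX => //; try lia; apply: wideal_y => //; lia.
  apply: widealMl => //; try lia.
  by apply: (@wideal_le _ _ _ (2 * 8)); last lia; apply: mi_weight; [lia | exact: mi_subst].
have [Q1 [-> w1]] := Q 7 l1 k1 t1 s1 b1 f1 (ltnW l12) isT ltac:(lia) h1 E1.
have [Q2 [-> w2]] := Q 7 l2 k2 t2 s2 b2 f2 l20 isT ltac:(lia) h2 E2.
have := @NF4_determined R T Q1 0 0 Q2 0 0 s1 s2 l1 l2 l21 l20 l12.
rewrite !addr0 rmorph0 !mulr0 /s gsubstX ?gsubstY ?gevY // mulrA -!rmorphM divff ?mulf_neq0 // rmorph1 mul1r.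
by apply=> //; apply: wideal0; lia.
Qed.

Lemma yshape_order l f : yshape l f -> (ev f = 0 -> (0 < l)%N) /\ (mi 2 f -> (1 < l)%N).
Proof.
move=> [t [b [f' [t0 h ->]]]]; have ef : ev f' = 0 by exact: wideal_ev h.
split; first by case: l => // /eqP; rewrite expr0 !evE mul0r mul0r !addr0 mul1r (negPf t0).
move=> /mi2_ev[]; case: l => [|[|l]] //.
  by move=> /eqP; rewrite expr0 !evE !mul0r !addr0 mul1r (negPf t0).
by move=> _ _ /eqP; rewrite expr1 !gdE !evE ef (_ : _ + _ = t) ?(negPf t0) //; ring.
Qed.

Lemma diag_classified (eps : R) t0 t1 d : ev t0 = 0 -> ev t1 = 0 ->
  gspan (sym3 (y * t0) x 0 (y * (C eps + t1)) 0 y) d -> (d < 9)%N ->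
  classified (sym3 (y * t0) x 0 (y * (C eps + t1)) 0 y).
Proof.
move=> e0 e1 Ad d9.
have ym c : ev c = 0 -> mi 2 (y * c).
  move=> c0; have : mi (1 + 1) (y * c) by apply: widealM => //; [exact: wideal_y | exact: ev0_wideal].
  exact.
have F2 := ym _ e0.
have G1 : mi 1 (y * (C eps + t1)) by apply: widealMr => //; exact: wideal_y.
have F1 : ytype 1 (y * t0) by exact: ytype_mi.
have GK : ytype 1 (y * (C eps + t1)).
  rewrite mulrDr; apply: ytypeD; last exact/ytype_mi/ym.
  exists (eps *: 'X), 0, 0; split; last exact: wideal0.
  by rewrite map_polyZ map_polyX !hornerE; ring.
(* Three Newton steps raise K from 1 to 2, 4 and 8. *)
have [f1 [g1 [a1 b1 c1 d1 E1]]] := diag_step (K := 1) F2 G1 isT F1 GK.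
have [f2 [g2 [a2 b2 c2 d2 E2]]] := diag_step (K := 1 + 1) a1 b1 isT c1 d1.
have [f [g [fm gm fK gK E3]]] := diag_step (K := 1 + 1 + (1 + 1)) a2 b2 isT c2 d2.
have E := gequiv_trans (gequiv_trans E1 E2) E3; apply: (classified_equiv E).
have {E Ad} Ad := gspan_equiv E Ad.
have [fx [l1 [l17 yf sf]]] := ytype_order fK; have [gx [l2 [l27 yg sg]]] := ytype_order gK.
have l12 : (1 < l1)%N by move: l17; rewrite leq_eqVlt => /orP[/eqP->//|/sf/yshape_order[_ ->]].
have l21 : (0 < l2)%N.
  by move: l27; rewrite leq_eqVlt => /orP[/eqP->//|/sg/yshape_order[-> //]]; exact: wideal_ev gm.
have [l7|l7] := ltnP (l1 + l2) 7.
  have {}sf := sf ltac:(lia); have {}sg := sg ltac:(lia).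
  have [l|l] := leqP l2 l1; first exact: (diag_normal sf sg).
  have := @gequiv_congr R T (sym3 f x 0 g 0 y) (mx3 0 1 0 1 0 0 0 0 1).
  rewrite det_mx3 congr_sym3 (_ : ev _ = -1); last by rewrite !evE; ring.
  rewrite oppr_eq0 oner_neq0 => /(_ isT) E; apply: (classified_equiv (B := sym3 g x 0 f 0 y)).
    by move: E; congr (gequiv _ _); congr sym3; ring.
  by apply: (diag_normal sg sf); lia.
(* m1 <= l1 and m2 <= l2 with sum 7, which with the two constants at (1, 3) and (2, 3) gives nine
   classes. The cap at 6 keeps m2 positive. *)
pose m1 := minn l1 6; pose m2 := (7 - m1)%N.
have m1E : (m1 + m2 = 7)%N by rewrite /m2 /m1; lia.
suff : (#|{: bool + ('I_m1 + 'I_m2)}| <= d)%N.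
  by rewrite !card_sum !card_ord card_bool m1E leqNgt d9.
apply: (gspan_indep Ad (@diag_basis_sym R T m1 m2)); apply: diagtype_indep.
- by rewrite /m1; lia.
- by rewrite /m2 /m1; lia.
- by apply: yideal_weak yf; rewrite /m1; lia.
- by apply: yideal_weak yg; rewrite /m2 /m1; lia.
- by rewrite mulrC; apply: yidealM; apply: yideal_weak fx; rewrite /m1; lia.
- by rewrite mulrC; apply: yidealM; apply: yideal_weak gx; rewrite /m2; lia.
Qed.

(* The square of c + i s rotates the leading coefficient f + i g onto i. *)
Lemma half_angle (f g : R) : (f != 0) || (g != 0) -> exists c s : R,
  [/\ c ^+ 2 + s ^+ 2 != 0, (c ^+ 2 - s ^+ 2) * f + 2 * c * s * g = 0 &
   (c ^+ 2 - s ^+ 2) * g - 2 * c * s * f = 1].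
Proof.
move=> fg; pose r := Num.sqrt (f ^+ 2 + g ^+ 2).
have q0 : 0 < f ^+ 2 + g ^+ 2.
  by rewrite lt0r paddr_eq0 ?sqr_ge0 // !sqrf_eq0 negb_and fg addr_ge0 ?sqr_ge0.
have r0 : 0 < r by rewrite sqrtr_gt0.
have r2 : r ^+ 2 = f ^+ 2 + g ^+ 2 by rewrite sqr_sqrtr ?ltW.
have gr : g <= r /\ - g <= r.
  suff : `|g| <= r by rewrite ler_norml => /andP[]; lra.
  rewrite -(@ler_pXn2r _ 2) ?nnegrE ?normr_ge0 ?(ltW r0) // real_normK ?num_real // r2 lerDr sqr_ge0 //.
(* The generic choice of (c, s) is a multiple of (g + r, -f), which is zero exactly when g = -r; a
   quarter turn is then used. *)
have [g0|g0] := eqVneq (g + r) 0.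
  have f0 : f = 0 by apply/eqP; rewrite -sqrf_eq0; apply/eqP; nra.
  pose k := Num.sqrt r^-1; have k2 : k ^+ 2 = r^-1 by rewrite sqr_sqrtr ?invr_ge0 ?ltW.
  exists 0, k; rewrite k2 expr0n /= add0r f0 invr_neq0 ?gt_eqF // (_ : g = - r); last by lra.
  by split=> //; [ring | transitivity (r^-1 * r); [ring | rewrite mulVf ?gt_eqF]].
have gp : 0 < g + r by rewrite lt0r g0 /=; lra.
pose n := 2 * (g + r) * r ^+ 2; have n0 : 0 < n by rewrite !mulr_gt0 ?exprn_gt0.
pose k := Num.sqrt n^-1; have k2 : k ^+ 2 = n^-1 by rewrite sqr_sqrtr ?invr_ge0 ?ltW.
have f2 : f ^+ 2 = r ^+ 2 - g ^+ 2 by rewrite r2; ring.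
exists (k * (g + r)), (- k * f); split.
- rewrite (_ : _ + _ = k ^+ 2 * ((g + r) ^+ 2 + f ^+ 2)); last by ring.
  by rewrite mulf_neq0 ?k2 ?invr_neq0 ?gt_eqF // ltr_pwDl ?exprn_gt0 ?sqr_ge0.
- transitivity (k ^+ 2 * f * ((g + r) ^+ 2 - f ^+ 2 - 2 * (g + r) * g)); first by ring.
  by rewrite f2; ring.
- transitivity (k ^+ 2 * (((g + r) ^+ 2 - f ^+ 2) * g + 2 * (g + r) * f ^+ 2)); first by ring.
  by rewrite f2 k2 (_ : _ + _ = n) ?mulVf ?gt_eqF //; rewrite /n; ring.
Qed.

(** The common order L of the traceless part along the y-axis is 2, 3 or at least 4. In the first
    two cases a rotation of the first two basis vectors moves its leading coefficient to the
    off-diagonal entry, and all other terms have higher weight for the fifth normal form. *)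
Lemma scalar_classified t0 t1 d : ev t0 = 0 -> ev t1 = 0 ->
  gspan (sym3 (x + y * t0) (y * t1) 0 (x - y * t0) 0 y) d -> (d < 9)%N ->
  classified (sym3 (x + y * t0) (y * t1) 0 (x - y * t0) 0 y).
Proof.
have expand c : ev c = 0 -> exists p a b, y * c = y ^+ 2 * Y p + x * (y * a) + y ^+ 4 * b.
  move=> /(hadamard_mul 0)[a [b ->]]; have [p [a' [b' ->]]] := ypoly_expand 2 b.
  by exists p, (a + y * a'), b'; ring.
move=> /expand[p [a [b ->]]] /expand[q [a' [b' ->]]] Ad d9.
(* A factor y^2 is already extracted, so divisibility of both polynomials by a further y^2 means
   order at least 4; the classes are then 2 + 4 + 4. *)
have [[c [c' [E E']]]|[l [t [c [t' [c' [l2 tt E E']]]]]]] := ypoly_order2 2 p q.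
  suff : (#|{: bool + ('I_4 + 'I_4)}| <= d)%N by rewrite !card_sum !card_ord card_bool; lia.
  apply: (gspan_indep Ad (@scalar_basis_sym R T 4)); apply: scalartype_indep => //.
    by exists (y * a), (c + b); rewrite E; ring.
  by exists (y * a'), (c' + b'); rewrite E'; ring.
(* Here l is 0 or 1, and y^4 is divisible by y^(L + 1). *)
pose L := l.+2; pose e := y ^+ (1 - l).
have y4 : y ^+ 4 = y ^+ L * y * e by rewrite /e -exprSr -exprD /L; congr (_ ^+ _); lia.
set f := _ + y ^+ 4 * b; set g := _ + y ^+ 4 * b' in Ad *.
have fE : f = y ^+ L * (C t + y * (c + e * b)) + x * y * a by rewrite /f y4 E /L !exprS; ring.
have gE : g = y ^+ L * (C t' + y * (c' + e * b')) + x * y * a' by rewrite /g y4 E' /L !exprS; ring.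
(* The rotation is not normalised: it multiplies the scalar part by n = k^2 + s^2, which is
   compensated by scaling x by 1/n. *)
have [k [s [n0 h0 h1]]] := half_angle tt; pose n := k ^+ 2 + s ^+ 2; pose lam := n^-1.
have C2 : C 2 = 2 by rewrite rmorph_nat.
have H0 : (C k ^+ 2 - C s ^+ 2) * C t + 2 * C k * C s * C t' = 0.
  by rewrite -(rmorph0 C) -h0 !(C2, rmorphD C, rmorphN C, rmorphXn C, rmorphM C); ring.
have H1 : (C k ^+ 2 - C s ^+ 2) * C t' - 2 * C k * C s * C t = 1.
  have := congr1 C h1; rewrite rmorph1 => E1; refine (etrans _ E1).
  by rewrite !(C2, rmorphD C, rmorphN C, rmorphXn C, rmorphM C); ring.
have HL : (C k ^+ 2 + C s ^+ 2) * C lam = 1.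
  by rewrite -!rmorphXn -rmorphD -rmorphM divff ?rmorph1.
have ux : ev (C lam * x) = 0 by rewrite !evE mulr0.
pose sb := gsubst (C lam * x) y.
have sx : sb x = C lam * x by rewrite /sb gsubstX ?gevY.
have sy : sb y = y by rewrite /sb gsubstY ?gevY.
have sf : sb f = y ^+ L * (C t + y * sb (c + e * b)) + C lam * x * y * sb a.
  by rewrite fE !(rmorphD sb (_ * _), rmorphM sb, rmorphXn sb) sx sy (rmorphD sb) (rmorphM sb) sy /sb gsubstC ?gevY.
have sg : sb g = y ^+ L * (C t' + y * sb (c' + e * b')) + C lam * x * y * sb a'.
  by rewrite gE !(rmorphD sb (_ * _), rmorphM sb, rmorphXn sb) sx sy (rmorphD sb) (rmorphM sb) sy /sb gsubstC ?gevY.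
pose al := C k ^+ 2 - C s ^+ 2; pose be := 2 * C k * C s.
pose Q := (al * sb (c + e * b) + be * sb (c' + e * b')) * (x ^+ 0 * y ^+ L.+1) +
  (al * C lam * sb a + be * C lam * sb a') * (x ^+ 1 * y ^+ 1).
pose Q' := (al * sb (c' + e * b') - be * sb (c + e * b)) * (x ^+ 0 * y ^+ L.+1) +
  (al * C lam * sb a' - be * C lam * sb a) * (x ^+ 1 * y ^+ 1).
have QE : al * sb f + be * sb g = Q.
  by rewrite sf sg /Q; transitivity (y ^+ L * (al * C t + be * C t') + Q); [rewrite /Q exprS; ring | rewrite H0 /Q; ring].
have QE' : al * sb g - be * sb f = y ^+ L + Q'.
  by rewrite sf sg; transitivity (y ^+ L * (al * C t' - be * C t) + Q'); [rewrite /Q' exprS; ring | rewrite H1; ring].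
have wQ u v : wideal (L + L) 2 (L + L + 1) (u * (x ^+ 0 * y ^+ L.+1) + v * (x ^+ 1 * y ^+ 1)).
  by apply: wideal_add; apply: wideal_mono; lia.
apply: (@classified_equiv R T _ (sym3 (x + Q) (y ^+ L + Q') 0 (x + - Q) 0 y)).
  exists (C lam * x), y, (mx3 (C k) (- C s) 0 (C s) (C k) 0 0 0 1); split.
  - by rewrite ux gevY.
  - by rewrite /gjac !gdE !evE !(mulr0, mul0r, mulr1, addr0, add0r, subr0) invr_neq0.
  - by rewrite det_mx3 !evE (_ : _ + _ = n) //; rewrite /n; ring.
  - rewrite map_sym3 -/sb congr_sym3 -QE -QE' !(rmorphD sb x, rmorphB sb x) sx sy rmorph0 /al /be.
    have xE : x = (C k ^+ 2 + C s ^+ 2) * C lam * x by rewrite HL mul1r.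
    by congr sym3; first [ring | rewrite [X in X + _]xE; ring].
exists (sym3 x (y ^+ L) 0 x 0 y), (2 * L + 2)%N; split; first exact: GNF5.
have := @NF5_determined R T Q Q' 0 (- Q) 0 0 L isT.
rewrite !addr0; apply; rewrite /Q /Q'; try exact: wQ; try (by apply: wideal0; lia).
by apply: widealN => //; try lia; exact: wQ.
Qed.
End Diagonal.

(** * The classification over the abstract ring of germs *)

Section AbstractClassification.
Context {R : realType} (T : germ_theory R).
Local Notation S := (gring T).
Local Notation ev := (gev T).

(** The predicate fed to [pencil_classification]. It quantifies over A and d so that it can be
    carried back along [jet1_transform], where A is replaced by an equivalent matrix. *)
Definition classifiable (P Q : 'M[R]_3) := forall (A : 'M[S]_3) d, gsym A -> jet1 A P Q ->
  gspan A d -> (d < 9)%N -> classified A.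

Theorem abstract_classification (A : 'M[S]_3) d :
  gsym A -> (forall i j, ev (A i j) = 0) ->
  ~ (forall i j, ev (gdx (A i j)) = 0 /\ ev (gdy (A i j)) = 0) ->
  gspan A d -> (d < 9)%N -> exists N c, gnormal N c /\ gequiv A N.
Proof.
move=> sA A0 Anz; pose P := map_mx ev (map_mx (@gdx R T) A); pose Q := map_mx ev (map_mx (@gdy R T) A).
have jA : jet1 A P Q by move=> i j; rewrite !mxE.
have sP : P^T = P by apply/matrixP => i j; rewrite !mxE -{1}sA mxE.
have sQ : Q^T = Q by apply/matrixP => i j; rewrite !mxE -{1}sA mxE.
suff H : classifiable P Q by exact: H.
(* The degenerate pencils force d > 8 and so cannot occur under the bound d < 9. *)
have big d' : (8 < d')%N -> (d' < 9)%N -> False by lia.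
apply: (@pencil_classification R classifiable) => //.
- move=> P' Q' al be ga de M sP' sQ' D DM H B e sB jB Be e9.
  have [B' [sB' BB' jB']] := jet1_transform sB jB D DM.
  by apply: (classified_equiv BB'); exact: H sB' jB' (gspan_equiv BB' Be) e9.
- by move=> P' _ _ B e sB jB Be e9; case: (big _ (gspan_corank1 sB jB Be) e9).
- by move=> *; move=> B e sB jB Be e9; case: (big _ (gspan_block sB jB Be) e9).
- by move=> B e sB jB Be e9; case: (big _ (gspan_isotropic sB jB Be) e9).
- by move=> B e sB jB _ _; do 2 eexists; split; [exact: GNF1 | exact: NF1_unfold].
- by move=> s B e sB jB _ _; do 2 eexists; split; [exact: (GNF2 T s) | exact: NF2_unfold].
- by move=> B e sB jB _ _; do 2 eexists; split; [exact: (GNF3 T false) | exact: (@NF3_unfold R T false)].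
- move=> eps B e sB jB Be e9; have [t0 [t1 [e0 e1 E]]] := diag_unfold sB jB.
  by apply: (classified_equiv E); exact: diag_classified (gspan_equiv E Be) e9.
- move=> B e sB jB Be e9; have [t0 [t1 [e0 e1 E]]] := scalar_unfold sB jB.
  by apply: (classified_equiv E); exact: scalar_classified (gspan_equiv E Be) e9.
- move=> B e sB jB Be e9; have [t0 [t1 [e0 e1 E]]] := block3_unfold sB jB.
  by apply: (classified_equiv E); exact: block3_classified (gspan_equiv E Be) e9.
- move=> B e sB jB Be e9; have [t0 [t1 [t2 [e0 e1 e2 E]]]] := block21_unfold sB jB.
  by apply: (classified_equiv E); exact: block21_classified (gspan_equiv E Be) e9.
- by move=> [P0 Q0]; apply: Anz => i j; have := (congr1 (fun M : 'M[R]_3 => M i j) P0, congr1 (fun M : 'M[R]_3 => M i j) Q0); rewrite !mxE => -[].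
Qed.
End AbstractClassification.

Theorem mainTheorem9 (R : realType) :
  (forall A : 'rV[R]_2 -> 'M[R]_3,
     sym_germ A -> A 0 = 0 -> (corank A <= 1)%N ->
     (exists2 d : nat, has_Ge_codim A d & (d < 9)%N) ->
     exists (N : 'rV[R]_2 -> 'M[R]_3) (c : nat),
       normal_form N c /\ G_equivalent A N) /\
  (forall (N : 'rV[R]_2 -> 'M[R]_3) (c : nat),
     normal_form N c -> corank N = 0%N /\ has_Ge_codim N c).
Proof.
split.
  move=> A sA A0 cA [d hd d9]; have [sA' _] := sA.
  have ev0 i j : gev (smooth_theory R) (mx_germ A i j) = 0.
    have := germ_eval_to_germ ((smooth_germ_mxP A).1 sA' i j); rewrite A0 mxE => E.
    by rewrite mxE; exact: E.
  have [M [c [NM AM]]] := abstract_classification ((sym_germP sA').1 sA) ev0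
    (corank_nonzero sA' cA) (codim_gspan sA hd) d9.
  have [N [nN sN EN]] := gnormal_normal_form NM.
  exists N, c; split; first exact: nN.
  by apply: (gequiv_G_equivalent sA' sN); rewrite EN.
move=> N c /normal_form_gnormal[sN gN]; have [c0 cd] := normal_form_codim gN.
split; first exact: corank0.
exact: gcodim_codim.
Qed.
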